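(* Let $0<c<\kappa\le1$. Then for every $g\in SO(3)$ there is an optimal decomposition of $g$ which is a subword of one of the following patterns, or of a pattern obtained from it by the indicated symmetries: (I) $R(t_XX)\,R(t_YY)\,R(-t_XX)\,R(-t_YY)$ with $0<t_X,t_Y\le\pi$, $\tan(t_X/2)=\kappa\tan(t_Y/2)$, and its images under the group $(X,Y)\mapsto\{\pm X,\pm Y\}$; (IV) $R(\hat t_YY)\,R(\hat t_XX)\,R(tW_+)\,R(\hat t_XX)\,R(\hat t_YY)$, $t\ge0$, and its images under the group $(X,Y)\mapsto\{-X,-Y\}$; (V) $R(\hat t_YY)\,R(\hat t_XX)\,R(tW_+)\,R(-\hat t_YY)\,R(-\hat t_XX)$, $t\ge0$, and its images under $(X,Y)\mapsto\{-X,-Y\}$; (VI) $R(\pi Y)\,R(tW_-)\,R(\pi Y)$, $t\ge0$, and its images under $(X,Y)\mapsto\{-X,-Y\}$; (VII) $R(\pi X)\,R(tW_-)\,R(\pi Y)$, $t\ge0$, and its images under $(X,Y)\mapsto\{-X,-Y\}$.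
   Context: Fix unit vectors $X,Y\in\mathbb R^3$ with angle $\alpha\in(0,\pi/2]$, $c=\cos\alpha\in[0,1)$, and $\kappa\in[0,1]$. For a unit vector $v$, $R(tv)\in SO(3)$ is rotation by angle $t$ about $v$ (counterclockwise viewed from the tip): $R(tv)=\cos t\,I+\sin t\,[v]_\times+(1-\cos t)vv^T$, $[v]_\times w=v\times w$; for nonzero non-unit $v$, $R(tv):=R((t|v|)\,v/|v|)$. For nonzero $C=aX+bY$, $\mathrm{cost}(C)=|a|+\kappa|b|$. A decomposition of $g\in SO(3)$ is a finite product $g=R(\tau_1C_1)\cdots R(\tau_nC_n)$ with $\tau_j\ge0$, $C_j$ nonzero in $\mathrm{span}\{X,Y\}$ (a factor $R(-\tau C)$, $\tau\ge0$, means $R(\tau(-C))$), with cost $\sum\tau_j\mathrm{cost}(C_j)$. Problem 1: minimize the cost over all decompositions of $g$; a decomposition is optimal if its cost equals the infimum. Set $W_+=(1+\kappa c)X-(\kappa+c)Y$, $W_-=(1-\kappa c)X+(\kappa-c)Y$, and (when $c+\kappa>0$) $\hat t_X=\arccos\frac{c-\kappa}{c+\kappa}$, $\hat t_Y=\arccos\left(-\frac{1-\kappa c}{1+\kappa c}\right)$, both in $[0,\pi]$. Subword: for a word $R(\tau_1C_1)\cdots R(\tau_nC_n)$ ($\tau_j\ge0$), a subword is $R(\tau_k'C_k)R(\tau_{k+1}C_{k+1})\cdots R(\tau_{m-1}C_{m-1})R(\tau_m'C_m)$ with $1\le k\le m\le n$, $0\le\tau_k'\le\tau_k$, $0\le\tau_m'\le\tau_m$.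 Symmetries of patterns: labels are $\pm X,\pm Y,\pm W_+,\pm W_-$; define label maps, each extended by $\sigma(-C)=-\sigma(C)$: $\nu:C\mapsto -C$; $\rho: X\mapsto X,\ Y\mapsto -Y,\ W_+\mapsto W_-,\ W_-\mapsto W_+$; $\varsigma: X\mapsto Y,\ Y\mapsto X,\ W_+\mapsto -W_+,\ W_-\mapsto W_-$. Applying $\nu$ or $\rho$ to a pattern replaces each label by its image and keeps the times. Applying $\varsigma$ replaces each label by its image and interchanges $t_X\leftrightarrow t_Y$ and $\hat t_X\leftrightarrow\hat t_Y$ in the times (times $\pi$ and free parameters $t$ unchanged), so that factors labelled $\pm X$ carry the $X$-time and factors labelled $\pm Y$ carry the $Y$-time; stated relations and ranges are kept verbatim. ''Under $(X,Y)\mapsto\{-X,-Y\}$'' means images under the group $\{\mathrm{id},\nu,\varsigma,\nu\varsigma\}$; ''under $(X,Y)\mapsto\{\pm X,\pm Y\}$'' means under the 8-element group generated by $\nu,\rho,\varsigma$. *)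

(* Defs.v *)
From Stdlib Require Import Reals List.
Open Scope R_scope.
Import ListNotations.

Record V3 := mkV { vx : R; vy : R; vz : R }.

Definition vadd (u v : V3) : V3 := mkV (vx u + vx v) (vy u + vy v) (vz u + vz v).
Definition vscale (a : R) (v : V3) : V3 := mkV (a * vx v) (a * vy v) (a * vz v).
Definition dot (u v : V3) : R := vx u * vx v + vy u * vy v + vz u * vz v.
Definition vnorm (v : V3) : R := sqrt (dot v v).

Record M3 := mkM { m11 : R; m12 : R; m13 : R;
                   m21 : R; m22 : R; m23 : R;
                   m31 : R; m32 : R; m33 : R }.

Definition mid3 : M3 := mkM 1 0 0 0 1 0 0 0 1.

Definition mmul (A B : M3) : M3 :=
  mkM (m11 A * m11 B + m12 A * m21 B + m13 A * m31 B)
      (m11 A * m12 B + m12 A * m22 B + m13 A * m32 B)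
      (m11 A * m13 B + m12 A * m23 B + m13 A * m33 B)
      (m21 A * m11 B + m22 A * m21 B + m23 A * m31 B)
      (m21 A * m12 B + m22 A * m22 B + m23 A * m32 B)
      (m21 A * m13 B + m22 A * m23 B + m23 A * m33 B)
      (m31 A * m11 B + m32 A * m21 B + m33 A * m31 B)
      (m31 A * m12 B + m32 A * m22 B + m33 A * m32 B)
      (m31 A * m13 B + m32 A * m23 B + m33 A * m33 B).

Definition mtrans (A : M3) : M3 :=
  mkM (m11 A) (m21 A) (m31 A) (m12 A) (m22 A) (m32 A) (m13 A) (m23 A) (m33 A).

Definition mdet (A : M3) : R :=
  m11 A * (m22 A * m33 A - m23 A * m32 A)
  - m12 A * (m21 A * m33 A - m23 A * m31 A)
  + m13 A * (m21 A * m32 A - m22 A * m31 A).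

Definition inSO3 (A : M3) : Prop := mmul (mtrans A) A = mid3 /\ mdet A = 1.

(** Rotation by angle t about a unit vector v (counterclockwise seen from the tip):
    cos t I + sin t [v]_x + (1 - cos t) v v^T. *)
Definition rot_unit (t : R) (v : V3) : M3 :=
  let x := vx v in let y := vy v in let z := vz v in
  let C := cos t in let S := sin t in let K := 1 - cos t in
  mkM (C + K * x * x)     (- S * z + K * x * y) (S * y + K * x * z)
      (S * z + K * y * x) (C + K * y * y)       (- S * x + K * y * z)
      (- S * y + K * z * x) (S * x + K * z * y) (C + K * z * z).

Definition rot (t : R) (v : V3) : M3 :=
  rot_unit (t * vnorm v) (vscale (/ vnorm v) v).

(** * Decompositions.  A factor R(tau C) with C = a X + b Y is stored as (tau, (a, b)). *)
Definition factor := (R * (R * R))%type.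

Definition fvec (X Y : V3) (ab : R * R) : V3 :=
  vadd (vscale (fst ab) X) (vscale (snd ab) Y).

Definition word_prod (X Y : V3) (w : list factor) : M3 :=
  fold_right (fun f acc => mmul (rot (fst f) (fvec X Y (snd f))) acc) mid3 w.

Definition fcost (kappa : R) (f : factor) : R :=
  fst f * (Rabs (fst (snd f)) + kappa * Rabs (snd (snd f))).

Definition word_cost (kappa : R) (w : list factor) : R :=
  fold_right (fun f acc => fcost kappa f + acc) 0 w.

Definition is_decomp (X Y : V3) (g : M3) (w : list factor) : Prop :=
  Forall (fun f => 0 <= fst f /\ fvec X Y (snd f) <> mkV 0 0 0) w /\
  word_prod X Y w = g.

Definition optimal (X Y : V3) (kappa : R) (g : M3) (w : list factor) : Prop :=
  is_decomp X Y g w /\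
  forall w', is_decomp X Y g w' -> word_cost kappa w <= word_cost kappa w'.

Definition subword (w' w : list factor) : Prop :=
  (exists l1 l2 tau tau' C,
      w = l1 ++ (tau, C) :: l2 /\ w' = [(tau', C)] /\ 0 <= tau' <= tau) \/
  (exists l1 mid l2 tau1 tau1' C1 tau2 tau2' C2,
      w = l1 ++ (tau1, C1) :: mid ++ (tau2, C2) :: l2 /\
      w' = (tau1', C1) :: mid ++ [(tau2', C2)] /\
      0 <= tau1' <= tau1 /\ 0 <= tau2' <= tau2).

Inductive base := BX | BY | BWp | BWm.
(* a label is (negated?, base) *)
Definition label := (bool * base)%type.
Inductive tspec := TX | TY | TPi | TFree.
Definition pattern := list (tspec * label).

(* coefficients (a,b) of the base labels w.r.t. X, Y, with c = cos alpha *)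
Definition base_coef (kappa c : R) (b : base) : R * R :=
  match b with
  | BX => (1, 0)
  | BY => (0, 1)
  | BWp => (1 + kappa * c, - (kappa + c))
  | BWm => (1 - kappa * c, kappa - c)
  end.

Definition label_coef (kappa c : R) (l : label) : R * R :=
  let ab := base_coef kappa c (snd l) in
  if fst l then (- fst ab, - snd ab) else ab.

Definition tval (tX tY t : R) (s : tspec) : R :=
  match s with TX => tX | TY => tY | TPi => PI | TFree => t end.

Definition eval_pattern (kappa c tX tY t : R) (p : pattern) : list factor :=
  map (fun st => (tval tX tY t (fst st), label_coef kappa c (snd st))) p.

Inductive sym := Nu | Rho | Vs.

Definition sym_label (s : sym) (l : label) : label :=
  let (n, b) := l in
  match s, b with
  | Nu, _ => (negb n, b)
  | Rho, BX => (n, BX)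
  | Rho, BY => (negb n, BY)
  | Rho, BWp => (n, BWm)
  | Rho, BWm => (n, BWp)
  | Vs, BX => (n, BY)
  | Vs, BY => (n, BX)
  | Vs, BWp => (negb n, BWp)
  | Vs, BWm => (n, BWm)
  end.

Definition sym_time (s : sym) (t : tspec) : tspec :=
  match s, t with
  | Vs, TX => TY
  | Vs, TY => TX
  | _, _ => t
  end.

Definition sym_pattern (s : sym) (p : pattern) : pattern :=
  map (fun st => (sym_time s (fst st), sym_label s (snd st))) p.

Definition syms_pattern (ss : list sym) (p : pattern) : pattern :=
  fold_right sym_pattern p ss.

(* group {id, nu, varsigma, nu varsigma} = group generated by nu, varsigma *)
Definition in_G4 (ss : list sym) : Prop := Forall (fun s => s = Nu \/ s = Vs) ss.
(* the 8-element group generated by nu, rho, varsigma: all words in them *)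
Definition in_G8 (ss : list sym) : Prop := True.


Definition pat_I : pattern :=
  [(TX, (false, BX)); (TY, (false, BY)); (TX, (true, BX)); (TY, (true, BY))].
Definition pat_IV : pattern :=
  [(TY, (false, BY)); (TX, (false, BX)); (TFree, (false, BWp));
   (TX, (false, BX)); (TY, (false, BY))].
Definition pat_V : pattern :=
  [(TY, (false, BY)); (TX, (false, BX)); (TFree, (false, BWp));
   (TY, (true, BY)); (TX, (true, BX))].
Definition pat_VI : pattern :=
  [(TPi, (false, BY)); (TFree, (false, BWm)); (TPi, (false, BY))].
Definition pat_VII : pattern :=
  [(TPi, (false, BX)); (TFree, (false, BWm)); (TPi, (false, BY))].

Definition hat_tX (kappa c : R) : R := acos ((c - kappa) / (c + kappa)).
Definition hat_tY (kappa c : R) : R := acos (- ((1 - kappa * c) / (1 + kappa * c))).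

(* tan(tX/2) = kappa tan(tY/2) for tX, tY in (0, pi]; at tX = pi or tY = pi
   (tan = +infinity) the relation is read as tX = tY = pi. *)
Definition rel_I (kappa tX tY : R) : Prop :=
  (tX < PI /\ tY < PI /\ tan (tX / 2) = kappa * tan (tY / 2)) \/ (tX = PI /\ tY = PI).

Definition allowed_word (kappa c : R) (w : list factor) : Prop :=
  (exists ss tX tY, in_G8 ss /\ 0 < tX <= PI /\ 0 < tY <= PI /\ rel_I kappa tX tY /\
      w = eval_pattern kappa c tX tY 0 (syms_pattern ss pat_I)) \/
  (exists ss t, in_G4 ss /\ 0 <= t /\
      w = eval_pattern kappa c (hat_tX kappa c) (hat_tY kappa c) t (syms_pattern ss pat_IV)) \/
  (exists ss t, in_G4 ss /\ 0 <= t /\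
      w = eval_pattern kappa c (hat_tX kappa c) (hat_tY kappa c) t (syms_pattern ss pat_V)) \/
  (exists ss t, in_G4 ss /\ 0 <= t /\
      w = eval_pattern kappa c 0 0 t (syms_pattern ss pat_VI)) \/
  (exists ss t, in_G4 ss /\ 0 <= t /\
      w = eval_pattern kappa c 0 0 t (syms_pattern ss pat_VII)).

(* Main.v *)
Require Import Defs.
From Stdlib Require Import Reals ZArith List Lra Lia Classical ClassicalEpsilon.
Import ListNotations.
Open Scope R_scope.

(** Fix g and n, and maximise n tr(g^T h) - cost over pairs (h, cost) in the closure of the set of words;
    the maximum is attained, and its end point is reached by a curve gamma in SO(3) along which the cost
    grows at unit rate.  The momentum, the axial vector of gamma(s)^T B gamma(s), has coordinates x, y, z
    along X, Y, X x Y.  By the first-order condition (x, y) stays on the boundary of the rectangle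
    |x| <= wtX, |y| <= wtY; the curve follows +-X or +-Y along an edge and +-W_+ or +-W_- while it rests
    at a corner with z = 0.  Hence gamma is a finite word in these letters.  Choose such a word with the
    fewest letters.  Along it x^2 + y^2 - 2 c x y + z^2 is constant, which fixes the times of all letters
    between two corners.  The second variation excludes five letters around the whole rectangle, and the
    third variation excludes continuing after a half loop through a corner with z = 0, where the momentum
    has changed sign.  The words that remain have finitely many shapes with bounded times, so a
    subsequence converges as n tends to infinity; the limit h maximises tr(g^T h E) at E = 1 over all
    words E, hence equals g, and its cost is minimal.

    A frame carries weights wtX for X and wtY for Y (1 and kappa in the theorem), so that all symmetries
    of the patterns act on frames. *)

(** * Linear algebra in dimension three *)

Notation vzero := (mkV 0 0 0).

Definition vneg (v : V3) : V3 := vscale (-1) v.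
Definition vsub (u v : V3) : V3 := vadd u (vneg v).
Definition cross (u v : V3) : V3 :=
  mkV (vy u * vz v - vz u * vy v) (vz u * vx v - vx u * vz v) (vx u * vy v - vy u * vx v).

Definition mtrace (A : M3) : R := m11 A + m22 A + m33 A.
Definition madd (A B : M3) : M3 :=
  mkM (m11 A + m11 B) (m12 A + m12 B) (m13 A + m13 B)
      (m21 A + m21 B) (m22 A + m22 B) (m23 A + m23 B)
      (m31 A + m31 B) (m32 A + m32 B) (m33 A + m33 B).
Definition mscale (a : R) (A : M3) : M3 :=
  mkM (a * m11 A) (a * m12 A) (a * m13 A)
      (a * m21 A) (a * m22 A) (a * m23 A)
      (a * m31 A) (a * m32 A) (a * m33 A).
Definition msub (A B : M3) : M3 := madd A (mscale (-1) B).
Definition mvmul (A : M3) (v : V3) : V3 :=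
  mkV (m11 A * vx v + m12 A * vy v + m13 A * vz v)
      (m21 A * vx v + m22 A * vy v + m23 A * vz v)
      (m31 A * vx v + m32 A * vy v + m33 A * vz v).
Definition madj (A : M3) : M3 :=
  mkM (m22 A * m33 A - m23 A * m32 A) (m13 A * m32 A - m12 A * m33 A) (m12 A * m23 A - m13 A * m22 A)
      (m23 A * m31 A - m21 A * m33 A) (m11 A * m33 A - m13 A * m31 A) (m13 A * m21 A - m11 A * m23 A)
      (m21 A * m32 A - m22 A * m31 A) (m12 A * m31 A - m11 A * m32 A) (m11 A * m22 A - m12 A * m21 A).
Definition skew (v : V3) : M3 :=
  mkM 0 (- vz v) (vy v) (vz v) 0 (- vx v) (- vy v) (vx v) 0.
(* The vector representing the linear form [v |-> mtrace (mmul B (skew v))]. *)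
Definition vee (B : M3) : V3 := mkV (m23 B - m32 B) (m31 B - m13 B) (m12 B - m21 B).

Lemma M3_ext A B :
  m11 A = m11 B -> m12 A = m12 B -> m13 A = m13 B ->
  m21 A = m21 B -> m22 A = m22 B -> m23 A = m23 B ->
  m31 A = m31 B -> m32 A = m32 B -> m33 A = m33 B -> A = B.
Proof. destruct A, B; simpl; intros; subst; reflexivity. Qed.

Lemma V3_ext u v : vx u = vx v -> vy u = vy v -> vz u = vz v -> u = v.
Proof. destruct u, v; simpl; intros; subst; reflexivity. Qed.

Lemma mkV_eq a b c a' b' c' : a = a' -> b = b' -> c = c' -> mkV a b c = mkV a' b' c'.
Proof. congruence. Qed.

Ltac entries :=
  intros; first [apply M3_ext | apply V3_ext | idtac];
  unfold mtrace, mdet, dot, msub, vsub, vneg, fvec;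
  cbn [m11 m12 m13 m21 m22 m23 m31 m32 m33 vx vy vz fst snd mid3 mmul mtrans madd mscale
       mvmul madj skew vee vadd vscale cross].
Ltac entries_ring := entries; ring.

Lemma mmul_assoc A B C : mmul (mmul A B) C = mmul A (mmul B C).
Proof. entries_ring. Qed.
Lemma mmul_1l A : mmul mid3 A = A.
Proof. entries_ring. Qed.
Lemma mmul_1r A : mmul A mid3 = A.
Proof. entries_ring. Qed.
Lemma mmul_addl A B C : mmul (madd A B) C = madd (mmul A C) (mmul B C).
Proof. entries_ring. Qed.
Lemma mmul_addr A B C : mmul A (madd B C) = madd (mmul A B) (mmul A C).
Proof. entries_ring. Qed.
Lemma mmul_subl A B C : mmul (msub A B) C = msub (mmul A C) (mmul B C).
Proof. entries_ring. Qed.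
Lemma mmul_subr A B C : mmul A (msub B C) = msub (mmul A B) (mmul A C).
Proof. entries_ring. Qed.
Lemma mmul_scalel a A B : mmul (mscale a A) B = mscale a (mmul A B).
Proof. entries_ring. Qed.
Lemma mmul_scaler a A B : mmul A (mscale a B) = mscale a (mmul A B).
Proof. entries_ring. Qed.
Lemma mscale_1 A : mscale 1 A = A.
Proof. entries_ring. Qed.
Lemma mscale_mscale a b A : mscale a (mscale b A) = mscale (a * b) A.
Proof. entries_ring. Qed.

Lemma mtrans_mul A B : mtrans (mmul A B) = mmul (mtrans B) (mtrans A).
Proof. entries_ring. Qed.
Lemma mtrans_mtrans A : mtrans (mtrans A) = A.
Proof. entries_ring. Qed.
Lemma mtrans_1 : mtrans mid3 = mid3.
Proof. reflexivity. Qed.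

Lemma mtrace_add A B : mtrace (madd A B) = mtrace A + mtrace B.
Proof. entries_ring. Qed.
Lemma mtrace_sub A B : mtrace (msub A B) = mtrace A - mtrace B.
Proof. entries_ring. Qed.
Lemma mtrace_scale a A : mtrace (mscale a A) = a * mtrace A.
Proof. entries_ring. Qed.
Lemma mtrace_trans A : mtrace (mtrans A) = mtrace A.
Proof. entries_ring. Qed.
Lemma mtrace_mulC A B : mtrace (mmul A B) = mtrace (mmul B A).
Proof. entries_ring. Qed.
Lemma mtrace_1 : mtrace mid3 = 3.
Proof. entries_ring. Qed.
Lemma mtrace_skew B v : mtrace (mmul B (skew v)) = dot (vee B) v.
Proof. entries_ring. Qed.

Lemma mdet_mul A B : mdet (mmul A B) = mdet A * mdet B.
Proof. entries_ring. Qed.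
Lemma mdet_trans A : mdet (mtrans A) = mdet A.
Proof. entries_ring. Qed.
Lemma mmul_adj A : mmul A (madj A) = mscale (mdet A) mid3.
Proof. entries_ring. Qed.

Lemma mvmul_mul A B v : mvmul (mmul A B) v = mvmul A (mvmul B v).
Proof. entries_ring. Qed.
Lemma mvmul_1 v : mvmul mid3 v = v.
Proof. entries_ring. Qed.
Lemma mvmul_add A u v : mvmul A (vadd u v) = vadd (mvmul A u) (mvmul A v).
Proof. entries_ring. Qed.
Lemma mvmul_scale A a v : mvmul A (vscale a v) = vscale a (mvmul A v).
Proof. entries_ring. Qed.
Lemma mvmul_neg A v : mvmul A (vneg v) = vneg (mvmul A v).
Proof. entries_ring. Qed.

Lemma vneg_vneg v : vneg (vneg v) = v.
Proof. entries_ring. Qed.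
Lemma vee_trans B : vee (mtrans B) = vneg (vee B).
Proof. entries_ring. Qed.
Lemma skew_scale a v : skew (vscale a v) = mscale a (skew v).
Proof. entries_ring. Qed.

Lemma dotC u v : dot u v = dot v u.
Proof. entries_ring. Qed.
Lemma dot_addr u v w : dot u (vadd v w) = dot u v + dot u w.
Proof. entries_ring. Qed.
Lemma dot_scalel a u v : dot (vscale a u) v = a * dot u v.
Proof. entries_ring. Qed.
Lemma dot_scaler u a v : dot u (vscale a v) = a * dot u v.
Proof. entries_ring. Qed.
Lemma dot_subl u v w : dot (vsub u v) w = dot u w - dot v w.
Proof. entries_ring. Qed.
Lemma dot_negl u v : dot (vneg u) v = - dot u v.
Proof. entries_ring. Qed.
Lemma dot_negr u v : dot u (vneg v) = - dot u v.
Proof. entries_ring. Qed.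
Lemma dot_mvmul A u v : dot u (mvmul A v) = dot (mvmul (mtrans A) u) v.
Proof. entries_ring. Qed.
Lemma dot_self_ge0 v : 0 <= dot v v.
Proof. unfold dot; nra. Qed.

Lemma vscale_inv_l a v : a <> 0 -> vscale (/ a) (vscale a v) = v.
Proof. intros a_nz; entries; field; exact a_nz. Qed.

Lemma vscale_eq0 a v : a <> 0 -> vscale a v = vzero -> v = vzero.
Proof. intros a_nz E. rewrite <- (vscale_inv_l a v a_nz), E. entries_ring. Qed.

Lemma vsub_eq0 u v : vsub u v = vzero -> u = v.
Proof.
  intros E. transitivity (vadd (vsub u v) v); [entries_ring | rewrite E; entries_ring].
Qed.

Lemma dot_self_eq0 v : dot v v = 0 -> v = vzero.
Proof. destruct v; unfold dot; simpl; intros; f_equal; nra. Qed.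

(** * Norms *)

Lemma Rabs_le_bounds x k : Rabs x <= k -> - k <= x <= k.
Proof. pose proof (Rle_abs x); pose proof (Rle_abs (- x)). rewrite Rabs_Ropp in *. lra. Qed.

Lemma Rabs_eq_cases x k : Rabs x = k -> x = k \/ x = - k.
Proof. unfold Rabs. destruct Rcase_abs; intros <-; [right; ring | left; reflexivity]. Qed.

Lemma Rabs_le_sqrt x y : x * x <= y -> Rabs x <= sqrt y.
Proof. intros xy. rewrite <- sqrt_Rsqr_abs. apply sqrt_le_1_alt. exact xy. Qed.

Lemma vnorm_ge0 v : 0 <= vnorm v.
Proof. apply sqrt_pos. Qed.
Lemma vnorm_sq v : vnorm v * vnorm v = dot v v.
Proof. apply sqrt_sqrt, dot_self_ge0. Qed.
Lemma vnorm_pos v : v <> vzero -> 0 < vnorm v.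
Proof.
  intros v_nz. destruct (vnorm_ge0 v) as [|E]; auto.
  destruct v_nz. apply dot_self_eq0. rewrite <- vnorm_sq, <- E; ring.
Qed.
Lemma vnorm_0 : vnorm vzero = 0.
Proof. unfold vnorm. replace (dot _ _) with 0 by entries_ring. apply sqrt_0. Qed.
Lemma vnorm_unit v : dot v v = 1 -> vnorm v = 1.
Proof. intros E. unfold vnorm. rewrite E. apply sqrt_1. Qed.
Lemma vnorm_scale a v : vnorm (vscale a v) = Rabs a * vnorm v.
Proof.
  unfold vnorm. rewrite dot_scalel, dot_scaler, <- Rmult_assoc, sqrt_mult_alt by nra.
  rewrite <- (sqrt_Rsqr_abs a). reflexivity.
Qed.
Lemma vnorm_neg v : vnorm (vneg v) = vnorm v.
Proof. unfold vnorm. rewrite dot_negl, dot_negr, Ropp_involutive. reflexivity. Qed.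

Lemma vscale_vnorm v : v <> vzero -> vscale (vnorm v) (vscale (/ vnorm v) v) = v.
Proof. intros v_nz. pose proof (vnorm_pos v v_nz). entries; field; lra. Qed.

Lemma normalized_unit v : v <> vzero ->
  dot (vscale (/ vnorm v) v) (vscale (/ vnorm v) v) = 1.
Proof.
  intros v_nz. pose proof (vnorm_pos v v_nz).
  rewrite dot_scalel, dot_scaler, <- vnorm_sq. field. lra.
Qed.

Lemma dot_sq_le u v : dot u v * dot u v <= dot u u * dot v v.
Proof.
  pose proof (dot_self_ge0 (cross u v)).
  replace (dot u u * dot v v) with (dot u v * dot u v + dot (cross u v) (cross u v)) by entries_ring.
  lra.
Qed.

Lemma dot_le_vnorm u v : Rabs (dot u v) <= vnorm u * vnorm v.
Proof.
  unfold vnorm. rewrite <- sqrt_mult by apply dot_self_ge0. apply Rabs_le_sqrt, dot_sq_le.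
Qed.

Lemma vnorm_cross_le u v : vnorm (cross u v) <= vnorm u * vnorm v.
Proof.
  unfold vnorm. rewrite <- sqrt_mult by apply dot_self_ge0. apply sqrt_le_1_alt.
  assert (0 <= dot u v * dot u v) by nra.
  replace (dot u u * dot v v) with (dot u v * dot u v + dot (cross u v) (cross u v)) by entries_ring.
  lra.
Qed.

Lemma vnorm_add_le u v : vnorm (vadd u v) <= vnorm u + vnorm v.
Proof.
  pose proof (vnorm_ge0 u); pose proof (vnorm_ge0 v); pose proof (vnorm_ge0 (vadd u v)).
  pose proof (vnorm_sq u); pose proof (vnorm_sq v); pose proof (vnorm_sq (vadd u v)).
  pose proof (dot_le_vnorm u v); pose proof (Rle_abs (dot u v)).
  replace (dot (vadd u v) (vadd u v)) with (dot u u + 2 * dot u v + dot v v) in * by entries_ring.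
  apply Rsqr_incr_0_var; [unfold Rsqr; nra | lra].
Qed.

(* The Frobenius norm, invariant under multiplication by rotations. *)
Definition mnorm (A : M3) : R := sqrt (mtrace (mmul (mtrans A) A)).
Definition mdist (A B : M3) : R := mnorm (msub A B).

Definition col1 (A : M3) : V3 := mkV (m11 A) (m21 A) (m31 A).
Definition col2 (A : M3) : V3 := mkV (m12 A) (m22 A) (m32 A).
Definition col3 (A : M3) : V3 := mkV (m13 A) (m23 A) (m33 A).

Ltac entries_col := unfold col1, col2, col3; entries.

Lemma mtrace_gram_ge0 A : 0 <= mtrace (mmul (mtrans A) A).
Proof.
  replace (mtrace _) with (dot (col1 A) (col1 A) + dot (col2 A) (col2 A) + dot (col3 A) (col3 A))
    by (entries_col; ring).
  pose proof (dot_self_ge0 (col1 A)); pose proof (dot_self_ge0 (col2 A));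
  pose proof (dot_self_ge0 (col3 A)); lra.
Qed.

Lemma mnorm_ge0 A : 0 <= mnorm A.
Proof. apply sqrt_pos. Qed.
Lemma mnorm_sq A : mnorm A * mnorm A = mtrace (mmul (mtrans A) A).
Proof. apply sqrt_sqrt, mtrace_gram_ge0. Qed.
Lemma mnorm_cols A :
  mnorm A = vnorm (mkV (vnorm (col1 A)) (vnorm (col2 A)) (vnorm (col3 A))).
Proof.
  unfold mnorm. unfold vnorm at 1. f_equal. unfold dot at 1; cbn [vx vy vz].
  rewrite !vnorm_sq. entries_col; ring.
Qed.
Lemma mnorm_scale a A : mnorm (mscale a A) = Rabs a * mnorm A.
Proof.
  unfold mnorm. replace (mtrace _) with (a * a * mtrace (mmul (mtrans A) A)) by entries_ring.
  rewrite sqrt_mult_alt by nra. rewrite <- (sqrt_Rsqr_abs a). reflexivity.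
Qed.
Lemma mnorm_trans A : mnorm (mtrans A) = mnorm A.
Proof. unfold mnorm. f_equal. entries_ring. Qed.
Lemma mnorm_zero : mnorm (mscale 0 mid3) = 0.
Proof. rewrite mnorm_scale, Rabs_R0; ring. Qed.
Lemma mnorm_skew v : mnorm (skew v) = sqrt 2 * vnorm v.
Proof.
  unfold mnorm, vnorm. rewrite <- sqrt_mult_alt by lra. f_equal. entries_ring.
Qed.

Lemma sqrt_le_2 x : x <= 4 -> sqrt x <= 2.
Proof.
  intros x_le. rewrite <- (sqrt_square 2) by lra. apply sqrt_le_1_alt. lra.
Qed.

Lemma mnorm_skew_le v : mnorm (skew v) <= 2 * vnorm v.
Proof.
  rewrite mnorm_skew. apply Rmult_le_compat_r; [apply vnorm_ge0 | apply sqrt_le_2; lra].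
Qed.

Lemma mtrace_mul_le A B : Rabs (mtrace (mmul A B)) <= mnorm A * mnorm B.
Proof.
  rewrite <- (mnorm_trans A), !mnorm_cols. eapply Rle_trans; [|apply Rle_trans with (2 := dot_le_vnorm _ _)].
  2: apply Rle_abs.
  replace (mtrace (mmul A B)) with (dot (col1 (mtrans A)) (col1 B) + dot (col2 (mtrans A)) (col2 B)
    + dot (col3 (mtrans A)) (col3 B)) by (entries_col; ring).
  unfold dot at 4; cbn [vx vy vz].
  eapply Rle_trans; [apply Rabs_triang|]. apply Rplus_le_compat; [|apply dot_le_vnorm].
  eapply Rle_trans; [apply Rabs_triang|]. apply Rplus_le_compat; apply dot_le_vnorm.
Qed.

Lemma mnorm_add_le A B : mnorm (madd A B) <= mnorm A + mnorm B.
Proof.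
  pose proof (mnorm_ge0 A); pose proof (mnorm_ge0 B); pose proof (mnorm_ge0 (madd A B)).
  pose proof (mnorm_sq A); pose proof (mnorm_sq B); pose proof (mnorm_sq (madd A B)) as sq.
  pose proof (mtrace_mul_le (mtrans A) B) as cauchy. rewrite mnorm_trans in cauchy.
  pose proof (Rle_abs (mtrace (mmul (mtrans A) B))).
  replace (mtrace (mmul (mtrans (madd A B)) (madd A B))) with
    (mtrace (mmul (mtrans A) A) + 2 * mtrace (mmul (mtrans A) B) + mtrace (mmul (mtrans B) B)) in sq
    by entries_ring.
  apply Rsqr_incr_0_var; [unfold Rsqr; nra | lra].
Qed.

Lemma vnorm_mvmul_le A v : vnorm (mvmul A v) <= mnorm A * vnorm v.
Proof.
  unfold mnorm, vnorm. rewrite <- sqrt_mult by (apply mtrace_gram_ge0 || apply dot_self_ge0).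
  apply sqrt_le_1_alt.
  pose proof (dot_sq_le (col1 (mtrans A)) v); pose proof (dot_sq_le (col2 (mtrans A)) v);
  pose proof (dot_sq_le (col3 (mtrans A)) v).
  replace (dot (mvmul A v) (mvmul A v)) with (dot (col1 (mtrans A)) v * dot (col1 (mtrans A)) v
    + dot (col2 (mtrans A)) v * dot (col2 (mtrans A)) v
    + dot (col3 (mtrans A)) v * dot (col3 (mtrans A)) v) by (entries_col; ring).
  replace (mtrace (mmul (mtrans A) A)) with (dot (col1 (mtrans A)) (col1 (mtrans A))
    + dot (col2 (mtrans A)) (col2 (mtrans A)) + dot (col3 (mtrans A)) (col3 (mtrans A)))
    by (entries_col; ring).
  lra.
Qed.

Lemma mnorm_mul_le A B : mnorm (mmul A B) <= mnorm A * mnorm B.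
Proof.
  assert (sq_le : forall v, dot (mvmul A v) (mvmul A v) <= mtrace (mmul (mtrans A) A) * dot v v).
  { intros v. rewrite <- vnorm_sq, <- mnorm_sq, <- vnorm_sq.
    pose proof (vnorm_mvmul_le A v). pose proof (vnorm_ge0 (mvmul A v)). nra. }
  unfold mnorm at 1. unfold mnorm at 2. unfold mnorm.
  rewrite <- sqrt_mult by apply mtrace_gram_ge0. apply sqrt_le_1_alt.
  pose proof (sq_le (col1 B)); pose proof (sq_le (col2 B)); pose proof (sq_le (col3 B)).
  replace (mtrace (mmul (mtrans (mmul A B)) (mmul A B))) with
    (dot (mvmul A (col1 B)) (mvmul A (col1 B)) + dot (mvmul A (col2 B)) (mvmul A (col2 B))
     + dot (mvmul A (col3 B)) (mvmul A (col3 B))) by (entries_col; ring).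
  replace (mtrace (mmul (mtrans B) B)) with
    (dot (col1 B) (col1 B) + dot (col2 B) (col2 B) + dot (col3 B) (col3 B)) by (entries_col; ring).
  lra.
Qed.

Lemma mdist_self A : mdist A A = 0.
Proof.
  unfold mdist. replace (msub A A) with (mscale 0 mid3) by entries_ring. apply mnorm_zero.
Qed.
Lemma mdist_sym A B : mdist A B = mdist B A.
Proof.
  unfold mdist. replace (msub A B) with (mscale (-1) (msub B A)) by entries_ring.
  rewrite mnorm_scale, Rabs_left; lra.
Qed.
Lemma mdist_triang A B C : mdist A C <= mdist A B + mdist B C.
Proof.
  unfold mdist. replace (msub A C) with (madd (msub A B) (msub B C)) by entries_ring.
  apply mnorm_add_le.
Qed.
Lemma mdist_trans A B : mdist (mtrans A) (mtrans B) = mdist A B.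
Proof.
  unfold mdist. rewrite <- mnorm_trans. reflexivity.
Qed.

Lemma mdist_zero_eq A B : mdist A B <= 0 -> A = B.
Proof.
  intros AB. assert (E : mdist A B = 0) by (apply Rle_antisym; [exact AB | apply mnorm_ge0]).
  unfold mdist in E. pose proof (mnorm_sq (msub A B)) as sq. rewrite E in sq.
  replace (mtrace (mmul (mtrans (msub A B)) (msub A B))) with
    (dot (vsub (col1 A) (col1 B)) (vsub (col1 A) (col1 B))
     + dot (vsub (col2 A) (col2 B)) (vsub (col2 A) (col2 B))
     + dot (vsub (col3 A) (col3 B)) (vsub (col3 A) (col3 B))) in sq by (entries_col; ring).
  pose proof (dot_self_ge0 (vsub (col1 A) (col1 B))) as ge1.
  pose proof (dot_self_ge0 (vsub (col2 A) (col2 B))) as ge2.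
  pose proof (dot_self_ge0 (vsub (col3 A) (col3 B))) as ge3.
  assert (E1 : col1 A = col1 B) by (apply vsub_eq0, dot_self_eq0; lra).
  assert (E2 : col2 A = col2 B) by (apply vsub_eq0, dot_self_eq0; lra).
  assert (E3 : col3 A = col3 B) by (apply vsub_eq0, dot_self_eq0; lra).
  injection E1; injection E2; injection E3; intros. apply M3_ext; assumption.
Qed.

(** * The group SO(3) *)

Lemma SO3_trans_mul A : inSO3 A -> mmul (mtrans A) A = mid3.
Proof. intros [gram _]; exact gram. Qed.

Lemma SO3_trans_adj A : inSO3 A -> mtrans A = madj A.
Proof.
  intros [gram det].
  rewrite <- (mmul_1r (mtrans A)), <- (mscale_1 mid3), <- det, <- mmul_adj, <- mmul_assoc, gram.
  apply mmul_1l.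
Qed.

Lemma SO3_mul_trans A : inSO3 A -> mmul A (mtrans A) = mid3.
Proof.
  intros SA. rewrite (SO3_trans_adj A SA), mmul_adj. destruct SA as [_ ->]. apply mscale_1.
Qed.

Lemma SO3_mulKl A B : inSO3 A -> mmul (mtrans A) (mmul A B) = B.
Proof. intros SA. rewrite <- mmul_assoc, (SO3_trans_mul A SA). apply mmul_1l. Qed.
Lemma SO3_mulVKl A B : inSO3 A -> mmul A (mmul (mtrans A) B) = B.
Proof. intros SA. rewrite <- mmul_assoc, (SO3_mul_trans A SA). apply mmul_1l. Qed.

Lemma SO3_1 : inSO3 mid3.
Proof. split; [apply mmul_1r | entries_ring]. Qed.
Lemma SO3_mul A B : inSO3 A -> inSO3 B -> inSO3 (mmul A B).
Proof.
  intros SA [gramB detB]; split.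
  - rewrite mtrans_mul, mmul_assoc, (SO3_mulKl A B SA). exact gramB.
  - rewrite mdet_mul, detB. destruct SA as [_ ->]. ring.
Qed.
Lemma SO3_trans A : inSO3 A -> inSO3 (mtrans A).
Proof.
  intros SA; split; [rewrite mtrans_mtrans; apply SO3_mul_trans; exact SA |].
  rewrite mdet_trans; apply SA.
Qed.

Lemma SO3_dot A u v : inSO3 A -> dot (mvmul A u) (mvmul A v) = dot u v.
Proof. intros SA. rewrite dot_mvmul, <- mvmul_mul, (SO3_trans_mul A SA), mvmul_1. reflexivity. Qed.
Lemma SO3_vnorm A v : inSO3 A -> vnorm (mvmul A v) = vnorm v.
Proof. intros SA. unfold vnorm. rewrite (SO3_dot A v v SA). reflexivity. Qed.

Lemma SO3_cross A u v : inSO3 A -> cross (mvmul A u) (mvmul A v) = mvmul A (cross u v).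
Proof.
  intros SA. transitivity (mvmul (mtrans (madj A)) (cross u v)); [entries_ring|].
  rewrite <- (SO3_trans_adj A SA), mtrans_mtrans. reflexivity.
Qed.

Lemma SO3_skew A v : inSO3 A -> mmul (mmul A (skew v)) (mtrans A) = skew (mvmul A v).
Proof.
  intros SA. transitivity (skew (mvmul (mtrans (madj A)) v)); [entries_ring|].
  rewrite <- (SO3_trans_adj A SA), mtrans_mtrans. reflexivity.
Qed.

Lemma SO3_mnorm_mull Q A : inSO3 Q -> mnorm (mmul Q A) = mnorm A.
Proof.
  intros SQ. unfold mnorm. rewrite mtrans_mul, mmul_assoc, (SO3_mulKl Q A SQ). reflexivity.
Qed.
Lemma SO3_mnorm_mulr Q A : inSO3 Q -> mnorm (mmul A Q) = mnorm A.
Proof.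
  intros SQ. rewrite <- mnorm_trans, mtrans_mul, SO3_mnorm_mull by (apply SO3_trans, SQ).
  apply mnorm_trans.
Qed.
Lemma SO3_mnorm_le A : inSO3 A -> mnorm A <= 2.
Proof.
  intros SA. unfold mnorm. rewrite (SO3_trans_mul A SA), mtrace_1. apply sqrt_le_2. lra.
Qed.

Lemma SO3_mdist_mull Q A B : inSO3 Q -> mdist (mmul Q A) (mmul Q B) = mdist A B.
Proof. intros SQ. unfold mdist. rewrite <- mmul_subr. apply SO3_mnorm_mull, SQ. Qed.
Lemma SO3_mdist_mulr Q A B : inSO3 Q -> mdist (mmul A Q) (mmul B Q) = mdist A B.
Proof. intros SQ. unfold mdist. rewrite <- mmul_subl. apply SO3_mnorm_mulr, SQ. Qed.
Lemma SO3_mdist_mul A B C D : inSO3 B -> inSO3 C ->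
  mdist (mmul A B) (mmul C D) <= mdist A C + mdist B D.
Proof.
  intros SB SC. eapply Rle_trans; [apply (mdist_triang _ (mmul C B))|].
  rewrite SO3_mdist_mulr, SO3_mdist_mull by assumption. apply Rle_refl.
Qed.

Lemma SO3_mdist_id_sq A : inSO3 A -> mdist A mid3 * mdist A mid3 = 6 - 2 * mtrace A.
Proof.
  intros SA. unfold mdist. rewrite mnorm_sq.
  transitivity (mtrace (mmul (mtrans A) A) + mtrace mid3 - 2 * mtrace A); [entries_ring|].
  rewrite (SO3_trans_mul A SA), mtrace_1. ring.
Qed.

Lemma SO3_mtrace_le A : inSO3 A -> mtrace A <= 3.
Proof. intros SA. pose proof (SO3_mdist_id_sq A SA). nra. Qed.

Lemma SO3_mtrace_eq3 A : inSO3 A -> mtrace A = 3 -> A = mid3.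
Proof.
  intros SA tr. pose proof (SO3_mdist_id_sq A SA) as sq. rewrite tr in sq.
  apply mdist_zero_eq. nra.
Qed.

Lemma trans_eq_of_vee_eq0 A : vee A = vzero -> mtrans A = A.
Proof. intros E. injection E; intros. apply M3_ext; cbn; lra. Qed.

Lemma SO3_mtrace_sq A : inSO3 A -> mtrace (mmul A A) = mtrace A * mtrace A - 2 * mtrace A.
Proof.
  intros SA. transitivity (mtrace A * mtrace A - 2 * mtrace (madj A)); [entries_ring|].
  rewrite <- (SO3_trans_adj A SA), mtrace_trans. reflexivity.
Qed.

Lemma SO3_dot_vee A : inSO3 A -> dot (vee A) (vee A) = (3 - mtrace A) * (1 + mtrace A).
Proof.
  intros SA. transitivity (mtrace (mmul (mtrans A) A) - mtrace (mmul A A)); [entries_ring|].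
  rewrite (SO3_trans_mul A SA), mtrace_1, (SO3_mtrace_sq A SA). ring.
Qed.

Lemma SO3_symmetric_cases A : inSO3 A -> vee A = vzero -> A = mid3 \/ mtrace A = -1.
Proof.
  intros SA sym. pose proof (SO3_dot_vee A SA) as E. rewrite sym in E.
  replace (dot vzero vzero) with 0 in E by entries_ring. symmetry in E.
  apply Rmult_integral in E. destruct E; [left | right; lra].
  apply SO3_mtrace_eq3; [exact SA | lra].
Qed.

(* An eigenvector for -1 forces det (A + I) = 2 + 2 tr A to vanish. *)
Lemma SO3_involution A v : inSO3 A -> mvmul A v = vneg v -> v <> vzero -> mtrans A = A.
Proof.
  intros SA eigen v_nz. apply trans_eq_of_vee_eq0, dot_self_eq0.
  rewrite (SO3_dot_vee A SA). enough (mtrace A = -1) as -> by ring.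
  assert (det0 : mdet (madd A mid3) = 0).
  { apply NNPP; intros det_nz. apply v_nz, (vscale_eq0 _ _ det_nz).
    transitivity (mvmul (madj (madd A mid3)) (vadd (mvmul A v) v)); [entries_ring|].
    rewrite eigen. entries_ring. }
  assert (expand : mdet (madd A mid3) = mdet A + mtrace (madj A) + mtrace A + 1) by entries_ring.
  rewrite det0, <- (SO3_trans_adj A SA), mtrace_trans in expand. destruct SA as [_ det].
  lra.
Qed.

(** * Rotations *)

Lemma sin_sq t : sin t * sin t = 1 - cos t * cos t.
Proof. pose proof (sin2_cos2 t). unfold Rsqr in *. lra. Qed.

Lemma rodrigues t u : dot u u = 1 ->
  rot_unit t u = madd mid3 (madd (mscale (sin t) (skew u))
                   (mscale (1 - cos t) (mmul (skew u) (skew u)))).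
Proof.
  destruct u as [x y z]; unfold dot; cbn; intros U.
  assert (zz : z * z = 1 - x * x - y * y) by lra.
  unfold rot_unit. generalize (cos t) (sin t); intros C S. apply M3_ext; cbn; ring [zz].
Qed.

Lemma rot_unit_SO3 t u : dot u u = 1 -> inSO3 (rot_unit t u).
Proof.
  destruct u as [x y z]; unfold dot; cbn; intros U.
  assert (zz : z * z = 1 - x * x - y * y) by lra.
  pose proof (sin_sq t) as ss.
  split.
  - unfold rot_unit, mmul, mtrans, mid3; cbn. f_equal; ring [zz ss].
  - unfold rot_unit, mdet; cbn. ring [zz ss].
Qed.

Lemma rot_unit_add s t u :
  dot u u = 1 -> rot_unit (s + t) u = mmul (rot_unit s u) (rot_unit t u).
Proof.
  destruct u as [x y z]; unfold dot; cbn; intros U.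
  assert (zz : z * z = 1 - x * x - y * y) by lra.
  unfold rot_unit, mmul; cbn. rewrite cos_plus, sin_plus. f_equal; ring [zz].
Qed.

Lemma rot_unit_0 u : rot_unit 0 u = mid3.
Proof. unfold rot_unit, mid3. rewrite cos_0, sin_0. f_equal; ring. Qed.

Lemma rot_unit_opp t u : rot_unit (- t) u = mtrans (rot_unit t u).
Proof. unfold rot_unit, mtrans; cbn. rewrite cos_neg, sin_neg. f_equal; ring. Qed.

Lemma rot_unit_vneg t u : rot_unit t (vneg u) = rot_unit (- t) u.
Proof. unfold rot_unit, vneg; cbn. rewrite cos_neg, sin_neg. f_equal; ring. Qed.

Lemma rot_unit_period t u : rot_unit (t - 2 * PI) u = rot_unit t u.
Proof.
  unfold rot_unit. rewrite cos_minus, sin_minus, cos_2PI, sin_2PI. f_equal; ring.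
Qed.

Lemma mtrace_mul_rot_unit B t u : mtrace (mmul B (rot_unit t u)) =
  cos t * mtrace B + sin t * dot (vee B) u + (1 - cos t) * dot u (mvmul B u).
Proof. unfold rot_unit. generalize (cos t) (sin t). entries_ring. Qed.

Lemma mvmul_rot_unit t u v : mvmul (rot_unit t u) v =
  vadd (vscale (cos t) v) (vadd (vscale (sin t) (cross u v))
    (vscale ((1 - cos t) * dot u v) u)).
Proof. unfold rot_unit. generalize (cos t) (sin t). entries_ring. Qed.

Lemma rot_unit_conj Q t u : inSO3 Q -> dot u u = 1 ->
  mmul (mmul Q (rot_unit t u)) (mtrans Q) = rot_unit t (mvmul Q u).
Proof.
  intros SQ U. rewrite !rodrigues by (rewrite ?SO3_dot; assumption).
  rewrite <- (SO3_skew Q u SQ).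
  rewrite !mmul_addr, !mmul_addl, !mmul_scaler, !mmul_scalel, mmul_1r, (SO3_mul_trans Q SQ).
  do 3 f_equal. rewrite !mmul_assoc. do 2 f_equal. symmetry. apply SO3_mulKl, SQ.
Qed.

Lemma rot_eq_rot_unit t u : dot u u = 1 -> rot t u = rot_unit t u.
Proof.
  intros U. unfold rot. rewrite (vnorm_unit u U), Rinv_1, Rmult_1_r. f_equal. entries_ring.
Qed.

Lemma rot_vzero t : rot t vzero = mid3.
Proof. unfold rot. rewrite vnorm_0, Rmult_0_r. apply rot_unit_0. Qed.

Lemma rot_0 v : rot 0 v = mid3.
Proof. unfold rot. rewrite Rmult_0_l. apply rot_unit_0. Qed.

Lemma rot_SO3 t v : inSO3 (rot t v).
Proof.
  destruct (classic (v = vzero)) as [-> | v_nz].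
  - rewrite rot_vzero; apply SO3_1.
  - apply rot_unit_SO3, normalized_unit, v_nz.
Qed.

Lemma rot_add s t v : rot (s + t) v = mmul (rot s v) (rot t v).
Proof.
  destruct (classic (v = vzero)) as [-> | v_nz].
  - rewrite !rot_vzero, mmul_1l; reflexivity.
  - unfold rot. rewrite Rmult_plus_distr_r. apply rot_unit_add, normalized_unit, v_nz.
Qed.

Lemma rot_opp t v : rot (- t) v = mtrans (rot t v).
Proof. unfold rot. rewrite <- rot_unit_opp. f_equal. ring. Qed.

Lemma rot_vneg t v : rot t (vneg v) = rot (- t) v.
Proof.
  unfold rot. rewrite vnorm_neg.
  replace (vscale (/ vnorm v) (vneg v)) with (vneg (vscale (/ vnorm v) v)) by entries_ring.
  rewrite rot_unit_vneg. f_equal. ring.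
Qed.

Lemma rot_vscale_pos t a v : 0 < a -> rot t (vscale a v) = rot (t * a) v.
Proof.
  intros a_pos. destruct (classic (v = vzero)) as [-> | v_nz].
  - replace (vscale a vzero) with vzero by entries_ring. rewrite !rot_vzero. reflexivity.
  - unfold rot. pose proof (vnorm_pos v v_nz).
    rewrite vnorm_scale, Rabs_right by lra. f_equal; [ring | entries; field; lra].
Qed.

Lemma rot_vscale t a v : rot t (vscale a v) = rot (t * a) v.
Proof.
  destruct (Rtotal_order a 0) as [a_neg | [-> | a_pos]].
  - replace (vscale a v) with (vneg (vscale (- a) v)) by entries_ring.
    rewrite rot_vneg, rot_vscale_pos by lra. f_equal; ring.
  - replace (vscale 0 v) with vzero by entries_ring.
    rewrite rot_vzero, Rmult_0_r, rot_0. reflexivity.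
  - apply rot_vscale_pos, a_pos.
Qed.

Lemma rot_period t v : v <> vzero -> rot (t - 2 * PI / vnorm v) v = rot t v.
Proof.
  intros v_nz. pose proof (vnorm_pos v v_nz). unfold rot.
  rewrite <- (rot_unit_period (t * vnorm v)). f_equal. field. lra.
Qed.

Lemma rot_conj Q t v : inSO3 Q -> mmul (mmul Q (rot t v)) (mtrans Q) = rot t (mvmul Q v).
Proof.
  intros SQ. destruct (classic (v = vzero)) as [-> | v_nz].
  - replace (mvmul Q vzero) with vzero by entries_ring.
    rewrite rot_vzero, mmul_1r. apply SO3_mul_trans, SQ.
  - unfold rot. rewrite (SO3_vnorm Q v SQ), <- mvmul_scale.
    apply rot_unit_conj; [exact SQ | apply normalized_unit, v_nz].
Qed.

Lemma mmul_rot Q t v : inSO3 Q -> mmul Q (rot t v) = mmul (rot t (mvmul Q v)) Q.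
Proof.
  intros SQ. rewrite <- (rot_conj Q t v SQ), !mmul_assoc, (SO3_trans_mul Q SQ), mmul_1r.
  reflexivity.
Qed.

(** * Taylor bounds *)

Lemma cos_ge_quadratic t : 1 - t * t / 2 <= cos t.
Proof.
  destruct (Rle_dec (t * t) 4) as [small | large].
  - destruct (pre_cos_bound t 0) as [bound _]; try nra.
    unfold cos_approx, cos_term in bound. cbn in bound. lra.
  - pose proof (COS_bound t). lra.
Qed.

Lemma cos_le_quartic t : -2 <= t <= 2 -> cos t <= 1 - t * t / 2 + t * t * t * t / 24.
Proof.
  intros t_le. destruct (pre_cos_bound t 0) as [_ bound]; try lra.
  unfold cos_approx, cos_term in bound. cbn in bound. lra.
Qed.

Lemma sin_bounds_cubic t : 0 <= t <= 4 ->
  t - t * t * t / 6 <= sin t <= t - t * t * t / 6 + t * t * t * t * t / 120.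
Proof.
  intros t_le. destruct (pre_sin_bound t 0) as [lower upper]; try lra.
  unfold sin_approx, sin_term in lower, upper. cbn in lower, upper. lra.
Qed.

Lemma sin_sub_le t : 0 <= t -> Rabs (sin t - t) <= 2 * (t * t).
Proof.
  intros t_ge0. destruct (Rle_dec t 1) as [t_le1 | t_gt1].
  - destruct (sin_bounds_cubic t) as [lower upper]; [lra|].
    assert (0 <= t * t * t <= t * t) by (split; nra).
    assert (t * t * t * t * t <= t * t) by nra.
    apply Rabs_le. split; lra.
  - pose proof (SIN_bound t). apply Rabs_le; split; nra.
Qed.

Lemma Rabs_one_minus_cos_le t : Rabs (1 - cos t) <= t * t / 2.
Proof.
  pose proof (cos_ge_quadratic t). pose proof (COS_bound t). apply Rabs_le. lra.
Qed.

Lemma mdist_rot_id_le t v : mdist (rot t v) mid3 <= 2 * (Rabs t * vnorm v).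
Proof.
  rewrite <- (Rabs_right (vnorm v)) by (apply Rle_ge, vnorm_ge0).
  rewrite <- Rabs_mult. set (th := t * vnorm v).
  assert (trace : mtrace (rot t v) = 1 + 2 * cos th).
  { destruct (classic (v = vzero)) as [-> | v_nz].
    - unfold th. rewrite rot_vzero, vnorm_0, Rmult_0_r, cos_0, mtrace_1. ring.
    - unfold rot. fold th. pose proof (normalized_unit v v_nz) as U.
      rewrite <- (mmul_1l (rot_unit _ _)), mtrace_mul_rot_unit, mvmul_1, U, mtrace_1.
      replace (vee mid3) with vzero by entries_ring. entries. ring. }
  pose proof (SO3_mdist_id_sq _ (rot_SO3 t v)) as sq. rewrite trace in sq.
  pose proof (cos_ge_quadratic th).
  assert (sq_abs : Rabs th * Rabs th = th * th) by (rewrite <- Rabs_mult; apply Rabs_right; nra).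
  apply Rsqr_incr_0_var; [unfold Rsqr; nra | pose proof (Rabs_pos th); lra].
Qed.

Lemma mnorm_skew_unit_le u : dot u u = 1 -> mnorm (skew u) <= 2.
Proof. intros U. pose proof (mnorm_skew_le u). rewrite (vnorm_unit u U) in *. lra. Qed.

Lemma mnorm_skew_sq_unit_le u : dot u u = 1 -> mnorm (mmul (skew u) (skew u)) <= 2.
Proof.
  intros U. eapply Rle_trans; [apply mnorm_mul_le|].
  rewrite mnorm_skew, (vnorm_unit u U), Rmult_1_r, sqrt_sqrt; lra.
Qed.

Lemma mnorm_scale_le a A x y : Rabs a <= x -> mnorm A <= y -> mnorm (mscale a A) <= x * y.
Proof.
  intros ax Ay. rewrite mnorm_scale.
  apply Rmult_le_compat; auto using Rabs_pos, mnorm_ge0.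
Qed.

Lemma mdist_rot_linear_le t v : 0 <= t ->
  mdist (rot t v) (madd mid3 (mscale t (skew v))) <= 5 * (t * t * (vnorm v * vnorm v)).
Proof.
  intros t_ge0. destruct (classic (v = vzero)) as [-> | v_nz].
  { rewrite rot_vzero, vnorm_0. replace (madd _ _) with mid3 by entries_ring.
    rewrite mdist_self. lra. }
  pose proof (vnorm_pos v v_nz). pose proof (normalized_unit v v_nz) as U.
  rewrite <- (vscale_vnorm v v_nz) at 2. rewrite skew_scale, mscale_mscale.
  unfold rot. set (th := t * vnorm v). set (u := vscale (/ vnorm v) v) in *.
  assert (0 <= th) by (unfold th; nra).
  unfold mdist. replace (msub _ _) with (madd (mscale (sin th - th) (skew u))
     (mscale (1 - cos th) (mmul (skew u) (skew u)))) by (rewrite (rodrigues th u U); entries_ring).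
  replace (5 * _) with (2 * (th * th) * 2 + th * th / 2 * 2) by (unfold th; field).
  eapply Rle_trans; [apply mnorm_add_le|]. apply Rplus_le_compat; apply mnorm_scale_le.
  - apply sin_sub_le; lra.
  - apply mnorm_skew_unit_le, U.
  - apply Rabs_one_minus_cos_le.
  - apply mnorm_skew_sq_unit_le, U.
Qed.

(** * Third-order expansions of matrix-valued functions *)

Lemma exists_small d c q : 0 < d -> 0 < c -> exists e, 0 < e <= d /\ e * q < c.
Proof.
  intros d_pos c_pos. pose proof (Rabs_pos q). pose proof (Rle_abs q).
  exists (Rmin d (c / (Rabs q + 1))). pose proof (Rmin_l d (c / (Rabs q + 1))).
  assert (pos : 0 < Rmin d (c / (Rabs q + 1))) by (apply Rmin_pos; [|apply Rdiv_lt_0_compat]; lra).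
  split; [lra|].
  apply Rle_lt_trans with (Rmin d (c / (Rabs q + 1)) * Rabs q); [apply Rmult_le_compat_l; lra|].
  apply Rlt_le_trans with (Rmin d (c / (Rabs q + 1)) * (Rabs q + 1)); [apply Rmult_lt_compat_l; lra|].
  apply Rle_trans with (c / (Rabs q + 1) * (Rabs q + 1)).
  - apply Rmult_le_compat_r; [lra | apply Rmin_r].
  - apply Req_le. field. lra.
Qed.

Lemma le_of_le_add_small x y k : (forall e, 0 < e <= 1 -> x <= y + k * e) -> x <= y.
Proof.
  intros le. apply Rnot_lt_le; intros lt.
  destruct (exists_small 1 (x - y) k) as (e & e_le & ek); [lra | lra |].
  specialize (le e e_le). lra.
Qed.

Definition poly3 (A1 A2 A3 : M3) (e : R) : M3 :=
  madd mid3 (madd (mscale e A1) (madd (mscale (e * e) A2) (mscale (e * e * e) A3))).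

Definition expansion3 (G : R -> M3) (A1 A2 A3 : M3) : Prop :=
  exists M d, 0 <= M /\ 0 < d <= 1 /\ forall e, 0 <= e <= d ->
    mdist (G e) (poly3 A1 A2 A3 e) <= M * (e * e * e * e).

Lemma mnorm_poly3_le A1 A2 A3 e : 0 <= e <= 1 ->
  mnorm (poly3 A1 A2 A3 e) <= 2 + (mnorm A1 + (mnorm A2 + mnorm A3)).
Proof.
  intros e_le. assert (0 <= e * e <= 1) by nra. assert (0 <= e * e * e <= 1) by nra.
  assert (shrink : forall k A, 0 <= k <= 1 -> mnorm (mscale k A) <= mnorm A).
  { intros k A k_le. rewrite mnorm_scale, Rabs_right by lra. pose proof (mnorm_ge0 A). nra. }
  unfold poly3. repeat (eapply Rle_trans; [apply mnorm_add_le | apply Rplus_le_compat]); auto.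
  apply SO3_mnorm_le, SO3_1.
Qed.

Lemma poly3_mul A1 A2 A3 B1 B2 B3 : exists k, 0 <= k /\ forall e, 0 <= e <= 1 ->
  mdist (mmul (poly3 A1 A2 A3 e) (poly3 B1 B2 B3 e))
    (poly3 (madd A1 B1) (madd A2 (madd (mmul A1 B1) B2))
      (madd A3 (madd (mmul A2 B1) (madd (mmul A1 B2) B3))) e) <= k * (e * e * e * e).
Proof.
  set (T4 := madd (mmul A3 B1) (madd (mmul A2 B2) (mmul A1 B3))).
  set (T5 := madd (mmul A3 B2) (mmul A2 B3)). set (T6 := mmul A3 B3).
  exists (mnorm T4 + (mnorm T5 + mnorm T6)).
  pose proof (mnorm_ge0 T4); pose proof (mnorm_ge0 T5); pose proof (mnorm_ge0 T6).
  split; [lra|]. intros e e_le. set (e4 := e * e * e * e).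
  assert (ee : 0 <= e * e <= 1) by nra. assert (e4_ge0 : 0 <= e4) by (unfold e4; nra).
  assert (0 <= e4 * e <= e4) by nra. assert (0 <= e4 * (e * e) <= e4) by nra.
  unfold mdist. replace (msub _ _) with
    (madd (mscale e4 T4) (madd (mscale (e4 * e) T5) (mscale (e4 * (e * e)) T6)))
    by (unfold e4, T4, T5, T6, poly3; entries_ring).
  replace ((mnorm T4 + (mnorm T5 + mnorm T6)) * e4) with
    (e4 * mnorm T4 + (e4 * mnorm T5 + e4 * mnorm T6)) by ring.
  repeat (eapply Rle_trans; [apply mnorm_add_le | apply Rplus_le_compat]);
    apply mnorm_scale_le; rewrite ?Rabs_right; lra.
Qed.

Lemma expansion3_mul F G A1 A2 A3 B1 B2 B3 :
  expansion3 F A1 A2 A3 -> expansion3 G B1 B2 B3 ->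
  expansion3 (fun e => mmul (F e) (G e)) (madd A1 B1) (madd A2 (madd (mmul A1 B1) B2))
      (madd A3 (madd (mmul A2 B1) (madd (mmul A1 B2) B3))).
Proof.
  intros (M & d & M_ge0 & d_le & expF) (M' & d' & M'_ge0 & d'_le & expG).
  destruct (poly3_mul A1 A2 A3 B1 B2 B3) as (k & k_ge0 & poly_mul).
  set (sA := 2 + (mnorm A1 + (mnorm A2 + mnorm A3))).
  set (sB := 2 + (mnorm B1 + (mnorm B2 + mnorm B3))).
  pose proof (mnorm_poly3_le A1 A2 A3) as boundA. fold sA in boundA.
  pose proof (mnorm_poly3_le B1 B2 B3) as boundB. fold sB in boundB.
  assert (0 <= sA) by (eapply Rle_trans; [apply mnorm_ge0 | apply (boundA 0); lra]).
  assert (0 <= sB) by (eapply Rle_trans; [apply mnorm_ge0 | apply (boundB 0); lra]).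
  exists (M * (M' + sB) + (sA * M' + k)), (Rmin d d').
  pose proof (Rmin_l d d'); pose proof (Rmin_r d d').
  split; [|split; [split; [apply Rmin_pos|]; lra|]].
  { repeat apply Rplus_le_le_0_compat; try apply Rmult_le_pos; lra. }
  intros e e_le. specialize (expF e ltac:(lra)). specialize (expG e ltac:(lra)).
  specialize (boundA e ltac:(lra)). specialize (boundB e ltac:(lra)).
  specialize (poly_mul e ltac:(lra)).
  set (P := poly3 A1 A2 A3 e) in *. set (Q := poly3 B1 B2 B3 e) in *.
  set (e4 := e * e * e * e) in *.
  assert (0 <= e4 <= 1) by (unfold e4; assert (0 <= e * e <= 1) by nra; nra).
  assert (G_le : mnorm (G e) <= M' + sB).
  { replace (G e) with (madd (msub (G e) Q) Q) by entries_ring.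
    eapply Rle_trans; [apply mnorm_add_le|]. unfold mdist in expG. nra. }
  eapply Rle_trans; [apply (mdist_triang _ (mmul P (G e)))|].
  eapply Rle_trans; [apply Rplus_le_compat_l, (mdist_triang _ (mmul P Q))|].
  unfold mdist at 1 2. rewrite <- mmul_subl, <- mmul_subr.
  replace ((M * (M' + sB) + (sA * M' + k)) * e4) with
    (M * e4 * (M' + sB) + (sA * (M' * e4) + k * e4)) by ring.
  apply Rplus_le_compat; [|apply Rplus_le_compat; [|exact poly_mul]];
    (eapply Rle_trans; [apply mnorm_mul_le | apply Rmult_le_compat]); auto using mnorm_ge0.
Qed.

Lemma skew_cube u : dot u u = 1 -> mmul (skew u) (mmul (skew u) (skew u)) = mscale (-1) (skew u).
Proof.
  intros U. transitivity (mscale (- dot u u) (skew u)); [entries_ring | rewrite U; entries_ring].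
Qed.

Lemma expansion3_rot v :
  expansion3 (fun e => rot e v) (skew v) (mscale (/2) (mmul (skew v) (skew v)))
      (mscale (/6) (mmul (skew v) (mmul (skew v) (skew v)))).
Proof.
  destruct (classic (v = vzero)) as [-> | v_nz].
  { exists 0, 1. split; [lra | split; [lra|]]. intros e _. rewrite rot_vzero.
    replace (poly3 _ _ _ e) with mid3 by (unfold poly3; entries_ring). rewrite mdist_self. lra. }
  pose proof (vnorm_pos v v_nz) as n_pos. pose proof (normalized_unit v v_nz) as U.
  pose proof (vscale_vnorm v v_nz) as v_eq. set (n := vnorm v) in *.
  set (u := vscale (/ n) v) in *. pose proof (Rmin_l 1 (/ n)); pose proof (Rmin_r 1 (/ n)).
  exists (n * n * n * n), (Rmin 1 (/ n)).
  split; [repeat apply Rmult_le_pos; lra|].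
  split; [split; [apply Rmin_pos; [lra | apply Rinv_0_lt_compat, n_pos] | lra]|].
  intros e e_le. set (th := e * n).
  assert (th_le : 0 <= th <= 1).
  { unfold th. split; [nra|]. apply Rle_trans with (/ n * n); [apply Rmult_le_compat_r; lra|].
    rewrite Rinv_l; lra. }
  unfold rot. fold n u th. rewrite (rodrigues th u U), <- v_eq, !skew_scale.
  unfold mdist. replace (msub _ _) with
    (madd (mscale (sin th - th + th * th * th / 6) (skew u))
          (mscale (1 - cos th - th * th / 2) (mmul (skew u) (skew u)))).
  2:{ unfold poly3. rewrite !mmul_scaler, !mmul_scalel, !mmul_scaler, (skew_cube u U).
      unfold th. generalize (skew u) (sin (e * n)) (cos (e * n)). entries; field. }
  assert (quartic : 0 <= th * th * th * th) by (assert (0 <= th * th) by nra; nra).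
  assert (th * th * th * th * th <= th * th * th * th) by nra.
  replace (n * n * n * n * (e * e * e * e)) with (th * th * th * th) by (unfold th; ring).
  apply Rle_trans with (th * th * th * th / 120 * 2 + th * th * th * th / 24 * 2); [|lra].
  destruct (sin_bounds_cubic th) as [sin_ge sin_le]; [lra|].
  pose proof (cos_ge_quadratic th). pose proof (cos_le_quartic th ltac:(lra)).
  eapply Rle_trans; [apply mnorm_add_le|]. apply Rplus_le_compat; apply mnorm_scale_le.
  - apply Rabs_le; split; lra.
  - apply mnorm_skew_unit_le, U.
  - apply Rabs_le; split; lra.
  - apply mnorm_skew_sq_unit_le, U.
Qed.

Lemma expansion3_mtrace_ge G A1 A2 A3 B : expansion3 G A1 A2 A3 -> mtrace (mmul B A1) = 0 ->
  exists m d, 0 <= m /\ 0 < d <= 1 /\ forall e, 0 <= e <= d ->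
    mtrace B + e * e * (mtrace (mmul B A2) + e * mtrace (mmul B A3) - m * (e * e))
      <= mtrace (mmul B (G e)).
Proof.
  intros (M & d & M_ge0 & d_le & exp) critical. exists (mnorm B * M), d.
  split; [apply Rmult_le_pos; auto using mnorm_ge0 | split; [exact d_le|]].
  intros e e_le. specialize (exp e e_le).
  pose proof (mtrace_mul_le B (msub (G e) (poly3 A1 A2 A3 e))) as T.
  rewrite mmul_subr, mtrace_sub in T. unfold poly3 in T at 1.
  rewrite !mmul_addr, !mmul_scaler, !mtrace_add, !mtrace_scale, mmul_1r, critical in T.
  apply Rabs_le_bounds in T.
  assert (mnorm B * mnorm (msub (G e) (poly3 A1 A2 A3 e)) <= mnorm B * (M * (e * e * e * e)))
    by (apply Rmult_le_compat_l; [apply mnorm_ge0 | exact exp]).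
  lra.
Qed.

Lemma second_order_increase G A1 A2 A3 B d : expansion3 G A1 A2 A3 -> 0 < d ->
  mtrace (mmul B A1) = 0 -> 0 < mtrace (mmul B A2) ->
  exists e, 0 < e <= d /\ mtrace B < mtrace (mmul B (G e)).
Proof.
  intros exp d_pos critical pos.
  destruct (expansion3_mtrace_ge _ _ _ _ _ exp critical) as (m & d' & m_ge0 & d'_le & ge).
  set (c2 := mtrace (mmul B A2)) in *. set (c3 := mtrace (mmul B A3)) in *.
  destruct (exists_small (Rmin d d') c2 (Rabs c3 + m)) as (e & e_le & small);
    [apply Rmin_pos; lra | exact pos |].
  pose proof (Rmin_l d d'); pose proof (Rmin_r d d').
  exists e. split; [lra|]. specialize (ge e ltac:(lra)).
  pose proof (Rle_abs (- c3)) as abs. rewrite Rabs_Ropp in abs.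
  assert (e * - c3 <= e * Rabs c3) by (apply Rmult_le_compat_l; lra).
  assert (e * (m * e) <= e * m) by (apply Rmult_le_compat_l; nra).
  assert (0 < e * e * (c2 + e * c3 - m * (e * e))) by (apply Rmult_lt_0_compat; [nra | lra]).
  lra.
Qed.

Lemma third_order_increase G A1 A2 A3 B d : expansion3 G A1 A2 A3 -> 0 < d ->
  mtrace (mmul B A1) = 0 -> mtrace (mmul B A2) = 0 -> 0 < mtrace (mmul B A3) ->
  exists e, 0 < e <= d /\ mtrace B < mtrace (mmul B (G e)).
Proof.
  intros exp d_pos critical flat pos.
  destruct (expansion3_mtrace_ge _ _ _ _ _ exp critical) as (m & d' & m_ge0 & d'_le & ge).
  set (c3 := mtrace (mmul B A3)) in *. rewrite flat in ge.
  destruct (exists_small (Rmin d d') c3 m) as (e & e_le & small);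
    [apply Rmin_pos; lra | exact pos |].
  pose proof (Rmin_l d d'); pose proof (Rmin_r d d').
  exists e. split; [lra|]. specialize (ge e ltac:(lra)).
  assert (0 < e * e * (e * (c3 - e * m))) by (repeat apply Rmult_lt_0_compat; lra).
  lra.
Qed.

Lemma first_order_le B v k :
  (exists d, 0 < d /\ forall e, 0 <= e <= d -> mtrace (mmul B (rot e v)) <= mtrace B + e * k) ->
  dot (vee B) v <= k.
Proof.
  intros (d & d_pos & le). set (q := 5 * (mnorm B * (vnorm v * vnorm v))).
  apply Rnot_lt_le; intros lt.
  destruct (exists_small d (dot (vee B) v - k) q d_pos) as (e & e_le & small); [lra|].
  specialize (le e ltac:(lra)).
  pose proof (mtrace_mul_le B (msub (rot e v) (madd mid3 (mscale e (skew v))))) as T.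
  rewrite mmul_subr, mtrace_sub, mmul_addr, mtrace_add, mmul_1r, mmul_scaler, mtrace_scale,
    mtrace_skew in T.
  apply Rabs_le_bounds in T.
  assert (mnorm B * mnorm (msub (rot e v) (madd mid3 (mscale e (skew v)))) <= e * (e * q)).
  { replace (e * (e * q)) with (mnorm B * (5 * (e * e * (vnorm v * vnorm v)))) by (unfold q; ring).
    apply Rmult_le_compat_l; [apply mnorm_ge0 | apply mdist_rot_linear_le; lra]. }
  assert (0 < e * (dot (vee B) v - k - e * q)) by (apply Rmult_lt_0_compat; lra).
  lra.
Qed.

Definition outer (u v : V3) : M3 :=
  mkM (vx u * vx v) (vx u * vy v) (vx u * vz v)
      (vy u * vx v) (vy u * vy v) (vy u * vz v)
      (vz u * vx v) (vz u * vy v) (vz u * vz v).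

Lemma mtrace_outer_mul u v A : mtrace (mmul (outer u v) A) = dot (mvmul (mtrans A) v) u.
Proof. unfold outer. entries_ring. Qed.

Lemma rotating_dot_le v w u t : 0 < t ->
  (forall s, 0 <= s <= t -> dot (mvmul (mtrans (rot s v)) w) u <= dot w u) ->
  0 <= dot (cross v w) u.
Proof.
  intros t_pos le.
  enough (dot (vee (outer u w)) v <= 0).
  { replace (dot (cross v w) u) with (- dot (vee (outer u w)) v) by (unfold outer; entries_ring).
    lra. }
  apply first_order_le. exists t. split; [exact t_pos|]. intros e e_le. specialize (le e e_le).
  rewrite mtrace_outer_mul. replace (mtrace (outer u w)) with (dot w u) by (unfold outer; entries_ring).
  lra.
Qed.

(** * Convergent sequences *)

Lemma Un_cv_const c : Un_cv (fun _ => c) c.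
Proof. intros e e_pos. exists 0%nat. intros. unfold Rdist. rewrite Rminus_diag, Rabs_R0. exact e_pos. Qed.
Lemma Un_cv_cos u l : Un_cv u l -> Un_cv (fun n => cos (u n)) (cos l).
Proof. apply continuity_seq, continuity_cos. Qed.
Lemma Un_cv_sin u l : Un_cv u l -> Un_cv (fun n => sin (u n)) (sin l).
Proof. apply continuity_seq, continuity_sin. Qed.
Lemma Un_cv_opp u l : Un_cv u l -> Un_cv (fun n => - u n) (- l).
Proof. apply CV_opp. Qed.
Lemma Un_cv_subseq u l phi : Un_cv u l -> (forall n, (n <= phi n)%nat) -> Un_cv (fun n => u (phi n)) l.
Proof.
  intros cv increasing e e_pos. destruct (cv e e_pos) as [N near]. exists N.
  intros n n_ge. apply near. specialize (increasing n). lia.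
Qed.

Ltac cv := repeat first [assumption | apply Un_cv_const | apply CV_plus | apply CV_minus
  | apply CV_mult | apply Un_cv_opp | apply Un_cv_cos | apply Un_cv_sin].

Lemma Un_cv_inv_S : Un_cv (fun n => / (INR n + 1)) 0.
Proof.
  intros e e_pos. destruct (archimed_cor1 e e_pos) as (N & N_lt & N_pos). exists N.
  intros n n_ge. apply le_INR in n_ge. apply lt_INR in N_pos. cbn in N_pos.
  unfold Rdist. rewrite Rminus_0_r, Rabs_right by (left; apply Rinv_0_lt_compat; lra).
  apply Rle_lt_trans with (/ INR N); [apply Rinv_le_contravar; lra | exact N_lt].
Qed.

Lemma inv_S_bounds n : 0 < / (INR n + 1) <= 1.
Proof.
  pose proof (pos_INR n). split; [apply Rinv_0_lt_compat; lra|].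
  rewrite <- Rinv_1. apply Rinv_le_contravar; lra.
Qed.

Lemma Un_cv_squeeze0 u v : Un_cv v 0 -> (forall n, 0 <= u n <= v n) -> Un_cv u 0.
Proof.
  intros cv between e e_pos. destruct (cv e e_pos) as [N near]. exists N. intros n n_ge.
  specialize (near n n_ge). specialize (between n). unfold Rdist in *.
  rewrite Rminus_0_r, Rabs_right in * by lra. lra.
Qed.

Lemma bounded_subseq (u : nat -> R) B : (forall n, Rabs (u n) <= B) ->
  exists phi l, (forall n, (n <= phi n)%nat) /\ Un_cv (fun n => u (phi n)) l.
Proof.
  intros bounded.
  destruct (Bolzano_Weierstrass u (fun c => - B <= c <= B)) as [l adherent].
  { apply compact_P3. }
  { intros n. specialize (bounded n). apply Rabs_le_bounds in bounded. lra. }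
  assert (near : forall n : nat, exists p, (n <= p)%nat /\ Rabs (u p - l) < / (INR n + 1)).
  { intros n. pose proof (proj1 (inv_S_bounds n)) as pos.
    destruct (adherent (disc l (mkposreal _ pos)) n) as (p & p_ge & p_near).
    - exists (mkposreal _ pos). intros x x_near; exact x_near.
    - exists p. split; assumption. }
  destruct (choice _ near) as [phi phi_near].
  exists phi, l. split; [intros n; apply phi_near|].
  intros e e_pos. destruct (Un_cv_inv_S e e_pos) as [N small]. exists N. intros n n_ge.
  specialize (small n n_ge). pose proof (inv_S_bounds n). unfold Rdist in *.
  rewrite Rminus_0_r, Rabs_right in small by lra. destruct (phi_near n). lra.
Qed.

Lemma bounded_subseq_family d (u : nat -> nat -> R) B : (forall n i, (i < d)%nat -> Rabs (u n i) <= B) ->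
  exists phi l, (forall n, (n <= phi n)%nat) /\
    forall i, (i < d)%nat -> Un_cv (fun n => u (phi n) i) (l i).
Proof.
  induction d as [|d IH]; intros bounded.
  - exists (fun n => n), (fun _ => 0). split; [auto | intros; lia].
  - destruct IH as (phi & l & phi_ge & phi_cv); [intros; apply bounded; lia|].
    destruct (bounded_subseq (fun n => u (phi n) d) B) as (psi & m & psi_ge & psi_cv).
    { intros; apply bounded; lia. }
    exists (fun n => phi (psi n)), (fun i => if Nat.eqb i d then m else l i). split.
    + intros n. specialize (phi_ge (psi n)); specialize (psi_ge n); lia.
    + intros i i_lt. destruct (Nat.eqb_spec i d) as [-> | i_ne]; [exact psi_cv|].
      apply (Un_cv_subseq (fun n => u (phi n) i)); [apply phi_cv; lia | exact psi_ge].
Qed.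

Definition mcv (u : nat -> M3) (A : M3) : Prop :=
  (Un_cv (fun n => m11 (u n)) (m11 A) /\ Un_cv (fun n => m12 (u n)) (m12 A) /\ Un_cv (fun n => m13 (u n)) (m13 A)) /\
  (Un_cv (fun n => m21 (u n)) (m21 A) /\ Un_cv (fun n => m22 (u n)) (m22 A) /\ Un_cv (fun n => m23 (u n)) (m23 A)) /\
  (Un_cv (fun n => m31 (u n)) (m31 A) /\ Un_cv (fun n => m32 (u n)) (m32 A) /\ Un_cv (fun n => m33 (u n)) (m33 A)).

Ltac mcv_entries :=
  unfold mcv in *; cbn [m11 m12 m13 m21 m22 m23 m31 m32 m33 mmul mtrans madd mscale msub mid3 rot rot_unit] in *;
  repeat match goal with E : _ /\ _ |- _ => destruct E end;
  repeat match goal with |- _ /\ _ => split end; cv.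

Lemma mcv_const A : mcv (fun _ => A) A.
Proof. mcv_entries. Qed.
Lemma mcv_mul u v A B : mcv u A -> mcv v B -> mcv (fun n => mmul (u n) (v n)) (mmul A B).
Proof. intros. mcv_entries. Qed.
Lemma mcv_trans u A : mcv u A -> mcv (fun n => mtrans (u n)) (mtrans A).
Proof. intros. mcv_entries. Qed.
Lemma mcv_mtrace u A : mcv u A -> Un_cv (fun n => mtrace (u n)) (mtrace A).
Proof. intros. unfold mtrace. mcv_entries. Qed.
Lemma mcv_rot t l v : Un_cv t l -> mcv (fun n => rot (t n) v) (rot l v).
Proof. intros. mcv_entries. Qed.

Lemma mcv_unique u A B : mcv u A -> mcv u B -> A = B.
Proof. intros. mcv_entries. apply M3_ext; eapply UL_sequence; eassumption. Qed.

Lemma mcv_subseq u A phi : mcv u A -> (forall n, (n <= phi n)%nat) -> mcv (fun n => u (phi n)) A.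
Proof.
  intros. unfold mcv in *. repeat match goal with E : _ /\ _ |- _ => destruct E end.
  repeat match goal with |- _ /\ _ => split end;
  match goal with |- Un_cv (fun n => ?f _) _ => apply (Un_cv_subseq (fun n => f (u n))); assumption end.
Qed.

Lemma mcv_mdist u A : mcv u A -> Un_cv (fun n => mdist (u n) A) 0.
Proof.
  intros cvu. rewrite <- sqrt_0. apply continuity_seq; [apply continuity_pt_sqrt; lra|].
  replace 0 with (mtrace (mmul (mtrans (msub A A)) (msub A A))) by entries_ring.
  apply mcv_mtrace, mcv_mul; [apply mcv_trans|]; mcv_entries.
Qed.

Lemma entry_le_mnorm A :
  (Rabs (m11 A) <= mnorm A /\ Rabs (m12 A) <= mnorm A /\ Rabs (m13 A) <= mnorm A) /\
  (Rabs (m21 A) <= mnorm A /\ Rabs (m22 A) <= mnorm A /\ Rabs (m23 A) <= mnorm A) /\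
  (Rabs (m31 A) <= mnorm A /\ Rabs (m32 A) <= mnorm A /\ Rabs (m33 A) <= mnorm A).
Proof.
  repeat match goal with |- _ /\ _ => split end; apply Rabs_le_sqrt; entries; nra.
Qed.

Lemma mdist_mcv u A : Un_cv (fun n => mdist (u n) A) 0 -> mcv u A.
Proof.
  intros cvu.
  assert (entry_cv : forall f, (forall n, Rabs (f (u n) - f A) <= mdist (u n) A) ->
    Un_cv (fun n => f (u n)) (f A)).
  { intros f f_le e e_pos. destruct (cvu e e_pos) as [N near]. exists N. intros n n_ge.
    specialize (near n n_ge). specialize (f_le n). unfold Rdist in *.
    rewrite Rminus_0_r in near. pose proof (Rle_abs (mdist (u n) A)). lra. }
  unfold mcv. repeat match goal with |- _ /\ _ => split end; apply entry_cv; intros n;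
  pose proof (entry_le_mnorm (msub (u n) A)) as entry; cbn in entry;
  match goal with |- Rabs (?x - ?y) <= _ => replace (x - y) with (x + -1 * y) by ring end;
  apply entry.
Qed.

Lemma SO3_mcv u A : (forall n, inSO3 (u n)) -> mcv u A -> inSO3 A.
Proof.
  intros Su cvu. split.
  - apply (mcv_unique (fun n => mmul (mtrans (u n)) (u n))); [apply mcv_mul; [apply mcv_trans|]; exact cvu|].
    apply mdist_mcv, (Un_cv_squeeze0 _ _ (Un_cv_const 0)). intros n.
    rewrite (SO3_trans_mul _ (Su n)), mdist_self. lra.
  - apply (UL_sequence (fun n => mdet (u n))); [unfold mdet; mcv_entries|].
    intros e e_pos. exists 0%nat. intros n _. destruct (Su n) as [_ ->].
    unfold Rdist. rewrite Rminus_diag, Rabs_R0. exact e_pos.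
Qed.

Lemma SO3_subseq (u : nat -> M3) : (forall n, inSO3 (u n)) ->
  exists phi A, (forall n, (n <= phi n)%nat) /\ mcv (fun n => u (phi n)) A.
Proof.
  intros Su.
  set (entry := fun A i => nth i [m11 A; m12 A; m13 A; m21 A; m22 A; m23 A; m31 A; m32 A; m33 A] 0).
  destruct (bounded_subseq_family 9 (fun n i => entry (u n) i) 2) as (phi & l & phi_ge & phi_cv).
  { intros n i i_lt. pose proof (SO3_mnorm_le _ (Su n)) as bound.
    destruct (entry_le_mnorm (u n)) as ((?&?&?)&(?&?&?)&(?&?&?)).
    do 9 (destruct i as [|i]; [cbn; lra|]). lia. }
  exists phi, (mkM (l 0%nat) (l 1%nat) (l 2%nat) (l 3%nat) (l 4%nat) (l 5%nat) (l 6%nat) (l 7%nat) (l 8%nat)).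
  split; [exact phi_ge|]. unfold mcv; cbn.
  repeat match goal with |- _ /\ _ => split end;
  match goal with |- Un_cv _ (l ?i) => apply (phi_cv i); lia end.
Qed.

(** * Frames, words and their costs *)

Record frame := mkFrame { axX : V3; axY : V3; wtX : R; wtY : R }.
Definition cosXY (F : frame) : R := dot (axX F) (axY F).
Definition normal (F : frame) : V3 := cross (axX F) (axY F).

Record admissible (F : frame) : Prop := {
  unit_axX : dot (axX F) (axX F) = 1;
  unit_axY : dot (axY F) (axY F) = 1;
  wtX_pos : 0 < wtX F;
  wtY_pos : 0 < wtY F;
  cos_wtX_lt : Rabs (cosXY F) * wtX F < wtY F;
  cos_wtY_lt : Rabs (cosXY F) * wtY F < wtX F }.

Lemma cosXY_bounds F : admissible F -> -1 < cosXY F < 1.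
Proof.
  intros [_ _ wX wY lt_wtY lt_wtX].
  assert (lt1 : Rabs (cosXY F) < 1).
  { pose proof (Rabs_pos (cosXY F)). apply Rnot_le_lt; intros ?. nra. }
  apply Rabs_def2 in lt1; lra.
Qed.

Lemma sinXY_sq_pos F : admissible F -> 0 < 1 - cosXY F * cosXY F.
Proof. intros adm. pose proof (cosXY_bounds F adm). nra. Qed.

Definition cvec (F : frame) (ab : R * R) : V3 := fvec (axX F) (axY F) ab.
Definition rate (F : frame) (ab : R * R) : R := wtX F * Rabs (fst ab) + wtY F * Rabs (snd ab).
Definition cneg (ab : R * R) : R * R := (- fst ab, - snd ab).

Definition wprod (F : frame) (w : list factor) : M3 := word_prod (axX F) (axY F) w.
Fixpoint wcost (F : frame) (w : list factor) : R :=
  match w with [] => 0 | f :: w => fst f * rate F (snd f) + wcost F w end.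
Fixpoint total_control (w : list factor) : R * R :=
  match w with
  | [] => (0, 0)
  | f :: w => (fst f * fst (snd f) + fst (total_control w), fst f * snd (snd f) + snd (total_control w))
  end.
Definition nonneg_times (w : list factor) : Prop := Forall (fun f => 0 <= fst f) w.

Lemma cvec_10 F : cvec F (1, 0) = axX F.
Proof. unfold cvec. entries_ring. Qed.
Lemma cvec_01 F : cvec F (0, 1) = axY F.
Proof. unfold cvec. entries_ring. Qed.
Lemma cvec_cneg F ab : cvec F (cneg ab) = vneg (cvec F ab).
Proof. unfold cvec, cneg. entries_ring. Qed.
Lemma dot_cvec v F ab : dot v (cvec F ab) = fst ab * dot v (axX F) + snd ab * dot v (axY F).
Proof. unfold cvec. entries_ring. Qed.
Lemma cneg_cneg ab : cneg (cneg ab) = ab.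
Proof. destruct ab. unfold cneg; cbn. rewrite !Ropp_involutive. reflexivity. Qed.

Lemma rate_10 F : rate F (1, 0) = wtX F.
Proof. unfold rate; cbn. rewrite Rabs_R1, Rabs_R0; ring. Qed.
Lemma rate_01 F : rate F (0, 1) = wtY F.
Proof. unfold rate; cbn. rewrite Rabs_R1, Rabs_R0; ring. Qed.
Lemma rate_cneg F ab : rate F (cneg ab) = rate F ab.
Proof. unfold rate; cbn. rewrite !Rabs_Ropp. reflexivity. Qed.
Lemma rate_ge0 F ab : admissible F -> 0 <= rate F ab.
Proof.
  intros [_ _ wX wY _ _]. unfold rate.
  pose proof (Rabs_pos (fst ab)); pose proof (Rabs_pos (snd ab)). nra.
Qed.

Lemma wprod_nil F : wprod F [] = mid3.
Proof. reflexivity. Qed.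
Lemma wprod_cons F t ab w : wprod F ((t, ab) :: w) = mmul (rot t (cvec F ab)) (wprod F w).
Proof. reflexivity. Qed.
Lemma wprod_single F t ab : wprod F [(t, ab)] = rot t (cvec F ab).
Proof. apply mmul_1r. Qed.
Lemma wprod_app F w1 w2 : wprod F (w1 ++ w2) = mmul (wprod F w1) (wprod F w2).
Proof.
  induction w1 as [|[t ab] w IH]; [symmetry; apply mmul_1l|].
  rewrite <- app_comm_cons, !wprod_cons, IH, mmul_assoc. reflexivity.
Qed.
Lemma wprod_SO3 F w : inSO3 (wprod F w).
Proof.
  induction w as [|[t ab] w IH]; [apply SO3_1|]. rewrite wprod_cons. apply SO3_mul; auto using rot_SO3.
Qed.

Lemma wcost_cons F t ab w : wcost F ((t, ab) :: w) = t * rate F ab + wcost F w.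
Proof. reflexivity. Qed.
Lemma wcost_app F w1 w2 : wcost F (w1 ++ w2) = wcost F w1 + wcost F w2.
Proof. induction w1 as [|f w IH]; cbn; [ring | rewrite IH; ring]. Qed.
Lemma wcost_ge0 F w : admissible F -> nonneg_times w -> 0 <= wcost F w.
Proof.
  intros adm. induction 1 as [|f w f_ge0 _ IH]; cbn; [lra|].
  pose proof (rate_ge0 F (snd f) adm). nra.
Qed.

Lemma nonneg_times_cons t ab w : 0 <= t -> nonneg_times w -> nonneg_times ((t, ab) :: w).
Proof. intros; constructor; assumption. Qed.
Lemma nonneg_times_app w1 w2 : nonneg_times (w1 ++ w2) <-> nonneg_times w1 /\ nonneg_times w2.
Proof. apply Forall_app. Qed.

Definition winv (w : list factor) : list factor := map (fun f => (fst f, cneg (snd f))) (rev w).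

Lemma winv_cons t ab w : winv ((t, ab) :: w) = winv w ++ [(t, cneg ab)].
Proof. unfold winv; cbn. rewrite map_app. reflexivity. Qed.
Lemma wprod_winv F w : wprod F (winv w) = mtrans (wprod F w).
Proof.
  induction w as [|[t ab] w IH]; [reflexivity|].
  rewrite winv_cons, wprod_app, wprod_single, wprod_cons, mtrans_mul, IH, cvec_cneg, rot_vneg, rot_opp.
  reflexivity.
Qed.
Lemma wcost_winv F w : wcost F (winv w) = wcost F w.
Proof.
  induction w as [|[t ab] w IH]; [reflexivity|].
  rewrite winv_cons, wcost_app, IH, !wcost_cons, rate_cneg. cbn. ring.
Qed.
Lemma nonneg_times_winv w : nonneg_times w -> nonneg_times (winv w).
Proof.
  intros nn. unfold winv, nonneg_times. rewrite Forall_map. apply Forall_rev.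
  revert nn. apply Forall_impl. auto.
Qed.

Lemma word_split F w s : admissible F -> nonneg_times w -> 0 <= s <= wcost F w ->
  exists w1 w2, nonneg_times w1 /\ nonneg_times w2 /\ wprod F w = mmul (wprod F w1) (wprod F w2) /\
    wcost F w1 = s /\ wcost F w2 = wcost F w - s.
Proof.
  intros adm nn. revert s. induction nn as [|[t ab] w t_ge0 nn IH]; intros s s_le.
  { cbn in s_le. exists [], []. rewrite wprod_nil, mmul_1l. repeat split; try constructor; cbn; lra. }
  rewrite wcost_cons in *. pose proof (rate_ge0 F ab adm). cbn in t_ge0.
  destruct (Rle_dec s (t * rate F ab)) as [inside | beyond].
  - destruct (Req_dec (rate F ab) 0) as [rate0 | rate_nz].
    + rewrite rate0 in *. exists [], ((t, ab) :: w). rewrite wprod_nil, mmul_1l, wcost_cons.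
      split; [constructor|]. split; [apply nonneg_times_cons; assumption|].
      split; [reflexivity|]. cbn. rewrite rate0. split; lra.
    + set (q := s / rate F ab). assert (s_eq : s = q * rate F ab) by (unfold q; field; exact rate_nz).
      assert (0 <= q) by (unfold q; apply Rle_mult_inv_pos; lra).
      assert (q <= t) by (apply Rmult_le_reg_r with (rate F ab); lra).
      exists [(q, ab)], ((t - q, ab) :: w). rewrite wprod_single, !wprod_cons, <- mmul_assoc, <- rot_add.
      split; [apply nonneg_times_cons; [assumption | constructor]|].
      split; [apply nonneg_times_cons; [lra | assumption]|].
      split; [do 2 f_equal; ring|]. rewrite !wcost_cons. cbn. lra.
  - destruct (IH (s - t * rate F ab)) as (w1 & w2 & nn1 & nn2 & prod & cost1 & cost2); [lra|].
    exists ((t, ab) :: w1), w2. rewrite !wprod_cons, wcost_cons, prod, mmul_assoc.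
    split; [apply nonneg_times_cons; assumption|]. split; [assumption|]. split; [reflexivity|]. lra.
Qed.

(* A control of unit cost rate has at most this norm. *)
Definition speed (F : frame) : R := / wtX F + / wtY F.

Lemma speed_pos F : admissible F -> 0 < speed F.
Proof.
  intros [_ _ wX wY _ _]. apply Rinv_0_lt_compat in wX, wY. unfold speed. lra.
Qed.

Lemma vnorm_cvec_le_sum F ab : admissible F -> vnorm (cvec F ab) <= Rabs (fst ab) + Rabs (snd ab).
Proof.
  intros adm. unfold cvec, fvec. eapply Rle_trans; [apply vnorm_add_le|].
  rewrite !vnorm_scale, (vnorm_unit (axX F)), (vnorm_unit (axY F)) by apply adm. lra.
Qed.

Lemma vnorm_cvec_le F ab : admissible F -> vnorm (cvec F ab) <= speed F * rate F ab.
Proof.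
  intros adm. eapply Rle_trans; [apply vnorm_cvec_le_sum, adm|]. destruct adm as [_ _ wX wY _ _].
  unfold speed, rate. destruct ab as [a b]; cbn. pose proof (Rabs_pos a); pose proof (Rabs_pos b).
  assert (0 <= wtX F / wtY F * Rabs a) by (apply Rmult_le_pos; [apply Rle_mult_inv_pos|]; lra).
  assert (0 <= wtY F / wtX F * Rabs b) by (apply Rmult_le_pos; [apply Rle_mult_inv_pos|]; lra).
  replace ((/ wtX F + / wtY F) * (wtX F * Rabs a + wtY F * Rabs b)) with
    (Rabs a + Rabs b + wtX F / wtY F * Rabs a + wtY F / wtX F * Rabs b) by (field; lra).
  lra.
Qed.

Lemma rate_total_control_le F w : admissible F -> nonneg_times w ->
  rate F (total_control w) <= wcost F w.
Proof.
  intros [_ _ wX wY _ _]. induction 1 as [|[t [a b]] w t_ge0 _ IH].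
  { unfold rate; cbn. rewrite Rabs_R0. lra. }
  cbn in t_ge0. rewrite wcost_cons. unfold rate in *. cbn.
  pose proof (Rabs_triang (t * a) (fst (total_control w))) as triX.
  pose proof (Rabs_triang (t * b) (snd (total_control w))) as triY.
  rewrite Rabs_mult, (Rabs_right t) in triX, triY by lra.
  apply (Rmult_le_compat_l (wtX F)) in triX; [|lra]. apply (Rmult_le_compat_l (wtY F)) in triY; lra.
Qed.

Lemma letter_angle_le F t ab : admissible F -> 0 <= t ->
  0 <= t * vnorm (cvec F ab) <= speed F * (t * rate F ab).
Proof.
  intros adm t_ge0. pose proof (vnorm_cvec_le F ab adm). pose proof (vnorm_ge0 (cvec F ab)).
  split; [apply Rmult_le_pos; assumption|].
  replace (speed F * (t * rate F ab)) with (t * (speed F * rate F ab)) by ring.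
  apply Rmult_le_compat_l; assumption.
Qed.

Lemma mdist_wprod_id_le F w : admissible F -> nonneg_times w ->
  mdist (wprod F w) mid3 <= 2 * speed F * wcost F w.
Proof.
  intros adm. induction 1 as [|[t ab] w t_ge0 _ IH].
  { rewrite wprod_nil, mdist_self. cbn. lra. }
  cbn in t_ge0. rewrite wprod_cons, wcost_cons, <- (mmul_1l mid3).
  eapply Rle_trans; [apply SO3_mdist_mul; [apply wprod_SO3 | apply SO3_1]|].
  pose proof (mdist_rot_id_le t (cvec F ab)) as near. rewrite Rabs_right in near by lra.
  pose proof (letter_angle_le F t ab adm t_ge0). lra.
Qed.

Lemma mdist_wprod_linear_le F w : admissible F -> nonneg_times w ->
  mdist (wprod F w) (madd mid3 (skew (cvec F (total_control w))))
    <= 5 * (speed F * speed F) * (wcost F w * wcost F w).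
Proof.
  intros adm. induction 1 as [|[t ab] w t_ge0 nn IH].
  { replace (madd _ _) with (wprod F []) by (unfold cvec; cbn; entries_ring).
    rewrite mdist_self. cbn. lra. }
  cbn in t_ge0. rewrite wprod_cons, wcost_cons.
  pose proof (wcost_ge0 F w adm nn). pose proof (speed_pos F adm). pose proof (rate_ge0 F ab adm).
  pose proof (letter_angle_le F t ab adm t_ge0) as angle.
  pose proof (mdist_rot_id_le t (cvec F ab)) as near. rewrite Rabs_right in near by lra.
  pose proof (mdist_rot_linear_le t (cvec F ab) t_ge0) as linear.
  pose proof (mdist_wprod_id_le F w adm nn) as near_w.
  set (R := rot t (cvec F ab)) in *. set (W := wprod F w) in *. set (S := skew (cvec F ab)) in *.
  set (T := skew (cvec F (total_control w))) in *.
  set (x := t * rate F ab) in *. set (y := wcost F w) in *. set (k := speed F) in *.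
  unfold mdist in *. replace (msub _ _) with
    (madd (msub R (madd mid3 (mscale t S))) (madd (mmul (msub R mid3) (msub W mid3)) (msub W (madd mid3 T)))).
  2:{ replace (skew _) with (madd (mscale t S) T) by (unfold S, T, cvec; cbn [total_control]; entries_ring).
      entries_ring. }
  assert (0 <= x) by (unfold x; nra).
  apply Rle_trans with (5 * (k * x * (k * x)) + (2 * (k * x) * (2 * k * y) + 5 * (k * k) * (y * y))).
  - repeat (eapply Rle_trans; [apply mnorm_add_le | apply Rplus_le_compat]).
    + eapply Rle_trans; [exact linear|]. nra.
    + eapply Rle_trans; [apply mnorm_mul_le|]. apply Rmult_le_compat; auto using mnorm_ge0. lra.
    + exact IH.
  - assert (0 <= k * k * (x * y)) by (apply Rmult_le_pos; nra). lra.
Qed.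

(** * Limits of words *)

(* The closure of the set of pairs (product, cost) of words; minima exist on it. *)
Definition reachable (F : frame) (h : M3) (c : R) : Prop :=
  forall e, 0 < e -> exists w, nonneg_times w /\ mdist (wprod F w) h <= e /\ wcost F w <= c + e.

Lemma reachable_wprod F w : nonneg_times w -> reachable F (wprod F w) (wcost F w).
Proof.
  intros nn e e_pos. exists w. rewrite mdist_self. repeat split; [exact nn | lra | lra].
Qed.
Lemma reachable_id F : reachable F mid3 0.
Proof. apply (reachable_wprod F []). constructor. Qed.
Lemma reachable_rot F ab e : 0 <= e -> reachable F (rot e (cvec F ab)) (e * rate F ab).
Proof.
  intros e_ge0. rewrite <- wprod_single. replace (e * rate F ab) with (wcost F [(e, ab)]) by (cbn; ring).
  apply reachable_wprod, nonneg_times_cons; [exact e_ge0 | constructor].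
Qed.
Lemma reachable_mono F h c c' : reachable F h c -> c <= c' -> reachable F h c'.
Proof.
  intros reach c_le e e_pos. destruct (reach e e_pos) as (w & nn & near & cost).
  exists w. repeat split; [exact nn | exact near | lra].
Qed.

Lemma reachable_lim F w h c u : (forall n, nonneg_times (w n)) -> mcv (fun n => wprod F (w n)) h ->
  (forall n, wcost F (w n) <= c + u n) -> Un_cv u 0 -> reachable F h c.
Proof.
  intros nn cvw cost cvu e e_pos.
  destruct (mcv_mdist _ _ cvw e e_pos) as [N near]. destruct (cvu e e_pos) as [N' small].
  exists (w (N + N')%nat). split; [apply nn|].
  specialize (near (N + N')%nat ltac:(lia)). specialize (small (N + N')%nat ltac:(lia)).
  unfold Rdist in near, small. rewrite Rminus_0_r in near, small. apply Rabs_def2 in near, small.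
  specialize (cost (N + N')%nat). lra.
Qed.

Lemma reachable_sequence F h c : reachable F h c -> exists w,
  (forall n, nonneg_times (w n)) /\ mcv (fun n => wprod F (w n)) h /\
  forall n, wcost F (w n) <= c + / (INR n + 1).
Proof.
  intros reach.
  destruct (choice (fun n w => nonneg_times w /\ mdist (wprod F w) h <= / (INR n + 1) /\
    wcost F w <= c + / (INR n + 1))) as [w w_spec].
  { intros n. apply reach, inv_S_bounds. }
  exists w. split; [|split]; try (intros n; apply w_spec).
  apply mdist_mcv, (Un_cv_squeeze0 _ _ Un_cv_inv_S). intros n. split; [apply mnorm_ge0 | apply w_spec].
Qed.

Lemma reachable_SO3 F h c : reachable F h c -> inSO3 h.
Proof.
  intros reach. destruct (reachable_sequence F h c reach) as (w & _ & cvw & _).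
  apply (SO3_mcv (fun n => wprod F (w n))); [intros; apply wprod_SO3 | exact cvw].
Qed.
Lemma reachable_ge0 F h c : admissible F -> reachable F h c -> 0 <= c.
Proof.
  intros adm reach. apply (le_of_le_add_small 0 c 1). intros e e_le.
  destruct (reach e ltac:(lra)) as (w & nn & _ & cost). pose proof (wcost_ge0 F w adm nn). lra.
Qed.

Lemma reachable_closed F h c :
  (forall e, 0 < e -> exists h' c', reachable F h' c' /\ mdist h' h <= e /\ c' <= c + e) ->
  reachable F h c.
Proof.
  intros approx e e_pos. destruct (approx (e / 2)) as (h' & c' & reach & near & cost); [lra|].
  destruct (reach (e / 2)) as (w & nn & near' & cost'); [lra|].
  exists w. split; [exact nn|]. split; [|lra]. pose proof (mdist_triang (wprod F w) h' h). lra.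
Qed.

Lemma reachable_mul F g h c d : reachable F g c -> reachable F h d -> reachable F (mmul g h) (c + d).
Proof.
  intros reach_g reach_h e e_pos. pose proof (reachable_SO3 _ _ _ reach_g) as Sg.
  destruct (reach_g (e / 2)) as (w1 & nn1 & near1 & cost1); [lra|].
  destruct (reach_h (e / 2)) as (w2 & nn2 & near2 & cost2); [lra|].
  exists (w1 ++ w2). split; [apply nonneg_times_app; auto|]. rewrite wprod_app, wcost_app. split; [|lra].
  eapply Rle_trans; [apply SO3_mdist_mul; [apply wprod_SO3 | exact Sg]|]. lra.
Qed.
Lemma reachable_trans F h c : reachable F h c -> reachable F (mtrans h) c.
Proof.
  intros reach e e_pos. destruct (reach e e_pos) as (w & nn & near & cost). exists (winv w).
  rewrite wprod_winv, wcost_winv, mdist_trans. auto using nonneg_times_winv.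
Qed.

Lemma reachable_near_id F h c : admissible F -> reachable F h c -> mdist h mid3 <= 2 * speed F * c.
Proof.
  intros adm reach. apply (le_of_le_add_small _ _ (1 + 2 * speed F)). intros e e_le.
  destruct (reach e ltac:(lra)) as (w & nn & near & cost). rewrite mdist_sym in near.
  pose proof (mdist_wprod_id_le F w adm nn). pose proof (mdist_triang h (wprod F w) mid3).
  pose proof (speed_pos F adm).
  assert (2 * speed F * wcost F w <= 2 * speed F * (c + e)) by (apply Rmult_le_compat_l; lra). lra.
Qed.

Lemma reachable_0 F h : admissible F -> reachable F h 0 -> h = mid3.
Proof.
  intros adm reach. apply mdist_zero_eq. pose proof (reachable_near_id F h 0 adm reach). lra.
Qed.

Lemma reachable_expansion F h c : admissible F -> reachable F h c -> 0 < c <= 1 -> exists ab,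
  rate F ab <= c + c * c /\
  mdist h (madd mid3 (skew (cvec F ab))) <= (20 * (speed F * speed F) + 1) * (c * c).
Proof.
  intros adm reach c_le. destruct (reach (c * c) ltac:(nra)) as (w & nn & near & cost).
  rewrite mdist_sym in near. pose proof (rate_total_control_le F w adm nn).
  pose proof (mdist_wprod_linear_le F w adm nn) as linear. pose proof (speed_pos F adm).
  pose proof (wcost_ge0 F w adm nn).
  exists (total_control w). split; [lra|].
  eapply Rle_trans; [apply (mdist_triang _ (wprod F w))|].
  assert (wcost F w * wcost F w <= 2 * c * (2 * c)) by (apply Rmult_le_compat; nra).
  assert (5 * (speed F * speed F) * (wcost F w * wcost F w) <= 5 * (speed F * speed F) * (2 * c * (2 * c)))
    by (apply Rmult_le_compat_l; nra).
  lra.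
Qed.

Lemma reachable_split F h c s : admissible F -> reachable F h c -> 0 <= s <= c ->
  exists h1 h2, h = mmul h1 h2 /\ reachable F h1 s /\ reachable F h2 (c - s).
Proof.
  intros adm reach s_le. destruct (reachable_sequence F h c reach) as (w & nn & cvw & cost).
  destruct (choice (fun n (vv : list factor * list factor) =>
    nonneg_times (fst vv) /\ nonneg_times (snd vv) /\
    wprod F (w n) = mmul (wprod F (fst vv)) (wprod F (snd vv)) /\
    wcost F (fst vv) <= s + 0 /\ wcost F (snd vv) <= c - s + / (INR n + 1))) as [vv vv_spec].
  { intros n. specialize (cost n). pose proof (wcost_ge0 F (w n) adm (nn n)). pose proof (inv_S_bounds n).
    destruct (word_split F (w n) (Rmin s (wcost F (w n))) adm (nn n)) as (v1 & v2 & nn1 & nn2 & prod & cost1 & cost2).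
    { split; [apply Rmin_glb; lra | apply Rmin_r]. }
    exists (v1, v2). cbn. rewrite cost1, cost2. do 3 (split; [assumption|]).
    split; [pose proof (Rmin_l s (wcost F (w n))); lra|]. unfold Rmin; destruct Rle_dec; lra. }
  destruct (SO3_subseq (fun n => wprod F (fst (vv n)))) as (phi & h1 & phi_ge & cv1).
  { intros; apply wprod_SO3. }
  destruct (SO3_subseq (fun n => wprod F (snd (vv (phi n))))) as (psi & h2 & psi_ge & cv2).
  { intros; apply wprod_SO3. }
  apply (mcv_subseq _ _ psi) in cv1; [|exact psi_ge].
  assert (ge : forall n, (n <= phi (psi n))%nat).
  { intros n. specialize (phi_ge (psi n)); specialize (psi_ge n); lia. }
  exists h1, h2. split; [|split].
  - apply (mcv_unique (fun n => mmul (wprod F (fst (vv (phi (psi n))))) (wprod F (snd (vv (phi (psi n))))))).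
    + apply (mcv_subseq _ _ (fun n => phi (psi n))) in cvw; [|exact ge].
      apply mdist_mcv, (Un_cv_squeeze0 _ _ (mcv_mdist _ _ cvw)). intros n.
      destruct (vv_spec (phi (psi n))) as (_ & _ & <- & _). split; [apply mnorm_ge0 | lra].
    + apply mcv_mul; assumption.
  - apply (reachable_lim F _ h1 s _) with (2 := cv1) (4 := Un_cv_const 0); intros n; apply vv_spec.
  - apply (reachable_lim F _ h2 (c - s) _) with (2 := cv2) (4 := Un_cv_subseq _ _ _ Un_cv_inv_S ge);
      intros n; apply vv_spec.
Qed.

Definition penalised_value (F : frame) (G : M3) (w : list factor) : R :=
  mtrace (mmul G (wprod F w)) - wcost F w.

Lemma mtrace_mul_SO3_le G h : inSO3 h -> Rabs (mtrace (mmul G h)) <= 2 * mnorm G.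
Proof.
  intros Sh. eapply Rle_trans; [apply mtrace_mul_le|].
  pose proof (SO3_mnorm_le h Sh). pose proof (mnorm_ge0 G). nra.
Qed.

Lemma penalised_value_sup F G : admissible F -> exists m,
  (forall w, nonneg_times w -> penalised_value F G w <= m) /\
  forall e, 0 < e -> exists w, nonneg_times w /\ m - e <= penalised_value F G w.
Proof.
  intros adm.
  destruct (completeness (fun x => exists w, nonneg_times w /\ x = penalised_value F G w)) as [m [upper least]].
  { exists (2 * mnorm G). intros x (w & nn & ->). pose proof (wcost_ge0 F w adm nn).
    pose proof (Rabs_le_bounds _ _ (mtrace_mul_SO3_le G _ (wprod_SO3 F w))). unfold penalised_value. lra. }
  { exists (penalised_value F G []), []. split; [constructor | reflexivity]. }
  exists m. split; [intros w nn; apply upper; exists w; auto|].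
  intros e e_pos. apply NNPP; intros none. assert (m <= m - e); [|lra].
  apply least. intros x (w & nn & ->). apply Rnot_lt_le; intros lt. apply none. exists w. split; [exact nn | lra].
Qed.

Lemma reachable_penalised_maximum F G : admissible F -> exists h0 c0, reachable F h0 c0 /\
  forall h c, reachable F h c -> mtrace (mmul G h) - c <= mtrace (mmul G h0) - c0.
Proof.
  intros adm. destruct (penalised_value_sup F G adm) as (m & upper & approx).
  destruct (choice (fun n w => nonneg_times w /\ m - / (INR n + 1) <= penalised_value F G w)) as [w w_spec].
  { intros n. apply approx, inv_S_bounds. }
  assert (cost_le : forall n, Rabs (wcost F (w n)) <= 2 * mnorm G + 1 - m).
  { intros n. destruct (w_spec n) as [nn value]. pose proof (wcost_ge0 F _ adm nn).
    pose proof (Rabs_le_bounds _ _ (mtrace_mul_SO3_le G _ (wprod_SO3 F (w n)))). pose proof (inv_S_bounds n).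
    unfold penalised_value in value. rewrite Rabs_right; lra. }
  destruct (SO3_subseq (fun n => wprod F (w n))) as (phi & h0 & phi_ge & cv_prod).
  { intros; apply wprod_SO3. }
  destruct (bounded_subseq (fun n => wcost F (w (phi n))) _ (fun n => cost_le (phi n))) as (psi & c0 & psi_ge & cv_cost).
  apply (mcv_subseq _ _ psi) in cv_prod; [|exact psi_ge].
  assert (ge : forall n, (n <= phi (psi n))%nat).
  { intros n. specialize (phi_ge (psi n)); specialize (psi_ge n); lia. }
  exists h0, c0. split.
  - apply (reachable_lim F _ h0 c0 (fun n => wcost F (w (phi (psi n))) - c0)) with (2 := cv_prod).
    + intros n. apply w_spec.
    + intros n. lra.
    + replace 0 with (c0 - c0) by ring. cv.
  - intros h c reach. apply Rle_trans with m.
    + destruct (reachable_sequence F h c reach) as (v & nn & cvv & cost).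
      rewrite <- (Rplus_0_r c).
      apply (@Rle_cv_lim (fun n => mtrace (mmul G (wprod F (v n))) - (c + / (INR n + 1))) (fun _ => m)).
      * intros n. specialize (upper _ (nn n)). specialize (cost n). unfold penalised_value in upper. lra.
      * apply CV_minus; [apply mcv_mtrace, mcv_mul; auto using mcv_const|].
        apply CV_plus; [apply Un_cv_const | apply Un_cv_inv_S].
      * apply Un_cv_const.
    + rewrite <- (Rminus_0_r m).
      apply (@Rle_cv_lim (fun n => m - / (INR (phi (psi n)) + 1)) (fun n => penalised_value F G (w (phi (psi n))))).
      * intros n. apply w_spec.
      * apply CV_minus; [apply Un_cv_const | apply (Un_cv_subseq _ _ _ Un_cv_inv_S ge)].
      * apply CV_minus; [apply mcv_mtrace, mcv_mul; auto using mcv_const | exact cv_cost].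
Qed.

(** * Minimizing curves *)

Definition rel (g h : M3) : M3 := mmul (mtrans g) h.

Lemma rel_self g : inSO3 g -> rel g g = mid3.
Proof. apply SO3_trans_mul. Qed.
Lemma rel_id h : rel mid3 h = h.
Proof. unfold rel. rewrite mtrans_1. apply mmul_1l. Qed.
Lemma mtrans_rel g h : mtrans (rel g h) = rel h g.
Proof. unfold rel. rewrite mtrans_mul, mtrans_mtrans. reflexivity. Qed.
Lemma rel_chain g m h : inSO3 m -> mmul (rel g m) (rel m h) = rel g h.
Proof. intros Sm. unfold rel. rewrite mmul_assoc, (SO3_mulVKl m h Sm). reflexivity. Qed.
Lemma rel_SO3 g h : inSO3 g -> inSO3 h -> inSO3 (rel g h).
Proof. intros Sg Sh. apply SO3_mul; [apply SO3_trans, Sg | exact Sh]. Qed.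
Lemma mul_rel g h : inSO3 g -> mmul g (rel g h) = h.
Proof. apply SO3_mulVKl. Qed.
Lemma rel_eq_id g h : inSO3 g -> rel g h = mid3 -> h = g.
Proof. intros Sg E. rewrite <- (mul_rel g h Sg), E. apply mmul_1r. Qed.
Lemma mdist_rel g g' h h' : inSO3 g' -> inSO3 h -> mdist (rel g h) (rel g' h') <= mdist g g' + mdist h h'.
Proof.
  intros Sg' Sh. rewrite <- (mdist_trans g g').
  apply SO3_mdist_mul; [exact Sh | apply SO3_trans, Sg'].
Qed.

Lemma reachable_rel_chain F g m h c d : inSO3 m ->
  reachable F (rel g m) c -> reachable F (rel m h) d -> reachable F (rel g h) (c + d).
Proof. intros Sm. rewrite <- (rel_chain g m h Sm). apply reachable_mul. Qed.

Lemma reachable_midpoint F g h c : admissible F -> inSO3 g -> inSO3 h -> reachable F (rel g h) c ->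
  exists m, inSO3 m /\ reachable F (rel g m) (c / 2) /\ reachable F (rel m h) (c / 2).
Proof.
  intros adm Sg Sh reach. pose proof (reachable_ge0 _ _ _ adm reach).
  destruct (reachable_split F _ c (c / 2) adm reach) as (h1 & h2 & E & reach1 & reach2); [lra|].
  pose proof (reachable_SO3 _ _ _ reach1) as S1.
  exists (mmul g h1). split; [apply SO3_mul; assumption|]. unfold rel in *. split.
  - rewrite (SO3_mulKl g h1 Sg). exact reach1.
  - rewrite mtrans_mul, mmul_assoc, E, (SO3_mulKl h1 h2 S1).
    replace (c / 2) with (c - c / 2) by field. exact reach2.
Qed.

Definition midpoint (F : frame) (g h : M3) (c : R) : M3 :=
  epsilon (inhabits mid3) (fun m =>
    inSO3 m /\ reachable F (rel g m) (c / 2) /\ reachable F (rel m h) (c / 2)).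

Fixpoint dyadic (F : frame) (h : M3) (c : R) (n : nat) : nat -> M3 :=
  match n with
  | O => fun i => match i with O => mid3 | _ => h end
  | S n => fun i =>
      if Nat.even i then dyadic F h c n (Nat.div2 i)
      else midpoint F (dyadic F h c n (Nat.div2 i)) (dyadic F h c n (S (Nat.div2 i))) (c * (/ 2) ^ n)
  end.

Lemma dyadic_double F h c n i : dyadic F h c (S n) (2 * i) = dyadic F h c n i.
Proof.
  change (dyadic F h c (S n) (2 * i)) with (if Nat.even (2 * i) then dyadic F h c n (Nat.div2 (2 * i)) else
    midpoint F (dyadic F h c n (Nat.div2 (2 * i))) (dyadic F h c n (S (Nat.div2 (2 * i)))) (c * (/ 2) ^ n)).
  rewrite Nat.even_mul, Nat.div2_double. reflexivity.
Qed.

Lemma dyadic_double_S F h c n i : dyadic F h c (S n) (S (2 * i)) =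
  midpoint F (dyadic F h c n i) (dyadic F h c n (S i)) (c * (/ 2) ^ n).
Proof.
  change (dyadic F h c (S n) (S (2 * i))) with (if Nat.even (S (2 * i)) then dyadic F h c n (Nat.div2 (S (2 * i))) else
    midpoint F (dyadic F h c n (Nat.div2 (S (2 * i)))) (dyadic F h c n (S (Nat.div2 (S (2 * i))))) (c * (/ 2) ^ n)).
  rewrite Nat.even_succ, Nat.odd_mul, Nat.div2_succ_double. reflexivity.
Qed.

Lemma dyadic_refine F h c n k i : dyadic F h c (k + n) (2 ^ k * i) = dyadic F h c n i.
Proof.
  induction k as [|k IH]; [cbn; f_equal; lia|].
  replace (2 ^ S k * i)%nat with (2 * (2 ^ k * i))%nat by (cbn; lia).
  change (S k + n)%nat with (S (k + n)). rewrite dyadic_double. exact IH.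
Qed.

Section Dyadic.
Variables (F : frame) (h : M3) (c : R).
Hypotheses (adm : admissible F) (reach : reachable F h c).

Lemma dyadic_step n i : inSO3 (dyadic F h c n i) /\
  reachable F (rel (dyadic F h c n i) (dyadic F h c n (S i))) (c * (/ 2) ^ n).
Proof.
  pose proof (reachable_ge0 _ _ _ adm reach) as c_ge0. pose proof (reachable_SO3 _ _ _ reach) as Sh.
  revert i. induction n as [|n IH]; intros i.
  - cbn. rewrite Rmult_1_r. destruct i as [|i].
    + split; [apply SO3_1|]. rewrite rel_id. exact reach.
    + split; [exact Sh|]. rewrite (rel_self h Sh). apply (reachable_mono _ _ 0); [apply reachable_id | lra].
  - replace (c * (/ 2) ^ S n) with (c * (/ 2) ^ n / 2) by (cbn; field).
    assert (mid : forall j, let m := midpoint F (dyadic F h c n j) (dyadic F h c n (S j)) (c * (/ 2) ^ n) in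
      inSO3 m /\ reachable F (rel (dyadic F h c n j) m) (c * (/ 2) ^ n / 2) /\
      reachable F (rel m (dyadic F h c n (S j))) (c * (/ 2) ^ n / 2)).
    { intros j m. unfold m, midpoint. apply epsilon_spec, reachable_midpoint; try exact adm; apply IH. }
    destruct (Nat.Even_or_Odd i) as [[j ->] | [j ->]].
    + rewrite dyadic_double, dyadic_double_S. split; [apply IH | apply mid].
    + replace (S (2 * j + 1)) with (2 * S j)%nat by lia. replace (2 * j + 1)%nat with (S (2 * j)) by lia.
      rewrite dyadic_double, dyadic_double_S. split; apply mid.
Qed.

Lemma dyadic_chain n i k :
  reachable F (rel (dyadic F h c n i) (dyadic F h c n (i + k))) (INR k * (c * (/ 2) ^ n)).
Proof.
  induction k as [|k IH].
  - rewrite Nat.add_0_r, rel_self by apply dyadic_step. cbn. rewrite Rmult_0_l. apply reachable_id.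
  - rewrite S_INR. replace ((INR k + 1) * (c * (/ 2) ^ n)) with (INR k * (c * (/ 2) ^ n) + c * (/ 2) ^ n) by ring.
    replace (i + S k)%nat with (S (i + k)) by lia.
    apply (reachable_rel_chain F _ (dyadic F h c n (i + k))); [apply dyadic_step | exact IH | apply dyadic_step].
Qed.

Definition dyadic_point (r : R) (m : M3) : Prop :=
  exists n i, r = INR i * (c * (/ 2) ^ n) /\ m = dyadic F h c n i.

Lemma dyadic_point_dist r m r' m' : dyadic_point r m -> dyadic_point r' m' ->
  reachable F (rel m m') (Rabs (r' - r)).
Proof.
  assert (ordered : forall n i n' i', (2 ^ n' * i <= 2 ^ n * i')%nat ->
    reachable F (rel (dyadic F h c n i) (dyadic F h c n' i'))
      (INR i' * (c * (/ 2) ^ n') - INR i * (c * (/ 2) ^ n))).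
  { intros n i n' i' le. rewrite <- (dyadic_refine F h c n n' i), <- (dyadic_refine F h c n' n i').
    rewrite (Nat.add_comm n n'). replace (2 ^ n * i')%nat with (2 ^ n' * i + (2 ^ n * i' - 2 ^ n' * i))%nat by lia.
    eapply reachable_mono; [apply dyadic_chain|]. apply Req_le.
    rewrite minus_INR, !mult_INR, !pow_INR, pow_add by exact le. change (INR 2) with 2.
    assert (half : forall k, 2 ^ k * (/ 2) ^ k = 1).
    { intros k. rewrite <- Rpow_mult_distr, Rinv_r, pow1 by lra. reflexivity. }
    transitivity (2 ^ n * (/ 2) ^ n * (INR i' * (c * (/ 2) ^ n')) - 2 ^ n' * (/ 2) ^ n' * (INR i * (c * (/ 2) ^ n)));
      [ring|]. rewrite !half. ring. }
  intros (n & i & -> & ->) (n' & i' & -> & ->).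
  destruct (Nat.le_ge_cases (2 ^ n' * i) (2 ^ n * i')) as [le | ge].
  - specialize (ordered _ _ _ _ le). eapply reachable_mono; [exact ordered | apply Rle_abs].
  - specialize (ordered _ _ _ _ ge). apply reachable_trans in ordered. rewrite mtrans_rel in ordered.
    eapply reachable_mono; [exact ordered | rewrite Rabs_minus_sym; apply Rle_abs].
Qed.

Lemma dyadic_point_dense s e : 0 < c -> 0 <= s -> 0 < e ->
  exists r m, dyadic_point r m /\ Rabs (r - s) <= e.
Proof.
  intros c_pos s_ge0 e_pos.
  destruct (pow_lt_1_zero (/ 2)) with (y := e / c) as [n small];
    [rewrite Rabs_right; lra | apply Rdiv_lt_0_compat; assumption |].
  specialize (small n (le_n n)). assert (half_pos : 0 < (/ 2) ^ n) by (apply pow_lt; lra).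
  rewrite Rabs_right in small by lra.
  set (q := c * (/ 2) ^ n). assert (q_pos : 0 < q) by (apply Rmult_lt_0_compat; assumption).
  assert (q_lt : q < e) by (unfold q; replace e with (c * (e / c)) by (field; lra); apply Rmult_lt_compat_l; assumption).
  destruct (base_Int_part (s / q)) as [int_le int_gt].
  assert (s_div : 0 <= s / q) by (apply Rle_mult_inv_pos; assumption).
  assert (nat_part : INR (Z.to_nat (Int_part (s / q))) = IZR (Int_part (s / q))).
  { rewrite INR_IZR_INZ, Z2Nat.id; [reflexivity|]. apply Z.lt_succ_r, lt_IZR. rewrite succ_IZR. lra. }
  exists (INR (Z.to_nat (Int_part (s / q))) * q), (dyadic F h c n (Z.to_nat (Int_part (s / q)))).
  split; [eexists _, _; split; reflexivity|]. rewrite nat_part.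
  assert (s_eq : s = s / q * q) by (field; lra).
  apply Rabs_le. rewrite s_eq at 2 4. rewrite <- Rmult_minus_distr_r. split; nra.
Qed.
End Dyadic.

Lemma reachable_completion F (D : R -> M3 -> Prop) :
  (forall r m, D r m -> inSO3 m) ->
  (forall r m r' m', D r m -> D r' m' -> reachable F (rel m m') (Rabs (r' - r))) ->
  (forall s e, 0 <= s -> 0 < e -> exists r m, D r m /\ Rabs (r - s) <= e) ->
  exists gam : R -> M3, (forall s, 0 <= s -> inSO3 (gam s)) /\
    (forall s t, 0 <= s -> 0 <= t -> reachable F (rel (gam s) (gam t)) (Rabs (t - s))) /\
    forall r m, 0 <= r -> D r m -> reachable F (rel m (gam r)) 0.
Proof.
  intros SD dist dense.
  set (near := fun s A => forall e, 0 < e -> exists r m, D r m /\ Rabs (r - s) <= e /\ mdist m A <= e).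
  assert (limit : forall s, 0 <= s -> exists A, inSO3 A /\ near s A).
  { intros s s_ge0.
    destruct (choice (fun n rm => D (fst rm) (snd rm) /\ Rabs (fst rm - s) <= / (INR n + 1))) as [u u_spec].
    { intros n. destruct (dense s (/ (INR n + 1)) s_ge0) as (r & m & Drm & close); [apply inv_S_bounds|].
      exists (r, m). split; assumption. }
    assert (Su : forall n, inSO3 (snd (u n))) by (intros n; apply (SD (fst (u n))), u_spec).
    destruct (SO3_subseq _ Su) as (phi & A & phi_ge & cvu). exists A.
    split; [apply (SO3_mcv _ _ (fun n => Su (phi n)) cvu)|]. intros e e_pos.
    destruct (mcv_mdist _ _ cvu e e_pos) as [N close]. destruct (Un_cv_inv_S e e_pos) as [N' small].
    set (n := (N + N')%nat). specialize (close n ltac:(lia)). specialize (phi_ge n).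
    specialize (small (phi n) ltac:(lia)). destruct (u_spec (phi n)) as [Du u_near].
    exists (fst (u (phi n))), (snd (u (phi n))). unfold Rdist in close, small. rewrite Rminus_0_r in close, small.
    apply Rabs_def2 in close, small. repeat split; [exact Du | lra | lra]. }
  destruct (choice (fun s A => 0 <= s -> inSO3 A /\ near s A)) as [gam gam_spec].
  { intros s. destruct (Rle_dec 0 s) as [s_ge0 | s_neg].
    - destruct (limit s s_ge0) as [A A_spec]. exists A. auto.
    - exists mid3. intros s_ge0. contradiction. }
  exists gam. split; [|split].
  - apply gam_spec.
  - intros s t s_ge0 t_ge0. destruct (gam_spec s s_ge0) as [Ss near_s]. destruct (gam_spec t t_ge0) as [St near_t].
    apply reachable_closed. intros e e_pos.
    destruct (near_s (e / 2)) as (r & m & Drm & r_s & m_s); [lra|].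
    destruct (near_t (e / 2)) as (r' & m' & Drm' & r_t & m_t); [lra|].
    exists (rel m m'), (Rabs (r' - r)). split; [apply dist; assumption|]. split.
    + eapply Rle_trans; [apply mdist_rel; [exact Ss | eapply SD, Drm']|]. lra.
    + replace (r' - r) with ((t - s) + ((r' - t) - (r - s))) by ring.
      eapply Rle_trans; [apply Rabs_triang|]. apply Rplus_le_compat_l. eapply Rle_trans; [apply Rabs_triang|].
      rewrite Rabs_Ropp. lra.
  - intros r m r_ge0 Drm. destruct (gam_spec r r_ge0) as [Sr near_r]. apply reachable_closed. intros e e_pos.
    destruct (near_r e e_pos) as (r' & m' & Drm' & r_r & m_r).
    exists (rel m m'), (Rabs (r' - r)). split; [apply dist; assumption|]. split; [|lra].
    unfold rel. rewrite SO3_mdist_mull by (apply SO3_trans; eapply SD, Drm). exact m_r.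
Qed.

Lemma reachable_curve F h c : admissible F -> reachable F h c -> 0 < c -> exists gam : R -> M3,
  (forall s, 0 <= s -> inSO3 (gam s)) /\ gam 0 = mid3 /\ gam c = h /\
  forall s t, 0 <= s <= t -> reachable F (rel (gam s) (gam t)) (t - s).
Proof.
  intros adm reach c_pos.
  destruct (reachable_completion F (dyadic_point F h c)) as (gam & Sgam & dist & extends).
  - intros r m (n & i & _ & ->). apply dyadic_step; assumption.
  - apply dyadic_point_dist; assumption.
  - intros s e. apply dyadic_point_dense; assumption.
  - assert (agrees : forall r m, 0 <= r -> inSO3 m -> dyadic_point F h c r m -> gam r = m).
    { intros r m r_ge0 Sm point. apply (rel_eq_id m (gam r) Sm).
      apply (reachable_0 F); [exact adm|]. apply extends; assumption. }
    exists gam. split; [exact Sgam|]. split; [|split].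
    + apply agrees; [lra | apply SO3_1 |]. exists 0%nat, 0%nat. cbn. split; [ring | reflexivity].
    + apply agrees; [lra | apply (reachable_SO3 F h c reach) |]. exists 0%nat, 1%nat. cbn. split; [ring | reflexivity].
    + intros s t st. rewrite <- (Rabs_right (t - s)) by lra. apply dist; lra.
Qed.

(** * Momentum *)

Definition conj_by (B P : M3) : M3 := mmul (mmul (mtrans P) B) P.

Lemma conj_by_id B : conj_by B mid3 = B.
Proof. unfold conj_by. rewrite mtrans_1, mmul_1l, mmul_1r. reflexivity. Qed.
Lemma conj_by_mul B P Q : conj_by B (mmul P Q) = conj_by (conj_by B P) Q.
Proof. unfold conj_by. rewrite mtrans_mul, !mmul_assoc. reflexivity. Qed.
Lemma mtrace_conj_by B P : inSO3 P -> mtrace (conj_by B P) = mtrace B.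
Proof. intros SP. unfold conj_by. rewrite mtrace_mulC, (SO3_mulVKl P _ SP). reflexivity. Qed.
Lemma mnorm_conj_by B P : inSO3 P -> mnorm (conj_by B P) = mnorm B.
Proof.
  intros SP. unfold conj_by. rewrite SO3_mnorm_mulr, SO3_mnorm_mull; auto using SO3_trans.
Qed.
Lemma mtrace_mul_conj B P E :
  mtrace (mmul B (mmul P (mmul E (mtrans P)))) = mtrace (mmul (conj_by B P) E).
Proof.
  unfold conj_by. rewrite <- !mmul_assoc, (mtrace_mulC _ (mtrans P)), <- !mmul_assoc. reflexivity.
Qed.

Lemma vee_conj_by B P : inSO3 P -> vee (conj_by B P) = mvmul (mtrans P) (vee B).
Proof.
  intros SP. unfold conj_by. rewrite <- (mtrans_mtrans P) at 2.
  transitivity (mvmul (mtrans (madj (mtrans P))) (vee B)); [entries_ring|].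
  rewrite <- (SO3_trans_adj _ (SO3_trans P SP)), mtrans_mtrans. reflexivity.
Qed.
Lemma vee_conj_by_rot B t v : vee (conj_by B (rot t v)) = mvmul (mtrans (rot t v)) (vee B).
Proof. apply vee_conj_by, rot_SO3. Qed.

Definition momX (F : frame) (B : M3) : R := dot (vee B) (axX F).
Definition momY (F : frame) (B : M3) : R := dot (vee B) (axY F).
Definition momZ (F : frame) (B : M3) : R := dot (vee B) (normal F).

Lemma dot_vee_cvec F B ab : dot (vee B) (cvec F ab) = fst ab * momX F B + snd ab * momY F B.
Proof. apply dot_cvec. Qed.

Lemma momentum_box F B : (forall ab, dot (vee B) (cvec F ab) <= rate F ab) ->
  Rabs (momX F B) <= wtX F /\ Rabs (momY F B) <= wtY F.
Proof.
  intros le. pose proof (le (1, 0)) as leX. pose proof (le (cneg (1, 0))) as leXn.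
  pose proof (le (0, 1)) as leY. pose proof (le (cneg (0, 1))) as leYn.
  rewrite dot_vee_cvec, ?rate_cneg, ?rate_10, ?rate_01 in *. cbn in *. split; apply Rabs_le; lra.
Qed.

Definition momentum_form (c x y z : R) : R := x * x + y * y - 2 * c * x * y + z * z.

Lemma gram_identity F v : admissible F -> dot v v * (1 - cosXY F * cosXY F) =
  momentum_form (cosXY F) (dot v (axX F)) (dot v (axY F)) (dot v (normal F)).
Proof.
  intros adm. unfold momentum_form.
  replace (dot v (normal F) * dot v (normal F)) with
    (dot v v * (dot (axX F) (axX F) * dot (axY F) (axY F) - cosXY F * cosXY F)
    - dot v (axX F) * (dot v (axX F) * dot (axY F) (axY F) - cosXY F * dot v (axY F))
    + dot v (axY F) * (cosXY F * dot v (axX F) - dot v (axY F) * dot (axX F) (axX F)))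
    by (unfold cosXY, normal; entries_ring).
  rewrite (unit_axX F adm), (unit_axY F adm). ring.
Qed.

Lemma momentum_form_conj F B P : admissible F -> inSO3 P ->
  momentum_form (cosXY F) (momX F (conj_by B P)) (momY F (conj_by B P)) (momZ F (conj_by B P)) =
  momentum_form (cosXY F) (momX F B) (momY F B) (momZ F B).
Proof.
  intros adm SP. unfold momX, momY, momZ. rewrite <- !(gram_identity F _ adm), (vee_conj_by B P SP).
  rewrite SO3_dot by (apply SO3_trans, SP). reflexivity.
Qed.

Lemma frame_vec_ext F u v : admissible F -> dot u (axX F) = dot v (axX F) ->
  dot u (axY F) = dot v (axY F) -> dot u (normal F) = dot v (normal F) -> u = v.
Proof.
  intros adm EX EY EZ. apply vsub_eq0, dot_self_eq0. pose proof (sinXY_sq_pos F adm).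
  pose proof (gram_identity F (vsub u v) adm) as gram. rewrite !dot_subl in gram.
  unfold momentum_form in gram. rewrite EX, EY, EZ in gram.
  apply Rmult_eq_reg_r with (1 - cosXY F * cosXY F); [|lra]. rewrite dot_subl, gram. ring.
Qed.

Lemma cross_cvec F ab v : admissible F ->
  dot (cross (cvec F ab) v) (axX F) = snd ab * dot v (normal F) /\
  dot (cross (cvec F ab) v) (axY F) = - (fst ab * dot v (normal F)) /\
  dot (cross (cvec F ab) v) (normal F) =
    - (fst ab * (cosXY F * dot v (axX F) - dot v (axY F))
       + snd ab * (dot v (axX F) - cosXY F * dot v (axY F))).
Proof.
  intros adm. unfold normal, cvec. split; [entries_ring|]. split; [entries_ring|].
  transitivity (- (fst ab * (cosXY F * dot v (axX F) - dot (axX F) (axX F) * dot v (axY F))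
       + snd ab * (dot (axY F) (axY F) * dot v (axX F) - cosXY F * dot v (axY F)))).
  - unfold cosXY. entries_ring.
  - rewrite (unit_axX F adm), (unit_axY F adm). ring.
Qed.

Lemma mom_rot_axX F B t : admissible F ->
  let B' := conj_by B (rot t (axX F)) in
  momX F B' = momX F B /\
  momY F B' = cosXY F * momX F B + (momY F B - cosXY F * momX F B) * cos t + momZ F B * sin t /\
  momZ F B' = momZ F B * cos t - (momY F B - cosXY F * momX F B) * sin t.
Proof.
  intros adm B'. unfold B', momX, momY, momZ.
  rewrite vee_conj_by_rot, (rot_eq_rot_unit t _ (unit_axX F adm)), <- rot_unit_opp, mvmul_rot_unit,
    cos_neg, sin_neg.
  generalize (vee B) (cos t) (sin t). intros v C S. pose proof (unit_axX F adm) as U.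
  unfold cosXY, normal. revert U. destruct (axX F) as [x1 x2 x3], (axY F) as [y1 y2 y3], v as [p q r].
  unfold dot, cross, vadd, vscale; cbn. intros U.
  assert (x33 : x3 * x3 = 1 - x1 * x1 - x2 * x2) by lra.
  repeat split; ring [x33].
Qed.

(** * Symmetries *)

Definition sym_frame (s : sym) (F : frame) : frame :=
  match s with
  | Nu => mkFrame (vneg (axX F)) (vneg (axY F)) (wtX F) (wtY F)
  | Rho => mkFrame (axX F) (vneg (axY F)) (wtX F) (wtY F)
  | Vs => mkFrame (axY F) (axX F) (wtY F) (wtX F)
  end.
Definition sym_control (s : sym) (ab : R * R) : R * R :=
  match s with
  | Nu => cneg ab
  | Rho => (fst ab, - snd ab)
  | Vs => (snd ab, fst ab)
  end.
Definition sym_word (s : sym) (w : list factor) : list factor :=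
  map (fun f => (fst f, sym_control s (snd f))) w.

Lemma sym_frameK s F : sym_frame s (sym_frame s F) = F.
Proof. destruct s, F; cbn; rewrite ?vneg_vneg; reflexivity. Qed.
Lemma sym_labelK s l : sym_label s (sym_label s l) = l.
Proof. destruct s, l as [[] []]; reflexivity. Qed.
Lemma cosXY_sym s F : cosXY (sym_frame s F) = match s with Rho => - cosXY F | _ => cosXY F end.
Proof.
  destruct s; unfold cosXY; cbn [sym_frame axX axY];
    rewrite ?dot_negl, ?dot_negr, ?Ropp_involutive; auto using dotC.
Qed.

Lemma cvec_sym s F ab : cvec (sym_frame s F) (sym_control s ab) = cvec F ab.
Proof. destruct s; unfold cvec, sym_frame, sym_control, cneg; cbn [axX axY]; entries_ring. Qed.
Lemma rate_sym s F ab : rate (sym_frame s F) (sym_control s ab) = rate F ab.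
Proof. destruct s, ab; unfold rate; cbn; rewrite ?Rabs_Ropp; ring. Qed.

Lemma admissible_sym s F : admissible F -> admissible (sym_frame s F).
Proof.
  intros [uX uY wX wY lt_wtY lt_wtX].
  assert (abs_cos : Rabs (cosXY (sym_frame s F)) = Rabs (cosXY F)).
  { rewrite cosXY_sym. destruct s; rewrite ?Rabs_Ropp; reflexivity. }
  constructor; rewrite ?abs_cos; destruct s; cbn [sym_frame axX axY wtX wtY];
    rewrite ?dot_negl, ?dot_negr, ?Ropp_involutive; assumption.
Qed.

Lemma wprod_sym s F w : wprod (sym_frame s F) (sym_word s w) = wprod F w.
Proof.
  induction w as [|[t ab] w IH]; [reflexivity|].
  change (sym_word s ((t, ab) :: w)) with ((t, sym_control s ab) :: sym_word s w).
  rewrite !wprod_cons, IH, cvec_sym. reflexivity.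
Qed.
Lemma wcost_sym s F w : wcost (sym_frame s F) (sym_word s w) = wcost F w.
Proof.
  induction w as [|[t ab] w IH]; [reflexivity|].
  change (sym_word s ((t, ab) :: w)) with ((t, sym_control s ab) :: sym_word s w).
  rewrite !wcost_cons, IH, rate_sym. reflexivity.
Qed.
Lemma nonneg_times_sym s w : nonneg_times w -> nonneg_times (sym_word s w).
Proof. induction 1; constructor; auto. Qed.
Lemma reachable_sym s F h c : reachable F h c -> reachable (sym_frame s F) h c.
Proof.
  intros reach e e_pos. destruct (reach e e_pos) as (w & nn & near & cost).
  exists (sym_word s w). rewrite wprod_sym, wcost_sym. auto using nonneg_times_sym.
Qed.

Lemma momX_sym s F B :
  momX (sym_frame s F) B = match s with Nu => - momX F B | Rho => momX F B | Vs => momY F B end.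
Proof. destruct s; try reflexivity. apply dot_negr. Qed.
Lemma momY_sym s F B :
  momY (sym_frame s F) B = match s with Nu | Rho => - momY F B | Vs => momX F B end.
Proof. destruct s; try reflexivity; apply dot_negr. Qed.
Lemma momZ_sym s F B :
  momZ (sym_frame s F) B = match s with Nu => momZ F B | _ => - momZ F B end.
Proof. destruct s; unfold momZ, normal; cbn [sym_frame axX axY]; entries_ring. Qed.

Lemma mom_rot_axY F B t : admissible F ->
  let B' := conj_by B (rot t (axY F)) in
  momY F B' = momY F B /\
  momX F B' = cosXY F * momY F B + (momX F B - cosXY F * momY F B) * cos t - momZ F B * sin t /\
  momZ F B' = momZ F B * cos t + (momX F B - cosXY F * momY F B) * sin t.
Proof.
  intros adm B'. pose proof (mom_rot_axX (sym_frame Vs F) B t (admissible_sym Vs F adm)) as swapped.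
  cbv zeta in swapped. change (axX (sym_frame Vs F)) with (axY F) in swapped. fold B' in swapped.
  rewrite !momX_sym, !momY_sym, !momZ_sym, !cosXY_sym in swapped. cbn iota in swapped. lra.
Qed.

(** * Letters *)

Definition base_control (F : frame) (b : base) : R * R :=
  match b with
  | BX => (1, 0)
  | BY => (0, 1)
  | BWp => (wtX F + wtY F * cosXY F, - (wtY F + wtX F * cosXY F))
  | BWm => (wtX F - wtY F * cosXY F, wtY F - wtX F * cosXY F)
  end.
Definition label_control (F : frame) (l : label) : R * R :=
  if fst l then cneg (base_control F (snd l)) else base_control F (snd l).
Definition label_vec (F : frame) (l : label) : V3 := cvec F (label_control F l).
Definition neg_label (l : label) : label := (negb (fst l), snd l).

Definition spell (F : frame) (l : list (R * label)) : list factor :=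
  map (fun p => (fst p, label_control F (snd p))) l.
Definition sym_letter (s : sym) (p : R * label) : R * label := (fst p, sym_label s (snd p)).

Lemma Wm_control_pos F : admissible F -> 0 < wtX F - wtY F * cosXY F /\ 0 < wtY F - wtX F * cosXY F.
Proof.
  intros [_ _ wX wY lt_wtY lt_wtX]. pose proof (Rle_abs (cosXY F)). split; nra.
Qed.
Lemma Wp_control_pos F : admissible F -> 0 < wtX F + wtY F * cosXY F /\ 0 < wtY F + wtX F * cosXY F.
Proof.
  intros adm. pose proof (Wm_control_pos _ (admissible_sym Rho F adm)) as pos.
  rewrite cosXY_sym in pos. cbn in pos. lra.
Qed.

Lemma label_control_neg F l : label_control F (neg_label l) = cneg (label_control F l).
Proof. destruct l as [[] b]; unfold label_control; cbn; rewrite ?cneg_cneg; reflexivity. Qed.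
Lemma label_control_sym s F l :
  label_control (sym_frame s F) (sym_label s l) = sym_control s (label_control F l).
Proof.
  unfold label_control, base_control. rewrite cosXY_sym. generalize (cosXY F); intros c.
  destruct F, l as [n b]; destruct s, b, n; cbn; unfold cneg; cbn; f_equal; ring.
Qed.
Lemma label_vec_sym s F l : label_vec (sym_frame s F) (sym_label s l) = label_vec F l.
Proof. unfold label_vec. rewrite label_control_sym. apply cvec_sym. Qed.
Lemma label_vec_neg F l : label_vec F (neg_label l) = vneg (label_vec F l).
Proof. unfold label_vec. rewrite label_control_neg. apply cvec_cneg. Qed.
Lemma label_vec_X F : label_vec F (false, BX) = axX F.
Proof. apply cvec_10. Qed.
Lemma label_vec_Y F : label_vec F (false, BY) = axY F.
Proof. apply cvec_01. Qed.
Lemma label_vec_Xn F : label_vec F (true, BX) = vneg (axX F).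
Proof. rewrite <- label_vec_X. apply (label_vec_neg F (false, BX)). Qed.
Lemma label_vec_Yn F : label_vec F (true, BY) = vneg (axY F).
Proof. rewrite <- label_vec_Y. apply (label_vec_neg F (false, BY)). Qed.

Lemma spell_app F l1 l2 : spell F (l1 ++ l2) = spell F l1 ++ spell F l2.
Proof. apply map_app. Qed.
Lemma spell_sym s F l : spell (sym_frame s F) (map (sym_letter s) l) = sym_word s (spell F l).
Proof.
  unfold spell, sym_word. rewrite !map_map. apply map_ext. intros [t lab]; cbn.
  rewrite label_control_sym. reflexivity.
Qed.
Lemma spell_winv F l :
  spell F (map (fun p => (fst p, neg_label (snd p))) (rev l)) = winv (spell F l).
Proof.
  unfold spell, winv. rewrite <- map_rev, !map_map. apply map_ext. intros [t lab]; cbn.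
  rewrite label_control_neg. reflexivity.
Qed.

Definition letter_reachable (F : frame) (h : M3) (c : R) : Prop :=
  exists l, nonneg_times (spell F l) /\ wprod F (spell F l) = h /\ wcost F (spell F l) = c.

Lemma letter_reachable_id F : letter_reachable F mid3 0.
Proof. exists []. repeat split. constructor. Qed.
Lemma letter_reachable_mul F g h c d :
  letter_reachable F g c -> letter_reachable F h d -> letter_reachable F (mmul g h) (c + d).
Proof.
  intros (l1 & nn1 & <- & <-) (l2 & nn2 & <- & <-). exists (l1 ++ l2).
  rewrite spell_app, wprod_app, wcost_app. split; [apply nonneg_times_app; auto | auto].
Qed.
Lemma letter_reachable_trans F h c : letter_reachable F h c -> letter_reachable F (mtrans h) c.
Proof.
  intros (l & nn & <- & <-). exists (map (fun p => (fst p, neg_label (snd p))) (rev l)).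
  rewrite spell_winv, wprod_winv, wcost_winv. split; [apply nonneg_times_winv, nn | auto].
Qed.
Lemma letter_reachable_rel_chain F g m h c d : inSO3 m ->
  letter_reachable F (rel g m) c -> letter_reachable F (rel m h) d -> letter_reachable F (rel g h) (c + d).
Proof. intros Sm. rewrite <- (rel_chain g m h Sm). apply letter_reachable_mul. Qed.
Lemma letter_reachable_rot F l t : 0 <= t ->
  letter_reachable F (rot t (label_vec F l)) (t * rate F (label_control F l)).
Proof.
  intros t_ge0. exists [(t, l)]. split; [apply nonneg_times_cons; [exact t_ge0 | constructor]|].
  split; [apply wprod_single | cbn; ring].
Qed.
Lemma letter_reachable_axX F t : admissible F -> 0 <= t ->
  letter_reachable F (rot (t / wtX F) (axX F)) t.
Proof.
  intros adm t_ge0. pose proof (wtX_pos F adm) as wX.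
  pose proof (letter_reachable_rot F (false, BX) (t / wtX F) (Rle_mult_inv_pos _ _ t_ge0 wX)) as reach.
  rewrite label_vec_X in reach. change (label_control F (false, BX)) with (1, 0) in reach.
  rewrite rate_10 in reach. replace (t / wtX F * wtX F) with t in reach by (field; lra). exact reach.
Qed.
Lemma letter_reachable_sym s F h c : letter_reachable (sym_frame s F) h c -> letter_reachable F h c.
Proof.
  intros (l & nn & <- & <-). exists (map (sym_letter s) l).
  pose proof (spell_sym s (sym_frame s F) l) as spell_l.
  pose proof (wprod_sym s (sym_frame s F) (spell (sym_frame s F) l)) as wprod_l.
  pose proof (wcost_sym s (sym_frame s F) (spell (sym_frame s F) l)) as wcost_l.
  rewrite sym_frameK in spell_l, wprod_l, wcost_l. rewrite spell_l.
  split; [apply nonneg_times_sym, nn | auto].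
Qed.

(** * Lipschitz functions of one real variable *)

Definition lipschitz_on (k a b : R) (f : R -> R) : Prop :=
  forall s t, a <= s <= b -> a <= t <= b -> Rabs (f t - f s) <= k * Rabs (t - s).

Lemma lipschitz_on_ordered k a b f :
  (forall s t, a <= s <= t -> t <= b -> Rabs (f t - f s) <= k * (t - s)) -> lipschitz_on k a b f.
Proof.
  intros ordered s t s_in t_in. destruct (Rle_dec s t) as [st | ts].
  - rewrite (Rabs_right (t - s)) by lra. apply ordered; lra.
  - rewrite (Rabs_left (t - s)), Rabs_minus_sym by lra. replace (- (t - s)) with (s - t) by ring.
    apply ordered; lra.
Qed.

Lemma lipschitz_on_weaken k a b a' b' f : a <= a' -> b' <= b -> lipschitz_on k a b f -> lipschitz_on k a' b' f.
Proof. intros a_le b_le lip s t s_in t_in. apply lip; lra. Qed.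

Lemma lipschitz_on_Rabs k a b f : lipschitz_on k a b f -> lipschitz_on k a b (fun s => Rabs (f s)).
Proof. intros lip s t s_in t_in. eapply Rle_trans; [apply Rabs_triang_inv2 | apply lip; assumption]. Qed.

Lemma lipschitz_on_opp k a b f : lipschitz_on k a b f -> lipschitz_on k a b (fun s => - f s).
Proof.
  intros lip s t s_in t_in. replace (- f t - - f s) with (- (f t - f s)) by ring. rewrite Rabs_Ropp. auto.
Qed.

Lemma lipschitz_on_reflect k a b f : lipschitz_on k a b f -> lipschitz_on k (- b) (- a) (fun s => f (- s)).
Proof.
  intros lip s t s_in t_in. rewrite <- (Rabs_Ropp (t - s)).
  replace (- (t - s)) with (- t - - s) by ring. apply lip; lra.
Qed.

Lemma lipschitz_on_near k a b f s c : 0 < k -> lipschitz_on k a b f -> a <= s <= b -> c < f s ->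
  exists d, 0 < d /\ forall r, a <= r <= b -> Rabs (r - s) <= d -> c < f r.
Proof.
  intros k_pos lip s_in above. destruct (exists_small 1 (f s - c) k) as (d & d_le & small); [lra | lra |].
  exists d. split; [lra|]. intros r r_in near. pose proof (Rabs_le_bounds _ _ (lip s r s_in r_in)).
  assert (k * Rabs (r - s) <= k * d) by (apply Rmult_le_compat_l; lra). lra.
Qed.

Definition clamp (a b x : R) : R := Rmax a (Rmin b x).

Lemma clamp_between a b x : a <= b -> a <= clamp a b x <= b.
Proof.
  intros ab. unfold clamp. pose proof (Rmax_l a (Rmin b x)). pose proof (Rmin_l b x).
  split; [assumption | apply Rmax_lub; assumption].
Qed.
Lemma clamp_id a b x : a <= x <= b -> clamp a b x = x.
Proof. intros x_in. unfold clamp. rewrite Rmin_right, Rmax_right; lra. Qed.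
Lemma clamp_dist_le a b x y : Rabs (clamp a b x - clamp a b y) <= Rabs (x - y).
Proof. unfold clamp, Rmax, Rmin, Rabs. repeat destruct Rle_dec; repeat destruct Rcase_abs; lra. Qed.

Lemma lipschitz_on_bounded_away k a b f c : a <= b -> 0 < k -> lipschitz_on k a b f ->
  (forall s, a <= s <= b -> f s < c) -> exists h, 0 < h /\ forall s, a <= s <= b -> f s <= c - h.
Proof.
  intros ab k_pos lip below.
  destruct (continuity_ab_maj (fun x => f (clamp a b x)) a b ab) as (top & max & top_in).
  { intros x _ e e_pos. exists (e / k). split; [apply Rdiv_lt_0_compat; lra|].
    intros y [_ near]. cbn in *. unfold Rdist in *.
    eapply Rle_lt_trans; [apply lip; apply clamp_between, ab|].
    apply Rle_lt_trans with (k * Rabs (y - x)); [apply Rmult_le_compat_l; [lra | apply clamp_dist_le]|].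
    apply Rlt_le_trans with (k * (e / k)); [apply Rmult_lt_compat_l; lra | right; field; lra]. }
  exists (c - f top). specialize (below top top_in). split; [lra|]. intros s s_in.
  specialize (max s s_in). cbn in max. rewrite !clamp_id in max by assumption. lra.
Qed.

Lemma lipschitz_on_last_time k a b f v : 0 < k -> a <= b -> lipschitz_on k a b f -> f a = v ->
  exists s, a <= s <= b /\ f s = v /\ forall r, s < r <= b -> f r <> v.
Proof.
  intros k_pos ab lip start.
  destruct (completeness (fun s => a <= s <= b /\ f s = v)) as [s [upper least]].
  { exists b. intros s [s_in _]. lra. }
  { exists a. split; [lra | exact start]. }
  assert (s_ge : a <= s) by (apply upper; split; [lra | exact start]).
  assert (s_le : s <= b) by (apply least; intros r [r_in _]; lra).
  exists s. split; [lra|]. split.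
  - apply NNPP; intros differs.
    destruct (lipschitz_on_near k a b (fun r => Rabs (f r - v)) s 0) as (d & d_pos & away); [assumption | | lra | |].
    { apply lipschitz_on_Rabs. intros p q p_in q_in. replace (f q - v - (f p - v)) with (f q - f p) by ring. auto. }
    { apply Rabs_pos_lt. lra. }
    assert (s <= s - d); [|lra]. apply least. intros r [r_in value]. apply Rnot_lt_le; intros close.
    assert (r <= s) by (apply upper; auto). specialize (away r r_in). cbn in away.
    rewrite value, Rminus_diag, Rabs_R0, Rabs_left1 in away by lra. lra.
  - intros r r_in value. assert (r <= s) by (apply upper; split; [lra | exact value]). lra.
Qed.

Lemma lipschitz_on_first_time k a b f v : 0 < k -> a <= b -> lipschitz_on k a b f -> f b = v ->
  exists s, a <= s <= b /\ f s = v /\ forall r, a <= r < s -> f r <> v.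
Proof.
  intros k_pos ab lip final.
  destruct (lipschitz_on_last_time k (- b) (- a) (fun s => f (- s)) v) as (s & s_in & value & last);
    [assumption | lra | apply lipschitz_on_reflect, lip | rewrite Ropp_involutive; exact final |].
  exists (- s). split; [lra|]. split; [exact value|]. intros r r_in.
  rewrite <- (Ropp_involutive r). apply last. lra.
Qed.

(* Halving an interval halves the total quadratic error, so only the telescoping part survives. *)
Lemma subadditive_le_of_quadratic_error (D : R -> R -> R) (f : R -> R) M a b : 0 <= M -> a <= b ->
  (forall s m t, a <= s <= m -> m <= t <= b -> D s t <= D s m + D m t) ->
  (forall s t, a <= s <= t -> t <= b -> D s t <= f t - f s + M * ((t - s) * (t - s))) ->
  D a b <= f b - f a.
Proof.
  intros M_ge0 ab subadditive bound.
  assert (halved : forall n s t, a <= s <= t -> t <= b ->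
    D s t <= f t - f s + M * ((t - s) * (t - s)) * (/ 2) ^ n).
  { induction n as [|n IH]; intros s t st tb.
    - cbn. rewrite Rmult_1_r. apply bound; assumption.
    - set (m := (s + t) / 2). pose proof (subadditive s m t ltac:(unfold m; lra) ltac:(unfold m; lra)) as sub.
      pose proof (IH s m ltac:(unfold m; lra) ltac:(unfold m; lra)) as left_half.
      pose proof (IH m t ltac:(unfold m; lra) ltac:(unfold m; lra)) as right_half.
      replace (m - s) with ((t - s) / 2) in left_half by (unfold m; field).
      replace (t - m) with ((t - s) / 2) in right_half by (unfold m; field).
      cbn [pow]. lra. }
  apply (le_of_le_add_small _ _ (M * ((b - a) * (b - a)))). intros e e_le.
  destruct (pow_lt_1_zero (/ 2)) with (y := e) as [n small]; [rewrite Rabs_right; lra | lra |].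
  specialize (small n (le_n n)). pose proof (Rle_abs ((/ 2) ^ n)).
  assert (0 <= M * ((b - a) * (b - a))) by (apply Rmult_le_pos; nra).
  eapply Rle_trans; [apply (halved n); lra|]. apply Rplus_le_compat_l, Rmult_le_compat_l; lra.
Qed.

(** * Extremal curves *)

Lemma vnorm_axX F : admissible F -> vnorm (axX F) = 1.
Proof. intros adm. apply vnorm_unit, adm. Qed.
Lemma vnorm_axY F : admissible F -> vnorm (axY F) = 1.
Proof. intros adm. apply vnorm_unit, adm. Qed.
Lemma vnorm_normal_le F : admissible F -> vnorm (normal F) <= 1.
Proof.
  intros adm. unfold normal. eapply Rle_trans; [apply vnorm_cross_le|].
  rewrite vnorm_axX, vnorm_axY by exact adm. lra.
Qed.

Record extremal_curve (F : frame) (B : M3) (L : R) (gam : R -> M3) : Prop := {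
  curve_SO3 : forall s, 0 <= s <= L -> inSO3 (gam s);
  curve_reachable : forall s t, 0 <= s <= t -> t <= L -> reachable F (rel (gam s) (gam t)) (t - s);
  curve_optimal : forall s t E e, 0 <= s <= t -> t <= L -> reachable F E e ->
    mtrace (mmul B (mmul (gam s) (mmul E (mtrans (gam t))))) <= mtrace B + e - (t - s) }.

Lemma extremal_curve_sym s F B L gam : extremal_curve F B L gam -> extremal_curve (sym_frame s F) B L gam.
Proof.
  intros [in_SO3 reach opt]. constructor; [assumption | auto using reachable_sym |].
  intros p q E e pq qL reachE. apply opt; [assumption | assumption |].
  rewrite <- (sym_frameK s F). apply reachable_sym, reachE.
Qed.

Lemma extremal_curve_reverse F B L gam : extremal_curve F B L gam ->
  extremal_curve F (mtrans B) L (fun s => gam (L - s)).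
Proof.
  intros [in_SO3 reach opt]. constructor.
  - intros s s_in. apply in_SO3; lra.
  - intros s t st tL. rewrite <- mtrans_rel. replace (t - s) with ((L - s) - (L - t)) by ring.
    apply reachable_trans, reach; lra.
  - intros s t E e st tL reachE.
    specialize (opt (L - t) (L - s) (mtrans E) e ltac:(lra) ltac:(lra) (reachable_trans _ _ _ reachE)).
    rewrite mtrace_trans, <- mtrace_trans, !mtrans_mul, !mtrans_mtrans, mtrace_mulC, !mmul_assoc. lra.
Qed.

Lemma reachable_control F h c : admissible F -> reachable F h c -> exists ab,
  rate F ab <= c + c * c /\
  mdist h (madd mid3 (skew (cvec F ab))) <= (20 * (speed F * speed F) + 5) * (c * c).
Proof.
  intros adm reach. pose proof (reachable_ge0 F h c adm reach) as c_ge0.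
  assert (speed_sq : 0 <= speed F * speed F) by apply Rle_0_sqr.
  assert (no_control : rate F (0, 0) = 0 /\ madd mid3 (skew (cvec F (0, 0))) = mid3).
  { split; [unfold rate; cbn; rewrite Rabs_R0; ring | unfold cvec; entries_ring]. }
  destruct no_control as [rate0 linear0].
  destruct (Rle_dec c 1) as [c_le1 | c_gt1]; [destruct c_ge0 as [c_pos | <-]|].
  - destruct (reachable_expansion F h c adm reach) as (ab & rate_le & near); [lra|].
    exists ab. split; [exact rate_le | nra].
  - exists (0, 0). rewrite rate0, linear0, (reachable_0 F h adm reach), mdist_self. lra.
  - exists (0, 0). rewrite rate0, linear0. split; [nra|].
    pose proof (mdist_triang h (mscale 0 mid3) mid3) as tri. unfold mdist in tri.
    replace (msub h (mscale 0 mid3)) with h in tri by entries_ring.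
    replace (msub (mscale 0 mid3) mid3) with (mscale (-1) mid3) in tri by entries_ring.
    rewrite mnorm_scale, (Rabs_left (-1)) in tri by lra.
    pose proof (SO3_mnorm_le h (reachable_SO3 F h c reach)). pose proof (SO3_mnorm_le mid3 SO3_1).
    unfold mdist. nra.
Qed.

Definition control_estimate (F : frame) (S : M3) (S' : M3) (E : M3) (M d : R) (ab : R * R) : Prop :=
  rate F ab <= d + M * (d * d) /\
  mdist E (madd mid3 (skew (cvec F ab))) <= M * (d * d) /\
  d - M * (d * d) <= dot (vee S) (cvec F ab) /\
  vnorm (vsub (vee S') (vsub (vee S) (cross (cvec F ab) (vee S)))) <= M * (d * d).

Section ExtremalCurve.
Variables (F : frame) (B : M3) (L : R) (gam : R -> M3).
Hypotheses (adm : admissible F) (ext : extremal_curve F B L gam).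

Local Notation state s := (conj_by B (gam s)).

Lemma curve_momentum_le_rate s ab : 0 <= s <= L -> dot (vee (state s)) (cvec F ab) <= rate F ab.
Proof.
  intros s_in. pose proof (curve_SO3 _ _ _ _ ext s s_in) as Ss. apply first_order_le.
  exists 1. split; [lra|]. intros e e_in. rewrite <- mtrace_mul_conj, (mtrace_conj_by B _ Ss).
  pose proof (curve_optimal _ _ _ _ ext s s _ _ ltac:(lra) ltac:(lra) (reachable_rot F ab e ltac:(lra))). lra.
Qed.

Lemma curve_momentum_box s : 0 <= s <= L -> Rabs (momX F (state s)) <= wtX F /\ Rabs (momY F (state s)) <= wtY F.
Proof. intros s_in. apply momentum_box. intros ab. apply curve_momentum_le_rate, s_in. Qed.

Lemma curve_state_step s t : 0 <= s <= L -> state t = conj_by (state s) (rel (gam s) (gam t)).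
Proof.
  intros s_in. rewrite <- conj_by_mul, mul_rel by (apply (curve_SO3 _ _ _ _ ext), s_in). reflexivity.
Qed.

Lemma curve_vnorm_vee s : 0 <= s <= L -> vnorm (vee (state s)) = vnorm (vee B).
Proof.
  intros s_in. pose proof (curve_SO3 _ _ _ _ ext s s_in) as Ss.
  rewrite (vee_conj_by B _ Ss). apply SO3_vnorm, SO3_trans, Ss.
Qed.

Lemma curve_vee_step s t : 0 <= s <= t -> t <= L ->
  vee (state t) = mvmul (mtrans (rel (gam s) (gam t))) (vee (state s)).
Proof.
  intros st tL. rewrite (curve_state_step s t) by lra. apply vee_conj_by.
  apply rel_SO3; apply (curve_SO3 _ _ _ _ ext); lra.
Qed.

Lemma curve_control : exists M, 0 < M /\ forall s t, 0 <= s <= t -> t <= L ->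
  exists ab, control_estimate F (state s) (state t) (rel (gam s) (gam t)) M (t - s) ab.
Proof.
  set (K := 20 * (speed F * speed F) + 5). set (N := 1 + mnorm B + vnorm (vee B)).
  pose proof (mnorm_ge0 B) as normB. pose proof (vnorm_ge0 (vee B)) as normV.
  assert (K_ge1 : 1 <= K) by (unfold K; pose proof (Rle_0_sqr (speed F)); unfold Rsqr in *; lra).
  exists (K * N). split; [unfold N; nra|]. intros s t st tL.
  pose proof (curve_SO3 _ _ _ _ ext s ltac:(lra)) as Ss. set (E := rel (gam s) (gam t)). set (d := t - s).
  destruct (reachable_control F E d adm (curve_reachable _ _ _ _ ext s t st tL)) as (ab & rate_le & near).
  fold K in near. set (v := cvec F ab) in *. exists ab. unfold control_estimate. fold v.
  assert (d_sq : 0 <= K * (d * d)) by (apply Rmult_le_pos; nra).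
  assert (scaled : forall x, 0 <= x <= N -> x * (K * (d * d)) <= K * N * (d * d)).
  { intros x x_le. replace (K * N * (d * d)) with (N * (K * (d * d))) by ring.
    apply Rmult_le_compat_r; lra. }
  assert (near' : mdist (mtrans E) (madd mid3 (mscale (-1) (skew v))) <= K * (d * d)).
  { rewrite <- mdist_trans, mtrans_mtrans.
    replace (mtrans (madd mid3 (mscale (-1) (skew v)))) with (madd mid3 (skew v)) by entries_ring. exact near. }
  split; [specialize (scaled 1 ltac:(unfold N; lra)); nra|].
  split; [specialize (scaled 1 ltac:(unfold N; lra)); lra|]. split.
  - pose proof (curve_optimal _ _ _ _ ext s t mid3 0 st tL (reachable_id F)) as opt.
    rewrite mmul_1l in opt. replace (mtrans (gam t)) with (mmul (mtrans E) (mtrans (gam s))) in opt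
      by (unfold E; rewrite mtrans_rel; unfold rel; rewrite mmul_assoc, (SO3_mul_trans _ Ss); apply mmul_1r).
    rewrite mtrace_mul_conj in opt.
    pose proof (Rabs_le_bounds _ _ (mtrace_mul_le (state s) (msub (mtrans E) (madd mid3 (mscale (-1) (skew v)))))) as error.
    rewrite mmul_subr, mtrace_sub, mmul_addr, mtrace_add, mmul_1r, mmul_scaler, mtrace_scale, mtrace_skew,
      (mnorm_conj_by B _ Ss), (mtrace_conj_by B _ Ss) in error.
    fold (mdist (mtrans E) (madd mid3 (mscale (-1) (skew v)))) in error.
    assert (mnorm B * mdist (mtrans E) (madd mid3 (mscale (-1) (skew v))) <= mnorm B * (K * (d * d)))
      by (apply Rmult_le_compat_l; assumption).
    specialize (scaled (mnorm B) ltac:(unfold N; lra)). unfold d in *. lra.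
  - rewrite (curve_vee_step s t st tL). fold E.
    replace (vsub _ _) with (mvmul (msub (mtrans E) (madd mid3 (mscale (-1) (skew v)))) (vee (state s))) by entries_ring.
    eapply Rle_trans; [apply vnorm_mvmul_le|]. rewrite curve_vnorm_vee by lra.
    fold (mdist (mtrans E) (madd mid3 (mscale (-1) (skew v)))).
    specialize (scaled (vnorm (vee B)) ltac:(unfold N; lra)).
    apply Rle_trans with (K * (d * d) * vnorm (vee B)); [apply Rmult_le_compat_r; assumption | lra].
Qed.

Definition curve_lip : R := 2 * speed F * (1 + vnorm (vee B)).

Lemma curve_lip_pos : 0 < curve_lip.
Proof. pose proof (speed_pos F adm). pose proof (vnorm_ge0 (vee B)). unfold curve_lip. nra. Qed.

Lemma curve_dot_lipschitz v : vnorm v <= 1 -> lipschitz_on curve_lip 0 L (fun s => dot (vee (state s)) v).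
Proof.
  intros v_le. apply lipschitz_on_ordered. intros s t st tL. cbv beta. rewrite (curve_vee_step s t st tL).
  pose proof (reachable_near_id F _ _ adm (curve_reachable _ _ _ _ ext s t st tL)) as near.
  rewrite <- mdist_trans, mtrans_1 in near. rewrite <- dot_subl.
  replace (vsub _ _) with (mvmul (msub (mtrans (rel (gam s) (gam t))) mid3) (vee (state s))) by entries_ring.
  eapply Rle_trans; [apply dot_le_vnorm|]. unfold mdist in near.
  pose proof (vnorm_mvmul_le (msub (mtrans (rel (gam s) (gam t))) mid3) (vee (state s))) as image.
  rewrite curve_vnorm_vee in image by lra. pose proof (vnorm_ge0 (vee B)). pose proof (speed_pos F adm).
  pose proof (vnorm_ge0 v).
  pose proof (vnorm_ge0 (mvmul (msub (mtrans (rel (gam s) (gam t))) mid3) (vee (state s)))).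
  apply Rle_trans with (2 * speed F * (t - s) * vnorm (vee B)).
  - assert (mnorm (msub (mtrans (rel (gam s) (gam t))) mid3) * vnorm (vee B) <= 2 * speed F * (t - s) * vnorm (vee B))
      by (apply Rmult_le_compat_r; assumption). nra.
  - unfold curve_lip. assert (0 <= 2 * speed F * (t - s)) by (apply Rmult_le_pos; lra). lra.
Qed.

Lemma momX_lipschitz : lipschitz_on curve_lip 0 L (fun s => momX F (state s)).
Proof. apply curve_dot_lipschitz. rewrite vnorm_axX by exact adm. lra. Qed.
Lemma momY_lipschitz : lipschitz_on curve_lip 0 L (fun s => momY F (state s)).
Proof. apply curve_dot_lipschitz. rewrite vnorm_axY by exact adm. lra. Qed.
Lemma momZ_lipschitz : lipschitz_on curve_lip 0 L (fun s => momZ F (state s)).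
Proof. apply curve_dot_lipschitz, vnorm_normal_le, adm. Qed.

Lemma curve_mdist_le s t : 0 <= s <= t -> t <= L -> mdist (gam s) (gam t) <= curve_lip * (t - s).
Proof.
  intros st tL. pose proof (curve_SO3 _ _ _ _ ext s ltac:(lra)) as Ss.
  pose proof (reachable_near_id F _ _ adm (curve_reachable _ _ _ _ ext s t st tL)) as near.
  rewrite mdist_sym, <- (SO3_mdist_mull (gam s) _ _ Ss), mul_rel, mmul_1r in near by exact Ss.
  pose proof (vnorm_ge0 (vee B)). pose proof (speed_pos F adm). unfold curve_lip.
  assert (0 <= 2 * speed F * (t - s)) by (apply Rmult_le_pos; lra). nra.
Qed.
End ExtremalCurve.

Lemma control_dot_step F S S' E M d ab v : vnorm v <= 1 -> control_estimate F S S' E M d ab ->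
  Rabs (dot (vee S') v - dot (vee S) v + dot (cross (cvec F ab) (vee S)) v) <= M * (d * d).
Proof.
  intros v_le (_ & _ & _ & step).
  replace (_ + _) with (dot (vsub (vee S') (vsub (vee S) (cross (cvec F ab) (vee S)))) v)
    by (rewrite !dot_subl; ring).
  eapply Rle_trans; [apply dot_le_vnorm|]. pose proof (vnorm_ge0 v).
  pose proof (vnorm_ge0 (vsub (vee S') (vsub (vee S) (cross (cvec F ab) (vee S))))). nra.
Qed.

Lemma control_momX_step F S S' E M d ab : admissible F -> control_estimate F S S' E M d ab ->
  Rabs (momX F S' - momX F S + snd ab * momZ F S) <= M * (d * d).
Proof.
  intros adm est. destruct (cross_cvec F ab (vee S) adm) as (cross_X & _ & _).
  unfold momX, momZ. rewrite <- cross_X. apply (control_dot_step F S S' E M d ab); [|exact est].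
  rewrite vnorm_axX by exact adm. lra.
Qed.

Lemma control_momZ_step F S S' E M d ab : admissible F -> control_estimate F S S' E M d ab ->
  Rabs (momZ F S' - momZ F S - (fst ab * (cosXY F * momX F S - momY F S)
    + snd ab * (momX F S - cosXY F * momY F S))) <= M * (d * d).
Proof.
  intros adm est. destruct (cross_cvec F ab (vee S) adm) as (_ & _ & cross_Z).
  pose proof (control_dot_step F S S' E M d ab (normal F) (vnorm_normal_le F adm) est) as step.
  rewrite cross_Z in step. exact step.
Qed.

Lemma Rmult_le_Rabs a x k : Rabs x <= k -> a * x <= k * Rabs a.
Proof.
  intros x_le. apply Rle_trans with (Rabs (a * x)); [apply Rle_abs|].
  rewrite Rabs_mult, Rmult_comm. apply Rmult_le_compat_r; [apply Rabs_pos | exact x_le].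
Qed.

Lemma control_power_le F S S' E M d ab : control_estimate F S S' E M d ab ->
  wtX F * Rabs (fst ab) + wtY F * Rabs (snd ab) <= d + M * (d * d) /\
  d - M * (d * d) <= fst ab * momX F S + snd ab * momY F S.
Proof. intros (rate_le & _ & power & _). rewrite dot_vee_cvec in power. split; [exact rate_le | exact power]. Qed.

Lemma rel_eq_rot_of_increments F gam s0 s1 pq M K (f : R -> R) : admissible F ->
  s0 <= s1 -> 0 <= M -> 0 <= K ->
  (forall s, s0 <= s <= s1 -> inSO3 (gam s)) ->
  (forall s t, s0 <= s <= t -> t <= s1 -> exists ab,
    mdist (rel (gam s) (gam t)) (madd mid3 (skew (cvec F ab))) <= M * ((t - s) * (t - s)) /\
    Rabs (fst ab - fst pq * (t - s)) + Rabs (snd ab - snd pq * (t - s))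
      <= f t - f s + K * ((t - s) * (t - s))) ->
  f s1 <= f s0 -> rel (gam s0) (gam s1) = rot (s1 - s0) (cvec F pq).
Proof.
  intros adm s01 M_ge0 K_ge0 gamSO3 increments f_le. set (C := cvec F pq). apply mdist_zero_eq.
  set (D := fun s t => mdist (rel (gam s) (gam t)) (rot (t - s) C)).
  enough (D s0 s1 <= 2 * f s1 - 2 * f s0) by (unfold D in *; lra).
  apply (subadditive_le_of_quadratic_error D (fun s => 2 * f s) (M + 2 * K + 5 * (vnorm C * vnorm C)));
    [pose proof (Rle_0_sqr (vnorm C)); unfold Rsqr in *; lra | exact s01 | |].
  - intros s m t sm mt. unfold D. rewrite <- (rel_chain (gam s) (gam m) (gam t)) by (apply gamSO3; lra).
    replace (t - s) with ((m - s) + (t - m)) by ring. rewrite rot_add.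
    apply SO3_mdist_mul; [apply rel_SO3; apply gamSO3; lra | apply rot_SO3].
  - intros s t st ts1. destruct (increments s t st ts1) as (ab & near & le). unfold D. set (d := t - s) in *.
    pose proof (mdist_triang (rel (gam s) (gam t)) (madd mid3 (skew (cvec F ab))) (rot d C)) as tri1.
    pose proof (mdist_triang (madd mid3 (skew (cvec F ab))) (madd mid3 (mscale d (skew C))) (rot d C)) as tri2.
    pose proof (mdist_rot_linear_le d C ltac:(unfold d; lra)) as linear. rewrite mdist_sym in linear.
    assert (middle : mdist (madd mid3 (skew (cvec F ab))) (madd mid3 (mscale d (skew C)))
      <= 2 * (Rabs (fst ab - fst pq * d) + Rabs (snd ab - snd pq * d))).
    { unfold mdist. replace (msub _ _) with (skew (cvec F (fst ab - fst pq * d, snd ab - snd pq * d)))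
        by (unfold C, cvec; entries_ring).
      eapply Rle_trans; [apply mnorm_skew_le|]. apply Rmult_le_compat_l; [lra|].
      apply vnorm_cvec_le_sum, adm. }
    lra.
Qed.

Section Runs.
Variables (F : frame) (B : M3) (L : R) (gam : R -> M3).
Hypotheses (adm : admissible F) (ext : extremal_curve F B L gam).

Local Notation state s := (conj_by B (gam s)).

Lemma X_control_deviation S S' E M d ab : 0 < M -> 0 <= d ->
  Rabs (momX F S) <= wtX F -> Rabs (momY F S) <= wtY F -> 0 <= momX F S ->
  control_estimate F S S' E M d ab ->
  Rabs (fst ab - / wtX F * d) <= (4 * M * (d * d) + 3 * wtY F * Rabs (snd ab)) / wtX F.
Proof.
  intros M_pos d_ge0 x_le y_le x_ge0 est. pose proof (wtX_pos F adm) as wX. pose proof (wtY_pos F adm) as wY.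
  destruct (control_power_le _ _ _ _ _ _ _ est) as [rate_le power].
  pose proof (Rmult_le_Rabs (snd ab) _ _ y_le) as by_le. rewrite Rabs_right in x_le by lra.
  set (a := fst ab) in *. set (b := snd ab) in *. set (x := momX F S) in *.
  pose proof (Rabs_pos a). assert (0 <= wtY F * Rabs b) by (apply Rmult_le_pos; [lra | apply Rabs_pos]).
  assert (0 <= M * (d * d)) by (apply Rmult_le_pos; nra).
  assert (deviation : Rabs (wtX F * a - d) <= 4 * M * (d * d) + 3 * wtY F * Rabs b).
  { destruct (Rle_dec 0 a) as [a_ge0 | a_neg].
    - rewrite (Rabs_right a) in rate_le by lra. assert (a * x <= a * wtX F) by (apply Rmult_le_compat_l; lra).
      apply Rabs_le; lra.
    - rewrite (Rabs_left a) in rate_le by lra. assert (a * x <= 0) by nra. assert (wtX F * a <= 0) by nra.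
      apply Rabs_le; lra. }
  replace (a - / wtX F * d) with ((wtX F * a - d) / wtX F) by (field; lra).
  unfold Rdiv. rewrite Rabs_mult, (Rabs_right (/ wtX F)) by (left; apply Rinv_0_lt_compat, wX).
  apply Rmult_le_compat_r; [left; apply Rinv_0_lt_compat, wX | exact deviation].
Qed.

Lemma X_run s0 s1 M K (f : R -> R) : 0 < M -> 0 <= K -> 0 <= s0 <= s1 -> s1 <= L ->
  (forall s, s0 <= s <= s1 -> 0 <= momX F (state s)) ->
  (forall s t, s0 <= s <= t -> t <= s1 -> exists ab,
    control_estimate F (state s) (state t) (rel (gam s) (gam t)) M (t - s) ab /\
    Rabs (snd ab) <= f t - f s + K * ((t - s) * (t - s))) ->
  f s1 <= f s0 -> rel (gam s0) (gam s1) = rot ((s1 - s0) / wtX F) (axX F).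
Proof.
  intros M_pos K_ge0 s01 s1L x_ge0 small_b f_le. pose proof (wtX_pos F adm) as wX. pose proof (wtY_pos F adm) as wY.
  set (k := 3 * wtY F / wtX F + 1). assert (k_pos : 0 < k).
  { unfold k. assert (0 <= 3 * wtY F / wtX F) by (apply Rle_mult_inv_pos; lra). lra. }
  assert (axis : cvec F (/ wtX F, 0) = vscale (/ wtX F) (axX F)) by (unfold cvec; entries_ring).
  unfold Rdiv. rewrite <- rot_vscale, <- axis.
  apply (rel_eq_rot_of_increments F gam s0 s1 _ M (4 * M / wtX F + k * K) (fun s => k * f s));
    [exact adm | lra | lra | | | | cbv beta; apply Rmult_le_compat_l; lra].
  { assert (0 <= 4 * M / wtX F) by (apply Rle_mult_inv_pos; lra). nra. }
  { intros s s_in. apply (curve_SO3 _ _ _ _ ext); lra. }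
  intros s t st ts1. destruct (small_b s t st ts1) as (ab & est & b_le). exists ab.
  split; [apply est|]. cbn [fst snd]. rewrite Rmult_0_l, Rminus_0_r.
  destruct (curve_momentum_box F B L gam ext s ltac:(lra)) as [x_le y_le].
  pose proof (X_control_deviation _ _ _ M (t - s) ab M_pos ltac:(lra) x_le y_le (x_ge0 s ltac:(lra)) est) as dev.
  set (d := t - s) in *. set (b := snd ab) in *.
  replace ((4 * M * (d * d) + 3 * wtY F * Rabs b) / wtX F) with
    (4 * M / wtX F * (d * d) + (k - 1) * Rabs b) in dev by (unfold k; field; lra).
  assert (k * Rabs b <= k * (f t - f s + K * (d * d))) by (apply Rmult_le_compat_l; lra). lra.
Qed.

Lemma edge_run s0 s1 : 0 <= s0 <= s1 -> s1 <= L ->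
  (forall s, s0 <= s <= s1 -> 0 <= momX F (state s)) ->
  (forall s, s0 <= s <= s1 -> Rabs (momY F (state s)) < wtY F) ->
  rel (gam s0) (gam s1) = rot ((s1 - s0) / wtX F) (axX F).
Proof.
  intros s01 s1L x_ge0 y_lt. destruct (curve_control F B L gam adm ext) as (M & M_pos & control).
  destruct (lipschitz_on_bounded_away (curve_lip F B) s0 s1 (fun s => Rabs (momY F (state s))) (wtY F))
    as (h & h_pos & y_le); [lra | apply curve_lip_pos, adm | | exact y_lt |].
  { apply lipschitz_on_Rabs, (lipschitz_on_weaken _ 0 L), momY_lipschitz; assumption || lra. }
  apply (X_run s0 s1 M (2 * M / h) (fun _ => 0)); try assumption; [apply Rle_mult_inv_pos; lra | | lra].
  intros s t st ts1. destruct (control s t ltac:(lra) ltac:(lra)) as [ab est]. exists ab. split; [exact est|].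
  destruct (control_power_le _ _ _ _ _ _ _ est) as [rate_le power].
  destruct (curve_momentum_box F B L gam ext s ltac:(lra)) as [x_le _].
  pose proof (Rmult_le_Rabs (fst ab) _ _ x_le). pose proof (Rmult_le_Rabs (snd ab) _ _ (y_le s ltac:(lra))).
  apply Rmult_le_reg_l with h; [exact h_pos|].
  replace (h * (0 - 0 + 2 * M / h * ((t - s) * (t - s)))) with (2 * M * ((t - s) * (t - s))) by (field; lra). lra.
Qed.

Lemma edge_run_open s0 s1 : 0 <= s0 < s1 -> s1 <= L ->
  (forall s, s0 <= s <= s1 -> 0 <= momX F (state s)) ->
  (forall s, s0 < s < s1 -> Rabs (momY F (state s)) < wtY F) ->
  rel (gam s0) (gam s1) = rot ((s1 - s0) / wtX F) (axX F).
Proof.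
  intros s01 s1L x_ge0 y_lt. pose proof (wtX_pos F adm) as wX. set (k := curve_lip F B). set (T := s1 - s0).
  assert (gamSO3 : forall s, s0 <= s <= s1 -> inSO3 (gam s)) by (intros; apply (curve_SO3 _ _ _ _ ext); lra).
  apply mdist_zero_eq, (le_of_le_add_small _ _ (k * (T / 2) + T / wtX F)). intros e e_le.
  set (d := e * (T / 4)). set (a := s0 + d). set (b := s1 - d).
  assert (d_in : 0 < d <= T / 4) by (unfold d, T; nra).
  assert (inner : rel (gam a) (gam b) = rot ((b - a) / wtX F) (axX F)).
  { apply edge_run; unfold a, b, T in *; try lra; intros s s_in; [apply x_ge0 | apply y_lt]; lra. }
  assert (ends : mdist (rel (gam s0) (gam s1)) (rel (gam a) (gam b)) <= k * d + k * d).
  { eapply Rle_trans; [apply mdist_rel; apply gamSO3; unfold a, T in *; lra|].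
    rewrite (mdist_sym (gam s1)).
    pose proof (curve_mdist_le F B L gam adm ext s0 a ltac:(unfold a; lra) ltac:(unfold a, T in *; lra)) as start.
    pose proof (curve_mdist_le F B L gam adm ext b s1 ltac:(unfold b, T in *; lra) ltac:(lra)) as finish.
    replace (a - s0) with d in start by (unfold a; ring). replace (s1 - b) with d in finish by (unfold b; ring).
    fold k in start, finish. lra. }
  assert (angle : mdist (rot ((b - a) / wtX F) (axX F)) (rot (T / wtX F) (axX F)) <= 4 * (d / wtX F)).
  { rewrite mdist_sym. replace (T / wtX F) with ((b - a) / wtX F + 2 * (d / wtX F)) by (unfold a, b, T; field; lra).
    rewrite rot_add. rewrite <- (mmul_1r (rot ((b - a) / wtX F) (axX F))) at 2.
    rewrite SO3_mdist_mull by apply rot_SO3. eapply Rle_trans; [apply mdist_rot_id_le|].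
    assert (0 <= d / wtX F) by (apply Rle_mult_inv_pos; lra).
    rewrite vnorm_axX, Rabs_right by (exact adm || lra). lra. }
  pose proof (mdist_triang (rel (gam s0) (gam s1)) (rel (gam a) (gam b)) (rot (T / wtX F) (axX F))) as tri.
  rewrite inner in tri at 2.
  replace (0 + (k * (T / 2) + T / wtX F) * e) with (k * d + k * d + 4 * (d / wtX F)) by (unfold d; field; lra). lra.
Qed.

(* The bound momX <= wtX keeps the curve from using the Y axis next to a corner with momZ < 0. *)
Lemma corner_control S S' E M d ab h : 0 < h -> 0 < M ->
  Rabs (momX F S) <= wtX F -> 0 <= momY F S -> momZ F S <= - h ->
  control_estimate F S S' E M d ab ->
  Rabs (snd ab) <= momX F S' / h - momX F S / h
    + (M / h + 2 * M / wtY F * (1 - momZ F S / h)) * (d * d).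
Proof.
  intros h_pos M_pos x_le y_ge0 z_le est. pose proof (wtY_pos F adm) as wY.
  destruct (control_power_le _ _ _ _ _ _ _ est) as [rate_le power].
  pose proof (Rmult_le_Rabs (fst ab) _ _ x_le) as ax_le.
  pose proof (Rabs_le_bounds _ _ (control_momX_step F S S' E M d ab adm est)) as stepX.
  set (b := snd ab) in *. set (x := momX F S) in *. set (x' := momX F S') in *. set (z := momZ F S) in *.
  assert (d_sq : 0 <= d * d) by nra. assert (Md : 0 <= M * (d * d)) by (apply Rmult_le_pos; lra).
  apply Rmult_le_reg_l with h; [exact h_pos|].
  replace (h * (x' / h - x / h + (M / h + 2 * M / wtY F * (1 - z / h)) * (d * d)))
    with (x' - x + M * (d * d) + 2 * M / wtY F * (d * d) * (h - z)) by (field; lra).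
  destruct (Rle_dec 0 b) as [b_ge0 | b_neg].
  - rewrite (Rabs_right b) by lra. assert (b * z <= b * - h) by (apply Rmult_le_compat_l; lra).
    assert (0 <= 2 * M / wtY F) by (apply Rle_mult_inv_pos; lra).
    assert (0 <= 2 * M / wtY F * (d * d) * (h - z)) by (apply Rmult_le_pos; [apply Rmult_le_pos|]; lra). lra.
  - rewrite (Rabs_left b) in * by lra. assert (b * momY F S <= 0) by nra.
    assert (b_small : - b <= 2 * M / wtY F * (d * d)).
    { apply Rmult_le_reg_l with (wtY F); [exact wY|].
      replace (wtY F * (2 * M / wtY F * (d * d))) with (2 * (M * (d * d))) by (field; lra). lra. }
    assert (- b * (h - z) <= 2 * M / wtY F * (d * d) * (h - z)) by (apply Rmult_le_compat_r; lra). lra.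
Qed.

Lemma near_corner s0 : 0 <= s0 <= L ->
  momX F (state s0) = wtX F -> momY F (state s0) = wtY F -> momZ F (state s0) < 0 ->
  exists d h, 0 < d /\ 0 < h /\ forall s, s0 <= s <= s0 + d -> s <= L ->
    0 <= momX F (state s) /\ 0 <= momY F (state s) /\ momZ F (state s) <= - h.
Proof.
  intros s0_in x0 y0 z0. pose proof (wtX_pos F adm) as wX. pose proof (wtY_pos F adm) as wY.
  pose proof (curve_lip_pos F B adm) as k_pos.
  set (h := - momZ F (state s0) / 2). assert (h_lt : h < - momZ F (state s0)) by (unfold h; lra).
  destruct (lipschitz_on_near _ _ _ _ s0 0 k_pos (momX_lipschitz F B L gam adm ext) s0_in) as (dX & dX_pos & x_pos); [lra|].
  destruct (lipschitz_on_near _ _ _ _ s0 0 k_pos (momY_lipschitz F B L gam adm ext) s0_in) as (dY & dY_pos & y_pos); [lra|].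
  destruct (lipschitz_on_near _ _ _ _ s0 h k_pos (lipschitz_on_opp _ _ _ _ (momZ_lipschitz F B L gam adm ext)) s0_in)
    as (dZ & dZ_pos & z_neg); [exact h_lt|].
  exists (Rmin dX (Rmin dY dZ)), h. split; [repeat apply Rmin_pos; assumption|]. split; [unfold h; lra|].
  pose proof (Rmin_l dX (Rmin dY dZ)). pose proof (Rmin_r dX (Rmin dY dZ)).
  pose proof (Rmin_l dY dZ). pose proof (Rmin_r dY dZ). intros s s_in sL.
  specialize (x_pos s). specialize (y_pos s). specialize (z_neg s). cbv beta in z_neg.
  rewrite Rabs_right in x_pos, y_pos, z_neg by lra.
  split; [left; apply x_pos; lra|]. split; [left; apply y_pos; lra|].
  enough (h < - momZ F (state s)) by lra. apply z_neg; lra.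
Qed.

Lemma corner_run s0 : 0 <= s0 <= L ->
  momX F (state s0) = wtX F -> momY F (state s0) = wtY F -> momZ F (state s0) < 0 ->
  exists d, 0 < d /\ forall s1, s0 <= s1 <= s0 + d -> s1 <= L ->
    rel (gam s0) (gam s1) = rot ((s1 - s0) / wtX F) (axX F).
Proof.
  intros s0_in x0 y0 z0. pose proof (wtY_pos F adm) as wY.
  destruct (near_corner s0 s0_in x0 y0 z0) as (d & h & d_pos & h_pos & near).
  destruct (curve_control F B L gam adm ext) as (M & M_pos & control).
  exists d. split; [exact d_pos|]. intros s1 s1_in s1L.
  set (K := M / h + 2 * M / wtY F * (1 + vnorm (vee B) / h)).
  assert (factor_ge0 : 0 <= 2 * M / wtY F) by (apply Rle_mult_inv_pos; lra).
  apply (X_run s0 s1 M K (fun s => momX F (state s) / h)); try assumption; try lra.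
  - unfold K. assert (0 <= M / h) by (apply Rle_mult_inv_pos; lra).
    assert (0 <= vnorm (vee B) / h) by (apply Rle_mult_inv_pos; [apply vnorm_ge0 | lra]). nra.
  - intros s s_in. apply near; lra.
  - intros s t st ts1. destruct (control s t ltac:(lra) ltac:(lra)) as [ab est]. exists ab. split; [exact est|].
    destruct (near s ltac:(lra) ltac:(lra)) as (_ & y_ge0 & z_le).
    destruct (curve_momentum_box F B L gam ext s ltac:(lra)) as [x_le _].
    eapply Rle_trans; [exact (corner_control _ _ _ M (t - s) ab h h_pos M_pos x_le y_ge0 z_le est)|].
    apply Rplus_le_compat_l, Rmult_le_compat_r; [nra|]. apply Rplus_le_compat_l, Rmult_le_compat_l; [exact factor_ge0|].
    enough (- momZ F (state s) / h <= vnorm (vee B) / h) by lra.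
    apply Rmult_le_compat_r; [left; apply Rinv_0_lt_compat, h_pos|].
    pose proof (Rabs_le_bounds _ _ (dot_le_vnorm (vee (state s)) (normal F))) as z_ge.
    rewrite (curve_vnorm_vee F B L gam ext) in z_ge by lra. pose proof (vnorm_normal_le F adm).
    pose proof (vnorm_ge0 (vee B)). unfold momZ. nra.
  - apply Rmult_le_compat_r; [left; apply Rinv_0_lt_compat, h_pos|].
    destruct (curve_momentum_box F B L gam ext s1 ltac:(lra)) as [x_le _].
    apply Rabs_le_bounds in x_le. lra.
Qed.

Lemma rate_Wm : rate F (label_control F (false, BWm)) =
  (wtX F - wtY F * cosXY F) * wtX F + (wtY F - wtX F * cosXY F) * wtY F.
Proof.
  destruct (Wm_control_pos F adm) as [u_pos v_pos]. unfold rate, label_control; cbn [fst snd base_control].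
  rewrite !Rabs_right by lra. ring.
Qed.

Lemma W_control_deviation S S' E M d ab : 0 < M ->
  momX F S = wtX F -> momY F S = wtY F -> momZ F S = 0 -> momZ F S' = 0 ->
  control_estimate F S S' E M d ab ->
  let uv := label_control F (false, BWm) in
  Rabs (fst ab - fst uv / rate F uv * d) + Rabs (snd ab - snd uv / rate F uv * d)
    <= M * (fst uv + snd uv + wtX F + wtY F) / rate F uv * (d * d).
Proof.
  intros M_pos x_eq y_eq z_eq z'_eq est uv. destruct (Wm_control_pos F adm) as [u_pos v_pos].
  pose proof (wtX_pos F adm) as wX. pose proof (wtY_pos F adm) as wY.
  destruct (control_power_le _ _ _ _ _ _ _ est) as [rate_le power].
  pose proof (control_momZ_step F S S' E M d ab adm est) as stepZ. rewrite x_eq, y_eq, z_eq, ?z'_eq in *.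
  unfold uv. rewrite rate_Wm. unfold label_control; cbn [fst snd base_control].
  set (u := wtX F - wtY F * cosXY F) in *. set (v := wtY F - wtX F * cosXY F) in *.
  set (r := u * wtX F + v * wtY F). assert (r_pos : 0 < r) by (unfold r; nra).
  set (a := fst ab) in *. set (b := snd ab) in *. set (err := M * (d * d)) in *.
  assert (across : Rabs (b * u - a * v) <= err).
  { rewrite <- Rabs_Ropp. replace (- (b * u - a * v)) with
      (0 - 0 - (a * (cosXY F * wtX F - wtY F) + b * (wtX F - cosXY F * wtY F))) by (unfold u, v; ring). exact stepZ. }
  assert (along : Rabs (a * wtX F + b * wtY F - d) <= err).
  { pose proof (Rle_abs a). pose proof (Rle_abs b). apply Rabs_le. split; nra. }
  set (p := b * u - a * v) in *. set (q := a * wtX F + b * wtY F - d) in *.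
  replace (a - u / r * d) with ((u * q - wtY F * p) / r) by (unfold p, q, r; field; fold r; lra).
  replace (b - v / r * d) with ((v * q + wtX F * p) / r) by (unfold p, q, r; field; fold r; lra).
  replace (M * (u + v + wtX F + wtY F) / r * (d * d)) with
    ((u * err + wtY F * err) / r + (v * err + wtX F * err) / r) by (unfold err; field; lra).
  apply Rabs_le_bounds in across, along.
  apply Rplus_le_compat; unfold Rdiv; rewrite Rabs_mult, (Rabs_right (/ r)) by (left; apply Rinv_0_lt_compat, r_pos);
    (apply Rmult_le_compat_r; [left; apply Rinv_0_lt_compat, r_pos | apply Rabs_le; split; nra]).
Qed.

Lemma W_run s0 s1 : 0 <= s0 <= s1 -> s1 <= L ->
  (forall s, s0 <= s <= s1 -> momX F (state s) = wtX F /\ momY F (state s) = wtY F /\ momZ F (state s) = 0) ->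
  letter_reachable F (rel (gam s0) (gam s1)) (s1 - s0).
Proof.
  intros s01 s1L at_corner. destruct (curve_control F B L gam adm ext) as (M & M_pos & control).
  set (uv := label_control F (false, BWm)). set (r := rate F uv).
  destruct (Wm_control_pos F adm) as [u_pos v_pos]. pose proof (wtX_pos F adm) as wX. pose proof (wtY_pos F adm) as wY.
  assert (r_pos : 0 < r) by (unfold r, uv; rewrite rate_Wm; nra).
  assert (run : rel (gam s0) (gam s1) = rot (s1 - s0) (cvec F (fst uv / r, snd uv / r))).
  { apply (rel_eq_rot_of_increments F gam s0 s1 _ M (M * (fst uv + snd uv + wtX F + wtY F) / r) (fun _ => 0));
      [exact adm | lra | lra | | | | lra].
    - apply Rle_mult_inv_pos; [|exact r_pos]. unfold uv, label_control; cbn [fst snd base_control]. nra.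
    - intros s s_in. apply (curve_SO3 _ _ _ _ ext); lra.
    - intros s t st ts1. destruct (control s t ltac:(lra) ltac:(lra)) as [ab est]. exists ab. split; [apply est|].
      destruct (at_corner s ltac:(lra)) as (x_eq & y_eq & z_eq). destruct (at_corner t ltac:(lra)) as (_ & _ & z'_eq).
      pose proof (W_control_deviation _ _ _ M _ _ M_pos x_eq y_eq z_eq z'_eq est) as dev.
      cbv zeta in dev. fold uv r in dev. cbn [fst snd]. lra. }
  replace (cvec F (fst uv / r, snd uv / r)) with (vscale (/ r) (label_vec F (false, BWm))) in run
    by (unfold label_vec; fold uv; unfold cvec; entries; field; lra).
  rewrite rot_vscale in run. rewrite run. replace (s1 - s0) with ((s1 - s0) * / r * r) at 2 by (field; lra).
  apply letter_reachable_rot. apply Rmult_le_pos; [lra | left; apply Rinv_0_lt_compat, r_pos].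
Qed.

Lemma curve_on_boundary s : 0 <= s < L -> Rabs (momX F (state s)) = wtX F \/ Rabs (momY F (state s)) = wtY F.
Proof.
  intros s_in. pose proof (wtX_pos F adm) as wX. pose proof (wtY_pos F adm) as wY.
  destruct (curve_momentum_box F B L gam ext s ltac:(lra)) as [x_le y_le].
  apply NNPP; intros inside. apply not_or_and in inside. destruct inside as [x_ne y_ne].
  destruct (curve_control F B L gam adm ext) as (M & M_pos & control).
  set (h := Rmin (wtX F - Rabs (momX F (state s))) (wtY F - Rabs (momY F (state s)))).
  assert (h_pos : 0 < h) by (apply Rmin_pos; lra).
  assert (x_gap : Rabs (momX F (state s)) <= wtX F - h)
    by (pose proof (Rmin_l (wtX F - Rabs (momX F (state s))) (wtY F - Rabs (momY F (state s)))); unfold h; lra).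
  assert (y_gap : Rabs (momY F (state s)) <= wtY F - h)
    by (pose proof (Rmin_r (wtX F - Rabs (momX F (state s))) (wtY F - Rabs (momY F (state s)))); unfold h; lra).
  set (q := M + 2 * M / h * (wtX F + wtY F)).
  destruct (exists_small (L - s) 1 q) as (d & d_in & small); [lra | lra |].
  destruct (control s (s + d) ltac:(lra) ltac:(lra)) as [ab est]. replace (s + d - s) with d in est by ring.
  destruct (control_power_le _ _ _ _ _ _ _ est) as [rate_le power].
  pose proof (Rmult_le_Rabs (fst ab) _ _ x_gap). pose proof (Rmult_le_Rabs (snd ab) _ _ y_gap).
  set (a := Rabs (fst ab)) in *. set (b := Rabs (snd ab)) in *.
  assert (a_ge0 : 0 <= a) by apply Rabs_pos. assert (b_ge0 : 0 <= b) by apply Rabs_pos.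
  assert (ab_small : a + b <= 2 * M / h * (d * d)).
  { apply Rmult_le_reg_l with h; [exact h_pos|].
    replace (h * (2 * M / h * (d * d))) with (2 * M * (d * d)) by (field; lra). lra. }
  assert ((wtX F + wtY F) * (a + b) <= (wtX F + wtY F) * (2 * M / h * (d * d))) by (apply Rmult_le_compat_l; lra).
  assert (d * (d * q) < d * 1) by (apply Rmult_lt_compat_l; lra).
  unfold q in *. nra.
Qed.
End Runs.

Section CornerWindow.
Variables (B : M3) (L : R) (gam : R -> M3) (s0 d : R).

Local Notation state s := (conj_by B (gam s)).

Record corner_window (F : frame) : Prop := {
  window_admissible : admissible F;
  window_extremal : extremal_curve F B L gam;
  window_bounds : 0 <= s0 /\ 0 < d /\ s0 + d < L;
  window_short : d <= wtX F /\ d <= wtY F;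
  window_start : momX F (state s0) = wtX F /\ momY F (state s0) = wtY F /\ momZ F (state s0) = 0;
  window_pos : forall s, s0 <= s <= s0 + d -> 0 < momX F (state s) /\ 0 < momY F (state s) }.

Lemma corner_window_swap F : corner_window F -> corner_window (sym_frame Vs F).
Proof.
  intros [adm ext bounds [short_X short_Y] (x0 & y0 & z0) pos]. constructor;
    [apply admissible_sym, adm | apply extremal_curve_sym, ext | exact bounds | split; assumption | |].
  - rewrite momX_sym, momY_sym, momZ_sym. cbn. rewrite z0. auto using Ropp_0.
  - intros s s_in. rewrite momX_sym, momY_sym. destruct (pos s s_in). auto.
Qed.

Variable F : frame.
Hypothesis window : corner_window F.

Lemma window_le s : s0 <= s <= s0 + d -> momX F (state s) <= wtX F /\ momY F (state s) <= wtY F.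
Proof.
  intros s_in. destruct window as [_ ext bounds _ _ _].
  destruct (curve_momentum_box F B L gam ext s ltac:(lra)) as [x_le y_le].
  apply Rabs_le_bounds in x_le, y_le. lra.
Qed.

Lemma window_on_boundary s : s0 <= s <= s0 + d -> momY F (state s) < wtY F -> momX F (state s) = wtX F.
Proof.
  intros s_in y_lt. destruct window as [adm ext bounds _ _ pos]. destruct (pos s s_in).
  destruct (curve_on_boundary F B L gam adm ext s ltac:(lra)) as [on_X | on_Y]; rewrite Rabs_right in *; lra.
Qed.

Lemma window_corner_momZ s : s0 <= s <= s0 + d ->
  momX F (state s) = wtX F -> momY F (state s) = wtY F -> momZ F (state s) = 0.
Proof.
  intros s_in x_eq y_eq. destruct window as [adm ext bounds _ (x0 & y0 & z0) _].
  pose proof (momentum_form_conj F B (gam s) adm (curve_SO3 _ _ _ _ ext s ltac:(lra))) as form_s.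
  rewrite <- (momentum_form_conj F B (gam s0) adm (curve_SO3 _ _ _ _ ext s0 ltac:(lra))) in form_s.
  rewrite x_eq, y_eq, x0, y0, z0 in form_s. unfold momentum_form in form_s. nra.
Qed.

Lemma window_X_run s t : s0 <= s < t -> t <= s0 + d -> (forall r, s < r < t -> momY F (state r) < wtY F) ->
  rel (gam s) (gam t) = rot ((t - s) / wtX F) (axX F).
Proof.
  intros st td y_lt. destruct window as [adm ext bounds _ _ pos].
  apply (edge_run_open F B L gam adm ext); try lra.
  - intros r r_in. left; apply pos; lra.
  - intros r r_in. rewrite Rabs_right; [apply y_lt; exact r_in | left; apply pos; lra].
Qed.

Lemma window_X_limit s t : s0 <= s < t -> t <= s0 + d -> (forall r, s < r < t -> momY F (state r) < wtY F) ->
  momX F (state s) = wtX F.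
Proof.
  intros st td y_lt. destruct window as [adm ext bounds _ _ _]. apply Rle_antisym; [apply window_le; lra|].
  apply Rnot_lt_le; intros x_lt.
  destruct (lipschitz_on_near _ 0 L _ s (- wtX F) (curve_lip_pos F B adm)
    (lipschitz_on_opp _ _ _ _ (momX_lipschitz F B L gam adm ext))) as (e & e_pos & near); [lra | lra |].
  pose proof (Rmin_l e ((t - s) / 2)). pose proof (Rmin_r e ((t - s) / 2)).
  assert (r_gt : 0 < Rmin e ((t - s) / 2)) by (apply Rmin_pos; lra).
  set (r := s + Rmin e ((t - s) / 2)).
  specialize (near r ltac:(unfold r; lra)). cbv beta in near.
  rewrite (window_on_boundary r) in near by (first [apply y_lt; unfold r; lra | unfold r; lra]).
  apply (Rlt_irrefl (- wtX F)), near. unfold r. rewrite Rabs_right; lra.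
Qed.

Lemma window_leaves t : s0 <= t <= s0 + d -> momY F (state t) < wtY F ->
  exists s, s0 <= s < t /\ momX F (state s) = wtX F /\ momY F (state s) = wtY F /\
    forall r, s < r <= t -> momY F (state r) < wtY F.
Proof.
  intros t_in y_lt. destruct window as [adm ext bounds _ (_ & y0 & _) _].
  destruct (lipschitz_on_last_time _ s0 t (fun s => momY F (state s)) (wtY F) (curve_lip_pos F B adm))
    as (s & s_in & ys & last); [lra | | exact y0 |].
  { apply (lipschitz_on_weaken _ 0 L), (momY_lipschitz F B L gam adm ext); lra. }
  assert (s_lt : s < t) by (destruct (proj2 s_in) as [|E]; [assumption | rewrite E in ys; lra]).
  assert (after : forall r, s < r <= t -> momY F (state r) < wtY F).
  { intros r r_in. destruct (window_le r ltac:(lra)) as [_ [y_r | y_r]]; [exact y_r | contradiction (last r r_in y_r)]. }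
  exists s. split; [lra|]. split; [|auto]. apply (window_X_limit s t); [lra | lra|]. intros r r_in. apply after; lra.
Qed.

Lemma window_excursion s t : s0 <= s < t -> t <= s0 + d ->
  (forall r, s < r < t -> momY F (state r) < wtY F) -> momY F (state s) = wtY F -> momY F (state t) < wtY F.
Proof.
  intros st td y_lt y_s. destruct window as [adm ext bounds short _ _].
  pose proof (window_X_limit s t st td y_lt) as x_s.
  pose proof (window_corner_momZ s ltac:(lra) x_s y_s) as z_s.
  rewrite (curve_state_step F B L gam ext s t) by lra. rewrite (window_X_run s t st td y_lt).
  set (th := (t - s) / wtX F). pose proof (wtX_pos F adm) as wX.
  destruct (mom_rot_axX F (state s) th adm) as (_ & -> & _). rewrite x_s, y_s, z_s.
  assert (th_pos : 0 < th) by (apply Rdiv_lt_0_compat; lra).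
  assert (th_le : th <= 1) by (unfold th; apply Rmult_le_reg_r with (wtX F); [exact wX|]; field_simplify; lra).
  assert (cos_lt : cos th < 1) by (rewrite <- cos_0; apply cos_decreasing_1; pose proof PI2_1; lra).
  pose proof (cos_wtX_lt F adm). pose proof (Rle_abs (cosXY F)).
  assert (cosXY F * wtX F < wtY F) by nra. nra.
Qed.

Lemma window_no_return t t' : s0 <= t <= t' -> t' <= s0 + d ->
  momY F (state t) < wtY F -> momY F (state t') < wtY F.
Proof.
  intros tt' t'd y_t. destruct window as [adm ext bounds _ _ _].
  destruct (window_le t' ltac:(lra)) as [_ [y_t' | y_t']]; [exact y_t' | exfalso].
  destruct (window_leaves t ltac:(lra) y_t) as (s & s_in & x_s & y_s & below).
  destruct (lipschitz_on_first_time _ t t' (fun s => momY F (state s)) (wtY F) (curve_lip_pos F B adm))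
    as (v & v_in & y_v & first); [lra | | exact y_t' |].
  { apply (lipschitz_on_weaken _ 0 L), (momY_lipschitz F B L gam adm ext); lra. }
  assert (momY F (state v) < wtY F); [|lra].
  apply (window_excursion s v); [lra | lra | | exact y_s]. intros r r_in.
  destruct (Rle_dec r t) as [r_le | r_gt]; [apply below; lra|].
  destruct (window_le r ltac:(lra)) as [_ [y_r | y_r]]; [exact y_r | contradiction (first r ltac:(lra) y_r)].
Qed.
End CornerWindow.

Section CornerZero.
Variables (B : M3) (L : R) (gam : R -> M3) (s0 d : R) (F : frame).
Hypothesis window : corner_window B L gam s0 d F.

Local Notation state s := (conj_by B (gam s)).

Lemma window_W_run s : s0 <= s <= s0 + d -> momX F (state s) = wtX F -> momY F (state s) = wtY F ->
  letter_reachable F (rel (gam s0) (gam s)) (s - s0).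
Proof.
  intros s_in x_s y_s. pose proof (corner_window_swap _ _ _ _ _ _ window) as swapped.
  destruct window as [adm ext bounds _ _ _].
  apply (W_run F B L gam adm ext); [lra | lra|]. intros r r_in.
  assert (y_r : momY F (state r) = wtY F).
  { destruct (window_le _ _ _ _ _ _ window r ltac:(lra)) as [_ [y_lt | y_eq]]; [exfalso | exact y_eq].
    pose proof (window_no_return _ _ _ _ _ _ window r s ltac:(lra) ltac:(lra) y_lt). lra. }
  assert (x_r : momX F (state r) = wtX F).
  { destruct (window_le _ _ _ _ _ _ window r ltac:(lra)) as [[x_lt | x_eq] _]; [exfalso | exact x_eq].
    pose proof (window_no_return _ _ _ _ _ _ swapped r s ltac:(lra) ltac:(lra)) as x_s_lt.
    rewrite !momY_sym in x_s_lt. cbn in x_s_lt. specialize (x_s_lt x_lt). lra. }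
  split; [exact x_r|]. split; [exact y_r|]. apply (window_corner_momZ _ _ _ _ _ _ window); [lra | assumption | assumption].
Qed.

Lemma window_leaves_letters t : s0 <= t <= s0 + d -> momY F (state t) < wtY F ->
  letter_reachable F (rel (gam s0) (gam t)) (t - s0).
Proof.
  intros t_in y_t. destruct (window_leaves _ _ _ _ _ _ window t t_in y_t) as (s & s_in & x_s & y_s & below).
  replace (t - s0) with ((s - s0) + (t - s)) by ring.
  destruct (window_bounds _ _ _ _ _ _ window) as (s0_ge0 & d_pos & d_lt).
  assert (Ss : inSO3 (gam s)) by (apply (curve_SO3 F B L gam); [apply window | lra]).
  apply (letter_reachable_rel_chain F _ (gam s)); [exact Ss | apply window_W_run; (assumption || lra)|].
  rewrite (window_X_run _ _ _ _ _ _ window s t) by (first [lra | intros r r_in; apply below; lra]).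
  apply letter_reachable_axX; [apply window | lra].
Qed.
End CornerZero.

Definition starts_with_letters (F : frame) (L : R) (gam : R -> M3) (s : R) : Prop :=
  exists d, 0 < d /\ forall t, s <= t <= s + d -> t <= L ->
    letter_reachable F (rel (gam s) (gam t)) (t - s).

Lemma starts_with_letters_sym sy F L gam s :
  starts_with_letters (sym_frame sy F) L gam s -> starts_with_letters F L gam s.
Proof.
  intros (d & d_pos & letters). exists d. split; [exact d_pos|]. intros t st tL.
  apply (letter_reachable_sym sy), letters; assumption.
Qed.

Section LocalLetters.
Variables (B : M3) (L : R) (gam : R -> M3).

Local Notation state s := (conj_by B (gam s)).

Lemma corner_zero_letters F s0 : admissible F -> extremal_curve F B L gam -> 0 <= s0 < L ->
  momX F (state s0) = wtX F -> momY F (state s0) = wtY F -> momZ F (state s0) = 0 ->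
  starts_with_letters F L gam s0.
Proof.
  intros adm ext s0_in x0 y0 z0. pose proof (wtX_pos F adm) as wX. pose proof (wtY_pos F adm) as wY.
  pose proof (curve_lip_pos F B adm) as k_pos.
  destruct (lipschitz_on_near _ 0 L _ s0 0 k_pos (momX_lipschitz F B L gam adm ext)) as (dX & dX_pos & x_pos); [lra | lra |].
  destruct (lipschitz_on_near _ 0 L _ s0 0 k_pos (momY_lipschitz F B L gam adm ext)) as (dY & dY_pos & y_pos); [lra | lra |].
  destruct (exists_small (Rmin (Rmin dX dY) (Rmin (wtX F) (wtY F))) (L - s0) 1) as (d & d_in & dL);
    [repeat apply Rmin_pos; assumption | lra |].
  pose proof (Rmin_l (Rmin dX dY) (Rmin (wtX F) (wtY F))). pose proof (Rmin_r (Rmin dX dY) (Rmin (wtX F) (wtY F))).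
  pose proof (Rmin_l dX dY). pose proof (Rmin_r dX dY).
  pose proof (Rmin_l (wtX F) (wtY F)). pose proof (Rmin_r (wtX F) (wtY F)).
  assert (window : corner_window B L gam s0 d F).
  { constructor; [exact adm | exact ext | lra | lra | auto |]. intros s s_in. specialize (x_pos s). specialize (y_pos s).
    rewrite Rabs_right in x_pos, y_pos by lra. split; [apply x_pos | apply y_pos]; lra. }
  exists d. split; [lra|]. intros t t_in tL. destruct (window_le _ _ _ _ _ _ window t t_in) as [x_le y_le].
  destruct y_le as [y_lt | y_eq]; [apply (window_leaves_letters B L gam s0 d); assumption|].
  destruct x_le as [x_lt | x_eq]; [|apply (window_W_run B L gam s0 d); assumption].
  apply (letter_reachable_sym Vs), (window_leaves_letters B L gam s0 d); [apply corner_window_swap, window | exact t_in |].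
  rewrite momY_sym. exact x_lt.
Qed.

Lemma corner_neg_letters F s : admissible F -> extremal_curve F B L gam -> 0 <= s <= L ->
  momX F (state s) = wtX F -> momY F (state s) = wtY F -> momZ F (state s) < 0 ->
  starts_with_letters F L gam s.
Proof.
  intros adm ext s_in x_eq y_eq z_neg.
  destruct (corner_run F B L gam adm ext s s_in x_eq y_eq z_neg) as (d & d_pos & run).
  exists d. split; [exact d_pos|]. intros t t_in tL. rewrite run by assumption.
  apply letter_reachable_axX; [exact adm | lra].
Qed.

Lemma corner_letters F s : admissible F -> extremal_curve F B L gam -> 0 <= s < L ->
  momX F (state s) = wtX F -> momY F (state s) = wtY F -> starts_with_letters F L gam s.
Proof.
  intros adm ext s_in x_eq y_eq. destruct (Rtotal_order (momZ F (state s)) 0) as [z_neg | [z_eq | z_pos]].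
  - apply corner_neg_letters; (assumption || lra).
  - apply corner_zero_letters; assumption.
  - apply (starts_with_letters_sym Vs), corner_neg_letters; rewrite ?momX_sym, ?momY_sym, ?momZ_sym;
      auto using admissible_sym, extremal_curve_sym; lra.
Qed.

Lemma edge_letters F s : admissible F -> extremal_curve F B L gam -> 0 <= s < L ->
  momX F (state s) = wtX F -> Rabs (momY F (state s)) < wtY F -> starts_with_letters F L gam s.
Proof.
  intros adm ext s_in x_eq y_lt. pose proof (wtX_pos F adm) as wX. pose proof (curve_lip_pos F B adm) as k_pos.
  destruct (lipschitz_on_near _ 0 L _ s 0 k_pos (momX_lipschitz F B L gam adm ext)) as (dX & dX_pos & x_pos); [lra | lra |].
  destruct (lipschitz_on_near _ 0 L _ s (- wtY F) k_pos (lipschitz_on_opp _ _ _ _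
    (lipschitz_on_Rabs _ _ _ _ (momY_lipschitz F B L gam adm ext)))) as (dY & dY_pos & y_small); [lra | lra |].
  cbv beta in y_small. pose proof (Rmin_l dX dY). pose proof (Rmin_r dX dY).
  exists (Rmin dX dY). split; [apply Rmin_pos; assumption|]. intros t t_in tL.
  rewrite (edge_run F B L gam adm ext s t); [apply letter_reachable_axX; [exact adm | lra] | lra | lra | |].
  - intros r r_in. left. apply x_pos; [lra|]. rewrite Rabs_right; lra.
  - intros r r_in. enough (- wtY F < - Rabs (momY F (state r))) by lra. apply y_small; [lra|]. rewrite Rabs_right; lra.
Qed.

Lemma X_edge_letters F s : admissible F -> extremal_curve F B L gam -> 0 <= s < L ->
  Rabs (momX F (state s)) = wtX F -> Rabs (momY F (state s)) < wtY F -> starts_with_letters F L gam s.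
Proof.
  intros adm ext s_in x_eq y_lt. destruct (Rabs_eq_cases _ _ x_eq) as [x_pos | x_neg].
  - apply edge_letters; assumption.
  - apply (starts_with_letters_sym Nu), edge_letters; auto using admissible_sym, extremal_curve_sym.
    + rewrite momX_sym, x_neg. apply Ropp_involutive.
    + rewrite momY_sym, Rabs_Ropp. exact y_lt.
Qed.

Lemma any_corner_letters F s : admissible F -> extremal_curve F B L gam -> 0 <= s < L ->
  Rabs (momX F (state s)) = wtX F -> Rabs (momY F (state s)) = wtY F -> starts_with_letters F L gam s.
Proof.
  assert (right_corners : forall F, admissible F -> extremal_curve F B L gam -> 0 <= s < L ->
    momX F (state s) = wtX F -> Rabs (momY F (state s)) = wtY F -> starts_with_letters F L gam s).
  { clear. intros F adm ext s_in x_eq y_eq. destruct (Rabs_eq_cases _ _ y_eq) as [y_pos | y_neg].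
    - apply corner_letters; assumption.
    - apply (starts_with_letters_sym Rho), corner_letters; auto using admissible_sym, extremal_curve_sym.
      rewrite momY_sym, y_neg. apply Ropp_involutive. }
  intros adm ext s_in x_eq y_eq. destruct (Rabs_eq_cases _ _ x_eq) as [x_pos | x_neg].
  - apply right_corners; assumption.
  - apply (starts_with_letters_sym Nu), right_corners; auto using admissible_sym, extremal_curve_sym.
    + rewrite momX_sym, x_neg. apply Ropp_involutive.
    + rewrite momY_sym, Rabs_Ropp. exact y_eq.
Qed.

Lemma curve_starts_with_letters F s : admissible F -> extremal_curve F B L gam -> 0 <= s < L ->
  starts_with_letters F L gam s.
Proof.
  intros adm ext s_in. destruct (curve_momentum_box F B L gam ext s ltac:(lra)) as [[x_lt | x_eq] [y_lt | y_eq]].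
  - destruct (curve_on_boundary F B L gam adm ext s s_in); lra.
  - apply (starts_with_letters_sym Vs), X_edge_letters; auto using admissible_sym, extremal_curve_sym.
  - apply X_edge_letters; assumption.
  - apply any_corner_letters; assumption.
Qed.
End LocalLetters.

Lemma curve_letters F B L gam : admissible F -> extremal_curve F B L gam -> 0 <= L ->
  letter_reachable F (rel (gam 0) (gam L)) L.
Proof.
  intros adm ext L_ge0.
  assert (gamSO3 : forall s, 0 <= s <= L -> inSO3 (gam s)) by apply (curve_SO3 _ _ _ _ ext).
  set (P := fun t => 0 <= t <= L /\ letter_reachable F (rel (gam 0) (gam t)) t).
  assert (P0 : P 0) by (split; [lra|]; rewrite rel_self by (apply gamSO3; lra); apply letter_reachable_id).
  assert (extend : forall r t, P r -> r <= t <= L -> letter_reachable F (rel (gam r) (gam t)) (t - r) -> P t).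
  { intros r t [r_in Pr] rt letters. split; [lra|]. replace t with (r + (t - r)) at 2 by ring.
    apply (letter_reachable_rel_chain F _ (gam r)); [apply gamSO3; lra | exact Pr | exact letters]. }
  destruct (completeness P) as [t [upper least]].
  { exists L. intros s [s_in _]. lra. }
  { exists 0. exact P0. }
  assert (t_ge0 : 0 <= t) by (apply upper, P0). assert (t_le : t <= L) by (apply least; intros s [s_in _]; lra).
  assert (Pt : P t).
  { destruct t_ge0 as [t_pos | <-]; [|exact P0].
    destruct (curve_starts_with_letters _ L _ F (L - t) adm (extremal_curve_reverse _ _ _ _ ext)) as (d & d_pos & back); [lra|].
    assert (approach : exists r, P r /\ t - d < r).
    { apply NNPP; intros none. assert (t <= t - d); [|lra]. apply least. intros r Pr.
      apply Rnot_lt_le; intros close. apply none. exists r; auto. }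
    destruct approach as (r & Pr & close). pose proof (upper r Pr) as r_le. pose proof (proj1 Pr).
    apply (extend r t Pr); [lra|]. specialize (back (L - r) ltac:(lra) ltac:(lra)).
    replace (L - (L - r)) with r in back by ring. replace (L - (L - t)) with t in back by ring.
    replace (L - r - (L - t)) with (t - r) in back by ring. rewrite <- mtrans_rel. apply letter_reachable_trans, back. }
  destruct t_le as [t_lt | ->]; [exfalso | apply Pt].
  destruct (curve_starts_with_letters B L gam F t adm ext) as (d & d_pos & forth); [lra|].
  pose proof (Rmin_l (t + d) L). pose proof (Rmin_r (t + d) L).
  assert (t < Rmin (t + d) L) by (apply Rmin_glb_lt; lra).
  assert (Rmin (t + d) L <= t); [|lra]. apply upper, (extend t); [exact Pt | lra | apply forth; lra].
Qed.

(** * Extremal words *)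

(* Written with B = g G for g the product of w, maximality of [penalised_value F G] at w restricts to the
   factors of w, with B replaced by its conjugates. *)
Definition extremal_word (F : frame) (B : M3) (w : list factor) : Prop :=
  nonneg_times w /\ forall w', nonneg_times w' ->
    mtrace (mmul B (mmul (wprod F w') (mtrans (wprod F w)))) <= mtrace B + wcost F w' - wcost F w.

Lemma maximal_extremal_word F G w : nonneg_times w ->
  (forall w', nonneg_times w' -> penalised_value F G w' <= penalised_value F G w) ->
  extremal_word F (mmul (wprod F w) G) w.
Proof.
  intros nn maximal. split; [exact nn|]. intros w' nn'. specialize (maximal w' nn'). unfold penalised_value in maximal.
  rewrite (mtrace_mulC (wprod F w) G), (mmul_assoc (wprod F w)), (mtrace_mulC (wprod F w)), !mmul_assoc,
    (SO3_trans_mul _ (wprod_SO3 F w)), mmul_1r. lra.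
Qed.

Lemma penalised_maximum F G : admissible F -> exists l, nonneg_times (spell F l) /\
  forall w, nonneg_times w -> penalised_value F G w <= penalised_value F G (spell F l).
Proof.
  intros adm. destruct (reachable_penalised_maximum F G adm) as (h0 & c0 & reach0 & maximal).
  assert (letters : letter_reachable F h0 c0).
  { destruct (reachable_ge0 F h0 c0 adm reach0) as [c0_pos | <-].
    2: { rewrite (reachable_0 F h0 adm reach0). apply letter_reachable_id. }
    destruct (reachable_curve F h0 c0 adm reach0 c0_pos) as (gam & gamSO3 & gam_start & gam_end & reach).
    assert (ext : extremal_curve F (mmul h0 G) c0 gam).
    { constructor; [intros s s_in; apply gamSO3; lra | intros s t st tc; apply reach; exact st |].
      intros s t E e st tc reachE.
      pose proof (reach 0 s ltac:(lra)) as before. rewrite gam_start, rel_id in before.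
      pose proof (reach t c0 ltac:(lra)) as after. rewrite gam_end in after.
      specialize (maximal _ _ (reachable_mul _ _ _ _ _ before (reachable_mul _ _ _ _ _ reachE after))).
      rewrite (mmul_assoc h0), !(mtrace_mulC h0), !mmul_assoc. unfold rel in maximal. lra. }
    pose proof (curve_letters F _ c0 gam adm ext ltac:(lra)) as letters.
    rewrite gam_start, gam_end, rel_id in letters. exact letters. }
  destruct letters as (l & nn & prod & cost). exists l. split; [exact nn|]. intros w nnw.
  specialize (maximal _ _ (reachable_wprod F w nnw)). unfold penalised_value. rewrite prod, cost. exact maximal.
Qed.

Lemma extremal_word_ext F B w1 w2 : nonneg_times w2 -> wprod F w1 = wprod F w2 -> wcost F w2 <= wcost F w1 ->
  extremal_word F B w1 -> extremal_word F B w2.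
Proof.
  intros nn prod cost [_ opt]. split; [exact nn|]. intros w' nn'. specialize (opt w' nn'). rewrite <- prod. lra.
Qed.

Lemma extremal_word_variation F B w w' h E : extremal_word F B w -> inSO3 h -> nonneg_times w' ->
  wcost F w' = wcost F w -> wprod F w' = mmul (mmul h (mmul E (mtrans h))) (wprod F w) ->
  mtrace (mmul (conj_by B h) E) <= mtrace B.
Proof.
  intros [_ opt] Sh nn' cost prod. specialize (opt w' nn').
  rewrite prod, cost, (mmul_assoc _ (wprod F w)), (SO3_mul_trans _ (wprod_SO3 F w)), mmul_1r, mtrace_mul_conj in opt. lra.
Qed.

Lemma extremal_word_factor F B w1 w2 w3 : extremal_word F B (w1 ++ w2 ++ w3) ->
  extremal_word F (conj_by B (wprod F w1)) w2.
Proof.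
  intros [nn opt]. apply nonneg_times_app in nn. destruct nn as [nn1 nn]. apply nonneg_times_app in nn.
  destruct nn as [nn2 nn3]. split; [exact nn2|]. intros w' nn'.
  assert (nn_new : nonneg_times (w1 ++ w' ++ w3)) by (rewrite !nonneg_times_app; auto).
  specialize (opt _ nn_new). rewrite !wprod_app, !wcost_app in opt.
  rewrite (mtrace_conj_by B _ (wprod_SO3 F w1)), <- mtrace_mul_conj.
  rewrite !mtrans_mul, !mmul_assoc, (SO3_mulVKl (wprod F w3) _ (wprod_SO3 F w3)) in opt. rewrite !mmul_assoc. lra.
Qed.

Lemma extremal_word_tail F B t ab w : extremal_word F B ((t, ab) :: w) ->
  extremal_word F (conj_by B (rot t (cvec F ab))) w.
Proof.
  intros ext. rewrite <- wprod_single. apply (extremal_word_factor F B [(t, ab)] w []). rewrite app_nil_r. exact ext.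
Qed.

Lemma extremal_word_prefix F B w1 w2 : extremal_word F B (w1 ++ w2) -> extremal_word F B w1.
Proof.
  intros ext. rewrite <- (conj_by_id B). exact (extremal_word_factor F B [] w1 w2 ext).
Qed.

Lemma sym_wordK s w : sym_word s (sym_word s w) = w.
Proof.
  unfold sym_word. rewrite map_map. rewrite <- (map_id w) at 2. apply map_ext. intros [t [a b]].
  destruct s; cbn; unfold cneg; cbn; rewrite ?Ropp_involutive; reflexivity.
Qed.

Lemma extremal_word_sym s F B w : extremal_word F B w -> extremal_word (sym_frame s F) B (sym_word s w).
Proof.
  intros [nn opt]. split; [apply nonneg_times_sym, nn|]. intros w' nn'.
  specialize (opt (sym_word s w') (nonneg_times_sym s w' nn')).
  rewrite <- (sym_wordK s w'), !wprod_sym, !wcost_sym. exact opt.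
Qed.

Lemma extremal_word_inv F B w : extremal_word F B w -> extremal_word F (mtrans (conj_by B (wprod F w))) (winv w).
Proof.
  intros [nn opt]. split; [apply nonneg_times_winv, nn|]. intros w' nn'.
  specialize (opt (winv w') (nonneg_times_winv w' nn')). rewrite wprod_winv, wcost_winv in opt.
  rewrite wprod_winv, wcost_winv, mtrans_mtrans, mtrace_trans, (mtrace_conj_by B _ (wprod_SO3 F w)).
  rewrite <- mtrace_trans, !mtrans_mul, mtrans_mtrans. unfold conj_by.
  rewrite !mmul_assoc, mtrace_mulC, !mmul_assoc, (SO3_mul_trans _ (wprod_SO3 F w)), mmul_1r.
  rewrite <- mmul_assoc, mtrace_mulC. lra.
Qed.

Lemma sym_word_Nu_winv w : sym_word Nu (winv w) = rev w.
Proof.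
  unfold sym_word, winv. rewrite map_map. rewrite <- (map_id (rev w)) at 2. apply map_ext.
  intros [t ab]. cbn. rewrite cneg_cneg. reflexivity.
Qed.

(* Time reversal composed with [Nu] keeps the letters, reverses their order and negates momZ. *)
Lemma extremal_word_rev F B w : extremal_word F B w ->
  extremal_word (sym_frame Nu F) (mtrans (conj_by B (wprod F w))) (rev w).
Proof. intros ext. rewrite <- sym_word_Nu_winv. apply extremal_word_sym, extremal_word_inv, ext. Qed.

Lemma mom_trans_Nu F B : momX (sym_frame Nu F) (mtrans B) = momX F B /\
  momY (sym_frame Nu F) (mtrans B) = momY F B /\ momZ (sym_frame Nu F) (mtrans B) = - momZ F B.
Proof.
  rewrite momX_sym, momY_sym, momZ_sym. unfold momX, momY, momZ. rewrite vee_trans, !dot_negl. cbn. lra.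
Qed.

Lemma extremal_momentum_le_rate F B w ab : extremal_word F B w -> dot (vee B) (cvec F ab) <= rate F ab.
Proof.
  intros [nn opt]. apply first_order_le. exists 1. split; [lra|]. intros e e_in.
  specialize (opt ((e, ab) :: w) (nonneg_times_cons e ab w ltac:(lra) nn)).
  rewrite wprod_cons, wcost_cons, mmul_assoc, (SO3_mul_trans _ (wprod_SO3 F w)), mmul_1r in opt. lra.
Qed.

Lemma extremal_momentum_box F B w : extremal_word F B w ->
  Rabs (momX F B) <= wtX F /\ Rabs (momY F B) <= wtY F.
Proof. intros ext. apply momentum_box. intros ab. exact (extremal_momentum_le_rate F B w ab ext). Qed.

Lemma extremal_momentum_eq_rate F B t ab w : extremal_word F B ((t, ab) :: w) -> 0 < t ->
  dot (vee B) (cvec F ab) = rate F ab.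
Proof.
  intros ext t_pos. apply Rle_antisym; [exact (extremal_momentum_le_rate _ _ _ ab ext)|].
  enough (dot (vee B) (vneg (cvec F ab)) <= - rate F ab) as le by (rewrite dot_negr in le; lra).
  destruct ext as [nn opt]. inversion nn as [|head tail _ nn_w]; subst.
  apply first_order_le. exists t. split; [exact t_pos|]. intros e e_in.
  specialize (opt ((t - e, ab) :: w) (nonneg_times_cons (t - e) ab w ltac:(lra) nn_w)).
  rewrite !wprod_cons, !wcost_cons in opt. replace (t - e) with (- e + t) in opt by ring.
  rewrite rot_add, mtrans_mul, !mmul_assoc, (SO3_mulVKl _ _ (wprod_SO3 F w)),
    (SO3_mul_trans _ (rot_SO3 t _)), mmul_1r in opt. rewrite rot_vneg. lra.
Qed.

Lemma extremal_word_split F B s t ab w : 0 <= s -> 0 <= t -> extremal_word F B ((s + t, ab) :: w) ->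
  extremal_word F B ((s, ab) :: (t, ab) :: w).
Proof.
  intros s_ge0 t_ge0 ext. pose proof (proj1 ext) as nn. inversion nn as [|head tail _ nn_w]; subst.
  apply (extremal_word_ext F B ((s + t, ab) :: w)); [|rewrite !wprod_cons, rot_add; apply mmul_assoc | | exact ext].
  - apply nonneg_times_cons; [assumption|]. apply nonneg_times_cons; assumption.
  - rewrite !wcost_cons. lra.
Qed.

Lemma extremal_word_inside F B t ab w s : extremal_word F B ((t, ab) :: w) -> 0 <= s <= t ->
  extremal_word F (conj_by B (rot s (cvec F ab))) ((t - s, ab) :: w).
Proof.
  intros ext s_in. apply extremal_word_tail, extremal_word_split; [lra | lra |].
  replace (s + (t - s)) with t by ring. exact ext.
Qed.

Lemma extremal_word_letter_le F B t ab t' ab' w : extremal_word F B ((t, ab) :: w) -> 0 <= t' ->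
  rot t' (cvec F ab') = rot t (cvec F ab) -> t * rate F ab <= t' * rate F ab'.
Proof.
  intros [nn opt] t'_ge0 same. inversion nn as [|head tail _ nn_w]; subst.
  specialize (opt ((t', ab') :: w) (nonneg_times_cons _ _ _ t'_ge0 nn_w)).
  rewrite !wprod_cons, !wcost_cons, same, (SO3_mul_trans _ (SO3_mul _ _ (rot_SO3 t _) (wprod_SO3 F w))), mmul_1r in opt.
  lra.
Qed.

Lemma extremal_angle_le_PI F B t ab w : extremal_word F B ((t, ab) :: w) -> 0 < rate F ab ->
  cvec F ab <> vzero -> t * vnorm (cvec F ab) <= PI.
Proof.
  intros ext rate_pos v_nz. pose proof (vnorm_pos _ v_nz) as n_pos. set (n := vnorm (cvec F ab)) in *.
  pose proof PI_RGT_0. assert (period_pos : 0 < 2 * PI / n) by (apply Rdiv_lt_0_compat; lra).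
  assert (turns : 2 * PI / n * n = 2 * PI) by (field; lra).
  apply Rnot_lt_le; intros over. destruct (Rle_dec t (2 * PI / n)) as [within | beyond].
  - pose proof (extremal_word_letter_le F B t ab (2 * PI / n - t) (cneg ab) w ext ltac:(lra)) as shorter.
    rewrite rate_cneg, cvec_cneg, rot_vneg in shorter.
    replace (- (2 * PI / n - t)) with (t - 2 * PI / n) in shorter by ring.
    specialize (shorter (rot_period t _ v_nz)). apply Rmult_le_reg_r in shorter; [nra | exact rate_pos].
  - pose proof (extremal_word_letter_le F B t ab (t - 2 * PI / n) ab w ext ltac:(lra) (rot_period t _ v_nz)) as shorter.
    apply Rmult_le_reg_r in shorter; [lra | exact rate_pos].
Qed.

Lemma extremal_start_signs F B t ab w : admissible F -> extremal_word F B ((t, ab) :: w) -> 0 < t ->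
  (momX F B = wtX F -> 0 <= snd ab * momZ F B) /\ (momX F B = - wtX F -> snd ab * momZ F B <= 0) /\
  (momY F B = wtY F -> fst ab * momZ F B <= 0) /\ (momY F B = - wtY F -> 0 <= fst ab * momZ F B).
Proof.
  intros adm ext t_pos. destruct (cross_cvec F ab (vee B) adm) as (cross_X & cross_Y & _).
  assert (box : forall s, 0 <= s <= t -> let l := mvmul (mtrans (rot s (cvec F ab))) (vee B) in
    (- wtX F <= dot l (axX F) <= wtX F) /\ (- wtY F <= dot l (axY F) <= wtY F)).
  { intros s s_in l. destruct (extremal_momentum_box _ _ _ (extremal_word_inside F B t ab w s ext s_in)) as [x_le y_le].
    unfold momX, momY in *. rewrite vee_conj_by_rot in *. split; apply Rabs_le_bounds; assumption. }
  unfold momX, momY, momZ in *. repeat split; intros extreme.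
  - rewrite <- cross_X. apply (rotating_dot_le _ _ _ t t_pos). intros s s_in. rewrite extreme. apply box, s_in.
  - enough (0 <= dot (cross (cvec F ab) (vee B)) (vneg (axX F))) as le by (rewrite dot_negr in le; lra).
    apply (rotating_dot_le _ _ _ t t_pos). intros s s_in. rewrite !dot_negr, extreme. pose proof (box s s_in). cbn in *. lra.
  - enough (0 <= dot (cross (cvec F ab) (vee B)) (axY F)) as le by lra.
    apply (rotating_dot_le _ _ _ t t_pos). intros s s_in. rewrite extreme. apply box, s_in.
  - enough (0 <= dot (cross (cvec F ab) (vee B)) (vneg (axY F))) as le by (rewrite dot_negr in le; lra).
    apply (rotating_dot_le _ _ _ t t_pos). intros s s_in. rewrite !dot_negr, extreme. pose proof (box s s_in). cbn in *. lra.
Qed.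

Lemma extremal_end_signs F B t ab w : admissible F -> extremal_word F B ((t, ab) :: w) -> 0 < t ->
  let B' := conj_by B (rot t (cvec F ab)) in
  (momX F B' = wtX F -> snd ab * momZ F B' <= 0) /\ (momX F B' = - wtX F -> 0 <= snd ab * momZ F B') /\
  (momY F B' = wtY F -> 0 <= fst ab * momZ F B') /\ (momY F B' = - wtY F -> fst ab * momZ F B' <= 0).
Proof.
  intros adm ext t_pos B'. apply (extremal_word_prefix F B [(t, ab)] w), extremal_word_rev in ext.
  rewrite wprod_single in ext. fold B' in ext.
  destruct (mom_trans_Nu F B') as (same_X & same_Y & opp_Z).
  destruct (extremal_start_signs _ _ _ _ _ (admissible_sym Nu F adm) ext t_pos) as (X_max & X_min & Y_max & Y_min).
  rewrite same_X, same_Y, opp_Z in *. cbn [sym_frame wtX wtY] in *.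
  repeat split; intros extreme;
    [specialize (X_max extreme) | specialize (X_min extreme) | specialize (Y_max extreme) | specialize (Y_min extreme)]; lra.
Qed.

(** * Second and third order conditions *)

Fixpoint perturb (e : R) (w : list factor) (xs : list R) : list factor :=
  match w, xs with
  | (t, ab) :: w, x :: xs => (t + e * x, ab) :: perturb e w xs
  | _, _ => w
  end.
Fixpoint variation_cost (F : frame) (w : list factor) (xs : list R) : R :=
  match w, xs with
  | (t, ab) :: w, x :: xs => x * rate F ab + variation_cost F w xs
  | _, _ => 0
  end.
Fixpoint variation_field (F : frame) (w : list factor) (xs : list R) : list V3 :=
  match w, xs with
  | (t, ab) :: w, x :: xs =>
      vscale x (cvec F ab) :: map (mvmul (rot t (cvec F ab))) (variation_field F w xs)
  | _, _ => []
  end.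
Fixpoint rot_list (e : R) (vs : list V3) : M3 :=
  match vs with [] => mid3 | v :: vs => mmul (rot e v) (rot_list e vs) end.
Fixpoint vsum (vs : list V3) : V3 :=
  match vs with [] => vzero | v :: vs => vadd v (vsum vs) end.
Fixpoint cross_sum (vs : list V3) : V3 :=
  match vs with [] => vzero | v :: vs => vadd (cross v (vsum vs)) (cross_sum vs) end.

Lemma rot_list_map Q e vs : inSO3 Q -> mmul Q (rot_list e vs) = mmul (rot_list e (map (mvmul Q) vs)) Q.
Proof.
  intros SQ. induction vs as [|v vs IH]; cbn; [rewrite mmul_1l, mmul_1r; reflexivity|].
  rewrite <- mmul_assoc, (mmul_rot Q e v SQ), mmul_assoc, IH, <- mmul_assoc. reflexivity.
Qed.
Lemma vsum_map Q vs : vsum (map (mvmul Q) vs) = mvmul Q (vsum vs).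
Proof. induction vs as [|v vs IH]; cbn; [entries_ring | rewrite IH, mvmul_add; reflexivity]. Qed.
Lemma cross_sum_map Q vs : inSO3 Q -> cross_sum (map (mvmul Q) vs) = mvmul Q (cross_sum vs).
Proof.
  intros SQ. induction vs as [|v vs IH]; cbn; [entries_ring|].
  rewrite IH, vsum_map, (SO3_cross Q _ _ SQ), mvmul_add. reflexivity.
Qed.

Lemma wprod_perturb F e w xs : wprod F (perturb e w xs) = mmul (rot_list e (variation_field F w xs)) (wprod F w).
Proof.
  revert xs. induction w as [|[t ab] w IH]; intros [|x xs]; cbn [perturb variation_field rot_list]; try (symmetry; apply mmul_1l).
  rewrite !wprod_cons, IH, rot_vscale, Rplus_comm, rot_add, !mmul_assoc. f_equal.
  rewrite <- !mmul_assoc, rot_list_map by apply rot_SO3. reflexivity.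
Qed.
Lemma wcost_perturb F e w xs : wcost F (perturb e w xs) = wcost F w + e * variation_cost F w xs.
Proof.
  revert xs. induction w as [|[t ab] w IH]; intros [|x xs]; cbn [perturb variation_cost]; rewrite ?wcost_cons, ?IH; ring.
Qed.
Lemma nonneg_times_perturb w xs : Forall (fun f => 0 < fst f) w ->
  exists d, 0 < d /\ forall e, 0 <= e <= d -> nonneg_times (perturb e w xs).
Proof.
  intros pos. revert xs. induction pos as [|[t ab] w t_pos pos IH]; intros xs.
  { exists 1. split; [lra|]. intros e _. destruct xs; constructor. }
  assert (nn : nonneg_times w) by (eapply Forall_impl; [|exact pos]; cbn; intros; lra).
  cbn in t_pos. destruct xs as [|x xs]; [exists 1; split; [lra|]; intros; apply nonneg_times_cons; [lra | exact nn]|].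
  destruct (IH xs) as (d & d_pos & nn_perturb).
  destruct (exists_small d t (- x)) as (d' & d'_in & small); [assumption | assumption |].
  exists d'. split; [lra|]. intros e e_in. apply nonneg_times_cons; [|apply nn_perturb; lra].
  destruct (Rle_dec 0 x) as [x_ge0 | x_neg]; nra.
Qed.

Lemma rot_list_expansion vs : exists A3, expansion3 (fun e => rot_list e vs) (skew (vsum vs))
  (madd (mscale (/ 2) (mmul (skew (vsum vs)) (skew (vsum vs)))) (mscale (/ 2) (skew (cross_sum vs)))) A3.
Proof.
  induction vs as [|v vs [A3 IH]].
  - exists (mscale 0 mid3). cbn [vsum cross_sum].
    replace (madd _ _) with (mscale (/ 2) (mmul (skew vzero) (skew vzero))) by entries_ring.
    replace (mscale 0 mid3) with (mscale (/ 6) (mmul (skew vzero) (mmul (skew vzero) (skew vzero)))) by entries_ring.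
    destruct (expansion3_rot vzero) as (M & d & M_ge0 & d_in & expansion). exists M, d.
    split; [exact M_ge0|]. split; [exact d_in|]. intros e e_in. specialize (expansion e e_in).
    rewrite rot_vzero in expansion.
    exact expansion.
  - eexists. pose proof (expansion3_mul _ _ _ _ _ _ _ _ (expansion3_rot v) IH) as expansion.
    replace (madd (skew v) (skew (vsum vs))) with (skew (vsum (v :: vs))) in expansion by (cbn [vsum]; entries_ring).
    replace (madd (mscale (/ 2) (mmul (skew v) (skew v))) _) with
      (madd (mscale (/ 2) (mmul (skew (vsum (v :: vs))) (skew (vsum (v :: vs))))) (mscale (/ 2) (skew (cross_sum (v :: vs)))))
      in expansion by (cbn [vsum cross_sum]; generalize (vsum vs) (cross_sum vs); intros; entries; field).
    exact expansion.
Qed.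

Lemma extremal_second_variation F B w xs : extremal_word F B w -> Forall (fun f => 0 < fst f) w ->
  variation_cost F w xs = 0 -> vsum (variation_field F w xs) = vzero ->
  dot (vee B) (cross_sum (variation_field F w xs)) <= 0.
Proof.
  intros ext pos flat_cost closed. apply Rnot_lt_le; intros increasing.
  destruct (nonneg_times_perturb w xs pos) as (d & d_pos & nn).
  destruct (rot_list_expansion (variation_field F w xs)) as [A3 expansion]. rewrite closed in expansion.
  destruct (second_order_increase _ _ _ _ B d expansion d_pos) as (e & e_in & increase).
  - rewrite mtrace_skew. entries_ring.
  - rewrite mmul_addr, mtrace_add, !mmul_scaler, !mtrace_scale, mtrace_skew.
    replace (mtrace (mmul B (mmul (skew vzero) (skew vzero)))) with 0 by entries_ring. lra.
  - pose proof (extremal_word_variation F B w (perturb e w xs) mid3 (rot_list e (variation_field F w xs)) ext SO3_1) as le.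
    rewrite conj_by_id, mtrans_1, mmul_1l, mmul_1r, wcost_perturb, wprod_perturb, flat_cost in le.
    specialize (le (nn e ltac:(lra)) ltac:(lra) eq_refl). lra.
Qed.

(* The same condition with all velocities transported to the end of the first letter. *)
Lemma extremal_second_variation_after F B t ab w x xs : extremal_word F B ((t, ab) :: w) -> 0 < t ->
  Forall (fun f => 0 < fst f) w -> x * rate F ab + variation_cost F w xs = 0 ->
  let vs := vscale x (cvec F ab) :: variation_field F w xs in
  vsum vs = vzero -> dot (vee (conj_by B (rot t (cvec F ab)))) (cross_sum vs) <= 0.
Proof.
  intros ext t_pos pos flat_cost vs closed. pose proof (rot_SO3 t (cvec F ab)) as SQ.
  assert (axis_fixed : mvmul (rot t (cvec F ab)) (vscale x (cvec F ab)) = vscale x (cvec F ab)).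
  { rewrite mvmul_scale. f_equal. destruct (classic (cvec F ab = vzero)) as [-> | v_nz]; [rewrite rot_vzero; apply mvmul_1|].
    unfold rot. rewrite mvmul_rot_unit. pose proof (vnorm_pos _ v_nz). pose proof (vnorm_sq (cvec F ab)) as norm_sq.
    set (v := cvec F ab) in *. set (n := vnorm v) in *.
    replace (dot (vscale (/ n) v) v) with n by (rewrite dot_scalel, <- norm_sq; field; lra). entries; field; lra. }
  assert (field : variation_field F ((t, ab) :: w) (x :: xs) = map (mvmul (rot t (cvec F ab))) vs).
  { unfold vs. cbn [variation_field map]. rewrite axis_fixed. reflexivity. }
  pose proof (extremal_second_variation F B ((t, ab) :: w) (x :: xs) ext) as second.
  rewrite field, vsum_map, (cross_sum_map _ _ SQ), closed in second.
  rewrite vee_conj_by_rot, <- (SO3_dot (rot t (cvec F ab)) _ _ SQ), <- mvmul_mul, (SO3_mul_trans _ SQ), mvmul_1.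
  apply second; [constructor; assumption | exact flat_cost | entries_ring].
Qed.

(* With W = P + R, exp[W] exp(-[P]) exp(-[R]) is exp[D] up to fourth order, where
   D = (P x R)/2 + ((R - P) x (P x R))/12 + (W x (P x R))/4. *)
Lemma corner_cut_increase B P R mu d : vee B = vscale mu (vadd P R) -> 0 < mu -> cross P R <> vzero -> 0 < d ->
  exists e, 0 < e <= d /\
    mtrace B < mtrace (mmul B (mmul (rot e (vadd P R)) (mmul (rot e (vneg P)) (rot e (vneg R))))).
Proof.
  intros vee_B mu_pos independent d_pos. set (W := vadd P R) in *. set (N := cross P R) in *.
  pose proof (expansion3_mul _ _ _ _ _ _ _ _ (expansion3_rot W)
    (expansion3_mul _ _ _ _ _ _ _ _ (expansion3_rot (vneg P)) (expansion3_rot (vneg R)))) as expansion.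
  assert (normals : dot W N = 0) by (unfold W, N; entries_ring).
  eapply (third_order_increase _ _ _ _ B d expansion d_pos).
  - replace (madd _ _) with (mscale 0 mid3) by (unfold W; entries_ring). rewrite mmul_scaler, mtrace_scale. ring.
  - match goal with |- mtrace (mmul B ?A) = 0 =>
      replace A with (skew (vscale (/ 2) N)) by (unfold W, N; entries; field) end.
    rewrite mtrace_skew, vee_B, dot_scalel, dot_scaler, normals. ring.
  - match goal with |- 0 < mtrace (mmul B ?A) =>
      replace A with (skew (vadd (vscale (/ 12) (cross (vadd R (vneg P)) N)) (vscale (/ 4) (cross W N))))
        by (unfold W, N; entries; field) end.
    rewrite mtrace_skew, vee_B. replace (dot _ _) with (mu / 6 * dot N N) by (unfold W, N; entries; field).
    apply Rmult_lt_0_compat; [lra|]. rewrite <- vnorm_sq. pose proof (vnorm_pos N independent). nra.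
Qed.

Definition cmix (al : R) (ab : R * R) (be : R) (ab' : R * R) : R * R :=
  (al * fst ab + be * fst ab', al * snd ab + be * snd ab').

Lemma cvec_cmix F al ab be ab' :
  cvec F (cmix al ab be ab') = vadd (vscale al (cvec F ab)) (vscale be (cvec F ab')).
Proof. unfold cvec, cmix. entries_ring. Qed.

Lemma SO3_trans_reverses A v : inSO3 A -> mvmul (mtrans A) v = vneg v -> mvmul A v = vneg v.
Proof.
  intros SA reversed. transitivity (mvmul A (vneg (mvmul (mtrans A) v))); [rewrite reversed, vneg_vneg; reflexivity|].
  rewrite mvmul_neg, <- mvmul_mul, (SO3_mul_trans A SA), mvmul_1. reflexivity.
Qed.

Lemma half_loop_shortening F t1 ab1 t2 ab2 t3 ab3 w al be e :
  let h := wprod F [(t1, ab1); (t2, ab2)] in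
  let W := cvec F (cmix al ab2 be ab3) in
  mvmul (mtrans h) W = vneg W ->
  wprod F ((e, cneg (cmix al ab2 be ab3)) :: (t1, ab1) :: (t2 - e * al, ab2) :: (t3 - e * be, ab3) :: w) =
  mmul (mmul h (mmul (mmul (rot e W) (mmul (rot e (vneg (vscale al (cvec F ab2)))) (rot e (vneg (vscale be (cvec F ab3))))))
    (mtrans h))) (wprod F ((t1, ab1) :: (t2, ab2) :: (t3, ab3) :: w)).
Proof.
  intros h W half_turn. assert (Sh : inSO3 h) by apply wprod_SO3.
  pose proof (SO3_trans_reverses h W Sh half_turn) as half_turn'.
  change (wprod F ((t1, ab1) :: (t2, ab2) :: (t3, ab3) :: w)) with
    (wprod F ([(t1, ab1); (t2, ab2)] ++ (t3, ab3) :: w)).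
  rewrite wprod_app. fold h. rewrite !mmul_assoc, (SO3_mulKl h _ Sh),
    <- (mmul_assoc h (rot e W)), (mmul_rot h e W Sh), half_turn'.
  rewrite mmul_assoc, wprod_cons, cvec_cneg. fold W. f_equal.
  unfold h. rewrite !wprod_cons, !rot_vneg, !rot_vscale, wprod_nil, mmul_1r.
  replace (t2 - e * al) with (t2 + - e * al) by ring. replace (t3 - e * be) with (- e * be + t3) by ring.
  rewrite !rot_add, !mmul_assoc. reflexivity.
Qed.

(* A half loop along which the momentum changes sign can be shortened at its end: the common direction of
   momentum commutes past the half loop up to sign. *)
Lemma extremal_half_loop_end F B t1 ab1 t2 ab2 t3 ab3 w al be mu :
  extremal_word F B ((t1, ab1) :: (t2, ab2) :: (t3, ab3) :: w) -> 0 < t2 -> 0 < t3 -> 0 < al -> 0 < be -> 0 < mu ->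
  let W := cvec F (cmix al ab2 be ab3) in
  rate F (cmix al ab2 be ab3) = al * rate F ab2 + be * rate F ab3 ->
  vee (conj_by B (wprod F [(t1, ab1); (t2, ab2)])) = vscale mu W -> vee B = vscale (- mu) W ->
  cross (cvec F ab2) (cvec F ab3) = vzero.
Proof.
  intros ext t2_pos t3_pos al_pos be_pos mu_pos W rate_mix vee_end vee_start. apply NNPP; intros independent.
  set (h := wprod F [(t1, ab1); (t2, ab2)]) in *. assert (Sh : inSO3 h) by apply wprod_SO3.
  assert (half_turn : mvmul (mtrans h) W = vneg W).
  { rewrite (vee_conj_by B h Sh), vee_start, mvmul_scale in vee_end.
    transitivity (vscale (- / mu) (vscale (- mu) (mvmul (mtrans h) W))); [entries; field; lra|].
    rewrite vee_end. entries; field; lra. }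
  set (P := vscale al (cvec F ab2)). set (R' := vscale be (cvec F ab3)).
  assert (mix : W = vadd P R') by apply cvec_cmix.
  assert (independent' : cross P R' <> vzero).
  { replace (cross P R') with (vscale (al * be) (cross (cvec F ab2) (cvec F ab3))) by (unfold P, R'; entries_ring).
    intros zero. apply vscale_eq0 in zero; [contradiction|]. apply Rgt_not_eq, Rmult_lt_0_compat; assumption. }
  destruct (exists_small 1 t2 al) as (d2 & d2_in & d2_small); [lra | assumption |].
  destruct (exists_small 1 t3 be) as (d3 & d3_in & d3_small); [lra | assumption |].
  pose proof (Rmin_l d2 d3). pose proof (Rmin_r d2 d3).
  rewrite mix in vee_end.
  destruct (corner_cut_increase (conj_by B h) P R' mu (Rmin d2 d3) vee_end mu_pos independent') as (e & e_in & increase);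
    [apply Rmin_pos; lra|]. rewrite <- mix in increase.
  pose proof (extremal_word_variation F B _
    ((e, cneg (cmix al ab2 be ab3)) :: (t1, ab1) :: (t2 - e * al, ab2) :: (t3 - e * be, ab3) :: w) h
    (mmul (rot e W) (mmul (rot e (vneg P)) (rot e (vneg R')))) ext Sh) as le.
  rewrite (mtrace_conj_by B h Sh) in increase. apply (Rlt_irrefl (mtrace B)), (Rlt_le_trans _ _ _ increase), le.
  - destruct ext as [nn _]. inversion nn as [|? ? t1_ge0 nn_tail]; subst. inversion nn_tail as [|? ? _ nn_tail']; subst.
    inversion nn_tail' as [|? ? _ nn_w]; subst.
    assert (e * al <= d2 * al) by (apply Rmult_le_compat_r; lra).
    assert (e * be <= d3 * be) by (apply Rmult_le_compat_r; lra).
    repeat (apply nonneg_times_cons; [cbn in *; lra|]). exact nn_w.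
  - rewrite !wcost_cons, rate_cneg, rate_mix. ring.
  - apply half_loop_shortening. exact half_turn.
Qed.

(** * Cycles *)

Definition frame_vec (F : frame) (v : V3) : V3 :=
  vadd (vscale (vx v) (axX F)) (vadd (vscale (vy v) (axY F)) (vscale (vz v) (normal F))).

Lemma frame_vec_scale F a v : frame_vec F (vscale a v) = vscale a (frame_vec F v).
Proof. unfold frame_vec. generalize (normal F). intros n. entries_ring. Qed.
Lemma frame_vec_add F u v : frame_vec F (vadd u v) = vadd (frame_vec F u) (frame_vec F v).
Proof. unfold frame_vec. generalize (normal F). intros n. entries_ring. Qed.
Lemma frame_vec_0 F : frame_vec F vzero = vzero.
Proof. unfold frame_vec. generalize (normal F). intros n. entries_ring. Qed.
Lemma frame_vec_cvec F ab : frame_vec F (mkV (fst ab) (snd ab) 0) = cvec F ab.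
Proof. unfold frame_vec, cvec. generalize (normal F). intros n. entries_ring. Qed.
Lemma vsum_frame_vec F us : vsum (map (frame_vec F) us) = frame_vec F (vsum us).
Proof. induction us as [|u us IH]; cbn [map vsum]; [symmetry; apply frame_vec_0 | rewrite IH, frame_vec_add; reflexivity].
Qed.

Definition turn_axX (c C S : R) (v : V3) : V3 :=
  mkV (vx v + vy v * c * (1 - C) + vz v * S * c) (vy v * C - vz v * S) (vy v * S + vz v * C).
Definition turn_axY (c C S : R) (v : V3) : V3 :=
  mkV (vx v * C + vz v * S) (vy v + vx v * c * (1 - C) - vz v * S * c) (- vx v * S + vz v * C).

Lemma rot_axX_frame_vec F t v : admissible F ->
  mvmul (rot t (axX F)) (frame_vec F v) = frame_vec F (turn_axX (cosXY F) (cos t) (sin t) v).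
Proof.
  intros adm. rewrite (rot_eq_rot_unit t _ (unit_axX F adm)), mvmul_rot_unit. unfold turn_axX.
  generalize (cos t) (sin t). intros C S. pose proof (unit_axX F adm) as U.
  unfold frame_vec, cosXY, normal. revert U. destruct (axX F) as [x1 x2 x3], (axY F) as [y1 y2 y3], v as [p q r].
  unfold dot, cross, vadd, vscale; cbn. intros U.
  assert (x33 : x3 * x3 = 1 - x1 * x1 - x2 * x2) by lra. apply V3_ext; cbn; ring [x33].
Qed.

Lemma rot_axY_frame_vec F t v : admissible F ->
  mvmul (rot t (axY F)) (frame_vec F v) = frame_vec F (turn_axY (cosXY F) (cos t) (sin t) v).
Proof.
  intros adm. assert (swap : forall u, frame_vec (sym_frame Vs F) u = frame_vec F (mkV (vy u) (vx u) (- vz u)))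
    by (intros u; unfold frame_vec, normal; cbn [sym_frame axX axY]; entries_ring).
  pose proof (rot_axX_frame_vec (sym_frame Vs F) t (mkV (vy v) (vx v) (- vz v)) (admissible_sym Vs F adm)) as swapped.
  rewrite cosXY_sym, !swap in swapped. cbn in swapped. rewrite Ropp_involutive in swapped. destruct v as [p q r].
  cbn in swapped. rewrite swapped. f_equal. unfold turn_axY. cbn. f_equal; ring.
Qed.

Definition wedge (c : R) (u v : V3) : V3 :=
  mkV ((vx u * vz v - vz u * vx v) * c + (vy u * vz v - vz u * vy v))
      (- ((vx u * vz v - vz u * vx v) + (vy u * vz v - vz u * vy v) * c))
      (vx u * vy v - vy u * vx v).

Lemma dot_cross_frame_vec F B u v : admissible F ->
  dot (vee B) (cross (frame_vec F u) (frame_vec F v)) =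
  dot (wedge (cosXY F) u v) (mkV (momX F B) (momY F B) (momZ F B)).
Proof.
  intros adm. unfold momX, momY, momZ. generalize (vee B). intros l.
  transitivity (((vx u * vz v - vz u * vx v) * cosXY F + (vy u * vz v - vz u * vy v) * dot (axY F) (axY F)) * dot l (axX F)
    - ((vx u * vz v - vz u * vx v) * dot (axX F) (axX F) + (vy u * vz v - vz u * vy v) * cosXY F) * dot l (axY F)
    + (vx u * vy v - vy u * vx v) * dot l (normal F)).
  - unfold frame_vec, cosXY, normal. entries_ring.
  - rewrite (unit_axX F adm), (unit_axY F adm). unfold wedge, dot; cbn. ring.
Qed.

Fixpoint wedge_sum (c : R) (us : list V3) : V3 :=
  match us with [] => vzero | u :: us => vadd (wedge c u (vsum us)) (wedge_sum c us) end.

Lemma dot_cross_sum_frame_vec F B us : admissible F ->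
  dot (vee B) (cross_sum (map (frame_vec F) us)) =
  dot (wedge_sum (cosXY F) us) (mkV (momX F B) (momY F B) (momZ F B)).
Proof.
  intros adm. induction us as [|u us IH]; cbn [map cross_sum wedge_sum]; [entries_ring|].
  rewrite vsum_frame_vec, dot_addr, (dot_cross_frame_vec F B _ _ adm), IH.
  generalize (wedge (cosXY F) u (vsum us)) (wedge_sum (cosXY F) us). intros. entries_ring.
Qed.

Lemma trig_unique u v C S C' S' : 0 < u * u + v * v ->
  u * C - v * S = u * C' - v * S' -> v * C + u * S = v * C' + u * S' -> C = C' /\ S = S'.
Proof.
  intros pos same_p same_q.
  assert (C_eq : (u * u + v * v) * (C - C') = 0).
  { replace ((u * u + v * v) * (C - C')) with
      (u * ((u * C - v * S) - (u * C' - v * S')) + v * ((v * C + u * S) - (v * C' + u * S'))) by ring.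
    rewrite same_p, same_q. ring. }
  assert (S_eq : (u * u + v * v) * (S - S') = 0).
  { replace ((u * u + v * v) * (S - S')) with
      (u * ((v * C + u * S) - (v * C' + u * S')) - v * ((u * C - v * S) - (u * C' - v * S'))) by ring.
    rewrite same_p, same_q. ring. }
  apply Rmult_integral in C_eq, S_eq. lra.
Qed.

Definition half_tan_cos (T : R) : R := (1 - T * T) / (1 + T * T).
Definition half_tan_sin (T : R) : R := 2 * T / (1 + T * T).

(* The rotation carrying the momenta (k, h, (1 + m)/P) to (-k, h, (1 - m)/P) has half-angle tangent k P. *)
Lemma reversal_half_tan c k h P t : 0 < P -> 0 < k -> let m := c * (h * P) * (k * P) in -1 < m < 1 ->
  - k = c * h + (k - c * h) * cos t - (1 + m) / P * sin t ->
  (1 - m) / P = (1 + m) / P * cos t + (k - c * h) * sin t ->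
  cos t = half_tan_cos (k * P) /\ sin t = half_tan_sin (k * P).
Proof.
  intros P_pos k_pos m m_in reversed_X reversed_Z. unfold half_tan_cos, half_tan_sin.
  assert (den : 1 + k * P * (k * P) <> 0) by nra.
  assert (z_pos : 0 < (1 + m) / P) by (apply Rdiv_lt_0_compat; lra).
  pose proof (Rle_0_sqr (k - c * h)) as sq_ge0. pose proof (Rmult_lt_0_compat _ _ z_pos z_pos).
  unfold Rsqr in sq_ge0. apply (trig_unique (k - c * h) ((1 + m) / P)); [lra | |].
  - transitivity (- k - c * h); [lra|]. unfold m. field. split; lra.
  - rewrite <- reversed_Z. unfold m. field. split; lra.
Qed.

Lemma quadratic_form_positive A Q C : (0 < A \/ 0 < C) \/ ((A < 0 \/ C < 0) /\ A * C < Q * Q) ->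
  exists s t, 0 < A * (s * s) + 2 * Q * (s * t) + C * (t * t).
Proof.
  intros [[A_pos | C_pos] | [[A_neg | C_neg] indefinite]].
  - exists 1, 0. lra.
  - exists 0, 1. lra.
  - exists Q, (- A). nra.
  - exists (- C), Q. nra.
Qed.

Definition cycle_form (S T m s t : R) : R :=
  (1 + m) * (S * S * T * T - 1 - 2 * m - m * (T * T) - m * (S * S)) * (s * s)
  + 2 * ((1 + S * S) * (1 - m * m)) * (s * t)
  + (1 - m) * (S * S * T * T - 1 + 2 * m + m * (T * T) + m * (S * S)) * (t * t).

Lemma cycle_form_positive c S T : 0 < S -> 0 < T -> c <> 0 -> let m := c * S * T in -1 < m < 1 ->
  exists s t, 0 < cycle_form S T m s t.
Proof.
  intros S_pos T_pos c_nz m m_in. apply quadratic_form_positive.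
  assert (ST_pos : 0 < S * T) by nra. assert (S2 : 0 < S * S) by nra. assert (T2 : 0 < T * T) by nra.
  assert (m_nz : m <> 0).
  { unfold m. rewrite Rmult_assoc. apply Rmult_integral_contrapositive_currified; lra. }
  destruct (Rle_dec 1 (S * S * T * T)) as [large | small].
  - left. destruct (Rle_dec 0 m) as [m_ge0 | m_neg].
    + right. apply Rmult_lt_0_compat; [lra|]. nra.
    + left. apply Rmult_lt_0_compat; [lra|]. nra.
  - right. split.
    + destruct (Rle_dec 0 m) as [m_ge0 | m_neg].
      * left. assert (0 < (1 + m) * - (S * S * T * T - 1 - 2 * m - m * (T * T) - m * (S * S)))
          by (apply Rmult_lt_0_compat; nra). lra.
      * right. assert (0 < (1 - m) * - (S * S * T * T - 1 + 2 * m + m * (T * T) + m * (S * S)))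
          by (apply Rmult_lt_0_compat; nra). lra.
    + set (D := (1 + T * T) * (S * S) * (2 + S * S - S * S * (T * T) + 2 * (m * m) + c * c * (T * T) * (3 + T * T))).
      assert (D_pos : 0 < D).
      { unfold D. apply Rmult_lt_0_compat; [nra|].
        assert (0 <= c * c * (T * T) * (3 + T * T)) by (apply Rmult_le_pos; [apply Rmult_le_pos; nra | nra]). nra. }
      assert (0 < (1 - m * m) * D) by (apply Rmult_lt_0_compat; nra).
      replace ((1 + S * S) * (1 - m * m) * ((1 + S * S) * (1 - m * m))) with
        ((1 + m) * (S * S * T * T - 1 - 2 * m - m * (T * T) - m * (S * S)) *
         ((1 - m) * (S * S * T * T - 1 + 2 * m + m * (T * T) + m * (S * S))) + (1 - m * m) * D) by (unfold D, m; ring).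
      lra.
Qed.

(* The velocities of the times of the cycle X, Y, -X, -Y, X that close up to first order, parametrised by s and t. *)
Definition cycle_velocities (S T m s t : R) : list R :=
  [ s * (S * (1 + T * T));
    s * (T * (-1 + S * S - 2 * m)) + t * (T * (1 + S * S));
    s * (S * (1 - T * T + 2 * m)) - t * (S * (1 - T * T - 2 * m));
    - s * (T * (1 + S * S)) + t * (T * (1 - S * S - 2 * m));
    - t * (S * (1 + T * T)) ].

Definition cycle_coords (c S T s t : R) : list V3 :=
  let Y_turn := turn_axY c (half_tan_cos T) (half_tan_sin T) in
  let X_back := turn_axX c (half_tan_cos S) (- half_tan_sin S) in
  let Y_back := turn_axY c (half_tan_cos T) (- half_tan_sin T) in
  let q i := nth i (cycle_velocities S T (c * S * T) s t) 0 in
  [ vscale (q 0%nat) (mkV 1 0 0);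
    vscale (q 1%nat) (mkV 0 1 0);
    vscale (q 2%nat) (Y_turn (mkV (-1) 0 0));
    vscale (q 3%nat) (Y_turn (X_back (mkV 0 (-1) 0)));
    vscale (q 4%nat) (Y_turn (X_back (Y_back (mkV 1 0 0)))) ].

Lemma cycle_coords_closed c S T s t : vsum (cycle_coords c S T s t) = vzero.
Proof.
  assert (S_den : 1 + S * S <> 0) by nra. assert (T_den : 1 + T * T <> 0) by nra.
  unfold cycle_coords, turn_axX, turn_axY, half_tan_cos, half_tan_sin; cbn. apply V3_ext; cbn; field; auto.
Qed.

Lemma cycle_coords_wedge c S T s t P : P <> 0 ->
  dot (wedge_sum c (cycle_coords c S T s t)) (mkV (T / P) (S / P) ((1 + c * S * T) / P)) =
  2 * S * T / P * cycle_form S T (c * S * T) s t.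
Proof.
  intros P_nz. assert (S_den : 1 + S * S <> 0) by nra. assert (T_den : 1 + T * T <> 0) by nra.
  unfold cycle_coords, cycle_form, wedge, turn_axX, turn_axY, half_tan_cos, half_tan_sin, dot; cbn. field. auto.
Qed.

Definition cycle_word (t1 t2 t3 t4 t5 : R) : list factor :=
  [(t1, (1, 0)); (t2, (0, 1)); (t3, cneg (1, 0)); (t4, cneg (0, 1)); (t5, (1, 0))].

Lemma cycle_field F S T t2 t3 t4 t5 s t : admissible F ->
  cos t2 = half_tan_cos T /\ sin t2 = half_tan_sin T -> cos t3 = half_tan_cos S /\ sin t3 = half_tan_sin S ->
  cos t4 = half_tan_cos T /\ sin t4 = half_tan_sin T ->
  let qs := cycle_velocities S T (cosXY F * S * T) s t in
  vscale (hd 0 qs) (cvec F (1, 0)) :: variation_field F (tl (cycle_word 0 t2 t3 t4 t5)) (tl qs) =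
  map (frame_vec F) (cycle_coords (cosXY F) S T s t).
Proof.
  intros adm [cos_t2 sin_t2] [cos_t3 sin_t3] [cos_t4 sin_t4] qs.
  assert (Y_turn : forall v, mvmul (rot t2 (cvec F (0, 1))) (frame_vec F v) =
    frame_vec F (turn_axY (cosXY F) (half_tan_cos T) (half_tan_sin T) v)).
  { intros v. rewrite cvec_01, rot_axY_frame_vec, cos_t2, sin_t2 by exact adm. reflexivity. }
  assert (X_back : forall v, mvmul (rot t3 (cvec F (cneg (1, 0)))) (frame_vec F v) =
    frame_vec F (turn_axX (cosXY F) (half_tan_cos S) (- half_tan_sin S) v)).
  { intros v. rewrite cvec_cneg, cvec_10, rot_vneg, rot_axX_frame_vec, cos_neg, sin_neg, cos_t3, sin_t3 by exact adm.
    reflexivity. }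
  assert (Y_back : forall v, mvmul (rot t4 (cvec F (cneg (0, 1)))) (frame_vec F v) =
    frame_vec F (turn_axY (cosXY F) (half_tan_cos T) (- half_tan_sin T) v)).
  { intros v. rewrite cvec_cneg, cvec_01, rot_vneg, rot_axY_frame_vec, cos_neg, sin_neg, cos_t4, sin_t4 by exact adm.
    reflexivity. }
  assert (X_axis : frame_vec F (mkV 1 0 0) = cvec F (1, 0)) by apply (frame_vec_cvec F (1, 0)).
  assert (Y_axis : frame_vec F (mkV 0 1 0) = cvec F (0, 1)) by apply (frame_vec_cvec F (0, 1)).
  assert (Xn_axis : frame_vec F (mkV (-1) 0 0) = cvec F (cneg (1, 0)))
    by (rewrite cvec_cneg, <- X_axis; unfold frame_vec; generalize (normal F); intros; entries_ring).
  assert (Yn_axis : frame_vec F (mkV 0 (-1) 0) = cvec F (cneg (0, 1)))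
    by (rewrite cvec_cneg, <- Y_axis; unfold frame_vec; generalize (normal F); intros; entries_ring).
  unfold qs, cycle_coords, cycle_word, cycle_velocities. cbn [nth hd tl map variation_field].
  rewrite !frame_vec_scale, <- !Y_turn, <- !X_back, <- Y_back, !mvmul_scale, X_axis, Y_axis, Xn_axis, Yn_axis. reflexivity.
Qed.

Definition momenta (F : frame) (B : M3) : V3 := mkV (momX F B) (momY F B) (momZ F B).

Lemma cycle_velocities_cost F S T t1 t2 t3 t4 t5 s t P : P <> 0 -> wtX F = T / P -> wtY F = S / P ->
  variation_cost F (cycle_word t1 t2 t3 t4 t5) (cycle_velocities S T (cosXY F * S * T) s t) = 0.
Proof.
  intros P_nz T_eq S_eq. cbn [cycle_word cycle_velocities variation_cost].
  rewrite !rate_cneg, rate_10, rate_01, T_eq, S_eq. field. exact P_nz.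
Qed.

(* The heights a and b of the momentum at the ends of a Y-letter running from (wtX, wtY, b) to (- wtX, wtY, a). *)
Definition cycle_heights (F : frame) (a b : R) : Prop :=
  0 < a /\ 0 < b /\ b * b - a * a = 4 * cosXY F * wtX F * wtY F.

Section CycleTimes.
Variables (F : frame) (a b : R).
Hypotheses (adm : admissible F) (heights : cycle_heights F a b).

Let P := 2 / (a + b).
Let m := cosXY F * (wtY F * P) * (wtX F * P).

Lemma cycle_scale : 0 < P /\ -1 < m < 1 /\ a = (1 - m) / P /\ b = (1 + m) / P.
Proof.
  destruct heights as (a_pos & b_pos & gap). assert (P_pos : 0 < P) by (apply Rdiv_lt_0_compat; lra).
  assert (m_eq : m = (b - a) * P / 2).
  { transitivity ((b * b - a * a) * P * P / 4); [unfold m; rewrite gap; field | unfold P; field; lra]. }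
  assert (sum : (a + b) * P = 2) by (unfold P; field; lra).
  assert (0 < a * P) by (apply Rmult_lt_0_compat; assumption). assert (0 < b * P) by (apply Rmult_lt_0_compat; assumption).
  split; [exact P_pos|]. split; [lra|].
  split; apply Rmult_eq_reg_r with P; try lra; unfold Rdiv; rewrite Rmult_assoc, Rinv_l; lra.
Qed.

Lemma cycle_Y_time B t : momenta F B = mkV (wtX F) (wtY F) b ->
  momenta F (conj_by B (rot t (axY F))) = mkV (- wtX F) (wtY F) a ->
  cos t = half_tan_cos (wtX F * P) /\ sin t = half_tan_sin (wtX F * P).
Proof.
  intros start reversed. destruct cycle_scale as (P_pos & m_in & a_eq & b_eq).
  destruct (mom_rot_axY F B t adm) as (_ & rot_X & rot_Z). injection start as x_eq y_eq z_eq.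
  injection reversed as x'_eq _ z'_eq. rewrite x_eq, y_eq, z_eq in rot_X, rot_Z.
  apply (reversal_half_tan (cosXY F) (wtX F) (wtY F)); [exact P_pos | apply adm | exact m_in | |];
    fold m; rewrite <- ?a_eq, <- b_eq; lra.
Qed.

Lemma cycle_X_time B t : momenta F B = mkV (- wtX F) (wtY F) a ->
  momenta F (conj_by B (rot t (vneg (axX F)))) = mkV (- wtX F) (- wtY F) b ->
  cos t = half_tan_cos (wtY F * P) /\ sin t = half_tan_sin (wtY F * P).
Proof.
  rewrite rot_vneg. intros start reversed. destruct cycle_scale as (P_pos & m_in & a_eq & b_eq).
  destruct (mom_rot_axX F B (- t) adm) as (_ & rot_Y & rot_Z). injection start as x_eq y_eq z_eq.
  injection reversed as _ y'_eq z'_eq. rewrite cos_neg, sin_neg, x_eq, y_eq, z_eq in rot_Y, rot_Z.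
  assert (m_opp : - cosXY F * (wtX F * P) * (wtY F * P) = - m) by (unfold m; ring).
  apply (reversal_half_tan (- cosXY F) (wtY F) (wtX F)); [exact P_pos | apply adm | | |]; rewrite m_opp; [lra | |].
  - replace (1 + - m) with (1 - m) by ring. rewrite <- a_eq. lra.
  - replace (1 - - m) with (1 + m) by ring. replace (1 + - m) with (1 - m) by ring. rewrite <- a_eq, <- b_eq. lra.
Qed.
End CycleTimes.

Lemma momenta_eq F B x y z : momenta F B = mkV x y z -> momX F B = x /\ momY F B = y /\ momZ F B = z.
Proof. intros E. injection E. auto. Qed.

(* Some variation of the five times has zero first and positive second variation. *)
Lemma extremal_cycle_absurd F B t1 t2 t3 t4 t5 w a b : admissible F -> cosXY F <> 0 ->
  extremal_word F B (cycle_word t1 t2 t3 t4 t5 ++ w) ->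
  0 < t1 -> 0 < t2 -> 0 < t3 -> 0 < t4 -> 0 < t5 -> cycle_heights F a b ->
  let B1 := conj_by B (rot t1 (axX F)) in let B2 := conj_by B1 (rot t2 (axY F)) in
  let B3 := conj_by B2 (rot t3 (vneg (axX F))) in let B4 := conj_by B3 (rot t4 (vneg (axY F))) in
  momenta F B1 = mkV (wtX F) (wtY F) b -> momenta F B2 = mkV (- wtX F) (wtY F) a ->
  momenta F B3 = mkV (- wtX F) (- wtY F) b -> momenta F B4 = mkV (wtX F) (- wtY F) a -> False.
Proof.
  intros adm c_nz ext t1_pos t2_pos t3_pos t4_pos t5_pos heights B1 B2 B3 B4 mom1 mom2 mom3 mom4.
  apply extremal_word_prefix in ext.
  destruct (cycle_scale F a b heights) as (P_pos & m_in & _ & b_eq).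
  pose proof (cycle_Y_time F a b adm heights B1 t2 mom1 mom2) as trig2.
  pose proof (cycle_X_time F a b adm heights B2 t3 mom2 mom3) as trig3.
  assert (trig4 : cos t4 = half_tan_cos (wtX F * (2 / (a + b))) /\ sin t4 = half_tan_sin (wtX F * (2 / (a + b)))).
  { apply (cycle_Y_time (sym_frame Nu F) a b (admissible_sym Nu F adm)) with (B := B3).
    - unfold cycle_heights. rewrite cosXY_sym. exact heights.
    - destruct (momenta_eq _ _ _ _ _ mom3) as (x3 & y3 & z3). unfold momenta.
      rewrite momX_sym, momY_sym, momZ_sym, x3, y3, z3. cbn. f_equal; ring.
    - destruct (momenta_eq _ _ _ _ _ mom4) as (x4 & y4 & z4). change (axY (sym_frame Nu F)) with (vneg (axY F)). fold B4.
      unfold momenta.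
      rewrite momX_sym, momY_sym, momZ_sym, x4, y4, z4. cbn. f_equal; ring. }
  set (P := 2 / (a + b)) in *. set (T := wtX F * P) in *. set (S := wtY F * P) in *.
  pose proof (wtX_pos F adm) as wX. pose proof (wtY_pos F adm) as wY.
  assert (T_eq : wtX F = T / P) by (unfold T; field; lra). assert (S_eq : wtY F = S / P) by (unfold S; field; lra).
  assert (T_pos : 0 < T) by (apply Rmult_lt_0_compat; assumption).
  assert (S_pos : 0 < S) by (apply Rmult_lt_0_compat; assumption).
  destruct (cycle_form_positive (cosXY F) S T S_pos T_pos c_nz m_in) as (s & t & form_pos). cbv zeta in form_pos.
  set (qs := cycle_velocities S T (cosXY F * S * T) s t).
  pose proof (cycle_field F S T t2 t3 t4 t5 s t adm trig2 trig3 trig4) as field. cbv zeta in field. fold qs in field.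
  pose proof (extremal_second_variation_after F B t1 (1, 0) (tl (cycle_word 0 t2 t3 t4 t5)) (hd 0 qs) (tl qs) ext t1_pos)
    as second.
  cbv zeta in second. rewrite field, vsum_frame_vec, cycle_coords_closed,
    (dot_cross_sum_frame_vec F _ _ adm), cvec_10 in second.
  fold B1 (momenta F B1) in second. rewrite mom1, b_eq, T_eq, S_eq, (cycle_coords_wedge _ S T s t P) in second by lra.
  assert (0 < 2 * S * T / P) by (apply Rdiv_lt_0_compat; nra).
  apply (Rlt_irrefl 0), (Rlt_le_trans _ (2 * S * T / P * cycle_form S T (cosXY F * S * T) s t));
    [apply Rmult_lt_0_compat; assumption|].
  apply second; [repeat constructor; assumption | | apply frame_vec_0].
  exact (cycle_velocities_cost F S T t1 t2 t3 t4 t5 s t P ltac:(lra) T_eq S_eq).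
Qed.

(** * Extremal words in letters *)

Notation lX := (false, BX). Notation lXn := (true, BX).
Notation lY := (false, BY). Notation lYn := (true, BY).
Notation lWp := (false, BWp). Notation lWpn := (true, BWp).
Notation lWm := (false, BWm).

Definition sym_momenta (s : sym) (v : V3) : V3 :=
  match s with
  | Nu => mkV (- vx v) (- vy v) (vz v)
  | Rho => mkV (vx v) (- vy v) (- vz v)
  | Vs => mkV (vy v) (vx v) (- vz v)
  end.

Lemma momenta_sym s F B : momenta (sym_frame s F) B = sym_momenta s (momenta F B).
Proof. unfold momenta. rewrite momX_sym, momY_sym, momZ_sym. destruct s; reflexivity. Qed.

Lemma momenta_trans_Nu F B :
  momenta (sym_frame Nu F) (mtrans B) = mkV (momX F B) (momY F B) (- momZ F B).
Proof. unfold momenta. destruct (mom_trans_Nu F B) as (-> & -> & ->). reflexivity. Qed.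

Lemma vee_opp_of_momenta F B B' : admissible F -> momenta F B' = vneg (momenta F B) -> vee B' = vneg (vee B).
Proof.
  intros adm opp. apply momenta_eq in opp. destruct opp as (x_opp & y_opp & z_opp). cbn in *.
  apply (frame_vec_ext F _ _ adm); rewrite dot_negl; unfold momX, momY, momZ in *; lra.
Qed.

Definition signed (n : bool) (k : R) : R := if n then - k else k.

Definition supports (F : frame) (l : label) (B : M3) : Prop :=
  let (n, b) := l in
  match b with
  | BX => momX F B = signed n (wtX F)
  | BY => momY F B = signed n (wtY F)
  | BWm => momenta F B = mkV (signed n (wtX F)) (signed n (wtY F)) 0
  | BWp => momenta F B = mkV (signed n (wtX F)) (signed (negb n) (wtY F)) 0
  end.

Lemma supports_sym s F l B : supports (sym_frame s F) (sym_label s l) B -> supports F l B.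
Proof.
  destruct s, l as [[] []]; unfold supports; cbn [sym_label negb signed];
    rewrite ?momX_sym, ?momY_sym, ?momenta_sym; cbn [sym_frame wtX wtY sym_momenta momenta vx vy vz];
    intros eq; try lra; injection eq as x_eq y_eq z_eq; apply mkV_eq; lra.
Qed.

Lemma supports_trans_Nu F l B : supports (sym_frame Nu F) l (mtrans B) -> supports F l B.
Proof.
  destruct (mom_trans_Nu F B) as (same_X & same_Y & _).
  destruct l as [n []]; unfold supports; rewrite ?same_X, ?same_Y, ?momenta_trans_Nu; cbn [sym_frame wtX wtY]; auto;
    intros eq; injection eq as x_eq y_eq z_eq; apply mkV_eq; lra.
Qed.

Lemma spell_Nu F l : spell (sym_frame Nu F) l = spell F l.
Proof.
  apply map_ext. intros [t [n b]]. unfold label_control, base_control. rewrite cosXY_sym. reflexivity.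
Qed.
Lemma spell_rev F l : spell F (rev l) = rev (spell F l).
Proof. apply map_rev. Qed.
Lemma spell_cons F t l r : spell F ((t, l) :: r) = (t, label_control F l) :: spell F r.
Proof. reflexivity. Qed.

Lemma extremal_spell_sym s F B l : extremal_word F B (spell F l) ->
  extremal_word (sym_frame s F) B (spell (sym_frame s F) (map (sym_letter s) l)).
Proof. rewrite spell_sym. apply extremal_word_sym. Qed.

Lemma extremal_spell_rev F B l : extremal_word F B (spell F l) ->
  extremal_word (sym_frame Nu F) (mtrans (conj_by B (wprod F (spell F l)))) (spell (sym_frame Nu F) (rev l)).
Proof. rewrite spell_Nu, spell_rev. apply extremal_word_rev. Qed.

Lemma X_start_supported F B t r : extremal_word F B (spell F ((t, lX) :: r)) -> 0 < t -> supports F lX B.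
Proof.
  intros ext t_pos. pose proof (extremal_momentum_eq_rate _ _ _ _ _ ext t_pos) as power.
  change (label_control F lX) with (1, 0) in power. rewrite cvec_10, rate_10 in power. exact power.
Qed.

Lemma Wm_start_supported F B t r : admissible F -> extremal_word F B (spell F ((t, lWm) :: r)) -> 0 < t ->
  supports F lWm B.
Proof.
  rewrite spell_cons. intros adm ext t_pos. destruct (Wm_control_pos F adm) as [u_pos v_pos].
  pose proof (extremal_momentum_eq_rate _ _ _ _ _ ext t_pos) as power.
  destruct (extremal_momentum_box _ _ _ ext) as [x_le y_le]. apply Rabs_le_bounds in x_le, y_le.
  destruct (extremal_start_signs _ _ _ _ _ adm ext t_pos) as (z_ge & _ & z_le & _).
  rewrite dot_vee_cvec, (rate_Wm F adm) in power. unfold label_control in *; cbn [fst snd base_control] in *.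
  set (u := wtX F - wtY F * cosXY F) in *. set (v := wtY F - wtX F * cosXY F) in *.
  assert (0 <= u * (wtX F - momX F B)) by (apply Rmult_le_pos; lra).
  assert (0 <= v * (wtY F - momY F B)) by (apply Rmult_le_pos; lra).
  assert (x_eq : momX F B = wtX F) by nra. assert (y_eq : momY F B = wtY F) by nra.
  specialize (z_ge x_eq). specialize (z_le y_eq). apply mkV_eq; cbn [signed]; [exact x_eq | exact y_eq | nra].
Qed.

Lemma letter_start_supported F B t l r : admissible F -> extremal_word F B (spell F ((t, l) :: r)) -> 0 < t ->
  supports F l B.
Proof.
  assert (positive : forall F t b r, admissible F -> extremal_word F B (spell F ((t, (false, b)) :: r)) -> 0 < t ->
    supports F (false, b) B).
  { clear. intros F t b r adm ext t_pos. destruct b.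
    - apply (X_start_supported F B t r); assumption.
    - apply (supports_sym Vs), (X_start_supported _ B t (map (sym_letter Vs) r)); [|exact t_pos].
      exact (extremal_spell_sym Vs _ _ _ ext).
    - apply (supports_sym Rho), (Wm_start_supported _ B t (map (sym_letter Rho) r)); [apply admissible_sym, adm | | exact t_pos].
      exact (extremal_spell_sym Rho _ _ _ ext).
    - apply (Wm_start_supported F B t r); assumption. }
  intros adm ext t_pos. destruct l as [[] b]; [|exact (positive F t b r adm ext t_pos)].
  apply (supports_sym Nu), (positive _ t b (map (sym_letter Nu) r)); [apply admissible_sym, adm | | exact t_pos].
  exact (extremal_spell_sym Nu _ _ _ ext).
Qed.

Lemma letter_end_supported F B t l r : admissible F -> extremal_word F B (spell F ((t, l) :: r)) -> 0 < t ->
  supports F l (conj_by B (rot t (label_vec F l))).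
Proof.
  intros adm ext t_pos. apply (extremal_word_prefix F B (spell F [(t, l)])), extremal_spell_rev in ext.
  rewrite spell_cons, wprod_single in ext. apply supports_trans_Nu.
  apply (letter_start_supported _ _ t l [] (admissible_sym Nu F adm) ext t_pos).
Qed.

Lemma cvec_nz F ab : admissible F -> fst ab <> 0 \/ snd ab <> 0 -> cvec F ab <> vzero.
Proof.
  intros adm ab_nz zero. pose proof (sinXY_sq_pos F adm). destruct ab as [a b]; cbn in ab_nz.
  assert (along_X : dot (cvec F (a, b)) (axX F) = 0) by (rewrite zero; entries_ring).
  assert (along_Y : dot (cvec F (a, b)) (axY F) = 0) by (rewrite zero; entries_ring).
  rewrite dotC, dot_cvec, (unit_axX F adm) in along_X. rewrite dotC, dot_cvec, (dotC (axY F)), (unit_axY F adm) in along_Y.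
  fold (cosXY F) in along_X, along_Y. cbn in along_X, along_Y.
  set (c := cosXY F) in *.
  assert (a_eq : a * (1 - c * c) = (a * 1 + b * c) - c * (a * c + b * 1)) by ring.
  assert (b_eq : b * (1 - c * c) = (a * c + b * 1) - c * (a * 1 + b * c)) by ring.
  rewrite along_X, along_Y, Rmult_0_r, Rminus_0_r in a_eq, b_eq. apply Rmult_integral in a_eq, b_eq.
  intuition lra.
Qed.

Lemma rate_pos F ab : admissible F -> fst ab <> 0 \/ snd ab <> 0 -> 0 < rate F ab.
Proof.
  intros [_ _ wX wY _ _] ab_nz. unfold rate. pose proof (Rabs_pos (fst ab)). pose proof (Rabs_pos (snd ab)).
  destruct ab_nz as [nz | nz]; apply Rabs_pos_lt in nz; nra.
Qed.

Lemma label_control_nz F l : admissible F -> fst (label_control F l) <> 0 \/ snd (label_control F l) <> 0.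
Proof.
  intros adm. destruct (Wp_control_pos F adm), (Wm_control_pos F adm). destruct l as [[] []]; cbn; lra.
Qed.
Lemma label_vec_nz F l : admissible F -> label_vec F l <> vzero.
Proof. intros adm. apply cvec_nz; [exact adm | apply label_control_nz, adm]. Qed.

Lemma letter_angle_le_PI F B t l r : admissible F -> extremal_word F B (spell F ((t, l) :: r)) ->
  t * vnorm (label_vec F l) <= PI.
Proof.
  intros adm ext. apply (extremal_angle_le_PI F B t (label_control F l) (spell F r) ext).
  - apply rate_pos, label_control_nz; exact adm.
  - apply label_vec_nz, adm.
Qed.

Lemma X_time_le_PI F B t r : admissible F -> extremal_word F B (spell F ((t, lX) :: r)) -> t <= PI.
Proof.
  intros adm ext. pose proof (letter_angle_le_PI F B t lX r adm ext) as angle.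
  rewrite label_vec_X, vnorm_axX in angle by exact adm. lra.
Qed.

Lemma cos_lt_1 t : 0 < t <= PI -> cos t < 1.
Proof. intros t_in. rewrite <- cos_0. apply cos_decreasing_1; lra. Qed.

Lemma X_letter_crosses F B t r : admissible F -> extremal_word F B (spell F ((t, lX) :: r)) -> 0 < t ->
  let B' := conj_by B (rot t (axX F)) in
  Rabs (momY F B) = wtY F -> Rabs (momY F B') = wtY F ->
  (momY F B = - wtY F /\ momY F B' = wtY F /\ 0 <= momZ F B /\ 0 <= momZ F B') \/
  (momY F B = wtY F /\ momY F B' = - wtY F /\ momZ F B <= 0 /\ momZ F B' <= 0).
Proof.
  intros adm ext t_pos B' start_extreme end_extreme. pose proof (X_time_le_PI F B t r adm ext) as t_le.
  pose proof (X_start_supported F B t r ext t_pos) as x_eq. cbn [supports signed] in x_eq.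
  change (spell F ((t, lX) :: r)) with ((t, (1, 0)) :: spell F r) in ext.
  destruct (extremal_start_signs _ _ _ _ _ adm ext t_pos) as (_ & _ & start_max & start_min).
  pose proof (extremal_end_signs _ _ _ _ _ adm ext t_pos) as (_ & _ & end_max & end_min).
  rewrite cvec_10 in end_max, end_min. fold B' in end_max, end_min. cbn [fst] in *.
  destruct (mom_rot_axX F B t adm) as (_ & rot_Y & _). fold B' in rot_Y. rewrite x_eq in rot_Y.
  pose proof (cos_lt_1 t ltac:(lra)) as cos_lt. pose proof (sin_ge_0 t ltac:(lra) ltac:(lra)) as sin_ge0.
  destruct (Wm_control_pos F adm) as [_ v_pos]. destruct (Wp_control_pos F adm) as [_ v'_pos].
  destruct (Rabs_eq_cases _ _ start_extreme) as [y_eq | y_eq], (Rabs_eq_cases _ _ end_extreme) as [y'_eq | y'_eq];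
    rewrite y_eq, y'_eq in *.
  - exfalso. specialize (start_max eq_refl). assert (momZ F B * sin t <= 0) by nra.
    assert (0 < (wtY F - wtX F * cosXY F) * (1 - cos t)) by (apply Rmult_lt_0_compat; lra). lra.
  - right. specialize (start_max eq_refl). specialize (end_min eq_refl). repeat split; lra.
  - left. specialize (start_min eq_refl). specialize (end_max eq_refl). repeat split; lra.
  - exfalso. specialize (start_min eq_refl). assert (0 <= momZ F B * sin t) by (apply Rmult_le_pos; lra).
    assert (0 < (wtY F + wtX F * cosXY F) * (1 - cos t)) by (apply Rmult_lt_0_compat; lra). lra.
Qed.

(** * Words with the least number of letters *)

Definition minimal_word (F : frame) (B : M3) (l : list (R * label)) : Prop :=
  extremal_word F B (spell F l) /\
  forall l', nonneg_times (spell F l') -> wprod F (spell F l') = wprod F (spell F l) ->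
    wcost F (spell F l') <= wcost F (spell F l) -> (length l <= length l')%nat.

Lemma minimal_word_factor F B l1 l2 l3 : minimal_word F B (l1 ++ l2 ++ l3) ->
  minimal_word F (conj_by B (wprod F (spell F l1))) l2.
Proof.
  intros [ext least]. split.
  - rewrite !spell_app in ext. apply (extremal_word_factor F B _ _ _ ext).
  - intros l' nn' prod cost. specialize (least (l1 ++ l' ++ l3)).
    rewrite !spell_app, !wprod_app, !wcost_app, prod, !length_app in least.
    pose proof (proj1 ext) as nn. rewrite !spell_app, !nonneg_times_app in nn.
    specialize (least ltac:(rewrite !nonneg_times_app; tauto) eq_refl ltac:(lra)). lia.
Qed.
Lemma minimal_word_suffix F B l1 l2 : minimal_word F B (l1 ++ l2) ->
  minimal_word F (conj_by B (wprod F (spell F l1))) l2.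
Proof. intros least. apply (minimal_word_factor F B l1 l2 []). rewrite app_nil_r. exact least. Qed.
Lemma minimal_word_prefix F B l1 l2 : minimal_word F B (l1 ++ l2) -> minimal_word F B l1.
Proof. intros least. rewrite <- (conj_by_id B). exact (minimal_word_factor F B [] l1 l2 least). Qed.
Lemma minimal_word_tail F B t l r : minimal_word F B ((t, l) :: r) ->
  minimal_word F (conj_by B (rot t (label_vec F l))) r.
Proof.
  intros least. apply (minimal_word_suffix F B [(t, l)]) in least. rewrite spell_cons, wprod_single in least. exact least.
Qed.

Lemma map_sym_letterK s l : map (sym_letter s) (map (sym_letter s) l) = l.
Proof.
  rewrite map_map. rewrite <- (map_id l) at 2. apply map_ext. intros [t lab]. unfold sym_letter; cbn.
  rewrite sym_labelK. reflexivity.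
Qed.

Lemma spell_sym_inv s F l : spell F (map (sym_letter s) l) = sym_word s (spell (sym_frame s F) l).
Proof. rewrite <- (map_sym_letterK s l) at 2. rewrite spell_sym, sym_wordK. reflexivity. Qed.

Lemma minimal_word_sym s F B l : minimal_word F B l -> minimal_word (sym_frame s F) B (map (sym_letter s) l).
Proof.
  intros [ext least]. split; [apply extremal_spell_sym, ext|]. intros l' nn' prod cost. rewrite length_map.
  specialize (least (map (sym_letter s) l')). rewrite length_map, spell_sym_inv in least.
  rewrite <- (sym_wordK s (spell (sym_frame s F) l')), wprod_sym, spell_sym, wprod_sym in prod.
  rewrite <- (sym_wordK s (spell (sym_frame s F) l')), wcost_sym, spell_sym, wcost_sym in cost.
  apply least; [apply nonneg_times_sym, nn' | exact prod | exact cost].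
Qed.

Lemma wprod_Nu_rev F w : wprod (sym_frame Nu F) (rev w) = mtrans (wprod F w).
Proof. rewrite <- sym_word_Nu_winv, wprod_sym. apply wprod_winv. Qed.
Lemma wcost_Nu_rev F w : wcost (sym_frame Nu F) (rev w) = wcost F w.
Proof. rewrite <- sym_word_Nu_winv, wcost_sym. apply wcost_winv. Qed.

Lemma minimal_word_rev F B l : minimal_word F B l ->
  minimal_word (sym_frame Nu F) (mtrans (conj_by B (wprod F (spell F l)))) (rev l).
Proof.
  intros [ext least]. split; [apply extremal_spell_rev, ext|]. intros l' nn' prod cost.
  rewrite !spell_Nu in *. specialize (least (rev l')). rewrite length_rev, spell_rev in *.
  rewrite <- (rev_involutive (spell F l')) in prod, cost. rewrite !wprod_Nu_rev in prod. rewrite !wcost_Nu_rev in cost.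
  apply least; [apply Forall_rev, nn' | | exact cost].
  rewrite <- (mtrans_mtrans (wprod F (rev (spell F l')))), prod. apply mtrans_mtrans.
Qed.

Lemma minimal_word_time_pos F B t l r : minimal_word F B ((t, l) :: r) -> 0 < t.
Proof.
  intros [[nn _] least]. inversion nn as [|? ? [t_pos | t_zero] nn_r]; subst; [exact t_pos | exfalso].
  cbn in t_zero. specialize (least r nn_r). rewrite spell_cons, wprod_cons, wcost_cons, <- t_zero, rot_0, mmul_1l in least.
  specialize (least eq_refl ltac:(lra)). cbn in least. lia.
Qed.

Lemma minimal_word_no_repeat F B t1 t2 l r : minimal_word F B ((t1, l) :: (t2, l) :: r) -> False.
Proof.
  intros [[nn _] least]. inversion nn as [|? ? t1_ge0 nn_tail]; subst. inversion nn_tail as [|? ? t2_ge0 nn_r]; subst.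
  cbn in t1_ge0, t2_ge0. specialize (least ((t1 + t2, l) :: r)).
  rewrite !spell_cons, !wprod_cons, !wcost_cons, rot_add in least.
  specialize (least ltac:(apply nonneg_times_cons; [lra | exact nn_r]) (mmul_assoc _ _ _) ltac:(lra)). cbn in least. lia.
Qed.

Lemma supports_momY_extreme F l B : admissible F -> supports F l B -> snd l <> BX -> Rabs (momY F B) = wtY F.
Proof.
  intros adm supp not_X. pose proof (wtY_pos F adm) as wY.
  destruct l as [n []]; cbn in supp, not_X; try congruence; try (apply momenta_eq in supp; destruct supp as (_ & supp & _));
    rewrite supp; destruct n; cbn; rewrite ?Rabs_Ropp; apply Rabs_right; lra.
Qed.

Lemma minimal_X_then F B t1 t2 l2 r : admissible F -> minimal_word F B ((t1, lX) :: (t2, l2) :: r) ->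
  Rabs (momY F B) = wtY F -> let B1 := conj_by B (rot t1 (axX F)) in
  momX F B1 = wtX F /\ supports F l2 B1 /\ snd l2 <> BX /\
  ((momY F B = - wtY F /\ momY F B1 = wtY F /\ 0 <= momZ F B /\ 0 <= momZ F B1) \/
   (momY F B = wtY F /\ momY F B1 = - wtY F /\ momZ F B <= 0 /\ momZ F B1 <= 0)).
Proof.
  intros adm least y_extreme B1. pose proof (wtX_pos F adm) as wX.
  pose proof (minimal_word_time_pos _ _ _ _ _ least) as t1_pos. pose proof (proj1 least) as ext.
  pose proof (minimal_word_tail _ _ _ _ _ least) as least1. rewrite label_vec_X in least1. fold B1 in least1.
  pose proof (letter_start_supported _ _ _ _ _ adm (proj1 least1) (minimal_word_time_pos _ _ _ _ _ least1)) as supp.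
  pose proof (letter_end_supported _ _ _ _ _ adm ext t1_pos) as x1_eq.
  rewrite label_vec_X in x1_eq. fold B1 in x1_eq. cbn [supports signed] in x1_eq.
  assert (not_X : snd l2 <> BX).
  { destruct l2 as [[] []]; cbn; try congruence; cbn in supp; [lra|]. destruct (minimal_word_no_repeat _ _ _ _ _ _ least). }
  split; [exact x1_eq|]. split; [exact supp|]. split; [exact not_X|].
  apply (X_letter_crosses F B t1 _ adm ext t1_pos y_extreme), (supports_momY_extreme F l2); assumption.
Qed.

Lemma minimal_Y_then F B t1 t2 l2 r : admissible F -> minimal_word F B ((t1, lY) :: (t2, l2) :: r) ->
  Rabs (momX F B) = wtX F -> let B1 := conj_by B (rot t1 (axY F)) in
  momY F B1 = wtY F /\ supports F l2 B1 /\ snd l2 <> BY /\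
  ((momX F B = - wtX F /\ momX F B1 = wtX F /\ momZ F B <= 0 /\ momZ F B1 <= 0) \/
   (momX F B = wtX F /\ momX F B1 = - wtX F /\ 0 <= momZ F B /\ 0 <= momZ F B1)).
Proof.
  intros adm least x_extreme B1.
  pose proof (minimal_X_then (sym_frame Vs F) B t1 t2 (sym_label Vs l2) (map (sym_letter Vs) r)
    (admissible_sym Vs F adm) (minimal_word_sym Vs _ _ _ least)) as swapped.
  cbv zeta in swapped. change (axX (sym_frame Vs F)) with (axY F) in swapped. fold B1 in swapped.
  rewrite !momX_sym, !momY_sym, !momZ_sym in swapped. cbn [sym_frame wtX wtY] in swapped.
  destruct (swapped x_extreme) as (y1_eq & supp & not_Y & crossing). split; [exact y1_eq|].
  split; [apply (supports_sym Vs), supp|]. split; [destruct l2 as [n []]; cbn in *; congruence|].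
  destruct crossing as [(x_eq & x1_eq & z_ge & z1_ge) | (x_eq & x1_eq & z_le & z1_le)]; [left | right]; repeat split; lra.
Qed.

(** * Corners with z = 0 *)

Lemma momenta_cvec F ab : admissible F ->
  dot (cvec F ab) (axX F) = fst ab + snd ab * cosXY F /\
  dot (cvec F ab) (axY F) = fst ab * cosXY F + snd ab /\ dot (cvec F ab) (normal F) = 0.
Proof.
  intros adm. rewrite (dotC _ (axX F)), (dotC _ (axY F)), !dot_cvec, (dotC (axY F) (axX F)), (unit_axX F adm), (unit_axY F adm).
  fold (cosXY F). split; [ring|]. split; [ring|]. unfold cvec, normal. entries_ring.
Qed.

Lemma supports_Wp_vee F B : admissible F -> supports F lWp B ->
  vee B = vscale (/ (1 - cosXY F * cosXY F)) (label_vec F lWp).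
Proof.
  intros adm at_corner. apply momenta_eq in at_corner. destruct at_corner as (x_eq & y_eq & z_eq). cbn in x_eq, y_eq.
  pose proof (sinXY_sq_pos F adm) as s_pos. unfold momX, momY, momZ in *.
  destruct (momenta_cvec F (label_control F lWp) adm) as (along_X & along_Y & along_N).
  apply (frame_vec_ext F _ _ adm); rewrite dot_scalel; unfold label_vec; rewrite ?along_X, ?along_Y, ?along_N; cbn.
  - rewrite x_eq. field. lra.
  - rewrite y_eq. field. lra.
  - rewrite z_eq. ring.
Qed.

Lemma normal_nz F : admissible F -> normal F <> vzero.
Proof.
  intros adm zero. pose proof (sinXY_sq_pos F adm) as s_pos.
  assert (lagrange : dot (normal F) (normal F) = dot (axX F) (axX F) * dot (axY F) (axY F) - cosXY F * cosXY F)
    by (unfold normal, cosXY; entries_ring).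
  rewrite (unit_axX F adm), (unit_axY F adm), zero in lagrange.
  replace (dot vzero vzero) with 0 in lagrange by entries_ring. lra.
Qed.

Lemma half_loop_end_at_corner F B t1 ab1 t2 ab2 t3 ab3 w al be : admissible F ->
  extremal_word F B ((t1, ab1) :: (t2, ab2) :: (t3, ab3) :: w) -> 0 < t2 -> 0 < t3 -> 0 < al -> 0 < be ->
  supports F lWp B -> vee (conj_by B (wprod F [(t1, ab1); (t2, ab2)])) = vneg (vee B) ->
  cmix al ab2 be ab3 = label_control F lWpn ->
  rate F (label_control F lWpn) = al * rate F ab2 + be * rate F ab3 ->
  cross (cvec F ab2) (cvec F ab3) = vzero.
Proof.
  intros adm ext t2_pos t3_pos al_pos be_pos at_corner reversed mix rate_mix.
  pose proof (sinXY_sq_pos F adm) as s_pos. pose proof (supports_Wp_vee F B adm at_corner) as vee_B.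
  assert (mixed : cvec F (cmix al ab2 be ab3) = vneg (label_vec F lWp))
    by (rewrite mix; exact (label_vec_neg F lWp)).
  apply (extremal_half_loop_end F B t1 ab1 t2 ab2 t3 ab3 w al be (/ (1 - cosXY F * cosXY F)) ext); try assumption.
  - apply Rinv_0_lt_compat, s_pos.
  - rewrite mix. exact rate_mix.
  - rewrite reversed, vee_B, mixed. entries_ring.
  - rewrite vee_B, mixed. entries_ring.
Qed.

Lemma rate_Wpn F : admissible F -> rate F (label_control F lWpn) =
  (wtX F + wtY F * cosXY F) * wtX F + (wtY F + wtX F * cosXY F) * wtY F.
Proof.
  intros adm. destruct (Wp_control_pos F adm). unfold rate, label_control; cbn.
  rewrite !Rabs_Ropp, !Rabs_right by lra. ring.
Qed.

Lemma half_loop_turn_absurd F B t1 t2 t3 r : admissible F ->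
  extremal_word F B (spell F ((t1, lX) :: (t2, lY) :: (t3, lXn) :: r)) -> 0 < t2 -> 0 < t3 ->
  supports F lWp B -> vee (conj_by B (wprod F (spell F [(t1, lX); (t2, lY)]))) = vneg (vee B) -> False.
Proof.
  intros adm ext t2_pos t3_pos at_corner reversed. destruct (Wp_control_pos F adm) as [u_pos v_pos].
  pose proof (half_loop_end_at_corner F B t1 (1, 0) t2 (0, 1) t3 (cneg (1, 0)) (spell F r)
    (wtY F + wtX F * cosXY F) (wtX F + wtY F * cosXY F) adm ext t2_pos t3_pos v_pos u_pos at_corner reversed) as parallel.
  apply (normal_nz F adm). rewrite cvec_01, cvec_cneg, cvec_10 in parallel. unfold normal.
  rewrite <- parallel; [entries_ring | unfold cmix, cneg, label_control, cneg; cbn; f_equal; ring |].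
  rewrite (rate_Wpn F adm), rate_cneg, rate_10, rate_01. ring.
Qed.

Lemma half_loop_swap F B t1 t2 : vee B <> vzero ->
  vee (conj_by B (wprod F (spell F [(t1, lX); (t2, lY)]))) = vneg (vee B) ->
  wprod F (spell F [(t2, lYn); (t1, lXn)]) = wprod F (spell F [(t1, lX); (t2, lY)]).
Proof.
  intros B_nz reversed. set (h := wprod F (spell F [(t1, lX); (t2, lY)])) in *.
  assert (Sh : inSO3 h) by apply wprod_SO3. rewrite (vee_conj_by B h Sh) in reversed.
  transitivity (mtrans h).
  - unfold h. rewrite <- wprod_winv. reflexivity.
  - rewrite <- (mtrans_mtrans h) at 2. symmetry. exact (SO3_involution (mtrans h) (vee B) (SO3_trans h Sh) reversed B_nz).
Qed.

Lemma half_loop_straight_absurd F B t1 t2 t3 r : admissible F ->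
  extremal_word F B (spell F ((t1, lX) :: (t2, lY) :: (t3, lY) :: r)) -> 0 < t1 -> 0 < t2 -> 0 < t3 ->
  supports F lWp B -> vee (conj_by B (wprod F (spell F [(t1, lX); (t2, lY)]))) = vneg (vee B) -> False.
Proof.
  intros adm ext t1_pos t2_pos t3_pos at_corner reversed. destruct (Wp_control_pos F adm) as [u_pos v_pos].
  assert (B_nz : vee B <> vzero).
  { intros zero. apply momenta_eq in at_corner. destruct at_corner as (x_eq & _). unfold momX in x_eq. rewrite zero in x_eq.
    replace (dot vzero (axX F)) with 0 in x_eq by entries_ring. pose proof (wtX_pos F adm). cbn in x_eq. lra. }
  pose proof (half_loop_swap F B t1 t2 B_nz reversed) as swap.
  assert (ext' : extremal_word F B (spell F ((t2, lYn) :: (t1, lXn) :: (t3, lY) :: r))).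
  { apply (extremal_word_ext F B (spell F ((t1, lX) :: (t2, lY) :: (t3, lY) :: r))); [| | | exact ext].
    - destruct ext as [nn _]. repeat (inversion_clear nn as [|? ? _ nn_tail]; rename nn_tail into nn).
      rewrite !spell_cons. repeat (apply nonneg_times_cons; [lra|]). exact nn.
    - change (spell F ((t1, lX) :: (t2, lY) :: (t3, lY) :: r)) with (spell F [(t1, lX); (t2, lY)] ++ spell F ((t3, lY) :: r)).
      change (spell F ((t2, lYn) :: (t1, lXn) :: (t3, lY) :: r)) with (spell F [(t2, lYn); (t1, lXn)] ++ spell F ((t3, lY) :: r)).
      rewrite !wprod_app, swap. reflexivity.
    - rewrite !spell_cons, !wcost_cons. change (label_control F lYn) with (cneg (label_control F lY)).
      change (label_control F lXn) with (cneg (label_control F lX)). rewrite !rate_cneg. lra. }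
  pose proof (half_loop_end_at_corner F B t2 (cneg (0, 1)) t1 (cneg (1, 0)) t3 (0, 1) (spell F r)
    (wtX F + wtY F * cosXY F) (wtY F + wtX F * cosXY F) adm ext' t1_pos t3_pos u_pos v_pos at_corner) as parallel.
  apply (normal_nz F adm). rewrite cvec_01, cvec_cneg, cvec_10 in parallel. unfold normal.
  transitivity (vneg (cross (vneg (axX F)) (axY F))); [entries_ring|]. rewrite parallel; [entries_ring | | |].
  - rewrite <- reversed. do 2 f_equal. exact swap.
  - unfold cmix, label_control, cneg; cbn; f_equal; ring.
  - rewrite (rate_Wpn F adm), rate_cneg, rate_10, rate_01. ring.
Qed.

(** * Tails leaving a corner of type (wtX, - wtY, 0) *)

Definition acute (F : frame) : Prop := admissible F /\ 0 < cosXY F.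

Lemma acute_Nu F : acute F -> acute (sym_frame Nu F).
Proof. intros [adm c_pos]. split; [apply admissible_sym, adm | rewrite cosXY_sym; exact c_pos]. Qed.
Lemma acute_Vs F : acute F -> acute (sym_frame Vs F).
Proof. intros [adm c_pos]. split; [apply admissible_sym, adm | rewrite cosXY_sym; exact c_pos]. Qed.

Definition hatX (F : frame) : R := acos ((cosXY F * wtX F - wtY F) / (cosXY F * wtX F + wtY F)).
Definition hatY (F : frame) : R := hatX (sym_frame Vs F).

Lemma hatX_Nu F : hatX (sym_frame Nu F) = hatX F.
Proof. unfold hatX. rewrite cosXY_sym. reflexivity. Qed.
Lemma hatY_Nu F : hatY (sym_frame Nu F) = hatY F.
Proof. unfold hatY, hatX. rewrite !cosXY_sym. reflexivity. Qed.
Lemma hatY_Vs F : hatY (sym_frame Vs F) = hatX F.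
Proof. unfold hatY. rewrite sym_frameK. reflexivity. Qed.

Lemma hatX_spec F : acute F ->
  0 < hatX F < PI /\ cos (hatX F) = (cosXY F * wtX F - wtY F) / (cosXY F * wtX F + wtY F).
Proof.
  intros [adm c_pos]. pose proof (wtX_pos F adm). pose proof (wtY_pos F adm). destruct (Wp_control_pos F adm) as [_ v_pos].
  assert (ck_pos : 0 < cosXY F * wtX F) by (apply Rmult_lt_0_compat; lra).
  set (q := (cosXY F * wtX F - wtY F) / (cosXY F * wtX F + wtY F)).
  assert (q_in : -1 < q < 1).
  { unfold q. split; apply Rmult_lt_reg_r with (cosXY F * wtX F + wtY F); try lra;
      unfold Rdiv; rewrite Rmult_assoc, Rinv_l; lra. }
  unfold hatX. fold q. split; [apply acos_bound_lt; lra | apply cos_acos; lra].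
Qed.

Lemma hatX_unique F t : acute F -> 0 <= t <= PI ->
  wtY F - wtX F * cosXY F = - ((wtY F + wtX F * cosXY F) * cos t) -> t = hatX F.
Proof.
  intros [adm _] t_in cos_eq. destruct (Wp_control_pos F adm) as [_ v_pos].
  rewrite <- (acos_cos t t_in). unfold hatX. f_equal.
  apply Rmult_eq_reg_r with (cosXY F * wtX F + wtY F); [|lra]. unfold Rdiv. rewrite Rmult_assoc, Rinv_l; lra.
Qed.

(* The momentum at the far end of the X-edge, where z^2 = 4 c wtX wtY by conservation of the momentum form. *)
Lemma hatY_reverses F B : acute F -> 0 < momZ F B -> momX F B = wtX F -> momY F B = wtY F ->
  momZ F B * momZ F B = 4 * cosXY F * wtX F * wtY F ->
  momenta F (conj_by B (rot (hatY F) (axY F))) = mkV (- wtX F) (wtY F) 0.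
Proof.
  intros acuteF z_pos x_eq y_eq z_sq. pose proof (proj1 acuteF) as adm.
  destruct (hatX_spec _ (acute_Vs F acuteF)) as [hat_in cos_hat]. fold (hatY F) in hat_in, cos_hat.
  rewrite cosXY_sym in cos_hat. cbn [sym_frame wtX wtY] in cos_hat.
  destruct (mom_rot_axY F B (hatY F) adm) as (rot_Y & rot_X & rot_Z). rewrite x_eq, y_eq in *.
  destruct (Wp_control_pos F adm) as [u_pos _]. set (c := cosXY F) in *.
  assert (sin_hat : sin (hatY F) = momZ F B / (c * wtY F + wtX F)).
  { assert (sin_pos : 0 < sin (hatY F)) by (apply sin_gt_0; lra).
    assert (ratio_pos : 0 < momZ F B / (c * wtY F + wtX F)) by (apply Rdiv_lt_0_compat; lra).
    assert (sq : sin (hatY F) * sin (hatY F) = (momZ F B / (c * wtY F + wtX F)) * (momZ F B / (c * wtY F + wtX F))).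
    { rewrite sin_sq, cos_hat. transitivity (momZ F B * momZ F B / ((c * wtY F + wtX F) * (c * wtY F + wtX F)));
        [rewrite z_sq; field; lra | field; lra]. }
    nra. }
  rewrite cos_hat, sin_hat in rot_X, rot_Z. apply mkV_eq; [rewrite rot_X | exact rot_Y | rewrite rot_Z; field; lra].
  replace (momZ F B * (momZ F B / (c * wtY F + wtX F))) with (momZ F B * momZ F B / (c * wtY F + wtX F)) by (field; lra).
  rewrite z_sq. field. lra.
Qed.

Section TailX.
Variables (F : frame) (B : M3) (t : R).
Hypotheses (acuteF : acute F) (at_corner : supports F lWp B).

Local Notation B1 := (conj_by B (rot t (axX F))).

Lemma tail_corner_momenta : momX F B = wtX F /\ momY F B = - wtY F /\ momZ F B = 0.
Proof. exact (momenta_eq _ _ _ _ _ at_corner). Qed.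

Lemma tail_X_time_le_hat r : extremal_word F B (spell F ((t, lX) :: r)) -> t <= hatX F.
Proof.
  intros ext. pose proof (proj1 acuteF) as adm. destruct tail_corner_momenta as (x_eq & y_eq & z_eq).
  destruct (hatX_spec F acuteF) as [hat_in cos_hat]. apply Rnot_lt_le; intros beyond.
  pose proof (extremal_word_inside F B t (1, 0) (spell F r) (hatX F) ext ltac:(lra)) as ext_hat.
  destruct (extremal_start_signs _ _ _ _ _ adm ext_hat ltac:(lra)) as (_ & _ & y_max & _).
  rewrite cvec_10 in y_max.
  destruct (mom_rot_axX F B (hatX F) adm) as (_ & rot_Y & rot_Z). rewrite x_eq, y_eq, z_eq in rot_Y, rot_Z.
  destruct (Wp_control_pos F adm) as [_ v_pos]. rewrite rot_Z, rot_Y, cos_hat in y_max. cbn [fst] in y_max.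
  specialize (y_max ltac:(field; lra)).
  assert (0 < (wtY F + wtX F * cosXY F) * sin (hatX F)) by (apply Rmult_lt_0_compat; [lra | apply sin_gt_0; lra]). lra.
Qed.

Lemma tail_X_next t2 l2 r : minimal_word F B ((t, lX) :: (t2, l2) :: r) ->
  t = hatX F /\ l2 = lY /\ momX F B1 = wtX F /\ momY F B1 = wtY F /\ 0 < momZ F B1 /\
  momZ F B1 * momZ F B1 = 4 * cosXY F * wtX F * wtY F.
Proof.
  intros least. pose proof acuteF as [adm c_pos]. destruct tail_corner_momenta as (x_eq & y_eq & z_eq).
  pose proof (wtX_pos F adm) as wX. pose proof (wtY_pos F adm) as wY.
  destruct (minimal_X_then F B t t2 l2 r adm least) as (x1_eq & supp & not_X & crossing);
    [rewrite y_eq, Rabs_Ropp; apply Rabs_right; lra|].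
  destruct crossing as [(_ & y1_eq & _ & z1_ge0) | (y_eq' & _)]; [|lra].
  assert (z1_sq : momZ F B1 * momZ F B1 = 4 * cosXY F * wtX F * wtY F).
  { pose proof (momentum_form_conj F B _ adm (rot_SO3 t (axX F))) as form. unfold momentum_form in form.
    rewrite x_eq, y_eq, z_eq, x1_eq, y1_eq in form. lra. }
  assert (z1_pos : 0 < momZ F B1).
  { assert (0 < 4 * cosXY F * wtX F * wtY F) by (repeat apply Rmult_lt_0_compat; lra). nra. }
  split.
  { pose proof (minimal_word_time_pos _ _ _ _ _ least). pose proof (X_time_le_PI _ _ _ _ adm (proj1 least)).
    apply hatX_unique; [exact acuteF | lra|]. destruct (mom_rot_axX F B t adm) as (_ & rot_Y & _).
    rewrite x_eq, y_eq, z_eq, y1_eq in rot_Y. lra. }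
  split; [|auto].
  destruct l2 as [[] []]; cbn in supp, not_X; try congruence; try lra;
    apply momenta_eq in supp; destruct supp as (_ & _ & z1_eq); lra.
Qed.

Lemma tail_XY_reverses t2 : momenta F (conj_by B1 (rot t2 (axY F))) = mkV (- wtX F) (wtY F) 0 ->
  vee (conj_by B (wprod F (spell F [(t, lX); (t2, lY)]))) = vneg (vee B).
Proof.
  intros reversed. rewrite !spell_cons, wprod_cons, wprod_single, conj_by_mul.
  fold (label_vec F lX) (label_vec F lY). rewrite label_vec_X, label_vec_Y.
  apply (vee_opp_of_momenta F _ _ (proj1 acuteF)). rewrite reversed. cbn in at_corner. rewrite at_corner.
  unfold vneg, vscale; cbn. apply mkV_eq; ring.
Qed.

Lemma tail_XY_time_le_hat t2 : minimal_word F B [(t, lX); (t2, lY)] -> t2 <= hatY F.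
Proof.
  intros least. pose proof (proj1 acuteF) as adm.
  destruct (tail_X_next t2 lY [] least) as (_ & _ & x1 & y1 & z1_pos & z1_sq).
  pose proof (hatY_reverses F B1 acuteF z1_pos x1 y1 z1_sq) as reversed.
  destruct (hatX_spec _ (acute_Vs F acuteF)) as [hat_in _]. fold (hatY F) in hat_in.
  pose proof (minimal_word_time_pos _ _ _ _ _ least) as t_pos. pose proof (proj1 (proj1 least)) as nn.
  apply Rnot_lt_le; intros beyond.
  apply (half_loop_straight_absurd F B t (hatY F) (t2 - hatY F) [] adm); try lra;
    [| exact at_corner | apply tail_XY_reverses, reversed].
  apply (extremal_word_ext F B (spell F [(t, lX); (t2, lY)])); [| | | apply least].
  - rewrite !spell_cons. repeat (apply nonneg_times_cons; [lra|]). constructor.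
  - rewrite !spell_cons, !wprod_cons, <- (mmul_assoc (rot (hatY F) _)), <- rot_add. do 3 f_equal. ring.
  - rewrite !spell_cons, !wcost_cons. lra.
Qed.

Lemma tail_XY_next t2 t3 l3 r : minimal_word F B ((t, lX) :: (t2, lY) :: (t3, l3) :: r) ->
  l3 = lWpn /\ vee (conj_by B (wprod F (spell F [(t, lX); (t2, lY)]))) = vneg (vee B).
Proof.
  intros least. pose proof acuteF as [adm c_pos]. destruct (tail_X_next t2 lY _ least) as (_ & _ & x1 & y1 & z1_pos & z1_sq).
  pose proof (wtX_pos F adm) as wX. pose proof (wtY_pos F adm) as wY.
  pose proof (minimal_word_tail _ _ _ _ _ least) as least1. rewrite label_vec_X in least1.
  destruct (minimal_Y_then F B1 t2 t3 l3 r adm least1) as (y2 & supp & not_Y & crossing);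
    [rewrite x1; apply Rabs_right; lra|].
  set (B2 := conj_by B1 (rot t2 (axY F))) in *.
  destruct crossing as [(x1' & _) | (_ & x2 & _ & _)]; [lra|].
  assert (z2 : momZ F B2 = 0).
  { pose proof (momentum_form_conj F B1 _ adm (rot_SO3 t2 (axY F))) as form. fold B2 in form. unfold momentum_form in form.
    rewrite x1, y1, x2, y2 in form. nra. }
  assert (reversed : vee (conj_by B (wprod F (spell F [(t, lX); (t2, lY)]))) = vneg (vee B)).
  { apply tail_XY_reverses. fold B2. apply mkV_eq; assumption. }
  split; [|exact reversed].
  pose proof (minimal_word_tail _ _ _ _ _ least1) as least2. rewrite label_vec_Y in least2. fold B2 in least2.
  destruct l3 as [[] []]; cbn in supp, not_Y; try congruence; try lra;
    try (apply momenta_eq in supp; destruct supp as (x2' & y2' & _); lra).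
  exfalso. apply (half_loop_turn_absurd F B t t2 t3 r adm (proj1 least)); try assumption.
  - exact (minimal_word_time_pos _ _ _ _ _ least1).
  - exact (minimal_word_time_pos _ _ _ _ _ least2).
Qed.
End TailX.

Definition word_equiv (F : frame) (l l' : list (R * label)) : Prop :=
  wprod F (spell F l) = wprod F (spell F l') /\ wcost F (spell F l) = wcost F (spell F l').

Lemma word_equiv_refl F l : word_equiv F l l.
Proof. split; reflexivity. Qed.
Lemma word_equiv_trans F l1 l2 l3 : word_equiv F l1 l2 -> word_equiv F l2 l3 -> word_equiv F l1 l3.
Proof. intros [] []. split; congruence. Qed.
Lemma word_equiv_app F l1 l2 l1' l2' :
  word_equiv F l1 l1' -> word_equiv F l2 l2' -> word_equiv F (l1 ++ l2) (l1' ++ l2').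
Proof. intros [] []. split; rewrite !spell_app, ?wprod_app, ?wcost_app; congruence. Qed.
Lemma word_equiv_cons F p r r' : word_equiv F r r' -> word_equiv F (p :: r) (p :: r').
Proof. apply (word_equiv_app F [p] r [p] r'), word_equiv_refl. Qed.
Lemma word_equiv_zero F l r : word_equiv F r ((0, l) :: r).
Proof. split; rewrite spell_cons, ?wprod_cons, ?wcost_cons; [rewrite rot_0, mmul_1l; reflexivity | ring]. Qed.
Lemma word_equiv_zero_end F l r : word_equiv F r (r ++ [(0, l)]).
Proof. rewrite <- (app_nil_r r) at 1. apply word_equiv_app; [apply word_equiv_refl | apply word_equiv_zero]. Qed.
Lemma word_equiv_sym s F l l' :
  word_equiv (sym_frame s F) (map (sym_letter s) l) (map (sym_letter s) l') -> word_equiv F l l'.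
Proof. unfold word_equiv. rewrite !spell_sym, !wprod_sym, !wcost_sym. auto. Qed.
Lemma word_equiv_rev F l l' : word_equiv (sym_frame Nu F) (rev l) (rev l') -> word_equiv F l l'.
Proof.
  unfold word_equiv. rewrite !spell_Nu, !spell_rev, !wprod_Nu_rev, !wcost_Nu_rev. intros [prod cost].
  split; [|exact cost]. rewrite <- (mtrans_mtrans (wprod F (spell F l))), prod. apply mtrans_mtrans.
Qed.

(* With i set the tail starts with a Y-letter; a and b may be times or indices of times. *)
Definition tail_letters {A : Type} (i n : bool) (a b : A) : list (A * label) :=
  if i then [(a, (negb n, BY)); (b, (negb n, BX))] else [(a, (n, BX)); (b, (n, BY))].

Definition tail_times (F : frame) (i : bool) (a b : R) : Prop :=
  let first := if i then hatY F else hatX F in let second := if i then hatX F else hatY F in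
  0 <= a <= first /\ 0 <= b <= second /\ (b = 0 \/ a = first).

Lemma tail_times_Nu F i a b : tail_times (sym_frame Nu F) i a b -> tail_times F i a b.
Proof. unfold tail_times. rewrite hatX_Nu, hatY_Nu. auto. Qed.
Lemma tail_times_Vs F i a b : tail_times (sym_frame Vs F) i a b -> tail_times F (negb i) a b.
Proof. unfold tail_times. rewrite hatY_Vs. destruct i; auto. Qed.
Lemma tail_times_0 F i : acute F -> tail_times F i 0 0.
Proof.
  intros acuteF. destruct (hatX_spec F acuteF) as [hatX_in _]. destruct (hatX_spec _ (acute_Vs F acuteF)) as [hatY_in _].
  fold (hatY F) in hatY_in. destruct i; unfold tail_times; lra.
Qed.

Definition tail_or_turn (F : frame) (B : M3) (r : list (R * label)) : Prop :=
  (exists i a b, tail_times F i a b /\ word_equiv F r (tail_letters i false a b)) \/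
  (exists h t r', r = h ++ (t, lWpn) :: r' /\ vee (conj_by B (wprod F (spell F h))) = vneg (vee B)).

Lemma X_tail_or_turn F B t r : acute F -> supports F lWp B -> minimal_word F B ((t, lX) :: r) ->
  tail_or_turn F B ((t, lX) :: r).
Proof.
  intros acuteF at_corner least. pose proof (proj1 acuteF) as adm.
  pose proof (minimal_word_time_pos _ _ _ _ _ least) as t_pos.
  pose proof (tail_X_time_le_hat F B t acuteF at_corner r (proj1 least)) as t_le.
  destruct (hatX_spec _ (acute_Vs F acuteF)) as [hatY_in _]. fold (hatY F) in hatY_in.
  destruct r as [|[t2 l2] r].
  { left. exists false, t, 0. split; [unfold tail_times; lra | apply (word_equiv_zero_end F lY [(t, lX)])]. }
  destruct (tail_X_next F B t acuteF at_corner t2 l2 r least) as (t_eq & -> & _).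
  destruct r as [|[t3 l3] r].
  - left. exists false, t, t2. split; [|apply word_equiv_refl].
    pose proof (minimal_word_time_pos _ _ _ _ _ (minimal_word_tail _ _ _ _ _ least)).
    pose proof (tail_XY_time_le_hat F B t acuteF at_corner t2 least). unfold tail_times. lra.
  - right. destruct (tail_XY_next F B t acuteF at_corner t2 t3 l3 r least) as [-> reversed].
    exists [(t, lX); (t2, lY)], t3, r. split; [reflexivity | exact reversed].
Qed.

Lemma supports_sym_frame s F l B : supports F l B -> supports (sym_frame s F) (sym_label s l) B.
Proof. intros supp. apply (supports_sym s). rewrite sym_frameK, sym_labelK. exact supp. Qed.

(* [Vs] followed by [Nu] fixes the letter Wp and its corner and exchanges X with -Y. *)
Lemma tail_or_turn_flip F B r :
  tail_or_turn (sym_frame Nu (sym_frame Vs F)) B (map (sym_letter Nu) (map (sym_letter Vs) r)) -> tail_or_turn F B r.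
Proof.
  intros [(i & a & b & times & equiv) | (h & t & r' & split_r & reversed)].
  - left. exists (negb i), a, b. split; [apply tail_times_Vs, tail_times_Nu, times|].
    apply (word_equiv_sym Vs), (word_equiv_sym Nu). destruct i; exact equiv.
  - right. exists (map (sym_letter Vs) (map (sym_letter Nu) h)), t, (map (sym_letter Vs) (map (sym_letter Nu) r')). split.
    + rewrite <- (map_sym_letterK Vs r), <- (map_sym_letterK Nu (map (sym_letter Vs) r)), split_r, !map_app. reflexivity.
    + rewrite !spell_sym_inv, <- (wprod_sym Vs F), sym_wordK, <- (wprod_sym Nu (sym_frame Vs F)), sym_wordK. exact reversed.
Qed.

Lemma corner_tail_or_turn F B r : acute F -> supports F lWp B -> minimal_word F B r ->
  tail_or_turn F B r \/ exists t r', r = (t, lWp) :: r'.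
Proof.
  intros acuteF at_corner least. pose proof acuteF as [adm c_pos]. pose proof (wtX_pos F adm). pose proof (wtY_pos F adm).
  destruct r as [|[t l] r].
  { left. left. exists false, 0, 0. split; [apply tail_times_0, acuteF|].
    apply (word_equiv_trans F _ [(0, lY)]); apply word_equiv_zero. }
  pose proof (letter_start_supported _ _ _ _ _ adm (proj1 least) (minimal_word_time_pos _ _ _ _ _ least)) as supp.
  pose proof (momenta_eq _ _ _ _ _ at_corner) as (x_eq & y_eq & _). cbn in x_eq, y_eq.
  destruct l as [[] []]; cbn in supp; try lra;
    try (apply momenta_eq in supp; destruct supp as (x_eq' & y_eq' & _); lra).
  - left. apply tail_or_turn_flip, X_tail_or_turn.
    + apply acute_Nu, acute_Vs, acuteF.
    + exact (supports_sym_frame Nu _ _ _ (supports_sym_frame Vs _ _ _ at_corner)).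
    + exact (minimal_word_sym Nu _ _ _ (minimal_word_sym Vs _ _ _ least)).
  - left. apply X_tail_or_turn; assumption.
  - right. exists t, r. reflexivity.
Qed.

(* A half loop h reverses the momentum, so a following W-rotation slides through it and merges. *)
Lemma Wp_merge_absurd F B t h t' r : admissible F -> minimal_word F B ((t, lWp) :: h ++ (t', lWpn) :: r) ->
  let B1 := conj_by B (rot t (label_vec F lWp)) in
  supports F lWp B1 -> vee (conj_by B1 (wprod F (spell F h))) = vneg (vee B1) -> False.
Proof.
  intros adm least B1 at_corner reversed. set (P := wprod F (spell F h)) in *. assert (SP : inSO3 P) by apply wprod_SO3.
  rewrite (vee_conj_by B1 P SP) in reversed. apply SO3_trans_reverses in reversed; [|exact SP].
  assert (slide : mmul P (rot t' (label_vec F lWpn)) = mmul (rot t' (label_vec F lWp)) P).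
  { rewrite (mmul_rot P t' _ SP). do 2 f_equal. pose proof (supports_Wp_vee F B1 adm at_corner) as vee_B1.
    pose proof (sinXY_sq_pos F adm). set (s := 1 - cosXY F * cosXY F) in *.
    assert (Wp_eq : label_vec F lWp = vscale s (vee B1)) by (rewrite vee_B1; entries; field; lra).
    change lWpn with (neg_label lWp). rewrite label_vec_neg, Wp_eq, mvmul_neg, mvmul_scale, reversed. entries_ring. }
  assert (least' : minimal_word F B (((t, lWp) :: h) ++ [(t', lWpn)])).
  { apply (minimal_word_prefix F B _ r). rewrite <- app_assoc. exact least. }
  destruct least' as [[nn _] shortest]. rewrite spell_app, nonneg_times_app in nn. destruct nn as [nn nn'].
  inversion nn as [|? ? t_ge0 nn_h]; subst. inversion nn' as [|? ? t'_ge0 _]; subst. cbn in t_ge0, t'_ge0.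
  specialize (shortest ((t + t', lWp) :: h)). rewrite length_app in shortest. cbn [length] in shortest.
  enough (S (length h) + 1 <= S (length h))%nat by lia. apply shortest.
  - rewrite spell_cons. apply nonneg_times_cons; [lra | exact nn_h].
  - rewrite spell_app, wprod_app, !spell_cons, !wprod_cons, wprod_nil, mmul_1r.
    fold P (label_vec F lWp) (label_vec F lWpn). rewrite mmul_assoc, slide, <- mmul_assoc, rot_add. reflexivity.
  - rewrite spell_app, wcost_app, !spell_cons, !wcost_cons. change (label_control F lWpn) with (cneg (label_control F lWp)).
    rewrite rate_cneg. change (wcost F (spell F [])) with 0. lra.
Qed.

Lemma Wp_tail F B t r : acute F -> minimal_word F B ((t, lWp) :: r) ->
  exists i a b, tail_times F i a b /\ word_equiv F r (tail_letters i false a b).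
Proof.
  intros acuteF least. pose proof (proj1 acuteF) as adm.
  pose proof (letter_end_supported _ _ _ _ _ adm (proj1 least) (minimal_word_time_pos _ _ _ _ _ least)) as at_corner.
  destruct (corner_tail_or_turn F _ r acuteF at_corner (minimal_word_tail _ _ _ _ _ least))
    as [[tail | (h & t' & r' & -> & reversed)] | (t' & r' & ->)].
  - exact tail.
  - destruct (Wp_merge_absurd F B t h t' r' adm least at_corner reversed).
  - destruct (minimal_word_no_repeat _ _ _ _ _ _ least).
Qed.

(** * Shapes *)

Inductive family := Cycle | WithWp | WithWm.
Definition shape := (family * (bool * bool * bool))%type.
Definition axis (is_Y : bool) : base := if is_Y then BY else BX.
Definition axis_weight (F : frame) (is_Y : bool) : R := if is_Y then wtY F else wtX F.

Definition shape_slots (s : shape) : list (nat * label) :=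
  match s with
  | (Cycle, (n1, n2, e)) =>
      [(0%nat, (n1, axis e)); (1%nat, (n2, axis (negb e)));
       (2%nat, (negb n1, axis e)); (3%nat, (negb n2, axis (negb e)))]
  | (WithWp, (n, i, j)) =>
      rev (tail_letters i n 0%nat 1%nat) ++ (2%nat, (n, BWp)) :: tail_letters j n 3%nat 4%nat
  | (WithWm, (n, e, e')) => [(0%nat, (n, axis e)); (1%nat, (n, BWm)); (2%nat, (n, axis e'))]
  end.
Definition shape_word (s : shape) (p : nat -> R) : list (R * label) :=
  map (fun slot => (p (fst slot), snd slot)) (shape_slots s).

(* In a cycle, p 4 and p 5 are the times of the full letters of the pattern; unused parameters are 0. *)
Definition shape_times (F : frame) (s : shape) (p : nat -> R) : Prop :=
  match s with
  | (Cycle, (n1, n2, e)) =>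
      (0 <= p 0%nat <= p 4%nat /\ 0 <= p 2%nat <= p 4%nat /\ p 4%nat <= PI) /\
      (0 <= p 1%nat <= p 5%nat /\ 0 <= p 3%nat <= p 5%nat /\ p 5%nat <= PI) /\
      ((p 1%nat = p 5%nat \/ p 2%nat = 0) /\ (p 1%nat = p 5%nat \/ p 3%nat = 0) /\ (p 2%nat = p 4%nat \/ p 3%nat = 0)) /\
      axis_weight F e * (sin (p 4%nat / 2) * cos (p 5%nat / 2)) =
        axis_weight F (negb e) * (cos (p 4%nat / 2) * sin (p 5%nat / 2))
  | (WithWp, (n, i, j)) =>
      tail_times F i (p 0%nat) (p 1%nat) /\ tail_times F j (p 3%nat) (p 4%nat) /\
      0 <= p 2%nat /\ p 2%nat * vnorm (label_vec F (n, BWp)) <= PI /\ p 5%nat = 0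
  | (WithWm, (n, e, e')) =>
      0 <= p 0%nat <= PI /\ 0 <= p 2%nat <= PI /\
      0 <= p 1%nat /\ p 1%nat * vnorm (label_vec F (n, BWm)) <= PI /\ p 3%nat = 0 /\ p 4%nat = 0 /\ p 5%nat = 0
  end.

Definition has_shape (F : frame) (l : list (R * label)) : Prop :=
  exists s p, shape_times F s p /\ word_equiv F l (shape_word s p).

Definition params (l : list R) (i : nat) : R := nth i l 0.

Definition sym_shape (s : sym) (x : shape) : shape :=
  match s, x with
  | Nu, (Cycle, (n1, n2, e)) => (Cycle, (negb n1, negb n2, e))
  | Nu, (f, (n, i, j)) => (f, (negb n, i, j))
  | Vs, (Cycle, (n1, n2, e)) => (Cycle, (n1, n2, negb e))
  | Vs, (WithWp, (n, i, j)) => (WithWp, (negb n, negb i, negb j))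
  | Vs, (WithWm, (n, e, e')) => (WithWm, (n, negb e, negb e'))
  | Rho, (f, (n1, n2, e)) => (f, if e then (negb n1, n2, e) else (n1, negb n2, e))
  end.

(* The other families are not invariant under [Rho], which exchanges Wp and Wm. *)
Lemma shape_times_sym s F x p : (s = Rho -> fst x = Cycle) ->
  shape_times (sym_frame s F) x p -> shape_times F (sym_shape s x) p.
Proof.
  intros compatible times.
  destruct s, x as [[] [[n i] j]]; cbn [sym_shape fst] in *; try (discriminate (compatible eq_refl)); unfold shape_times in *.
  - exact times.
  - destruct times as (left_tail & right_tail & rest). rewrite <- (label_vec_sym Nu F (negb n, BWp)). cbn [sym_label].
    rewrite Bool.negb_involutive. auto using tail_times_Nu.
  - rewrite <- (label_vec_sym Nu F (negb n, BWm)). cbn [sym_label]. rewrite Bool.negb_involutive. exact times.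
  - destruct j; exact times.
  - rewrite Bool.negb_involutive in *. destruct j; exact times.
  - destruct times as (left_tail & right_tail & rest). rewrite <- (label_vec_sym Vs F (negb n, BWp)). cbn [sym_label].
    rewrite Bool.negb_involutive. auto using tail_times_Vs.
  - rewrite <- (label_vec_sym Vs F (n, BWm)). exact times.
Qed.

Lemma shape_word_sym s x p : (s = Rho -> fst x = Cycle) ->
  map (sym_letter s) (shape_word (sym_shape s x) p) = shape_word x p.
Proof.
  intros compatible.
  destruct s, x as [[] [[[] []] []]]; cbn [fst] in compatible; try (discriminate (compatible eq_refl)); reflexivity.
Qed.

Lemma has_shape_sym s F l x p : (s = Rho -> fst x = Cycle) -> shape_times (sym_frame s F) x p ->
  word_equiv (sym_frame s F) (map (sym_letter s) l) (shape_word x p) ->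
  shape_times F (sym_shape s x) p /\ word_equiv F l (shape_word (sym_shape s x) p).
Proof.
  intros compatible times equiv. split; [apply shape_times_sym; assumption|].
  apply (word_equiv_sym s). rewrite shape_word_sym; assumption.
Qed.

Lemma has_shape_Nu F l : has_shape (sym_frame Nu F) (map (sym_letter Nu) l) -> has_shape F l.
Proof.
  intros (x & p & times & equiv). exists (sym_shape Nu x), p. apply has_shape_sym; [discriminate | assumption | assumption].
Qed.
Lemma has_shape_Vs F l : has_shape (sym_frame Vs F) (map (sym_letter Vs) l) -> has_shape F l.
Proof.
  intros (x & p & times & equiv). exists (sym_shape Vs x), p. apply has_shape_sym; [discriminate | assumption | assumption].
Qed.

Lemma Wp_form_has_shape F l i a b t j a' b' : 0 <= t -> t * vnorm (label_vec F lWp) <= PI ->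
  tail_times F i a b -> tail_times F j a' b' ->
  word_equiv F l (rev (tail_letters i false a b) ++ (t, lWp) :: tail_letters j false a' b') -> has_shape F l.
Proof.
  intros t_ge0 angle left_tail right_tail equiv. exists (WithWp, (false, i, j)), (params [a; b; t; a'; b']).
  split; [cbn; auto|]. destruct i, j; exact equiv.
Qed.

Lemma Wp_has_shape F B l t n r : acute F -> minimal_word F B (l ++ (t, (n, BWp)) :: r) ->
  has_shape F (l ++ (t, (n, BWp)) :: r).
Proof.
  assert (positive : forall F B l t r, acute F -> minimal_word F B (l ++ (t, lWp) :: r) -> has_shape F (l ++ (t, lWp) :: r)).
  { clear. intros F B l t r acuteF least. pose proof (minimal_word_suffix _ _ _ _ least) as right_part.
    destruct (Wp_tail _ _ _ _ acuteF right_part) as (j & a' & b' & right_tail & right_equiv).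
    pose proof (minimal_word_rev _ _ _ least) as left_part. rewrite rev_app_distr in left_part.
    cbn [rev] in left_part. rewrite <- app_assoc in left_part. apply minimal_word_suffix in left_part.
    destruct (Wp_tail _ _ _ _ (acute_Nu F acuteF) left_part) as (i & a & b & left_tail & left_equiv).
    apply (Wp_form_has_shape F _ i a b t j a' b'); [| | apply tail_times_Nu, left_tail | exact right_tail |].
    - left. exact (minimal_word_time_pos _ _ _ _ _ right_part).
    - exact (letter_angle_le_PI _ _ _ _ _ (proj1 acuteF) (proj1 right_part)).
    - apply word_equiv_app; [|apply word_equiv_cons, right_equiv].
      apply word_equiv_rev. rewrite rev_involutive. exact left_equiv. }
  intros acuteF least. destruct n; [|exact (positive F B l t r acuteF least)].
  apply has_shape_Nu. rewrite map_app. apply (positive _ B); [apply acute_Nu, acuteF|].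
  pose proof (minimal_word_sym Nu _ _ _ least) as flipped. rewrite map_app in flipped. exact flipped.
Qed.

Lemma corner_has_shape F B l r : acute F -> minimal_word F B (l ++ r) ->
  supports F lWp (conj_by B (wprod F (spell F l))) ->
  (forall t n, ~ In (t, (n, BWp)) (l ++ r)) -> has_shape F (l ++ r).
Proof.
  intros acuteF least at_corner no_Wp. pose proof PI_RGT_0.
  assert (tail_of : forall F' B' r', acute F' -> supports F' lWp B' -> minimal_word F' B' r' ->
    (forall t n, ~ In (t, (n, BWp)) r') -> exists i a b, tail_times F' i a b /\ word_equiv F' r' (tail_letters i false a b)).
  { intros F' B' r' acuteF' at_corner' least' none.
    destruct (corner_tail_or_turn F' B' r' acuteF' at_corner' least') as [[tail | (h & t & r'' & -> & _)] | (t & r'' & ->)].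
    - exact tail.
    - destruct (none t true). apply in_or_app. right. left. reflexivity.
    - destruct (none t false). left. reflexivity. }
  destruct (tail_of _ _ r acuteF at_corner (minimal_word_suffix _ _ _ _ least)) as (j & a' & b' & right_tail & right_equiv).
  { intros t n in_right. apply (no_Wp t n), in_or_app. right. exact in_right. }
  destruct (tail_of (sym_frame Nu F) (mtrans (conj_by B (wprod F (spell F l)))) (rev l) (acute_Nu F acuteF))
    as (i & a & b & left_tail & left_equiv).
  { cbn [supports signed negb] in *. rewrite momenta_trans_Nu. apply momenta_eq in at_corner.
    destruct at_corner as (-> & -> & ->).
    apply mkV_eq; [reflexivity | reflexivity | ring]. }
  { apply minimal_word_rev, (minimal_word_prefix _ _ _ r least). }
  { intros t n in_left. apply (no_Wp t n), in_or_app. left. apply in_rev, in_left. }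
  apply (Wp_form_has_shape F _ i a b 0 j a' b'); [lra | lra | apply tail_times_Nu, left_tail | exact right_tail |].
  apply word_equiv_app.
  - apply word_equiv_rev. rewrite rev_involutive. exact left_equiv.
  - apply (word_equiv_trans F _ _ _ right_equiv), word_equiv_zero.
Qed.

Lemma Wm_then_X F B t r : acute F -> supports F lWm B -> minimal_word F B ((t, lX) :: r) -> r = [].
Proof.
  intros [adm c_pos] at_corner least. pose proof (wtX_pos F adm) as wX. pose proof (wtY_pos F adm) as wY.
  destruct (momenta_eq _ _ _ _ _ at_corner) as (x_eq & y_eq & z_eq). cbn in x_eq, y_eq.
  destruct r as [|[t2 l2] r]; [reflexivity | exfalso].
  destruct (minimal_X_then F B t t2 l2 r adm least) as (x1_eq & _ & _ & [(y_eq' & _) | (_ & y1_eq & _ & _)]);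
    [rewrite y_eq; apply Rabs_right; lra | lra |].
  pose proof (momentum_form_conj F B _ adm (rot_SO3 t (axX F))) as form. unfold momentum_form in form.
  rewrite x_eq, y_eq, z_eq, x1_eq, y1_eq in form.
  assert (0 < cosXY F * wtX F * wtY F) by (repeat apply Rmult_lt_0_compat; lra). nra.
Qed.

Lemma Wm_tail F B t r : acute F -> minimal_word F B ((t, lWm) :: r) ->
  exists e b, 0 <= b <= PI /\ word_equiv F r [(b, (false, axis e))].
Proof.
  intros acuteF least. pose proof acuteF as [adm _]. pose proof (wtX_pos F adm). pose proof (wtY_pos F adm).
  pose proof PI_RGT_0.
  pose proof (letter_end_supported _ _ _ _ _ adm (proj1 least) (minimal_word_time_pos _ _ _ _ _ least)) as at_corner.
  pose proof (minimal_word_tail _ _ _ _ _ least) as rest. set (B1 := conj_by B (rot t (label_vec F lWm))) in *.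
  destruct (momenta_eq _ _ _ _ _ at_corner) as (x_eq & y_eq & _). cbn in x_eq, y_eq.
  destruct r as [|[t2 l2] r]; [exists false, 0; split; [lra | apply word_equiv_zero]|].
  pose proof (minimal_word_time_pos _ _ _ _ _ rest) as t2_pos.
  pose proof (letter_start_supported _ _ _ _ _ adm (proj1 rest) t2_pos) as supp.
  destruct l2 as [[] []]; cbn in supp; try lra;
    try (apply momenta_eq in supp; destruct supp as (x_eq' & y_eq' & _); lra).
  - rewrite (Wm_then_X F B1 t2 r acuteF at_corner rest). exists false, t2. split; [|apply word_equiv_refl].
    pose proof (X_time_le_PI F B1 t2 r adm (proj1 rest)). lra.
  - pose proof (minimal_word_sym Vs _ _ _ rest) as swapped.
    pose proof (Wm_then_X _ B1 t2 _ (acute_Vs F acuteF) (supports_sym_frame Vs _ _ _ at_corner) swapped) as r_nil.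
    destruct r; [|discriminate r_nil]. exists true, t2. split; [|apply word_equiv_refl].
    pose proof (X_time_le_PI _ B1 t2 _ (admissible_sym Vs F adm) (proj1 swapped)). lra.
  - destruct (minimal_word_no_repeat _ _ _ _ _ _ least).
Qed.

Lemma Wm_has_shape F B l t n r : acute F -> minimal_word F B (l ++ (t, (n, BWm)) :: r) ->
  has_shape F (l ++ (t, (n, BWm)) :: r).
Proof.
  assert (positive : forall F B l t r, acute F -> minimal_word F B (l ++ (t, lWm) :: r) -> has_shape F (l ++ (t, lWm) :: r)).
  { clear. intros F B l t r acuteF least. pose proof (minimal_word_suffix _ _ _ _ least) as right_part.
    destruct (Wm_tail _ _ _ _ acuteF right_part) as (e' & b & b_in & right_equiv).
    pose proof (minimal_word_rev _ _ _ least) as left_part. rewrite rev_app_distr in left_part.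
    cbn [rev] in left_part. rewrite <- app_assoc in left_part. apply minimal_word_suffix in left_part.
    destruct (Wm_tail _ _ _ _ (acute_Nu F acuteF) left_part) as (e & a & a_in & left_equiv).
    exists (WithWm, (false, e, e')), (params [a; t; b]). split.
    - pose proof (minimal_word_time_pos _ _ _ _ _ right_part).
      pose proof (letter_angle_le_PI _ _ _ _ _ (proj1 acuteF) (proj1 right_part)). cbn. repeat split; lra.
    - apply (word_equiv_app F l _ [(a, (false, axis e))]); [|apply word_equiv_cons, right_equiv].
      apply word_equiv_rev. exact left_equiv. }
  intros acuteF least. destruct n; [|exact (positive F B l t r acuteF least)].
  apply has_shape_Nu. pose proof (minimal_word_sym Nu _ _ _ least) as flipped. rewrite map_app in *.
  apply (positive _ B); [apply acute_Nu, acuteF | exact flipped].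
Qed.

(** * Words in the letters X and Y *)

Definition twice_atan (q : R) : R := 2 * atan q.

Lemma sqrt_one_plus_sq q : sqrt (1 + q * q) * sqrt (1 + q * q) = 1 + q * q /\ sqrt (1 + q * q) <> 0.
Proof.
  assert (sq : sqrt (1 + q * q) * sqrt (1 + q * q) = 1 + q * q) by (apply sqrt_sqrt; nra).
  split; [exact sq|]. intros zero. rewrite zero in sq. nra.
Qed.
Lemma cos_twice_atan q : cos (twice_atan q) = half_tan_cos q.
Proof.
  unfold twice_atan, half_tan_cos. rewrite cos_2a, cos_atan, sin_atan. unfold Rsqr.
  destruct (sqrt_one_plus_sq q) as [sq nz]. rewrite <- sq at 5. field. exact nz.
Qed.
Lemma sin_twice_atan q : sin (twice_atan q) = half_tan_sin q.
Proof.
  unfold twice_atan, half_tan_sin. rewrite sin_2a, cos_atan, sin_atan. unfold Rsqr.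
  destruct (sqrt_one_plus_sq q) as [sq nz]. rewrite <- sq at 3. field. exact nz.
Qed.
Lemma twice_atan_bounds q : 0 < q -> 0 < twice_atan q < PI.
Proof.
  intros q_pos. unfold twice_atan. pose proof (atan_bound q). pose proof (atan_increasing 0 q q_pos) as pos.
  rewrite atan_0 in pos. lra.
Qed.
Lemma twice_atan_half p q :
  q * (sin (twice_atan p / 2) * cos (twice_atan q / 2)) = p * (cos (twice_atan p / 2) * sin (twice_atan q / 2)).
Proof.
  unfold twice_atan. replace (2 * atan p / 2) with (atan p) by lra. replace (2 * atan q / 2) with (atan q) by lra.
  rewrite !cos_atan, !sin_atan. unfold Rsqr. destruct (sqrt_one_plus_sq p), (sqrt_one_plus_sq q). field. auto.
Qed.

Definition cycle_time (F : frame) (a b : R) : R := twice_atan (wtX F * (2 / (a + b))).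

Lemma cycle_time_bounds F a b : admissible F -> cycle_heights F a b -> 0 < cycle_time F a b < PI.
Proof.
  intros adm (a_pos & b_pos & _). apply twice_atan_bounds, Rmult_lt_0_compat; [apply adm | apply Rdiv_lt_0_compat; lra].
Qed.

Lemma cycle_time_reverses F B a b : admissible F -> cycle_heights F a b -> momenta F B = mkV (wtX F) (wtY F) b ->
  momenta F (conj_by B (rot (cycle_time F a b) (axY F))) = mkV (- wtX F) (wtY F) a.
Proof.
  intros adm (a_pos & b_pos & gap) start. destruct (momenta_eq _ _ _ _ _ start) as (x_eq & y_eq & z_eq).
  destruct (mom_rot_axY F B (cycle_time F a b) adm) as (rot_Y & rot_X & rot_Z).
  unfold cycle_time in *. rewrite cos_twice_atan, sin_twice_atan, x_eq, y_eq, z_eq in *.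
  pose proof (wtX_pos F adm) as wX. unfold half_tan_cos, half_tan_sin in *.
  assert (cw_eq : cosXY F * wtY F = (b * b - a * a) / (4 * wtX F)) by (rewrite gap; field; lra). rewrite cw_eq in *.
  assert (den : (a + b) * (a + b) + wtX F * 2 * (wtX F * 2) <> 0) by nra.
  apply mkV_eq; [rewrite rot_X; field | exact rot_Y | rewrite rot_Z; field]; repeat split; try lra; nra.
Qed.

Definition quarter_frame (F : frame) : frame := sym_frame Rho (sym_frame Vs F).
Definition quarter_letters (l : list (R * label)) : list (R * label) := map (sym_letter Rho) (map (sym_letter Vs) l).

Lemma admissible_quarter F : admissible F -> admissible (quarter_frame F).
Proof. intros adm. apply admissible_sym, admissible_sym, adm. Qed.
Lemma momenta_quarter F B : momenta (quarter_frame F) B = mkV (momY F B) (- momX F B) (momZ F B).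
Proof. unfold quarter_frame. rewrite !momenta_sym. unfold momenta; cbn. apply mkV_eq; ring. Qed.
Lemma momenta_of_quarter F B p q z : momenta (quarter_frame F) B = mkV p q z -> momenta F B = mkV (- q) p z.
Proof. rewrite momenta_quarter. intros eq. injection eq as <- <- <-. rewrite Ropp_involutive. reflexivity. Qed.
Lemma cycle_heights_quarter F a b : cycle_heights F a b -> cycle_heights (quarter_frame F) b a.
Proof.
  intros (a_pos & b_pos & gap). unfold cycle_heights, quarter_frame. rewrite !cosXY_sym. cbn [sym_frame wtX wtY].
  split; [exact b_pos|]. split; [exact a_pos | lra].
Qed.

Definition axis_letter (l : label) : Prop := snd l = BX \/ snd l = BY.

Lemma axis_letter_sym s l : axis_letter l -> axis_letter (sym_label s l).
Proof. destruct l as [n b]. intros [eq | eq]; cbn in eq; subst b; destruct s; cbn; unfold axis_letter; cbn; auto. Qed.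

Definition axis_letters (l : list (R * label)) : Prop := Forall (fun p => axis_letter (snd p)) l.

Lemma axis_letters_sym s l : axis_letters l -> axis_letters (map (sym_letter s) l).
Proof. unfold axis_letters. rewrite Forall_map. apply Forall_impl. intros p. apply axis_letter_sym. Qed.

Lemma cycle_Y_time_le F B t r a b : admissible F -> cycle_heights F a b ->
  extremal_word F B (spell F ((t, lY) :: r)) -> momenta F B = mkV (wtX F) (wtY F) b -> t <= cycle_time F a b.
Proof.
  intros adm heights ext start. pose proof (cycle_time_bounds F a b adm heights) as T_in. set (T := cycle_time F a b) in *.
  apply Rnot_lt_le; intros beyond.
  pose proof (extremal_word_inside F B t (0, 1) (spell F r) T ext ltac:(lra)) as ext_T.
  destruct (extremal_start_signs _ _ _ _ _ adm ext_T ltac:(lra)) as (_ & x_min & _). rewrite cvec_01 in x_min.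
  destruct (momenta_eq _ _ _ _ _ (cycle_time_reverses F B a b adm heights start)) as (x_eq & _ & z_eq).
  fold T in x_eq, z_eq. rewrite z_eq in x_min. specialize (x_min x_eq). cbn in x_min. destruct heights as (a_pos & _). lra.
Qed.

Lemma cycle_Y_step F B t t' l r a b : admissible F -> cycle_heights F a b ->
  minimal_word F B ((t, lY) :: (t', l) :: r) -> axis_letter l -> momenta F B = mkV (wtX F) (wtY F) b ->
  let B' := conj_by B (rot t (axY F)) in let Q := quarter_frame F in
  t = cycle_time F a b /\ l = lXn /\ minimal_word Q B' ((t', lY) :: quarter_letters r) /\
  momenta Q B' = mkV (wtX Q) (wtY Q) a.
Proof.
  intros adm heights least axial start B' Q. pose proof heights as (a_pos & b_pos & gap).
  pose proof (wtX_pos F adm) as wX. destruct (momenta_eq _ _ _ _ _ start) as (x_eq & y_eq & z_eq).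
  destruct (minimal_Y_then F B t t' l r adm least) as (y1_eq & supp & not_Y & [(x_eq' & _) | (_ & x1_eq & _ & z1_ge0)]);
    [rewrite x_eq; apply Rabs_right; lra | lra |]. fold B' in y1_eq, supp, x1_eq, z1_ge0.
  assert (l_eq : l = lXn).
  { destruct l as [n c]. destruct axial as [eq | eq]; cbn in eq, not_Y; subst c; [|congruence].
    destruct n; [reflexivity | cbn in supp; lra]. }
  assert (z1_eq : momZ F B' = a).
  { pose proof (momentum_form_conj F B _ adm (rot_SO3 t (axY F))) as form. fold B' in form. unfold momentum_form in form.
    rewrite x_eq, y_eq, z_eq, x1_eq, y1_eq in form. nra. }
  assert (end_eq : momenta F B' = mkV (- wtX F) (wtY F) a) by (apply mkV_eq; assumption).
  split; [|split; [exact l_eq|split]].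
  - destruct (cycle_Y_time F a b adm heights B t start end_eq) as [cos_eq _]. rewrite <- cos_twice_atan in cos_eq.
    pose proof (cycle_time_bounds F a b adm heights). pose proof (minimal_word_time_pos _ _ _ _ _ least).
    pose proof (X_time_le_PI (sym_frame Vs F) B t _ (admissible_sym Vs F adm) (proj1 (minimal_word_sym Vs _ _ _ least))).
    apply cos_inj; [lra | unfold cycle_time in *; lra | exact cos_eq].
  - pose proof (minimal_word_tail _ _ _ _ _ least) as rest. rewrite label_vec_Y in rest. fold B' in rest.
    rewrite l_eq in rest.
    exact (minimal_word_sym Rho _ _ _ (minimal_word_sym Vs _ _ _ rest)).
  - unfold Q. rewrite momenta_quarter, x1_eq, y1_eq, z1_eq.
    apply mkV_eq; [reflexivity | apply Ropp_involutive | reflexivity].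
Qed.

Lemma cycle_shape_times F a b t1 t2 t3 t4 : admissible F -> cycle_heights F a b ->
  let T := cycle_time F a b in let T' := cycle_time (quarter_frame F) b a in
  0 <= t1 <= T' -> t2 = T -> 0 <= t3 <= T' -> 0 <= t4 <= T -> t3 = T' \/ t4 = 0 ->
  shape_times F (Cycle, (false, false, false)) (params [t1; t2; t3; t4; T'; T]).
Proof.
  intros adm heights T T' t1_in t2_eq t3_in t4_in full. pose proof heights as (a_pos & b_pos & _).
  pose proof (cycle_time_bounds F a b adm heights) as T_in. fold T in T_in.
  pose proof (cycle_time_bounds _ b a (admissible_quarter F adm) (cycle_heights_quarter F a b heights)) as T'_in.
  fold T' in T'_in.
  unfold shape_times, params; cbn [nth axis_weight negb]. split; [lra|]. split; [lra|]. split; [auto|].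
  pose proof (twice_atan_half (wtX (quarter_frame F) * (2 / (b + a))) (wtX F * (2 / (a + b)))) as half.
  fold (cycle_time (quarter_frame F) b a) (cycle_time F a b) T T' in half.
  change (wtX (quarter_frame F)) with (wtY F) in half. rewrite (Rplus_comm b a) in half.
  apply Rmult_eq_reg_l with (2 / (a + b)); [lra | apply Rgt_not_eq, Rdiv_lt_0_compat; lra].
Qed.

Lemma cycle_first_time_le F B t r a b : admissible F -> cycle_heights F a b -> minimal_word F B ((t, lX) :: r) ->
  momenta F (conj_by B (rot t (axX F))) = mkV (wtX F) (wtY F) b -> t <= cycle_time (quarter_frame F) b a.
Proof.
  intros adm heights least end_eq. pose proof heights as (a_pos & b_pos & gap).
  destruct (momenta_eq _ _ _ _ _ end_eq) as (x_eq & y_eq & z_eq).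
  apply (minimal_word_prefix F B [(t, lX)]), minimal_word_rev, (minimal_word_sym Vs) in least.
  rewrite spell_cons, wprod_single in least. fold (label_vec F lX) in least. rewrite label_vec_X in least.
  replace (cycle_time (quarter_frame F) b a) with (cycle_time (sym_frame Vs (sym_frame Nu F)) a b)
    by (unfold cycle_time; rewrite (Rplus_comm b a); reflexivity).
  apply (cycle_Y_time_le (sym_frame Vs (sym_frame Nu F)) (mtrans (conj_by B (rot t (axX F)))) t [] a b);
    [apply admissible_sym, admissible_sym, adm | | apply least |].
  - unfold cycle_heights. rewrite !cosXY_sym. cbn [sym_frame wtX wtY]. lra.
  - rewrite momenta_sym, momenta_trans_Nu, x_eq, y_eq, z_eq. cbn. apply mkV_eq; ring.
Qed.

Lemma cycle_rest F B t1 t2 t3 r a b : admissible F -> cosXY F <> 0 -> cycle_heights F a b ->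
  minimal_word F B ((t1, lX) :: (t2, lY) :: (t3, lXn) :: r) -> axis_letters r ->
  let B1 := conj_by B (rot t1 (axX F)) in let B2 := conj_by B1 (rot t2 (axY F)) in let Q := quarter_frame F in
  momenta F B1 = mkV (wtX F) (wtY F) b -> momenta Q B2 = mkV (wtX Q) (wtY Q) a ->
  minimal_word Q B2 ((t3, lY) :: quarter_letters r) ->
  r = [] \/ exists t4, r = [(t4, lYn)] /\ 0 <= t4 <= cycle_time F a b /\ t3 = cycle_time Q b a.
Proof.
  intros adm c_nz heights least axial B1 B2 Q mom1 mom2 least2. destruct r as [|[t4 l4] r]; [left; reflexivity | right].
  pose proof (admissible_quarter F adm) as admQ. pose proof (admissible_quarter _ admQ) as admQQ.
  pose proof (cycle_heights_quarter F a b heights) as heightsQ.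
  pose proof (cycle_heights_quarter _ _ _ heightsQ) as heightsQQ.
  inversion axial as [|? ? axial4 axial_r]; subst. cbn in axial4.
  destruct (cycle_Y_step Q B2 t3 t4 _ _ b a admQ heightsQ least2) as (t3_eq & l4_eq & least3 & mom3);
    [apply axis_letter_sym, axis_letter_sym, axial4 | exact mom2 |].
  assert (l4 = lYn) as -> by (destruct l4 as [[] []]; first [discriminate l4_eq | reflexivity]).
  set (B3 := conj_by B2 (rot t3 (axY Q))) in *. set (QQ := quarter_frame Q) in *.
  pose proof (minimal_word_time_pos _ _ _ _ _ least3) as t4_pos.
  pose proof (cycle_Y_time_le QQ B3 t4 _ a b admQQ heightsQQ (proj1 least3) mom3) as t4_le.
  change (cycle_time QQ a b) with (cycle_time F a b) in t4_le.
  destruct r as [|[t5 l5] r]; [exists t4; split; [reflexivity | lra] | exfalso].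
  pose proof (minimal_word_time_pos _ _ _ _ _ (minimal_word_tail _ _ _ _ _ least)) as t2_pos.
  pose proof (minimal_word_time_pos _ _ _ _ _ least2) as t3_pos.
  inversion axial_r as [|? ? axial5 _]; subst. cbn in axial5.
  destruct (cycle_Y_step QQ B3 t4 t5 _ _ a b admQQ heightsQQ least3) as (_ & l5_eq & least4 & mom4);
    [do 4 apply axis_letter_sym; exact axial5 | exact mom3 |].
  assert (l5 = lX) as -> by (destruct l5 as [[] []]; first [discriminate l5_eq | reflexivity]).
  pose proof (minimal_word_time_pos _ _ _ _ _ least4) as t5_pos.
  apply momenta_of_quarter in mom2. do 2 apply momenta_of_quarter in mom3. do 3 apply momenta_of_quarter in mom4.
  rewrite Ropp_involutive in mom4.
  pose proof (minimal_word_time_pos _ _ _ _ _ least) as t1_pos.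
  exact (extremal_cycle_absurd F B t1 t2 _ t4 t5 (spell F r) a b adm c_nz (proj1 least) t1_pos
    t2_pos t3_pos t4_pos t5_pos heights mom1 mom2 mom3 mom4).
Qed.

Lemma cycle_has_shape F B t1 t2 t3 l3 r a b : admissible F -> cosXY F <> 0 -> cycle_heights F a b ->
  minimal_word F B ((t1, lX) :: (t2, lY) :: (t3, l3) :: r) -> axis_letter l3 -> axis_letters r ->
  momenta F (conj_by B (rot t1 (axX F))) = mkV (wtX F) (wtY F) b ->
  exists p, shape_times F (Cycle, (false, false, false)) p /\
    word_equiv F ((t1, lX) :: (t2, lY) :: (t3, l3) :: r) (shape_word (Cycle, (false, false, false)) p).
Proof.
  intros adm c_nz heights least axial3 axial mom1. pose proof (minimal_word_tail _ _ _ _ _ least) as least1.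
  rewrite label_vec_X in least1. set (B1 := conj_by B (rot t1 (axX F))) in *.
  destruct (cycle_Y_step F B1 t2 t3 l3 r a b adm heights least1 axial3 mom1) as (t2_eq & -> & least2 & mom2).
  pose proof (admissible_quarter F adm) as admQ. pose proof (cycle_heights_quarter F a b heights) as heightsQ.
  pose proof (cycle_first_time_le F B t1 _ a b adm heights least mom1) as t1_le.
  pose proof (cycle_Y_time_le _ _ t3 _ b a admQ heightsQ (proj1 least2) mom2) as t3_le.
  pose proof (minimal_word_time_pos _ _ _ _ _ least) as t1_pos.
  pose proof (minimal_word_time_pos _ _ _ _ _ least2) as t3_pos.
  pose proof (cycle_time_bounds F a b adm heights) as T_in.
  destruct (cycle_rest F B t1 t2 t3 r a b adm c_nz heights least axial mom1 mom2 least2) as [-> | (t4 & -> & t4_in & t3_eq)].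
  - exists (params [t1; t2; t3; 0; cycle_time (quarter_frame F) b a; cycle_time F a b]).
    split; [apply cycle_shape_times; try assumption; [lra | lra | lra | right; reflexivity]|].
    apply (word_equiv_zero_end F lYn [(t1, lX); (t2, lY); (t3, lXn)]).
  - exists (params [t1; t2; t3; t4; cycle_time (quarter_frame F) b a; cycle_time F a b]).
    split; [apply cycle_shape_times; try assumption; [lra | lra | left; exact t3_eq]|]. apply word_equiv_refl.
Qed.

Lemma middle_X_momenta F B t1 l1 t2 t3 l3 r : admissible F ->
  minimal_word F B ((t1, l1) :: (t2, lX) :: (t3, l3) :: r) -> axis_letter l1 -> axis_letter l3 ->
  let B1 := conj_by B (rot t1 (label_vec F l1)) in let B2 := conj_by B1 (rot t2 (axX F)) in
  exists n z1 z2, l1 = (n, BY) /\ l3 = (negb n, BY) /\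
    momenta F B1 = mkV (wtX F) (signed n (wtY F)) z1 /\ momenta F B2 = mkV (wtX F) (signed (negb n) (wtY F)) z2 /\
    0 <= signed (negb n) z1 /\ 0 <= signed (negb n) z2 /\
    z2 * z2 - z1 * z1 = signed (negb n) (4 * cosXY F * wtX F * wtY F).
Proof.
  intros adm least axial1 axial3 B1 B2. pose proof (wtX_pos F adm) as wX. pose proof (wtY_pos F adm) as wY.
  pose proof (letter_end_supported _ _ _ _ _ adm (proj1 least) (minimal_word_time_pos _ _ _ _ _ least)) as supp1.
  pose proof (minimal_word_tail _ _ _ _ _ least) as least1. fold B1 in supp1, least1.
  pose proof (letter_start_supported _ _ _ _ _ adm (proj1 least1) (minimal_word_time_pos _ _ _ _ _ least1)) as x1_eq.
  cbn [supports signed] in x1_eq.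
  assert (not_X : snd l1 <> BX).
  { destruct l1 as [[] c]; cbn; intros ->; [cbn in supp1; lra | exact (minimal_word_no_repeat _ _ _ _ _ _ least)]. }
  destruct (minimal_X_then F B1 t2 t3 l3 r adm least1 (supports_momY_extreme F l1 B1 adm supp1 not_X))
    as (x2_eq & supp2 & not_X3 & crossing). fold B2 in x2_eq, supp2, crossing.
  destruct l1 as [n1 c1], l3 as [n3 c3]. destruct axial1 as [eq | eq]; cbn in eq, not_X; [congruence | subst c1].
  destruct axial3 as [eq | eq]; cbn in eq, not_X3; [congruence | subst c3]. cbn [supports] in supp1, supp2.
  pose proof (momentum_form_conj F B1 _ adm (rot_SO3 t2 (axX F))) as form. fold B2 in form. unfold momentum_form in form.
  exists n1, (momZ F B1), (momZ F B2).
  destruct crossing as [(y1_eq & y2_eq & z1_ge & z2_ge) | (y1_eq & y2_eq & z1_le & z2_le)].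
  - assert (n1 = true) as -> by (destruct n1; [reflexivity | cbn in supp1; lra]).
    assert (n3 = false) as -> by (destruct n3; [cbn in supp2; lra | reflexivity]).
    rewrite x1_eq, x2_eq, y1_eq, y2_eq in form. cbn [signed negb].
    repeat split; [apply mkV_eq; auto | apply mkV_eq; auto | lra | lra | lra].
  - assert (n1 = false) as -> by (destruct n1; [cbn in supp1; lra | reflexivity]).
    assert (n3 = true) as -> by (destruct n3; [reflexivity | cbn in supp2; lra]).
    rewrite x1_eq, x2_eq, y1_eq, y2_eq in form. cbn [signed negb].
    repeat split; [apply mkV_eq; auto | apply mkV_eq; auto | lra | lra | lra].
Qed.

Lemma axis_letters_no_Wp l t n : axis_letters l -> ~ In (t, (n, BWp)) l.
Proof.
  intros axial in_l. apply (proj1 (Forall_forall _ _) axial) in in_l. destruct in_l as [eq | eq]; discriminate eq.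
Qed.

Lemma Yn_X_Y_has_shape F B t1 t2 t3 r z1 z2 : acute F ->
  minimal_word F B ((t1, lYn) :: (t2, lX) :: (t3, lY) :: r) -> axis_letters r ->
  momenta F (conj_by B (rot t1 (label_vec F lYn))) = mkV (wtX F) (- wtY F) z1 -> 0 <= z1 -> 0 <= z2 ->
  z2 * z2 - z1 * z1 = 4 * cosXY F * wtX F * wtY F -> has_shape F ((t1, lYn) :: (t2, lX) :: (t3, lY) :: r).
Proof.
  intros acuteF least axial mom1 z1_ge z2_ge gap. pose proof acuteF as [adm c_pos].
  assert (all_axial : axis_letters ((t1, lYn) :: (t2, lX) :: (t3, lY) :: r))
    by (repeat (constructor; [cbn; unfold axis_letter; cbn; auto|]); exact axial).
  destruct z1_ge as [z1_pos | <-].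
  - set (w := (t1, lYn) :: (t2, lX) :: (t3, lY) :: r) in *. set (F1 := sym_frame Vs F). set (F2 := sym_frame Rho F1).
    set (F3 := sym_frame Nu F2).
    pose proof (minimal_word_sym Nu F2 _ _ (minimal_word_sym Rho F1 _ _ (minimal_word_sym Vs F _ _ least))) as least'.
    assert (z2_pos : 0 < z2).
    { assert (0 < cosXY F * wtX F * wtY F) by (destruct adm; repeat apply Rmult_lt_0_compat; assumption). nra. }
    destruct (cycle_has_shape F3 B t1 t2 t3 lXn (map (sym_letter Nu) (map (sym_letter Rho) (map (sym_letter Vs) r))) z2 z1)
      as (p & times & equiv).
    + do 3 apply admissible_sym. exact adm.
    + unfold F3, F2, F1. rewrite !cosXY_sym. lra.
    + unfold cycle_heights, F3, F2, F1. rewrite !cosXY_sym. cbn [sym_frame wtX wtY]. lra.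
    + exact least'.
    + left. reflexivity.
    + do 3 apply axis_letters_sym. exact axial.
    + rewrite label_vec_Yn in mom1. change (axX F3) with (vneg (axY F)). unfold F3, F2, F1. rewrite !momenta_sym, mom1.
      cbn. apply mkV_eq; ring.
    + apply has_shape_Vs. set (x := (Cycle, (false, false, false))) in *.
      destruct (has_shape_sym Nu F2 (map (sym_letter Rho) (map (sym_letter Vs) w)) x p ltac:(discriminate) times equiv)
        as [times2 equiv2].
      destruct (has_shape_sym Rho F1 (map (sym_letter Vs) w) (sym_shape Nu x) p (fun _ => eq_refl) times2 equiv2)
        as [times1 equiv1].
      exists (sym_shape Rho (sym_shape Nu x)), p. split; [exact times1 | exact equiv1].
  - apply (corner_has_shape F B [(t1, lYn)]); [exact acuteF | exact least | | intros; apply axis_letters_no_Wp, all_axial].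
    rewrite spell_cons, wprod_single. exact mom1.
Qed.

Lemma Y_X_Yn_has_shape F B t1 t2 t3 r z1 z2 : acute F ->
  minimal_word F B ((t1, lY) :: (t2, lX) :: (t3, lYn) :: r) -> axis_letters r ->
  let B1 := conj_by B (rot t1 (label_vec F lY)) in
  momenta F B1 = mkV (wtX F) (wtY F) z1 -> momenta F (conj_by B1 (rot t2 (axX F))) = mkV (wtX F) (- wtY F) z2 ->
  z1 <= 0 -> z2 <= 0 -> z2 * z2 - z1 * z1 = - (4 * cosXY F * wtX F * wtY F) ->
  has_shape F ((t1, lY) :: (t2, lX) :: (t3, lYn) :: r).
Proof.
  intros acuteF least axial B1 mom1 mom2 z1_le z2_le gap. pose proof acuteF as [adm c_pos].
  assert (all_axial : axis_letters ((t1, lY) :: (t2, lX) :: (t3, lYn) :: r))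
    by (repeat (constructor; [cbn; unfold axis_letter; cbn; auto|]); exact axial).
  destruct z2_le as [z2_neg | ->].
  - assert (z1_neg : z1 < 0).
    { assert (0 < cosXY F * wtX F * wtY F) by (destruct adm; repeat apply Rmult_lt_0_compat; assumption). nra. }
    apply has_shape_Vs.
    destruct (cycle_has_shape (sym_frame Vs F) B t1 t2 t3 lXn (map (sym_letter Vs) r) (- z2) (- z1)) as (p & times & equiv).
    + apply admissible_sym, adm.
    + rewrite cosXY_sym. lra.
    + unfold cycle_heights. rewrite cosXY_sym. cbn [sym_frame wtX wtY]. lra.
    + exact (minimal_word_sym Vs F _ _ least).
    + left. reflexivity.
    + apply axis_letters_sym, axial.
    + unfold B1 in mom1. rewrite label_vec_Y in mom1. change (axX (sym_frame Vs F)) with (axY F).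
      rewrite momenta_sym, mom1. reflexivity.
    + exists (Cycle, (false, false, false)), p. split; [exact times | exact equiv].
  - apply (corner_has_shape F B [(t1, lY); (t2, lX)]);
      [exact acuteF | exact least | | intros; apply axis_letters_no_Wp, all_axial].
    rewrite !spell_cons, wprod_cons, wprod_single, conj_by_mul.
    fold (label_vec F lY) (label_vec F lX) B1. rewrite label_vec_X. exact mom2.
Qed.

Lemma middle_X_has_shape F B t1 l1 t2 t3 l3 r : acute F ->
  minimal_word F B ((t1, l1) :: (t2, lX) :: (t3, l3) :: r) -> axis_letters ((t1, l1) :: (t2, lX) :: (t3, l3) :: r) ->
  has_shape F ((t1, l1) :: (t2, lX) :: (t3, l3) :: r).
Proof.
  intros acuteF least axial. inversion axial as [|? ? axial1 axial_tail]; subst.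
  inversion axial_tail as [|? ? _ axial_tail2]; subst. inversion axial_tail2 as [|? ? axial3 axial_r]; subst.
  destruct (middle_X_momenta F B t1 l1 t2 t3 l3 r (proj1 acuteF) least axial1 axial3)
    as ([] & z1 & z2 & -> & -> & mom1 & mom2 & z1_sign & z2_sign & gap); cbn [signed negb] in *.
  - exact (Yn_X_Y_has_shape F B t1 t2 t3 r z1 z2 acuteF least axial_r mom1 z1_sign z2_sign gap).
  - apply (Y_X_Yn_has_shape F B t1 t2 t3 r z1 z2 acuteF least axial_r mom1 mom2); lra.
Qed.

Lemma vnorm_axis_letter F l : admissible F -> axis_letter l -> vnorm (label_vec F l) = 1.
Proof.
  intros adm. destruct l as [[] c]; intros [eq | eq]; cbn in eq; subst c;
    rewrite ?label_vec_X, ?label_vec_Y, ?label_vec_Xn, ?label_vec_Yn, ?vnorm_neg; auto using vnorm_axX, vnorm_axY.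
Qed.

Lemma minimal_word_alternates F B t1 n1 e1 t2 n2 e2 r : admissible F ->
  minimal_word F B ((t1, (n1, axis e1)) :: (t2, (n2, axis e2)) :: r) -> e2 = negb e1.
Proof.
  intros adm least. pose proof (wtX_pos F adm). pose proof (wtY_pos F adm).
  pose proof (minimal_word_tail _ _ _ _ _ least) as least1.
  pose proof (letter_end_supported _ _ _ _ _ adm (proj1 least) (minimal_word_time_pos _ _ _ _ _ least)) as supp_end.
  pose proof (letter_start_supported _ _ _ _ _ adm (proj1 least1) (minimal_word_time_pos _ _ _ _ _ least1)) as supp_start.
  destruct e1, e2; try reflexivity; exfalso; destruct n1, n2; cbn in supp_end, supp_start; try lra;
    exact (minimal_word_no_repeat _ _ _ _ _ _ least).
Qed.

Lemma short_has_shape F B l : admissible F -> minimal_word F B l -> axis_letters l -> (length l <= 2)%nat -> has_shape F l.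
Proof.
  intros adm least axial short. pose proof PI_RGT_0.
  assert (times : forall n1 n2 e t1 t2, 0 <= t1 <= PI -> 0 <= t2 <= PI ->
    shape_times F (Cycle, (n1, n2, e)) (params [t1; t2; 0; 0; PI; PI])).
  { intros n1 n2 e t1 t2 t1_in t2_in. unfold shape_times, params; cbn [nth]. rewrite cos_PI2, sin_PI2.
    repeat split; try lra; right; reflexivity. }
  assert (time_in : forall B' t l r, minimal_word F B' ((t, l) :: r) -> axis_letter l -> 0 <= t <= PI).
  { intros B' t x r least' axial'. pose proof (minimal_word_time_pos _ _ _ _ _ least') as t_pos.
    pose proof (letter_angle_le_PI _ _ _ _ _ adm (proj1 least')) as angle.
    rewrite (vnorm_axis_letter F x adm axial') in angle. lra. }
  assert (pad : forall w n1 e1 n2 e2, word_equiv F w (w ++ [(0, (n1, axis e1)); (0, (n2, axis e2))])).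
  { intros w n1 e1 n2 e2. rewrite <- (app_nil_r w) at 1. apply word_equiv_app; [apply word_equiv_refl|].
    apply (word_equiv_trans F _ [(0, (n2, axis e2))]); apply word_equiv_zero. }
  assert (is_axis : forall x, axis_letter x -> exists n e, x = (n, axis e)).
  { intros [n c] [eq | eq]; cbn in eq; subst c; [exists n, false | exists n, true]; reflexivity. }
  destruct l as [|[t1 l1] [|[t2 l2] [|? ?]]]; [| | |cbn in short; lia].
  - exists (Cycle, (false, false, false)), (params [0; 0; 0; 0; PI; PI]). split; [apply times; lra|].
    apply (word_equiv_trans F _ _ _ (pad [] false false false true)), (pad [_; _]).
  - inversion axial as [|? ? axial1 _]; subst. pose proof (time_in _ _ _ _ least axial1) as t1_in.
    destruct (is_axis l1 axial1) as (n & e & ->).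
    exists (Cycle, (n, false, e)), (params [t1; 0; 0; 0; PI; PI]). split; [apply times; lra|].
    apply word_equiv_cons, (word_equiv_trans F _ _ _ (word_equiv_zero F (false, axis (negb e)) [])), (pad [_]).
  - inversion axial as [|? ? axial1 axial_tail]; subst. inversion axial_tail as [|? ? axial2 _]; subst.
    pose proof (time_in _ _ _ _ least axial1) as t1_in.
    pose proof (time_in _ _ _ _ (minimal_word_tail _ _ _ _ _ least) axial2) as t2_in.
    destruct (is_axis l1 axial1) as (n1 & e1 & ->), (is_axis l2 axial2) as (n2 & e2 & ->).
    rewrite (minimal_word_alternates F B t1 n1 e1 t2 n2 e2 [] adm least) in *.
    exists (Cycle, (n1, n2, e1)), (params [t1; t2; 0; 0; PI; PI]). split; [apply times; assumption | apply (pad [_; _])].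
Qed.

Lemma three_axis_letters_have_shape F B t1 l1 t2 l2 t3 l3 r : acute F ->
  minimal_word F B ((t1, l1) :: (t2, l2) :: (t3, l3) :: r) -> axis_letters ((t1, l1) :: (t2, l2) :: (t3, l3) :: r) ->
  has_shape F ((t1, l1) :: (t2, l2) :: (t3, l3) :: r).
Proof.
  assert (positive : forall F t1 l1 t2 c t3 l3 r, acute F -> let w := (t1, l1) :: (t2, (false, c)) :: (t3, l3) :: r in
    minimal_word F B w -> axis_letters w -> axis_letter (false, c) -> has_shape F w).
  { clear. intros F t1 l1 t2 c t3 l3 r acuteF w least axial [eq | eq]; cbn in eq; subst c.
    - exact (middle_X_has_shape F B t1 l1 t2 t3 l3 r acuteF least axial).
    - apply has_shape_Vs, (middle_X_has_shape _ B); [apply acute_Vs, acuteF | exact (minimal_word_sym Vs _ _ _ least) |].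
      exact (axis_letters_sym Vs _ axial). }
  intros acuteF least axial. inversion axial as [|? ? _ axial_tail]; subst.
  inversion axial_tail as [|? ? axial2 _]; subst. destruct l2 as [[] c].
  - apply has_shape_Nu, positive; [apply acute_Nu, acuteF | exact (minimal_word_sym Nu _ _ _ least) | | exact axial2].
    exact (axis_letters_sym Nu _ axial).
  - apply positive; assumption.
Qed.

Lemma minimal_word_has_shape F B l : acute F -> minimal_word F B l -> has_shape F l.
Proof.
  intros acuteF least.
  destruct (classic (exists t n, In (t, (n, BWp)) l)) as [(t & n & in_l) | no_Wp].
  { apply in_split in in_l. destruct in_l as (l1 & l2 & ->). exact (Wp_has_shape F B l1 t n l2 acuteF least). }
  destruct (classic (exists t n, In (t, (n, BWm)) l)) as [(t & n & in_l) | no_Wm].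
  { apply in_split in in_l. destruct in_l as (l1 & l2 & ->). exact (Wm_has_shape F B l1 t n l2 acuteF least). }
  assert (axial : axis_letters l).
  { apply Forall_forall. intros [t [n []]] in_l; cbn; unfold axis_letter; cbn; auto; exfalso; eauto. }
  destruct (le_lt_dec (length l) 2) as [short | long]; [exact (short_has_shape F B l (proj1 acuteF) least axial short)|].
  destruct l as [|[t1 l1] [|[t2 l2] [|[t3 l3] r]]]; cbn in long; try lia.
  apply (three_axis_letters_have_shape F B); assumption.
Qed.

Lemma minimal_word_exists F B l : extremal_word F B (spell F l) -> exists l', word_equiv F l' l /\ minimal_word F B l'.
Proof.
  remember (length l) as n eqn:length_l. revert l length_l. induction n as [n shorter_case] using lt_wf_ind. intros l -> ext.
  destruct (classic (exists l', nonneg_times (spell F l') /\ wprod F (spell F l') = wprod F (spell F l) /\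
    wcost F (spell F l') <= wcost F (spell F l) /\ (length l' < length l)%nat))
    as [(l' & nn & prod & cost & shorter) | none].
  - destruct (shorter_case (length l') shorter l' eq_refl) as (l2 & equiv & least).
    { apply (extremal_word_ext F B (spell F l)); [exact nn | symmetry; exact prod | exact cost | exact ext]. }
    exists l2. split; [|exact least]. apply (word_equiv_trans F _ _ _ equiv). split; [exact prod|].
    apply Rle_antisym; [exact cost|]. destruct ext as [_ opt]. specialize (opt _ nn).
    rewrite prod, SO3_mul_trans, mmul_1r in opt by apply wprod_SO3. lra.
  - exists l. split; [apply word_equiv_refl|]. split; [exact ext|]. intros l' nn prod cost. apply not_gt. intros shorter.
    apply none. exists l'. auto.
Qed.

(** * Words that cannot increase the trace *)

Lemma axis_trace_maximum B u : dot u u = 1 -> (forall t, mtrace (mmul B (rot t u)) <= mtrace B) ->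
  dot (vee B) u = 0 /\ dot u (mvmul B u) <= mtrace B.
Proof.
  intros unit_u maximal. set (A := mtrace B - dot u (mvmul B u)). set (D := dot (vee B) u).
  assert (parabola : forall q, q * (D - A * q) <= 0).
  { intros q. specialize (maximal (twice_atan q)).
    rewrite (rot_eq_rot_unit _ _ unit_u), mtrace_mul_rot_unit, cos_twice_atan, sin_twice_atan in maximal. fold D in maximal.
    replace (half_tan_cos q * mtrace B + half_tan_sin q * D + (1 - half_tan_cos q) * dot u (mvmul B u))
      with (mtrace B + 2 * / (1 + q * q) * (q * (D - A * q))) in maximal
      by (unfold A, half_tan_cos, half_tan_sin; field; nra).
    assert (0 < / (1 + q * q)) by (apply Rinv_0_lt_compat; nra). nra. }
  assert (A_ge0 : 0 <= A) by (pose proof (parabola 1); pose proof (parabola (-1)); lra).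
  split; [|unfold A in A_ge0; lra].
  specialize (parabola (D / (1 + A))).
  replace (D / (1 + A) * (D - A * (D / (1 + A)))) with (D * D * (/ (1 + A) * / (1 + A))) in parabola by (field; lra).
  assert (inv_pos : 0 < / (1 + A)) by (apply Rinv_0_lt_compat; lra). pose proof (Rmult_lt_0_compat _ _ inv_pos inv_pos).
  apply Rsqr_0_uniq, Rle_antisym; [unfold Rsqr; nra | apply Rle_0_sqr].
Qed.

Definition rotates_about (F : frame) (v : V3) : Prop := forall t, exists w, nonneg_times w /\ wprod F w = rot t v.

Lemma rotates_about_cvec F ab : rotates_about F (cvec F ab).
Proof.
  intros t. destruct (Rle_lt_dec 0 t) as [t_ge0 | t_neg].
  - exists [(t, ab)]. split; [apply nonneg_times_cons; [exact t_ge0 | constructor] | apply wprod_single].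
  - exists [(- t, cneg ab)]. split; [apply nonneg_times_cons; [lra | constructor]|].
    rewrite wprod_single, cvec_cneg, rot_vneg, Ropp_involutive. reflexivity.
Qed.

Lemma rotates_about_rot F u v s : rotates_about F u -> rotates_about F v -> rotates_about F (mvmul (rot s u) v).
Proof.
  intros about_u about_v t. destruct (about_u s) as (w1 & nn1 & prod1), (about_v t) as (w2 & nn2 & prod2),
    (about_u (- s)) as (w3 & nn3 & prod3).
  exists (w1 ++ w2 ++ w3). split; [rewrite !nonneg_times_app; auto|].
  rewrite !wprod_app, prod1, prod2, prod3, rot_opp, <- mmul_assoc. apply rot_conj, rot_SO3.
Qed.

Lemma SO3_reverses_unit B v : inSO3 B -> dot v v = 1 -> dot v (mvmul B v) <= -1 -> mvmul B v = vneg v.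
Proof.
  intros SB unit_v anti. apply vsub_eq0, dot_self_eq0, Rle_antisym; [|apply dot_self_ge0].
  replace (dot (vsub (mvmul B v) (vneg v)) (vsub (mvmul B v) (vneg v)))
    with (dot (mvmul B v) (mvmul B v) + 2 * dot v (mvmul B v) + dot v v)
    by (unfold vsub, vneg; generalize (mvmul B v); intros; entries_ring).
  rewrite (SO3_dot B v v SB). lra.
Qed.

Lemma quarter_turn_axY F : admissible F -> mvmul (rot (PI / 2) (axX F)) (axY F) = vadd (vscale (cosXY F) (axX F)) (normal F).
Proof.
  intros adm. rewrite (rot_eq_rot_unit _ _ (unit_axX F adm)), mvmul_rot_unit, sin_PI2, cos_PI2.
  unfold cosXY, normal. entries_ring.
Qed.

(* A half turn cannot reverse the three independent axes X, Y and c X + X x Y. *)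
Lemma trace_maximum_id F B : admissible F -> inSO3 B ->
  (forall w, nonneg_times w -> mtrace (mmul B (wprod F w)) <= mtrace B) -> B = mid3.
Proof.
  intros adm SB maximal. pose proof (unit_axX F adm) as unit_X. pose proof (unit_axY F adm) as unit_Y.
  set (u := mvmul (rot (PI / 2) (axX F)) (axY F)).
  assert (unit_u : dot u u = 1) by (unfold u; rewrite (SO3_dot _ _ _ (rot_SO3 _ _)); exact unit_Y).
  assert (axis : forall v, dot v v = 1 -> rotates_about F v -> dot (vee B) v = 0 /\ dot v (mvmul B v) <= mtrace B).
  { intros v unit_v about. apply axis_trace_maximum; [exact unit_v|]. intros t. destruct (about t) as (w & nn & <-). auto. }
  pose proof (rotates_about_cvec F (1, 0)) as about_X. pose proof (rotates_about_cvec F (0, 1)) as about_Y.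
  rewrite cvec_10 in about_X. rewrite cvec_01 in about_Y.
  destruct (axis _ unit_X about_X) as [X_zero X_le]. destruct (axis _ unit_Y about_Y) as [Y_zero Y_le].
  destruct (axis u unit_u (rotates_about_rot F _ _ _ about_X about_Y)) as [u_zero u_le].
  pose proof (quarter_turn_axY F adm) as u_eq. fold u in u_eq.
  assert (N_zero : dot (vee B) (normal F) = 0) by (rewrite u_eq, dot_addr, dot_scaler, X_zero in u_zero; lra).
  assert (vee_zero : vee B = vzero)
    by (apply (frame_vec_ext F _ _ adm); rewrite ?X_zero, ?Y_zero, ?N_zero; entries_ring).
  destruct (SO3_symmetric_cases B SB vee_zero) as [|trace_eq]; [assumption | exfalso]. rewrite trace_eq in *.
  pose proof (SO3_reverses_unit B _ SB unit_X X_le) as X_rev. pose proof (SO3_reverses_unit B _ SB unit_Y Y_le) as Y_rev.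
  pose proof (SO3_reverses_unit B _ SB unit_u u_le) as u_rev.
  assert (N_fixed : mvmul B (normal F) = normal F)
    by (unfold normal; rewrite <- (SO3_cross B _ _ SB), X_rev, Y_rev; entries_ring).
  rewrite u_eq, mvmul_add, mvmul_scale, X_rev, N_fixed in u_rev. apply (normal_nz F adm).
  revert u_rev. generalize (normal F) (axX F). intros n x eq. apply V3_ext; cbn;
    [apply (f_equal vx) in eq | apply (f_equal vy) in eq | apply (f_equal vz) in eq]; cbn in eq; lra.
Qed.

(** * Letting the penalty tend to infinity *)

Definition penalised_maximizer (F : frame) (g : M3) (n : nat) (w : list factor) : Prop :=
  let G := mscale (INR n) (mtrans g) in
  nonneg_times w /\ forall w', nonneg_times w' -> penalised_value F G w' <= penalised_value F G w.

Lemma penalised_value_mscale F a G w : penalised_value F (mscale a G) w = a * mtrace (mmul G (wprod F w)) - wcost F w.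
Proof. unfold penalised_value. rewrite mmul_scalel, mtrace_scale. reflexivity. Qed.

Section PenaltyLimit.
Variables (F : frame) (g : M3) (m : nat -> nat) (ws : nat -> list factor).
Hypotheses (adm : admissible F) (Sg : inSO3 g) (m_ge : forall n, (n <= m n)%nat)
  (maximizers : forall n, penalised_maximizer F g (m n) (ws n)).

Lemma penalty_limit_prod h : mcv (fun n => wprod F (ws n)) h -> h = g.
Proof.
  intros cv_h. assert (Sh : inSO3 h) by (apply (SO3_mcv _ _ (fun n => wprod_SO3 F (ws n)) cv_h)).
  apply (rel_eq_id g h Sg), (trace_maximum_id F _ adm (rel_SO3 g h Sg Sh)). unfold rel. intros w nn_w.
  set (gain := fun P => mtrace (mmul (mmul (mtrans g) P) (wprod F w)) - mtrace (mmul (mtrans g) P)).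
  enough (gain h <= 0) by (unfold gain in *; lra). apply Rnot_lt_le; intros gain_pos.
  assert (cv_gain : Un_cv (fun n => gain (wprod F (ws n))) (gain h))
    by (apply CV_minus; apply mcv_mtrace; repeat apply mcv_mul; auto using mcv_const).
  destruct (cv_gain (gain h / 2)) as [N near]; [lra|]. destruct (INR_unbounded (2 * wcost F w / gain h)) as [N' large].
  set (n := (N + N')%nat). specialize (near n ltac:(unfold n; lia)). apply Rabs_def2 in near.
  destruct (maximizers n) as [nn_n maximal]. specialize (maximal (ws n ++ w)).
  rewrite nonneg_times_app, !penalised_value_mscale, wprod_app, wcost_app, <- mmul_assoc in maximal.
  specialize (maximal (conj nn_n nn_w)). pose proof (wcost_ge0 F w adm nn_w).
  assert (n_le : INR N' <= INR (m n)) by (apply le_INR; specialize (m_ge n); unfold n in *; lia).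
  assert (gain_le : INR (m n) * gain (wprod F (ws n)) <= wcost F w) by (unfold gain; lra).
  assert (wcost F w < INR (m n) * (gain h / 2)).
  { replace (wcost F w) with (2 * wcost F w / gain h * (gain h / 2)) by (field; lra). apply Rmult_lt_compat_r; lra. }
  pose proof (pos_INR (m n)). nra.
Qed.

Lemma penalty_limit_cost c w : Un_cv (fun n => wcost F (ws n)) c -> nonneg_times w -> wprod F w = g -> c <= wcost F w.
Proof.
  intros cv_c nn_w prod. apply Rle_cv_lim with (Un := fun n => wcost F (ws n)) (Vn := fun _ => wcost F w);
    [|exact cv_c | apply Un_cv_const].
  intros n. destruct (maximizers n) as [_ maximal]. specialize (maximal w nn_w).
  rewrite !penalised_value_mscale, prod, (SO3_trans_mul g Sg), mtrace_1 in maximal.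
  pose proof (SO3_mtrace_le _ (SO3_mul _ _ (SO3_trans g Sg) (wprod_SO3 F (ws n)))). pose proof (pos_INR (m n)). nra.
Qed.
End PenaltyLimit.

(** * Compactness of shapes *)

Definition params_cv (q : nat -> nat -> R) (l : nat -> R) : Prop := forall i, (i < 6)%nat -> Un_cv (fun n => q n i) (l i).

Definition params_continuous (f : (nat -> R) -> R) : Prop :=
  forall q l, params_cv q l -> Un_cv (fun n => f (q n)) (f l).

Definition params_closed (P : (nat -> R) -> Prop) : Prop :=
  forall q l, params_cv q l -> (forall n, P (q n)) -> P l.

Lemma params_cv_subseq q l phi : params_cv q l -> (forall n, (n <= phi n)%nat) -> params_cv (fun n => q (phi n)) l.
Proof. intros cv_q phi_ge i i_lt. apply (Un_cv_subseq (fun n => q n i)); auto. Qed.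

Lemma params_closed_le f g : params_continuous f -> params_continuous g -> params_closed (fun p => f p <= g p).
Proof. intros cf cg q l cv_q holds. exact (Rle_cv_lim holds (cf q l cv_q) (cg q l cv_q)). Qed.

Lemma params_closed_and P Q : params_closed P -> params_closed Q -> params_closed (fun p => P p /\ Q p).
Proof. intros closed_P closed_Q q l cv_q holds. split; [apply (closed_P q) | apply (closed_Q q)]; firstorder. Qed.

Lemma params_closed_eq f g : params_continuous f -> params_continuous g -> params_closed (fun p => f p = g p).
Proof.
  intros cf cg q l cv_q holds.
  apply Rle_antisym; [apply (params_closed_le f g cf cg q) | apply (params_closed_le g f cg cf q)]; auto;
    intros n; rewrite holds; apply Rle_refl.
Qed.

Lemma params_closed_or P Q : params_closed P -> params_closed Q -> params_closed (fun p => P p \/ Q p).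
Proof.
  intros closed_P closed_Q q l cv_q holds.
  destruct (classic (exists N, forall n, (N <= n)%nat -> ~ P (q n))) as [[N none] | often].
  - right. apply (closed_Q (fun n => q (n + N)%nat)); [apply params_cv_subseq; [exact cv_q | lia]|].
    intros n. destruct (holds (n + N)%nat) as [P_n | Q_n]; [destruct (none (n + N)%nat ltac:(lia) P_n) | exact Q_n].
  - left. destruct (choice (fun N n => (N <= n)%nat /\ P (q n))) as [phi phi_spec].
    { intros N. apply NNPP. intros none. apply often. exists N. intros n n_ge P_n. apply none. exists n. auto. }
    apply (closed_P (fun n => q (phi n))); [apply params_cv_subseq; [exact cv_q|]|]; intros n; apply phi_spec.
Qed.

Lemma shape_times_closed F s : params_closed (shape_times F s).
Proof.
  assert (tail_closed : forall i j k, (j < 6)%nat -> (k < 6)%nat -> params_closed (fun p => tail_times F i (p j) (p k))).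
  { intros i j k j_lt k_lt. unfold tail_times. cbv zeta.
    repeat first [apply params_closed_and | apply params_closed_le | apply params_closed_eq | apply params_closed_or];
      intros q l cv_q; auto using Un_cv_const. }
  destruct s as [[] [[n i] j]]; unfold shape_times;
    repeat first [apply tail_closed; lia | apply params_closed_and | apply params_closed_le | apply params_closed_eq
      | apply params_closed_or];
    intros q l cv_q; unfold Rdiv;
    pose proof (cv_q 0%nat ltac:(lia)); pose proof (cv_q 1%nat ltac:(lia)); pose proof (cv_q 2%nat ltac:(lia));
    pose proof (cv_q 3%nat ltac:(lia)); pose proof (cv_q 4%nat ltac:(lia)); pose proof (cv_q 5%nat ltac:(lia)); cv.
Qed.

Lemma shape_times_bounded F s : acute F -> exists M, forall p, shape_times F s p -> forall i, (i < 6)%nat -> Rabs (p i) <= M.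
Proof.
  intros acuteF. pose proof (proj1 acuteF) as adm. pose proof PI_RGT_0.
  destruct (hatX_spec F acuteF) as [hatX_in _]. destruct (hatX_spec _ (acute_Vs F acuteF)) as [hatY_in _].
  fold (hatY F) in hatY_in.
  assert (time_le : forall l t, t * vnorm (label_vec F l) <= PI -> t <= PI / vnorm (label_vec F l)).
  { intros l t angle. pose proof (vnorm_pos _ (label_vec_nz F l adm)).
    apply Rmult_le_reg_r with (vnorm (label_vec F l)); [assumption|]. unfold Rdiv. rewrite Rmult_assoc, Rinv_l; lra. }
  assert (quotient_pos : forall l, 0 < PI / vnorm (label_vec F l))
    by (intros l; apply Rdiv_lt_0_compat; [assumption | apply vnorm_pos, label_vec_nz, adm]).
  assert (tail_le : forall i a b, tail_times F i a b -> 0 <= a <= PI /\ 0 <= b <= PI)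
    by (intros [] a b; unfold tail_times; lra).
  destruct s as [[] [[n i] j]].
  - exists PI. intros p times k k_lt. cbn in times.
    do 6 (destruct k as [|k]; [rewrite Rabs_right; lra|]). lia.
  - exists (PI + PI / vnorm (label_vec F (n, BWp))). intros p (left_tail & right_tail & t_ge & angle & zero) k k_lt.
    apply tail_le in left_tail, right_tail. apply time_le in angle. pose proof (quotient_pos (n, BWp)).
    do 6 (destruct k as [|k]; [rewrite Rabs_right; lra|]). lia.
  - exists (PI + PI / vnorm (label_vec F (n, BWm))). intros p (t0_in & t2_in & t_ge & angle & zeros) k k_lt.
    apply time_le in angle. pose proof (quotient_pos (n, BWm)).
    do 6 (destruct k as [|k]; [rewrite Rabs_right; lra|]). lia.
Qed.

Lemma shape_word_nonneg_times F s p : shape_times F s p -> nonneg_times (spell F (shape_word s p)).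
Proof.
  intros times. destruct s as [[] [[n []] []]]; unfold shape_times, tail_times in times; cbn;
    repeat (apply nonneg_times_cons; [lra|]); constructor.
Qed.

Lemma shape_slots_lt s i l : In (i, l) (shape_slots s) -> (i < 6)%nat.
Proof.
  assert (all_lt : Forall (fun slot => (fst slot < 6)%nat) (shape_slots s))
    by (destruct s as [[] [[n []] []]]; cbn; repeat constructor).
  intros slot_in. exact (proj1 (Forall_forall _ _) all_lt (i, l) slot_in).
Qed.

Lemma shape_word_cv F s q l : params_cv q l ->
  mcv (fun n => wprod F (spell F (shape_word s (q n)))) (wprod F (spell F (shape_word s l))) /\
  Un_cv (fun n => wcost F (spell F (shape_word s (q n)))) (wcost F (spell F (shape_word s l))).
Proof.
  intros cv_q. unfold shape_word. pose proof (shape_slots_lt s) as slots_lt.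
  induction (shape_slots s) as [|[i x] slots IH]; [split; [exact (mcv_const mid3) | exact (Un_cv_const 0)]|].
  destruct IH as [prod_cv cost_cv]; [intros j y slot_in; apply (slots_lt j y); right; exact slot_in|].
  pose proof (cv_q i (slots_lt i x (or_introl eq_refl))) as time_cv. split.
  - exact (mcv_mul _ _ _ _ (mcv_rot _ _ (label_vec F x) time_cv) prod_cv).
  - exact (CV_plus _ _ _ _ (CV_mult _ _ _ _ time_cv (Un_cv_const (rate F (label_control F x)))) cost_cv).
Qed.

Lemma infinitely_often {A : Type} (all : list A) (f : nat -> A) : (forall n, In (f n) all) ->
  exists a, forall N, exists n, (N <= n)%nat /\ f n = a.
Proof.
  intros listed. apply NNPP. intros never.
  assert (eventually_not : forall a, exists N, forall n, (N <= n)%nat -> f n <> a).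
  { intros a. apply NNPP. intros often. apply never. exists a. intros N. apply NNPP. intros none. apply often.
    exists N. intros n n_ge eq. apply none. exists n. auto. }
  assert (eventually_none : exists N, forall n, (N <= n)%nat -> ~ In (f n) all).
  { clear listed. induction all as [|a all [N none]]; [exists 0%nat; intros n _ []|].
    destruct (eventually_not a) as [N' not_a]. exists (N + N')%nat. intros n n_ge [eq | in_all].
    - apply (not_a n); [lia | congruence].
    - apply (none n); [lia | exact in_all]. }
  destruct eventually_none as [N none]. exact (none N (le_n N) (listed N)).
Qed.

Definition all_shapes : list shape :=
  let bools := [false; true] in list_prod [Cycle; WithWp; WithWm] (list_prod (list_prod bools bools) bools).

Lemma in_all_shapes s : In s all_shapes.
Proof.
  assert (in_bools : forall b : bool, In b [false; true]) by (intros []; cbn; auto).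
  destruct s as [f [[a b] c]]. repeat apply in_prod; auto. destruct f; cbn; auto.
Qed.

Lemma penalised_maximizer_shape F g n : acute F ->
  exists s p, shape_times F s p /\ penalised_maximizer F g n (spell F (shape_word s p)).
Proof.
  intros acuteF. destruct (penalised_maximum F (mscale (INR n) (mtrans g)) (proj1 acuteF)) as (l & nn & maximal).
  destruct (minimal_word_exists F _ l (maximal_extremal_word F _ _ nn maximal)) as (l' & [prod cost] & least).
  destruct (minimal_word_has_shape F _ l' acuteF least) as (s & p & times & [prod' cost']).
  exists s, p. split; [exact times|]. split; [exact (shape_word_nonneg_times F s p times)|].
  intros w nn_w. specialize (maximal w nn_w). unfold penalised_value in *. rewrite <- prod', <- cost', prod, cost.
  exact maximal.
Qed.

Lemma penalised_maximizers_limit F g : acute F -> exists s q l m,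
  params_cv q l /\ (forall n, (n <= m n)%nat) /\
  forall n, shape_times F s (q n) /\ penalised_maximizer F g (m n) (spell F (shape_word s (q n))).
Proof.
  intros acuteF.
  destruct (choice (fun n sp => shape_times F (fst sp) (snd sp) /\
    penalised_maximizer F g n (spell F (shape_word (fst sp) (snd sp))))) as [f f_spec].
  { intros n. destruct (penalised_maximizer_shape F g n acuteF) as (s & p & spec). exists (s, p). exact spec. }
  destruct (infinitely_often all_shapes (fun n => fst (f n)) (fun n => in_all_shapes _)) as [s often].
  destruct (choice (fun N n => (N <= n)%nat /\ fst (f n) = s) often) as [phi phi_spec].
  destruct (shape_times_bounded F s acuteF) as [M bounded].
  destruct (bounded_subseq_family 6 (fun n => snd (f (phi n))) M) as (psi & l & psi_ge & cv_l).
  { intros n i i_lt. apply bounded; [|exact i_lt]. destruct (phi_spec n) as [_ <-]. apply f_spec. }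
  exists s, (fun n => snd (f (phi (psi n)))), l, (fun n => phi (psi n)). split; [exact cv_l|]. split.
  - intros n. specialize (psi_ge n). destruct (phi_spec (psi n)) as [phi_ge _]. lia.
  - intros n. destruct (phi_spec (psi n)) as [_ shape_eq]. specialize (f_spec (phi (psi n))).
    rewrite shape_eq in f_spec. exact f_spec.
Qed.

Lemma shape_minimizer F g : acute F -> inSO3 g -> exists s p, shape_times F s p /\ wprod F (spell F (shape_word s p)) = g /\
  forall w, nonneg_times w -> wprod F w = g -> wcost F (spell F (shape_word s p)) <= wcost F w.
Proof.
  intros acuteF Sg. destruct (penalised_maximizers_limit F g acuteF) as (s & q & l & m & cv_q & m_ge & spec).
  destruct (shape_word_cv F s q l cv_q) as [prod_cv cost_cv]. exists s, l.
  split; [exact (shape_times_closed F s q l cv_q (fun n => proj1 (spec n)))|]. split.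
  - exact (penalty_limit_prod F g m _ (proj1 acuteF) Sg m_ge (fun n => proj2 (spec n)) _ prod_cv).
  - exact (fun w => penalty_limit_cost F g m _ Sg (fun n => proj2 (spec n)) _ w cost_cv).
Qed.

(** * Patterns *)

Lemma rel_I_of_half_angles kappa tX tY : 0 < kappa -> 0 < tX <= PI -> 0 < tY <= PI ->
  sin (tX / 2) * cos (tY / 2) = kappa * (cos (tX / 2) * sin (tY / 2)) -> rel_I kappa tX tY.
Proof.
  intros kappa_pos X_in Y_in half. unfold rel_I.
  assert (cos_zero : forall t, 0 < t <= PI -> cos (t / 2) = 0 -> t = PI).
  { intros t t_in zero. apply Rle_antisym; [lra|]. apply Rnot_lt_le. intros lt. pose proof (cos_gt_0 (t / 2)). lra. }
  assert (cos_nz : forall t, 0 < t <= PI -> cos (t / 2) <> 0 -> t < PI).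
  { intros t t_in nz. apply Rnot_le_lt. intros ge. apply nz. replace t with PI by lra. apply cos_PI2. }
  assert (sinX_pos : 0 < sin (tX / 2)) by (apply sin_gt_0; lra).
  assert (sinY_pos : 0 < sin (tY / 2)) by (apply sin_gt_0; lra).
  destruct (Req_dec (cos (tX / 2)) 0) as [zeroX | nzX].
  - right. split; apply cos_zero; try assumption. rewrite zeroX in half. nra.
  - destruct (Req_dec (cos (tY / 2)) 0) as [zeroY | nzY].
    { exfalso. rewrite zeroY, Rmult_0_r in half. symmetry in half.
      apply Rmult_integral in half. destruct half as [|half]; [lra|]. apply Rmult_integral in half. lra. }
    left. split; [auto|]. split; [auto|]. unfold tan. apply Rmult_eq_reg_r with (cos (tX / 2) * cos (tY / 2)); [|auto].
    transitivity (sin (tX / 2) * cos (tY / 2)); [field; exact nzX|]. rewrite half. field. exact nzY.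
Qed.

Definition base_frame (X Y : V3) (kappa : R) : frame := mkFrame X Y 1 kappa.

Lemma acute_base_frame X Y kappa : dot X X = 1 -> dot Y Y = 1 -> 0 < dot X Y -> dot X Y < kappa -> kappa <= 1 ->
  acute (base_frame X Y kappa).
Proof.
  intros unit_X unit_Y c_pos c_lt kappa_le. split; [|exact c_pos].
  constructor; unfold base_frame, cosXY; cbn; try lra; rewrite Rabs_right by lra; nra.
Qed.

Section Patterns.
Variables (X Y : V3) (kappa : R).
Hypotheses (c_pos : 0 < dot X Y) (kappa_pos : 0 < kappa).

Let F := base_frame X Y kappa.

Lemma eval_pattern_spell tX tY t p :
  eval_pattern kappa (dot X Y) tX tY t p = spell F (map (fun st => (tval tX tY t (fst st), snd st)) p).
Proof.
  unfold eval_pattern, spell. rewrite map_map. apply map_ext. intros [s [n b]]. unfold label_coef, label_control.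
  assert (base_eq : base_coef kappa (dot X Y) b = base_control F b)
    by (destruct b; cbn; unfold cosXY; cbn; rewrite ?Rmult_1_l; reflexivity).
  cbn [fst snd]. rewrite base_eq. reflexivity.
Qed.

Lemma word_cost_base_frame w : word_cost kappa w = wcost F w.
Proof.
  induction w as [|[t ab] w IH]; [reflexivity|]. rewrite wcost_cons, <- IH.
  change (word_cost kappa ((t, ab) :: w)) with (fcost kappa (t, ab) + word_cost kappa w). unfold fcost, rate; cbn. ring.
Qed.

Lemma hat_tX_base_frame : hat_tX kappa (dot X Y) = hatX F.
Proof. unfold hat_tX, hatX, F, cosXY; cbn. rewrite Rmult_1_r. reflexivity. Qed.
Lemma hat_tY_base_frame : hat_tY kappa (dot X Y) = hatY F.
Proof.
  assert (0 < kappa * dot X Y) by (apply Rmult_lt_0_compat; lra).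
  unfold hat_tY, hatY, hatX. rewrite cosXY_sym. unfold F, cosXY; cbn. f_equal. field. lra.
Qed.

Definition allowed (l : list (R * label)) : Prop := allowed_word kappa (dot X Y) (spell F l).

Lemma allowed_cycle n1 n2 e T T' : 0 < T <= PI -> 0 < T' <= PI ->
  axis_weight F e * (sin (T / 2) * cos (T' / 2)) = axis_weight F (negb e) * (cos (T / 2) * sin (T' / 2)) ->
  allowed [(T, (n1, axis e)); (T', (n2, axis (negb e))); (T, (negb n1, axis e)); (T', (negb n2, axis (negb e)))].
Proof.
  intros T_in T'_in half. left.
  exists (match e, n1, n2 with
          | false, false, false => [] | false, false, true => [Rho]
          | false, true, false => [Nu; Rho] | false, true, true => [Nu]
          | true, false, false => [Vs] | true, false, true => [Nu; Rho; Vs]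
          | true, true, false => [Rho; Vs] | true, true, true => [Nu; Vs]
          end), (if e then T' else T), (if e then T else T').
  split; [exact I|]. split; [destruct e; assumption|]. split; [destruct e; assumption|]. split.
  - destruct e; cbn in half; apply rel_I_of_half_angles; lra.
  - rewrite eval_pattern_spell. destruct n1, n2, e; reflexivity.
Qed.

Definition first_hat (i : bool) : R := if i then hatY F else hatX F.
Definition second_hat (i : bool) : R := if i then hatX F else hatY F.

Lemma allowed_Wp n i j t : 0 <= t -> allowed
  (rev (tail_letters i n (first_hat i) (second_hat i)) ++ (t, (n, BWp)) :: tail_letters j n (first_hat j) (second_hat j)).
Proof.
  intros t_ge0. right. set (ss := (if n then [Nu] else []) ++ (if i then [Nu; Vs] else [])).
  assert (in_group : in_G4 ss) by (unfold ss; destruct n, i; repeat (apply Forall_cons; [auto|]); apply Forall_nil).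
  destruct (xorb i j) eqn:differ; [right|]; left; exists ss, t; split; auto; split; auto;
    rewrite eval_pattern_spell, hat_tX_base_frame, hat_tY_base_frame; destruct n, i, j; try discriminate; reflexivity.
Qed.

Lemma allowed_Wm n e e' t : 0 <= t -> allowed [(PI, (n, axis e)); (t, (n, BWm)); (PI, (n, axis e'))].
Proof.
  intros t_ge0. right; right; right. set (ss := (if n then [Nu] else []) ++ (if e' then [] else [Vs])).
  assert (in_group : in_G4 ss) by (unfold ss; destruct n, e'; repeat (apply Forall_cons; [auto|]); apply Forall_nil).
  destruct (xorb e e') eqn:differ; [right|left]; exists ss, t; split; auto; split; auto;
    rewrite eval_pattern_spell; destruct n, e, e'; try discriminate; reflexivity.
Qed.

Definition subword_realised (l : list (R * label)) : Prop :=
  exists l' p, word_equiv F l l' /\ nonneg_times (spell F l') /\ allowed_word kappa (dot X Y) p /\ subword (spell F l') p.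

Definition zeros (l : list (R * label)) : list (R * label) := map (fun letter => (0, snd letter)) l.

Lemma word_equiv_zeros l : word_equiv F (zeros l) [].
Proof.
  induction l as [|[t x] l IH]; [apply word_equiv_refl|].
  destruct (word_equiv_zero F x (zeros l)) as [prod cost], IH as [prod' cost'].
  split; [rewrite <- prod' | rewrite <- cost']; symmetry; assumption.
Qed.

Lemma trimmed_realised l1 t1 t1' x1 mid t2 t2' x2 l2 : allowed (l1 ++ (t1, x1) :: mid ++ (t2, x2) :: l2) ->
  0 <= t1' <= t1 -> Forall (fun letter => 0 <= fst letter) mid -> 0 <= t2' <= t2 ->
  subword_realised (zeros l1 ++ (t1', x1) :: mid ++ (t2', x2) :: zeros l2).
Proof.
  intros allowed_full t1_in nn t2_in.
  exists ((t1', x1) :: mid ++ [(t2', x2)]), (spell F (l1 ++ (t1, x1) :: mid ++ (t2, x2) :: l2)).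
  split; [|split; [|split; [exact allowed_full|]]].
  - apply (word_equiv_app F _ _ []); [apply word_equiv_zeros|].
    apply word_equiv_cons, word_equiv_app; [apply word_equiv_refl|].
    apply word_equiv_cons, word_equiv_zeros.
  - rewrite spell_cons, spell_app, spell_cons. apply nonneg_times_cons; [lra|]. apply nonneg_times_app.
    split; [apply Forall_map, nn|].
    apply nonneg_times_cons; [lra | constructor].
  - right. exists (spell F l1), (spell F mid), (spell F l2), t1, t1', (label_control F x1), t2, t2', (label_control F x2).
    rewrite spell_app, !spell_cons, !spell_app, !spell_cons. auto.
Qed.

Ltac letters_nonneg := repeat (apply Forall_cons; [cbn; lra|]); apply Forall_nil.

Lemma cycle_degenerate e T T' : 0 <= T <= PI -> 0 <= T' <= PI ->
  axis_weight F e * (sin (T / 2) * cos (T' / 2)) = axis_weight F (negb e) * (cos (T / 2) * sin (T' / 2)) ->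
  (0 < T /\ 0 < T') \/ (T = 0 /\ T' = 0).
Proof.
  intros T_in T'_in half.
  assert (weight_pos : forall b, 0 < axis_weight F b) by (intros []; cbn; lra).
  assert (sin_zero : forall b t, 0 <= t <= PI -> axis_weight F b * sin (t / 2) = 0 -> t = 0).
  { intros b t t_in zero. apply Rmult_integral in zero. destruct zero as [zero | zero]; [specialize (weight_pos b); lra|].
    apply Rle_antisym; [|lra]. apply Rnot_lt_le. intros t_pos. pose proof (sin_gt_0 (t / 2)). lra. }
  destruct (proj1 T_in) as [T_pos | <-], (proj1 T'_in) as [T'_pos | <-]; [left; lra | | | right; lra]; exfalso;
    unfold Rdiv in half; rewrite Rmult_0_l, sin_0, cos_0 in half.
  - pose proof (sin_zero e T T_in). lra.
  - pose proof (sin_zero (negb e) T' T'_in). lra.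
Qed.

Lemma Cycle_realised n1 n2 e p : shape_times F (Cycle, (n1, n2, e)) p ->
  subword_realised (shape_word (Cycle, (n1, n2, e)) p).
Proof.
  unfold shape_times, shape_word; cbn [shape_slots map fst snd].
  generalize (p 0%nat) (p 1%nat) (p 2%nat) (p 3%nat) (p 4%nat) (p 5%nat).
  intros t1 t2 t3 t4 T T' ((t1_in & t3_in & T_le) & (t2_in & t4_in & T'_le) & (full2 & full2' & full3) & half).
  set (x1 := (n1, axis e)). set (x2 := (n2, axis (negb e))). set (x3 := (negb n1, axis e)).
  set (x4 := (negb n2, axis (negb e))).
  destruct (cycle_degenerate e T T' ltac:(lra) ltac:(lra) half) as [[T_pos T'_pos] | [-> ->]].
  - pose proof (allowed_cycle n1 n2 e T T' ltac:(lra) ltac:(lra) half) as full.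
    destruct (Req_dec t2 T') as [-> | partial2]; [destruct (Req_dec t3 T) as [-> | partial3]|].
    + apply (trimmed_realised [] T t1 x1 [(T', x2); (T, x3)] T' t4 x4 [] full);
        [lra | letters_nonneg | lra].
    + assert (t4 = 0) as -> by tauto.
      apply (trimmed_realised [] T t1 x1 [(T', x2)] T t3 x3 [(T', x4)] full);
        [lra | letters_nonneg | lra].
    + assert (t3 = 0) as -> by tauto. assert (t4 = 0) as -> by tauto.
      apply (trimmed_realised [] T t1 x1 [] T' t2 x2 [(T, x3); (T', x4)] full); [lra | letters_nonneg | lra].
  - replace t1 with 0 by lra. replace t2 with 0 by lra. replace t3 with 0 by lra. replace t4 with 0 by lra.
    pose proof PI_RGT_0.
    apply (trimmed_realised [] PI 0 x1 [] PI 0 x2 [(PI, x3); (PI, x4)]); [|lra | letters_nonneg | lra].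
    apply allowed_cycle; rewrite ?cos_PI2; lra.
Qed.

Lemma tail_letters_labels n i : exists x y, forall a b : R, tail_letters i n a b = [(a, x); (b, y)].
Proof. destruct i; cbn; eauto. Qed.

Lemma WithWp_realised n i j p : shape_times F (WithWp, (n, i, j)) p ->
  subword_realised (shape_word (WithWp, (n, i, j)) p).
Proof.
  intros (left_tail & right_tail & t_ge & _). pose proof (allowed_Wp n i j (p 2%nat) t_ge) as full.
  assert (word_eq : shape_word (WithWp, (n, i, j)) p =
    rev (tail_letters i n (p 0%nat) (p 1%nat)) ++ (p 2%nat, (n, BWp)) :: tail_letters j n (p 3%nat) (p 4%nat))
    by (destruct i, j; reflexivity).
  rewrite word_eq. revert left_tail right_tail t_ge full. unfold tail_times.
  fold (first_hat i) (second_hat i) (first_hat j) (second_hat j).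
  generalize (p 0%nat) (p 1%nat) (p 2%nat) (p 3%nat) (p 4%nat). clear p word_eq.
  intros a b t a' b' (a_in & b_in & left_full) (a'_in & b'_in & right_full) t_ge full.
  destruct (tail_letters_labels n i) as (x & y & left_eq), (tail_letters_labels n j) as (x' & y' & right_eq).
  rewrite left_eq, right_eq in *. cbn [rev app] in *. set (w := (n, BWp)) in *.
  destruct (Req_dec a (first_hat i)) as [-> | partial_left]; [|assert (b = 0) as -> by tauto];
    (destruct (Req_dec a' (first_hat j)) as [-> | partial_right]; [|assert (b' = 0) as -> by tauto]).
  - apply (trimmed_realised [] _ b y [(first_hat i, x); (t, w); (first_hat j, x')] _ b' y' [] full);
      [lra | letters_nonneg | lra].
  - apply (trimmed_realised [] _ b y [(first_hat i, x); (t, w)] _ a' x' [(second_hat j, y')] full);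
      [lra | letters_nonneg | lra].
  - apply (trimmed_realised [(second_hat i, y)] _ a x [(t, w); (first_hat j, x')] _ b' y' [] full);
      [lra | letters_nonneg | lra].
  - apply (trimmed_realised [(second_hat i, y)] _ a x [(t, w)] _ a' x' [(second_hat j, y')] full);
      [lra | letters_nonneg | lra].
Qed.

Lemma WithWm_realised n e e' p : shape_times F (WithWm, (n, e, e')) p ->
  subword_realised (shape_word (WithWm, (n, e, e')) p).
Proof.
  intros (t0_in & t2_in & t1_ge & _).
  apply (trimmed_realised [] PI (p 0%nat) (n, axis e) [(p 1%nat, (n, BWm))] PI (p 2%nat) (n, axis e') []);
    [apply allowed_Wm, t1_ge | exact t0_in | letters_nonneg | exact t2_in].
Qed.

Lemma shape_realised s p : shape_times F s p -> subword_realised (shape_word s p).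
Proof. destruct s as [[] [[n i] j]]; [apply Cycle_realised | apply WithWp_realised | apply WithWm_realised]. Qed.

Lemma minimizer_optimal g l l' : admissible F -> word_equiv F l l' -> nonneg_times (spell F l') -> wprod F (spell F l) = g ->
  (forall w, nonneg_times w -> wprod F w = g -> wcost F (spell F l) <= wcost F w) -> optimal X Y kappa g (spell F l').
Proof.
  intros adm [prod cost] nn prod_g least. split; [split|].
  - unfold nonneg_times, spell in *. rewrite Forall_map in *. revert nn. apply Forall_impl. intros [t x] t_ge0.
    split; [exact t_ge0|].
    apply (label_vec_nz F x adm).
  - rewrite <- prod_g, prod. reflexivity.
  - intros w [valid prod_w]. rewrite !word_cost_base_frame, <- cost. apply least; [|exact prod_w].
    revert valid. apply Forall_impl. tauto.
Qed.
End Patterns.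

Theorem theorem2p2 (X Y : V3) (kappa : R) :
  dot X X = 1 -> dot Y Y = 1 ->
  0 < dot X Y -> dot X Y < kappa -> kappa <= 1 ->
  forall g : M3, inSO3 g ->
  exists w : list factor,
    optimal X Y kappa g w /\
    exists p, allowed_word kappa (dot X Y) p /\ subword w p.
Proof.
  intros unit_X unit_Y c_pos c_lt kappa_le g Sg.
  pose proof (acute_base_frame X Y kappa unit_X unit_Y c_pos c_lt kappa_le) as acuteF.
  destruct (shape_minimizer _ g acuteF Sg) as (s & q & times & prod & least).
  destruct (shape_realised X Y kappa c_pos ltac:(lra) s q times) as (l & p & equiv & nn & allowed_p & sub).
  exists (spell (base_frame X Y kappa) l). split.
  - exact (minimizer_optimal X Y kappa g (shape_word s q) l (proj1 acuteF) equiv nn prod least).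
  - exists p. split; assumption.
Qed.
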